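(* For the group $U_3$, let $b=1$ and let $\tilde w\in\widetilde W$ with $X_{\tilde w}(b)\neq\emptyset$. Then $$\dim X_{\tilde w}(b)=\begin{cases}0,&\tilde w\in\mathbb{O}_{0,\delta}\text{ and }\ell(\tilde w)=0,\\ \frac12(\ell(\tilde w)+1),&\tilde w\in\mathbb{O}'_{1,\delta}\text{ and }\tilde w\text{ lies in the critical strips, or }\tilde w\in\mathbb{O}_{1,\delta},\\ \frac12(\ell(\tilde w)+2),&\tilde w\in\mathbb{O}_{0,\delta}\text{ with }\ell(\tilde w)>0,\text{ or }\tilde w\in\mathbb{O}_{2m,\delta}\text{ for some }m\in\mathbb{N}_+,\\ \frac12(\ell(\tilde w)+3),&\tilde w\in\mathbb{O}'_{1,\delta}\text{ and }\tilde w\text{ lies in the shrunken Weyl chambers, or }\tilde w\in\mathbb{O}_{3,\delta}.\end{cases}$$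
   Context: $\mathbf{k}$ is an algebraic closure of $\mathbb{F}_q$, $L=\mathbf{k}((\epsilon))$, $F=\mathbb{F}_q((\epsilon))$. $U_3$ stands for the quasi-split unitary group of semisimple rank 2 over $F$, split over $L$, taken in its adjoint form, so that its Iwahori–Weyl group is the group $\widetilde W$ below and the Frobenius $\sigma$ of $U_3(L)$ induces the automorphism $\delta$ below on $\widetilde W$. $I$ is a $\sigma$-stable Iwahori subgroup, and $X_{\tilde w}(b)=\{gI\in U_3(L)/I\mid g^{-1}b\sigma(g)\in I\tilde wI\}$. $W=\langle s_1,s_2\rangle$ is the finite Weyl group of type $A_2$; $\alpha_1,\alpha_2$ are the simple roots, identified with the simple coroots ($\langle\alpha_i,\alpha_i\rangle=2$, $\langle\alpha_1,\alpha_2\rangle=-1$); $Q=\mathbb{Z}\alpha_1\oplus\mathbb{Z}\alpha_2$; $P$ is the coweight lattice; $\widetilde W=P\rtimes W$ with translations $t^\lambda$. $W_a=Q\rtimes W$ is the Coxeter group generated by $s_0=t^{\alpha_1+\alpha_2}s_1s_2s_1$, $s_1$, $s_2$; $\widetilde W=W_a\rtimes\langle\tau\rangle$ with $\tau^3=1$, $\tau s_0\tau^{-1}=s_1$, $\tau s_1\tau^{-1}=s_2$, $\tau s_2\tau^{-1}=s_0$; $\ell$ extends the length of $W_a$ by $\ell(w\tau^j)=\ell(w)$. $\delta$ is the automorphism of $\widetilde W$ fixing $s_0$ and interchanging $s_1$ and $s_2$ (so $\delta(\tau)=\tau^{-1}$). The base alcove is $\mathfrak{a}=\{x\in Q\otimes\mathbb{R}\mid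 0<\langle x,\alpha\rangle<1\text{ for all positive roots }\alpha\}$. An element $\tilde w$ lies in the critical strips if $\tilde w(\mathfrak a)\subset\{x\mid 0<\langle x,\alpha\rangle<1\}$ for some positive root $\alpha$; otherwise it lies in the shrunken Weyl chambers. For $X\subset W_a$ put $\widehat X=X\sqcup\{(\tau x\tau^{-1})\tau^2\mid x\in X\}\sqcup\{(\tau^2x\tau^{-2})\tau\mid x\in X\}$. The following are $\delta$-conjugacy classes of $\widetilde W$ (under $\tilde x\cdot_\delta\tilde w=\tilde x\tilde w\delta(\tilde x)^{-1}$): $\mathbb{O}_{0,\delta}=\widehat X$ for $X=\{t^{k(\alpha_1+2\alpha_2)}s_2s_1,\ t^{k(2\alpha_1+\alpha_2)}s_1s_2,\ t^{k(\alpha_1-\alpha_2)}\mid k\in\mathbb{Z}\}$; $\mathbb{O}_{1,\delta}=\widehat X$ for $X=\{t^\lambda s_1,\ t^\lambda s_2\mid\lambda\in Q\}$; $\mathbb{O}'_{1,\delta}=\widehat X$ for $X=\{t^{k\alpha_1+(2i+1)\alpha_2}s_1s_2s_1,\ t^{(2k+1)\alpha_1+2i\alpha_2}s_1s_2s_1\mid k,i\in\mathbb{Z}\}$; $\mathbb{O}_{3,\delta}=\widehat X$ for $X=\{t^{2k\alpha_1+2i\alpha_2}s_1s_2s_1\mid k,i\in\mathbb{Z}\}$; for $m\in\mathbb{N}_+$, with $\epsilon(m)=1$ if $m$ is odd and $0$ if $m$ is even, $\mathbb{O}_{2m,\delta}=\widehat X_m$, where $X_m$ consists of the elements, for all $k\in\mathbb{Z}$,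 $t^{(k-\lfloor m/2\rfloor)\alpha_1+(2k+\epsilon(m))\alpha_2}s_2s_1$, $t^{(k+\lfloor (m+1)/2\rfloor)\alpha_1+(2k+\epsilon(m))\alpha_2}s_2s_1$, $t^{(2k+\epsilon(m))\alpha_1+(k+\lfloor (m+1)/2\rfloor)\alpha_2}s_1s_2$, $t^{(2k+\epsilon(m))\alpha_1+(k-\lfloor m/2\rfloor)\alpha_2}s_1s_2$, $t^{k\alpha_1+(m-k)\alpha_2}$, $t^{(k-m)\alpha_1-k\alpha_2}$. *)

(* Defs.v *)
From HB Require Import structures.
From mathcomp Require Import all_boot all_order all_fingroup all_algebra.
From mathcomp Require Import boolp classical_sets reals topology.
From mathcomp Require Import zify.

Set Implicit Arguments.
Unset Strict Implicit.
Unset Printing Implicit Defensive.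

Import GRing.Theory Num.Theory.
Local Open Scope ring_scope.
Local Open Scope classical_set_scope.

Record fps (k : Type) := Fps { coef : nat -> k }.

HB.instance Definition _ k := [isNew for @coef k].
HB.instance Definition _ (k : choiceType) := [Choice of fps k by <:].

Section PowerSeries.
Variable k : fieldType.
Implicit Types f g h : fps k.

Lemma fpsP f g : coef f =1 coef g -> f = g.
Proof. by move=> fg; apply: val_inj; apply: funext. Qed.

Definition fps0 : fps k := Fps (fun=> 0).
Definition fps1 : fps k := Fps (fun n => (n == 0)%:R).
Definition fps_opp f := Fps (fun n => - coef f n).
Definition fps_add f g := Fps (fun n => coef f n + coef g n).
Definition fps_mul f g :=
  Fps (fun n => \sum_(i < n.+1) coef f i * coef g (n - i)).

Let trunc m f : {poly k} := \poly_(i < m) coef f i.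

Let coef_mul m n f g : (n < m)%N ->
  coef (fps_mul f g) n = (trunc m f * trunc m g)`_n.
Proof.
move=> nm; rewrite coefM; apply: eq_bigr => i _.
by rewrite !coef_poly !ifT //; have := ltn_ord i; lia.
Qed.

Fact fps_addA : associative fps_add.
Proof. by move=> f g h; apply: fpsP => n /=; rewrite addrA. Qed.
Fact fps_addC : commutative fps_add.
Proof. by move=> f g; apply: fpsP => n /=; rewrite addrC. Qed.
Fact fps_add0 : left_id fps0 fps_add.
Proof. by move=> f; apply: fpsP => n /=; rewrite add0r. Qed.
Fact fps_addN : left_inverse fps0 fps_opp fps_add.
Proof. by move=> f; apply: fpsP => n /=; rewrite addNr. Qed.

HB.instance Definition _ :=
  GRing.isZmodule.Build (fps k) fps_addA fps_addC fps_add0 fps_addN.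

Fact fps_mulA : associative fps_mul.
Proof.
move=> f g h; apply: fpsP => n.
have E1 : coef (fps_mul f (fps_mul g h)) n =
    (trunc n.+1 f * (trunc n.+1 g * trunc n.+1 h))`_n.
  rewrite coefM; apply: eq_bigr => i _; rewrite coef_poly ltn_ord.
  by rewrite (@coef_mul n.+1) // ltnS leq_subr.
rewrite E1 mulrA coefM; apply: eq_bigr => i _.
by rewrite (@coef_mul n.+1 i) // coef_poly ltnS leq_subr.
Qed.
Fact fps_mulC : commutative fps_mul.
Proof. by move=> f g; apply: fpsP => n; rewrite !(@coef_mul n.+1) // mulrC. Qed.
Fact fps_mul1 : left_id fps1 fps_mul.
Proof.
move=> f; apply: fpsP => n; rewrite /= big_ord_recl mul1r subn0 big1 ?addr0 //.
by move=> i _; rewrite mul0r.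
Qed.
Fact fps_mulDl : left_distributive fps_mul fps_add.
Proof.
move=> f g h; apply: fpsP => n /=.
by rewrite -big_split; apply: eq_bigr => i _; rewrite mulrDl.
Qed.
Fact fps1_neq0 : fps1 != fps0.
Proof. by apply/eqP => /(congr1 (fun f => coef f 0)) /eqP; rewrite /= oner_eq0. Qed.

HB.instance Definition _ := GRing.Zmodule_isComNzRing.Build (fps k)
  fps_mulA fps_mulC fps_mul1 fps_mulDl fps1_neq0.

Definition fps_unit : {pred fps k} := fun f => `[< exists g, g * f = 1 >].
Definition fps_inv f : fps k :=
  if pselect (exists g, g * f = 1) is left h then projT1 (cid h) else f.

Fact fps_mulVx : {in fps_unit, left_inverse 1 fps_inv *%R}.
Proof.
move=> f /asboolP fu; rewrite /fps_inv; case: pselect => // h.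
by case: (cid h).
Qed.
Fact fps_unitPl f g : g * f = 1 -> fps_unit f.
Proof. by move=> fg; apply/asboolP; exists g. Qed.
Fact fps_invr_out : {in [predC fps_unit], fps_inv =1 id}.
Proof.
move=> f; rewrite inE /= => /asboolP fu; rewrite /fps_inv.
by case: pselect.
Qed.

HB.instance Definition _ := GRing.ComNzRing_hasMulInverse.Build (fps k)
  fps_mulVx fps_unitPl fps_invr_out.

Let low f : f != 0 -> exists2 a, coef f a != 0 & forall i, (i < a)%N -> coef f i = 0.
Proof.
move=> f0; have ex : exists a, coef f a != 0.
  apply: contrapT => no; move/eqP: f0; apply; apply: fpsP => n /=.
  by apply/eqP/negPn/negP => fn; apply: no; exists n.
case: (ex_minnP ex) => a fa mina; exists a => // i ia.
by apply/eqP/negPn/negP => /mina; rewrite leqNgt ia.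
Qed.

Fact fps_integral : GRing.integral_domain_axiom (fps k).
Proof.
move=> f g fg0; apply/norP => -[/low[a fa la] /low[b gb lb]].
move: (congr1 (fun h => coef h (a + b)%N) fg0) => /=.
have aP : (a < (a + b).+1)%N by rewrite ltnS leq_addr.
rewrite (bigD1 (Ordinal aP)) //= addKn big1 => [|i ia].
  by rewrite addr0 => /eqP; rewrite mulf_eq0 (negPf fa) (negPf gb).
case: (ltngtP i a) => [/la->|ai|ia']; rewrite ?mul0r //.
  by rewrite lb ?mulr0 //; have := ltn_ord i; lia.
by move: ia; rewrite -val_eqE /= ia' eqxx.
Qed.

HB.instance Definition _ :=
  GRing.ComUnitRing_isIntegral.Build (fps k) fps_integral.

Definition fps_eps : fps k := Fps (fun n => (n == 1)%:R).

End PowerSeries.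

(* A point of the apartment is given by its pairings with the two simple
   roots, i.e. by its coordinates in the basis of fundamental coweights;
   [barycentric x] is the representative in [A^3 / A(1,1,1)] with last
   coordinate 0.  The coweight lattice is the case [A = int]. *)
Definition barycentric (A : zmodType) (x : A * A) (i : 'I_3) : A :=
  [:: x.1 + x.2; x.2; 0]`_i.

(* [(w . y)_i = y_(w i)] is a left action, as products of permutations are
   read from left to right: [(u * v) i = v (u i)]. *)
Definition wact (A : zmodType) (w : 'S_3) (x : A * A) : A * A :=
  let y i := barycentric x (w i) in (y 0 - y 1, y 1 - y 2%:R).

Lemma wact_sub (A : zmodType) (w : 'S_3) (x : A * A) i j :
  barycentric (wact w x) i - barycentric (wact w x) j =
  barycentric x (w i) - barycentric x (w j).
Proof.
have E l : barycentric (wact w x) l =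
    barycentric x (w l) - barycentric x (w 2%:R).
  case: l => -[|[|[|//]]] h; rewrite /barycentric /= ?addrA ?subrK.
  - by rewrite (_ : Ordinal h = 0) //; exact: val_inj.
  - by rewrite (_ : Ordinal h = 1) //; exact: val_inj.
  - by rewrite (_ : Ordinal h = 2%:R) ?subrr //; exact: val_inj.
by rewrite !E opprB addrA subrK.
Qed.

Lemma bary_inj (A : zmodType) (x y : A * A) :
  (forall i j, barycentric x i - barycentric x j =
               barycentric y i - barycentric y j) -> x = y.
Proof.
case: x y => [a b] [c d] E; move: (E 0 1) (E 1 2%:R).
by rewrite /barycentric /= !addrK !subr0 => -> ->.
Qed.

Lemma wact1 (A : zmodType) (x : A * A) : wact 1%g x = x.
Proof. by apply: bary_inj => i j; rewrite wact_sub !perm1. Qed.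

Lemma wactM (A : zmodType) (u v : 'S_3) (x : A * A) :
  wact (u * v)%g x = wact u (wact v x).
Proof. by apply: bary_inj => i j; rewrite !wact_sub !permM. Qed.

Lemma wactD (A : zmodType) (w : 'S_3) : {morph @wact A w : x y / x + y}.
Proof.
have E x y i : @barycentric A (x + y) i = barycentric x i + barycentric y i.
  case: i => -[|[|[|//]]] h; rewrite /barycentric /= ?addr0 //.
  by rewrite addrACA.
by move=> x y; congr (_, _); rewrite /= !E opprD addrACA.
Qed.

Lemma wact0 (A : zmodType) (w : 'S_3) : @wact A w 0 = 0.
Proof. by apply: (addrI (wact w 0)); rewrite -wactD !addr0. Qed.

Lemma wactN (A : zmodType) (w : 'S_3) (x : A * A) : wact w (- x) = - wact w x.
Proof. by apply: (addrI (wact w x)); rewrite -wactD !subrr wact0. Qed.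

(* [IW lam w] is [t^lam w]. *)
Record iwahoriWeyl := IW { tr : int * int; lin : 'S_3 }.

Definition iw_pair x := (tr x, lin x).
Definition pair_iw p := IW p.1 p.2.
Lemma iw_pairK : cancel iw_pair pair_iw. Proof. by case. Qed.

HB.instance Definition _ := Choice.copy iwahoriWeyl (can_type iw_pairK).

Definition iw1 := IW 0 1%g.
Definition iw_mul x y := IW (tr x + wact (lin x) (tr y)) (lin x * lin y)%g.
Definition iw_inv x := IW (- wact (lin x)^-1%g (tr x)) (lin x)^-1%g.

Fact iw_mulA : associative iw_mul.
Proof.
by move=> x y z; rewrite /iw_mul /= wactD wactM addrA mulgA.
Qed.
Fact iw_mul1 : left_id iw1 iw_mul.
Proof. by case=> a u; rewrite /iw_mul /= wact1 add0r mul1g. Qed.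
Fact iw_1mul : right_id iw1 iw_mul.
Proof. by case=> a u; rewrite /iw_mul /= wact0 addr0 mulg1. Qed.
Fact iw_mulV : left_inverse iw1 iw_inv iw_mul.
Proof. by case=> a u; rewrite /iw_mul /= addNr mulVg. Qed.
Fact iw_Vmul : right_inverse iw1 iw_inv iw_mul.
Proof.
by case=> a u; rewrite /iw_mul /= wactN -wactM mulgV wact1 subrr.
Qed.

HB.instance Definition _ := isGroup.Build iwahoriWeyl
  iw_mulA iw_mul1 iw_1mul iw_mulV iw_Vmul.

Definition omega1 : int * int := (1, 0).
Definition alpha1 : int * int := (2, -1).
Definition alpha2 : int * int := (-1, 2).

Definition transl lam := IW lam 1.

Definition s1 := IW 0 (tperm 0 1).
Definition s2 := IW 0 (tperm 1 2%:R).
Definition s0 := (transl (alpha1 + alpha2) * (s1 * s2 * s1))%g.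
Definition tau := (transl omega1 * (s1 * s2))%g.

Lemma wact_s1 (A : zmodType) (x : A * A) :
  wact (tperm 0 1) x = (- x.1, x.1 + x.2).
Proof.
rewrite /wact tpermL tpermR tpermD // /barycentric /= subr0.
by rewrite opprD addrCA subrr addr0.
Qed.

Lemma wact_s2 (A : zmodType) (x : A * A) :
  wact (tperm 1 2%:R) x = (x.1 + x.2, - x.2).
Proof. by rewrite /wact tpermL tpermR tpermD // /barycentric /= subr0 sub0r. Qed.

Lemma ord3P (P : 'I_3 -> Prop) : P 0 -> P 1 -> P 2%:R -> forall i, P i.
Proof.
move=> P0 P1 P2 [[|[|[|//]]] h].
- by rewrite (_ : Ordinal h = 0) //; exact: val_inj.
- by rewrite (_ : Ordinal h = 1) //; exact: val_inj.
- by rewrite (_ : Ordinal h = 2%:R) //; exact: val_inj.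
Qed.

Ltac iw_compute :=
  congr IW; [ by rewrite /= ?(wactM, wact_s1, wact_s2, wact1)
  | by apply/permP; apply: ord3P; rewrite /= ?permM ?permE ].

Lemma tau3 : (tau ^+ 3 = 1)%g.
Proof. iw_compute. Qed.

Lemma tau_s0 : (tau * s0 = s1 * tau)%g.
Proof. iw_compute. Qed.

Lemma tau_s1 : (tau * s1 = s2 * tau)%g.
Proof. iw_compute. Qed.

Lemma tau_s2 : (tau * s2 = s0 * tau)%g.
Proof. iw_compute. Qed.

Definition simple_refl (i : 'I_3) : iwahoriWeyl := nth 1%g [:: s0; s1; s2] i.

Definition word (u : seq 'I_3) := (\prod_(i <- u) simple_refl i)%g.

Section Generation.

Let G (w : iwahoriWeyl) := exists u, exists j : nat, w = (word u * tau ^+ j)%g.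

Let tau_word u : exists v, (tau * word u = word v * tau)%g.
Proof.
elim: u => [|i u [v E]].
  by exists [::]; rewrite /word !big_nil mulg1 mul1g.
have Ei : (tau * simple_refl i = simple_refl (i + 1) * tau)%g.
  by elim/ord3P: i; [exact: tau_s0 | exact: tau_s1 | exact: tau_s2].
exists (i + 1 :: v); rewrite /word !big_cons -!/(word _).
by rewrite mulgA Ei -mulgA E mulgA.
Qed.

Let tauX_word j u : exists v, (tau ^+ j * word u = word v * tau ^+ j)%g.
Proof.
elim: j u => [|j IH] u; first by exists u; rewrite !expg0 mulg1 mul1g.
have [v E] := tau_word u; have [v' E'] := IH v.
exists v'; rewrite expgSr -mulgA E mulgA E' -mulgA; reflexivity.
Qed.

Let G1 : G 1%g.
Proof. by exists [::], 0%N; rewrite /word big_nil mul1g. Qed.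

Let GM x y : G x -> G y -> G (x * y)%g.
Proof.
move=> [u [j ->]] [v [l ->]]; have [v' E] := tauX_word j v.
exists (u ++ v'), (j + l)%N; rewrite /word big_cat expgnDr -!/(word _).
by rewrite -!mulgA; congr (_ * _)%g; rewrite mulgA E mulgA.
Qed.

Let Gs i : G (simple_refl i).
Proof. by exists [:: i], 0%N; rewrite /word big_seq1 mulg1. Qed.

Let Gtau : G tau.
Proof. by exists [::], 1%N; rewrite /word big_nil mul1g. Qed.

Let Gtr a b : G (IW (a, b) 1).
Proof.
have Gs1 : G s1 by exact: (Gs 1).
have Gs2 : G s2 by exact: (Gs 2%:R).
have Gp1 : G (IW (1, 0) 1).
  have -> : IW (1, 0) 1 = (tau * (s2 * s1))%g by iw_compute.
  exact: (GM Gtau (GM Gs2 Gs1)).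
have Gm1 : G (IW (-1, 0) 1).
  have -> : IW (-1, 0) 1 = (s1 * s2 * (tau * tau))%g by iw_compute.
  exact: (GM (GM Gs1 Gs2) (GM Gtau Gtau)).
have Gp2 : G (IW (0, 1) 1).
  have -> : IW (0, 1) 1 = (s2 * s1 * IW (-1, 0)%R 1 * (s1 * s2))%g by iw_compute.
  exact: (GM (GM (GM Gs2 Gs1) Gm1) (GM Gs1 Gs2)).
have Gm2 : G (IW (0, -1) 1).
  have -> : IW (0, -1) 1 = (s2 * s1 * IW (1, 0)%R 1 * (s1 * s2))%g by iw_compute.
  exact: (GM (GM (GM Gs2 Gs1) Gp1) (GM Gs1 Gs2)).
have trD (x y : int * int) : IW (x + y) 1 = (IW x 1 * IW y 1)%g.
  by congr IW; rewrite /= ?wact1 ?mulg1.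
have -> : (a, b) = (a, 0) + (0, b) :> (int * int)%type.
  by congr (_, _); rewrite /= ?addr0 ?add0r.
rewrite trD; apply: GM.
  elim: a => [|n IH|n IH].
  - exact: G1.
  - rewrite (_ : (n.+1%:Z, 0) = (1, 0) + (n%:Z, 0)) ?trD; first exact: GM.
    by congr (_, _); rewrite /= ?addr0 //; lia.
  - rewrite (_ : (- n.+1%:Z, 0) = (-1, 0) + (- n%:Z, 0)) ?trD; first exact: GM.
    by congr (_, _); rewrite /= ?addr0 //; lia.
elim: b => [|n IH|n IH].
- exact: G1.
- rewrite (_ : (0, n.+1%:Z) = (0, 1) + (0, n%:Z)) ?trD; first exact: GM.
  by congr (_, _); rewrite /= ?addr0 //; lia.
- rewrite (_ : (0, - n.+1%:Z) = (0, -1) + (0, - n%:Z)) ?trD; first exact: GM.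
  by congr (_, _); rewrite /= ?addr0 //; lia.
Qed.

Let Glin p : G (IW 0 p).
Proof.
have Gs1 : G s1 by exact: (Gs 1).
have Gs2 : G s2 by exact: (Gs 2%:R).
have linM u v : IW 0 (u * v)%g = (IW 0 u * IW 0 v)%g.
  by congr IW; rewrite /= wact0 addr0.
have Gs121 : G (IW 0 (tperm 0 2%:R)).
  have -> : IW 0 (tperm 0 2%:R) = (s1 * s2 * s1)%g by iw_compute.
  exact: (GM (GM Gs1 Gs2) Gs1).
have Gt i j : G (IW 0 (tperm i j)).
  by move: i j; do 2!apply: ord3P; rewrite ?tperm1 // tpermC.
have [ts -> _] := prod_tpermP p.
elim: ts => [|t ts IH]; first by rewrite big_nil.
by rewrite big_cons linM; apply: GM.
Qed.

Definition expressible n (w : iwahoriWeyl) :=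
  [exists u : n.-tuple 'I_3, exists j : 'I_3, w == (word u * tau ^+ j)%g].

Lemma expressible_ex w : exists n, expressible n w.
Proof.
have [u [j ->]] : G w.
  case: w => -[a b] p.
  rewrite (_ : IW _ _ = IW (a, b) 1 * IW 0 p)%g; first exact: GM.
  by congr IW; rewrite /= ?wact0 ?addr0 ?mul1g.
exists (size u); apply/existsP; exists (in_tuple u); apply/existsP.
exists (inord (j %% 3)); rewrite inordK ?ltn_mod //= {1}(divn_eq j 3).
by rewrite expgnDr mulnC expgM tau3 expg1n mul1g.
Qed.

End Generation.

(* The word length of [w tau^j], minimised over [j], is the Coxeter length of
   [w]: the decomposition [W_a ><| <tau>] is unique. *)
Definition iw_length w := ex_minn (expressible_ex w).

Definition hat (X : set iwahoriWeyl) : set iwahoriWeyl :=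
  X `|` [set (tau * x * tau^-1 * tau ^+ 2)%g | x in X]
    `|` [set (tau ^+ 2 * x * tau ^- 2 * tau)%g | x in X].

(* Translation by [a alpha1 + b alpha2]. *)
Definition tQ (a b : int) : iwahoriWeyl := transl (alpha1 *~ a + alpha2 *~ b).

Definition dclass0 : set iwahoriWeyl := hat [set w | exists k : int,
  [\/ w = (tQ k (2 * k) * (s2 * s1))%g,
      w = (tQ (2 * k) k * (s1 * s2))%g |
      w = tQ k (- k)]].

Definition dclass1 : set iwahoriWeyl := hat [set w | exists a b : int,
  w = (tQ a b * s1)%g \/ w = (tQ a b * s2)%g].

Definition dclass1' : set iwahoriWeyl := hat [set w | exists k i : int,
  w = (tQ k (2 * i + 1) * (s1 * s2 * s1))%g \/
  w = (tQ (2 * k + 1) (2 * i) * (s1 * s2 * s1))%g].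

Definition dclass3 : set iwahoriWeyl := hat [set w | exists k i : int,
  w = (tQ (2 * k) (2 * i) * (s1 * s2 * s1))%g].

Definition dclass_even (m : nat) : set iwahoriWeyl :=
  let lo := (m./2)%:Z in let hi := (m.+1./2)%:Z in let e := (odd m : nat)%:Z in
  hat [set w | exists k : int,
    [\/ w = (tQ (k - lo) (2 * k + e) * (s2 * s1))%g \/
        w = (tQ (k + hi) (2 * k + e) * (s2 * s1))%g,
        w = (tQ (2 * k + e) (k + hi) * (s1 * s2))%g \/
        w = (tQ (2 * k + e) (k - lo) * (s1 * s2))%g,
        w = tQ k (m%:Z - k) |
        w = tQ (k - m%:Z) (- k)]].

Section CriticalStrips.
Variable R : realType.

Definition apt_act (w : iwahoriWeyl) (x : R * R) : R * R :=
  ((tr w).1%:~R, (tr w).2%:~R) + wact (lin w) x.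

(* [pairing i x] for [i = 0, 1, 2] is the pairing of [x] with the positive
   roots [alpha1], [alpha2], [alpha1 + alpha2]. *)
Definition pairing (i : 'I_3) (x : R * R) : R := [:: x.1; x.2; x.1 + x.2]`_i.

Definition base_alcove : set (R * R) :=
  [set x | forall i, 0 < pairing i x < 1].

Definition in_critical_strips (w : iwahoriWeyl) : Prop :=
  exists i, apt_act w @` base_alcove `<=` [set x | 0 < pairing i x < 1].

Definition in_shrunken_chambers (w : iwahoriWeyl) : Prop :=
  ~ in_critical_strips w.

End CriticalStrips.

Section Krull.
Variable T : topologicalType.
Implicit Types X Y : set T.

Definition irreducible Y := Y !=set0 /\
  forall A B, closed A -> closed B -> Y `<=` A `|` B -> Y `<=` A \/ Y `<=` B.

Definition relatively_closed X Y := exists2 C, closed C & Y = X `&` C.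

Definition has_irreducible_chain X (d : nat) := exists Z : nat -> set T,
  (forall i, (i <= d)%N -> relatively_closed X (Z i) /\ irreducible (Z i)) /\
  (forall i, (i < d)%N -> Z i `<` Z i.+1).

(* Used for the space of [k]-points of a scheme locally of finite type over an
   algebraically closed field [k], where it is the dimension of the scheme. *)
Definition krull_dim X (d : nat) :=
  has_irreducible_chain X d /\
  forall e, (d < e)%N -> ~ has_irreducible_chain X e.

End Krull.

(* Over [L = k((eps))] the adjoint group of [U_3] is [PGL_3]; subsets of
   [PGL_3(L) = GL_3(L) / L^*] are represented by their preimages in the
   invertible matrices. *)

Section LoopGroup.
Variable k : fieldType.

Definition laurent := {fraction fps k}.
Local Notation L := laurent.
Local Notation ofps := (@FracField.tofrac (fps k)).

Definition eps : L := ofps (fps_eps k).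

(* Lower triangular modulo [eps]: with [t^lam] represented by [eps^lam], this
   is the choice for which [s0], [s1], [s2] are the simple affine reflections. *)
Definition iwahoriGL : set 'M[L]_3 := [set map_mx ofps h | h in
  [set h : 'M[fps k]_3 | h \in unitmx /\
     forall i j : 'I_3, (i < j)%N -> coef (h i j) 0 = 0]].

Definition iwahori : set 'M[L]_3 :=
  [set c *: h | c in [set c | c != 0] & h in iwahoriGL].

(* The permutation matrix is the one compatible with [wact]:
   [perm_mx w *m y] has entries [y_(w i)]. *)
Definition rep (w : iwahoriWeyl) : 'M[L]_3 :=
  diag_mx (\row_i eps ^ barycentric (tr w) i) *m perm_mx (lin w).

Definition double_coset (w : iwahoriWeyl) : set 'M[L]_3 :=
  [set h1 *m rep w *m h2 | h1 in iwahori & h2 in iwahori].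

Definition frob_fps (q : nat) (f : fps k) : fps k :=
  Fps (fun n => coef f n ^+ q).

Definition frob (q : nat) (x : L) : L :=
  let r := generic_quotient.repr x in
  ofps (frob_fps q \n_r) / ofps (frob_fps q \d_r).

(* The Frobenius of the quasi-split unitary group of the hermitian form
   [x_0 y_2^- + x_1 y_1^- + x_2 y_0^-] of [F_(q^2)((eps)) / F_q((eps))]. *)
Definition antidiag : 'M[L]_3 := \matrix_(i, j) (j == rev_ord i)%:R.

Definition sigma (q : nat) (g : 'M[L]_3) : 'M[L]_3 :=
  antidiag *m (invmx (map_mx (frob q) g))^T *m antidiag.

(* The [k]-points [PGL_3(L) / I]. *)
Definition icoset (g : 'M[L]_3) : set 'M[L]_3 := [set g *m h | h in iwahori].

Record flag := Flag {
  flag_set :> set 'M[L]_3;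
  _ : `[< exists2 g, g \in unitmx & flag_set = icoset g >] }.

HB.instance Definition _ := [isSub for flag_set].
HB.instance Definition _ := [Choice of flag by <:].

(* The ind-scheme structure of the loop group of [GL_3]: its [N]-th piece
   consists of the [g] such that [A = eps^N g] and [B = eps^N g^-1] are
   integral.  It is affine, closed in the space of pairs [(A, B)], whose
   regular functions are the polynomials in the coefficients of the entries. *)
Inductive regular_fun : ('M[fps k]_3 -> 'M[fps k]_3 -> k) -> Prop :=
| regular_const c : regular_fun (fun _ _ => c)
| regular_coefl i j n : regular_fun (fun A _ => coef (A i j) n)
| regular_coefr i j n : regular_fun (fun _ B => coef (B i j) n)
| regular_add f g : regular_fun f -> regular_fun g ->
    regular_fun (fun A B => f A B + g A B)
| regular_mul f g : regular_fun f -> regular_fun g ->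
    regular_fun (fun A B => f A B * g A B).

Definition loop_closed (Z : set 'M[L]_3) := forall N : nat,
  exists2 S, S `<=` regular_fun &
  forall A B, A *m B = (fps_eps k ^+ N.*2)%:M ->
    Z (eps ^- N *: map_mx ofps A) <-> forall f, S f -> f A B = 0.

(* The topology of the affine flag variety is the quotient topology of the one
   of the loop group. *)
Definition flag_open (U : set flag) :=
  loop_closed [set g | exists2 x, ~ U x & x = icoset g :> set 'M[L]_3].

Let on_piece N (A B : 'M[fps k]_3) :
  A *m B = (fps_eps k ^+ N.*2)%:M -> eps ^- N *: map_mx ofps A \in unitmx.
Proof.
move=> AB; have e0 : eps != 0.
  rewrite tofrac_eq0; apply/eqP => /(congr1 (fun f => coef f 1)) /eqP.
  by rewrite /= oner_eq0.
suff: (eps ^- N *: map_mx ofps A) *m (eps ^- N *: map_mx ofps B) = 1%:M.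
  by move=> /mulmx1_unit[+ _]; apply.
rewrite -scalemxAl -scalemxAr -map_mxM AB map_scalar_mx scalerA -invfM -exprD.
by rewrite addnn rmorphXn scale_scalar_mx mulVf ?expf_neq0.
Qed.

Let flag_of g (gu : g \in unitmx) : flag :=
  Flag (asboolT (ex_intro2 _ _ g gu (erefl (icoset g)))).

Fact flag_openT : flag_open setT.
Proof.
move=> N; exists [set fun _ _ => 1]; first by move=> _ ->; exact: regular_const.
move=> A B _; split=> [[x nx]|/(_ _ erefl)/eqP]; first by case: nx.
by rewrite oner_eq0.
Qed.

Fact flag_openI : setI_closed flag_open.
Proof.
move=> U V oU oV N; have [S Sr SP] := oU N; have [T Tr TP] := oV N.
exists [set f | exists g h, [/\ S g, T h & f = fun A B => g A B * h A B]].
  by move=> _ [g [h [/Sr rg /Tr rh ->]]]; exact: regular_mul.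
move=> A B AB; split.
  move=> [x nUV xg] _ [g [h [Sg Th ->]]]; case: (pselect (U x)) => Ux.
    have Vx : ~ V x by move=> Vx; apply: nUV.
    by rewrite ((TP A B AB).1 (ex_intro2 _ _ x Vx xg) h Th) mulr0.
  by rewrite ((SP A B AB).1 (ex_intro2 _ _ x Ux xg) g Sg) mul0r.
move=> gh0; apply: contrapT => nZ.
have [nS|] := pselect (forall g, S g -> g A B = 0).
  have [x nx xg] := (SP A B AB).2 nS.
  by apply: nZ; exists x => // -[].
move=> /existsNP[g /not_implyP[Sg g0]].
suff [x nx xg] : [set g0 | exists2 x, ~ V x & x = icoset g0 :> set 'M[L]_3]
    (eps ^- N *: map_mx ofps A) by apply: nZ; exists x => // -[].
apply/(TP A B AB) => h Th.
have /eqP := gh0 _ (ex_intro _ g (ex_intro _ h (And3 Sg Th erefl))).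
by rewrite mulf_eq0 => /orP[/eqP|/eqP].
Qed.

Fact flag_open_bigU (I : Type) (U : I -> set flag) :
  (forall i, flag_open (U i)) -> flag_open (\bigcup_i U i).
Proof.
move=> oU N; have /choice[S SP] : forall i, exists S, S `<=` regular_fun /\
    forall A B, A *m B = (fps_eps k ^+ N.*2)%:M ->
    (exists2 x, ~ U i x & x = icoset (eps ^- N *: map_mx ofps A) :> set _) <->
    forall f, S f -> f A B = 0.
  by move=> i; have [S ? ?] := oU i N; exists S.
exists (\bigcup_i S i); first by move=> f [i _]; case: (SP i) => + _; exact.
move=> A B AB; split.
  move=> [x nx xg] f [i _ Sf]; have [_ SPi] := SP i.
  by apply: (SPi A B AB).1 Sf; exists x => // Ux; apply: nx; exists i.
move=> f0; exists (flag_of (on_piece AB)) => // -[i _ Ui].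
have [_ /(_ A B AB)[_]] := SP i; case=> [f Sf|y ny yg].
  by apply: f0; exists i.
by apply: ny; rewrite (_ : y = flag_of (on_piece AB)) //; apply: val_inj.
Qed.

HB.instance Definition _ := @isOpenTopological.Build flag flag_open
  flag_openT flag_openI flag_open_bigU.

Definition adlv (q : nat) (b : 'M[L]_3) (w : iwahoriWeyl) : set flag :=
  [set x | exists g, [/\ g \in unitmx, x = icoset g :> set 'M[L]_3 &
     double_coset w (invmx g *m b *m sigma q g)]].

End LoopGroup.

(* Main.v *)
(** The dimensions are computed by Deligne-Lusztig reduction. Let [s] be an
affine simple reflection and suppose that [s w] is shorter than [w]. If
[w' = s w delta(s)] has the length of [w], the varieties of [w] and [w'] have
the same dimension; if [w'] is shorter by two, the variety of [w] is the union
of a part fibred over that of [w'] and a part fibred over that of [s w], with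
one-dimensional fibres. An explicit induction in the coordinates of the affine
Weyl group leads from every element with a nonempty variety to one of [1],
[s0], [s1], [s1 s2 s1], where the points [g] are controlled by the
[sigma ^ 2]-invariant lattices near [g]. The other elements with which the
induction ends have empty varieties: there [g^-1 sigma^2(g)] would shift all
vectors strictly in a periodic lattice chain, against the boundedness of the
powers of [sigma].

Dimensions are bounded below by explicit chains, which are lifted along the
fibrations, and above by a Hilbert function: a bounded piece is covered by
finitely many sets on which the functions of degree at most [n] in the matrix
coefficients span a space of dimension [O(n^d)], while each step of a strictly
increasing chain of irreducible closed subsets raises the exponent. *)

From HB Require Import structures.
From mathcomp Require Import all_boot all_order all_fingroup all_algebra.
From mathcomp Require Import separable finfield pgroup.
From mathcomp Require Import boolp classical_sets reals topology.
From mathcomp Require Import zify ring lra.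
Require Import Defs.

Set Implicit Arguments.
Unset Strict Implicit.
Unset Printing Implicit Defensive.

Import Order.TTheory GRing.Theory Num.Theory.
Local Open Scope ring_scope.
Local Open Scope classical_set_scope.

(** * Laurent series *)

(** The topology of [flag] is the quotient of that of the loop group, where every coset [g Ig] is
    infinite-dimensional. Dimensions become finite by keeping only the coefficients of order less
    than [M]: each coset then contributes the same constant [9 M - 3], once to the lower bound
    ([indge_Ig]) and once to the upper bound ([spanle_family]), and it cancels in [covered_chain].
    The constant is the same for all cosets of one determinant valuation, whence the bookkeeping
    with [dv] and [wdeg]. A chain need not stay in one bounded piece. Local boundedness suffices,
    and it comes from invariant lattices: [sigma] contains an inverse transpose and takes lattices
    to dual ones, so only [sigma ^ 2] acts on lattices, and in a bounded piece it fixes finitely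
    many. The step that preserves the length is bijective, but its inverse extracts [q]-th roots.
    Hence growth and openness are shown to be stable under such roots ([gr_dom], [lopen_root]). The
    closed formula for the dimension serves as induction hypothesis; that the reduction respects it
    is linear arithmetic in each chamber. *)

Section Laurent.
Variable k : fieldType.
Local Notation K := (fps k).
Local Notation L := (laurent k).
Local Notation ofps := (@FracField.tofrac (fps k)).
Local Notation eps := (eps k).
Implicit Types (f g : K) (x y : L).

Definition coefz f (m : int) : k := if m is Posz n then coef f n else 0.

Lemma coef_fpsM f g n : coef (f * g) n = \sum_(i < n.+1) coef f i * coef g (n - i).
Proof. by []. Qed.

Lemma coefzM_eps (a : nat) f m : coefz (fps_eps k ^+ a * f) m = coefz f (m - a%:Z).
Proof.
have E1 g p : coefz (fps_eps k * g) p = coefz g (p - 1).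
  case: p => [[|n]|n]; last by have -> : (Negz n - 1 = Negz n.+1)%R by lia.
    by rewrite /coefz coef_fpsM big_ord1 mul0r.
  rewrite (_ : n.+1%:Z - 1 = n) /coefz ?coef_fpsM; last by lia.
  rewrite (bigD1 (Ordinal (isT : 1 < n.+2)%N)) //= mul1r subSS subn0 big1 ?addr0 //.
  by move=> i; rewrite -val_eqE /= => /negPf ->; rewrite mul0r.
elim: a m => [|a IH] m; first by rewrite mul1r subr0.
by rewrite exprS -mulrA E1 IH; congr coefz; lia.
Qed.

Lemma fps_epsX_coef (a n : nat) : coef (fps_eps k ^+ a) n = (n == a)%:R.
Proof.
rewrite -[LHS]/(coefz (fps_eps k ^+ a) n) -[fps_eps k ^+ a]mulr1 coefzM_eps.
have [na|na] := leqP a n.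
  by rewrite subzn //= subn_eq0 eqn_leq na andbT.
rewrite (_ : n%:Z - a%:Z = Negz (a - n.+1)); last by lia.
by rewrite ltn_eqF.
Qed.

Lemma eps_neq0 : eps != 0.
Proof.
rewrite tofrac_eq0; apply/eqP => /(congr1 (fun f => coef f 1)) /eqP.
by rewrite /= oner_eq0.
Qed.

Lemma epsE : eps = ofps (fps_eps k). Proof. by []. Qed.

Lemma fps_unitP f : coef f 0 != 0 -> exists g, g * f = 1.
Proof.
move=> f0; have [v vP] : exists v : nat -> k, forall n,
    v n = ((n == 0)%:R - \sum_(i < n) v i * coef f (n - i)) / coef f 0.
  (* The recursion for one coefficient of the inverse uses all earlier ones, so [s n] builds the
     list of the first [n] coefficients. *)
  pose s := fix s n := if n is m.+1 then
    let l := s m in rcons l (((size l == 0)%:R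
       - \sum_(i < size l) l`_i * coef f (size l - i)) / coef f 0) else [::].
  have size_s n : size (s n) = n by elim: n => //= n IH; rewrite size_rcons IH.
  have s_nth n i : (i < n)%N -> (s n)`_i = (s i.+1)`_i.
    elim: n => // n IH; rewrite ltnS leq_eqVlt => /orP[/eqP ->//|lt_in].
    by rewrite [s n.+1]/= nth_rcons size_s lt_in IH.
  exists (fun n => (s n.+1)`_n) => n.
  rewrite [s n.+1]/= nth_rcons size_s ltnn eqxx; congr ((_ - _) / _).
  by apply: eq_bigr => i _; rewrite s_nth.
exists (Fps v); apply: fpsP => n; rewrite coef_fpsM.
rewrite big_ord_recr /= subnn (vP n) mulfVK // addrC subrK.
by [].
Qed.

Lemma fps_decomp f : f != 0 -> exists a u g, f = fps_eps k ^+ a * u /\ g * u = 1.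
Proof.
move=> f0; have ex : exists a, coef f a != 0.
  apply: contrapT => no; move/eqP: f0; apply; apply: fpsP => n /=.
  by apply/eqP/negPn/negP => fn; apply: no; exists n.
case: (ex_minnP ex) => a fa mina.
pose u : K := Fps (fun n => coef f (n + a)%N).
have [g gu] : exists g, g * u = 1 by apply: fps_unitP; rewrite /= add0n.
exists a, u, g; split=> //; apply: fpsP => n.
rewrite -[RHS]/(coefz (fps_eps k ^+ a * u) n) coefzM_eps.
have [na|na] := leqP a n; first by rewrite subzn //= subnK.
rewrite (_ : n%:Z - a%:Z = Negz (a - n.+1)) /=; last by lia.
by apply/eqP/negPn/negP => /mina; rewrite leqNgt na.
Qed.

Lemma frac_numden x : x = ofps \n_(generic_quotient.repr x) / ofps \d_(generic_quotient.repr x).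
Proof.
set r := generic_quotient.repr x.
have d0 : ofps \d_r != 0 by rewrite tofrac_eq0 denom_ratioP.
apply: (canRL (mulfK d0)).
rewrite -[x in LHS]generic_quotient.reprK -/r; unlock FracField.tofrac.
rewrite -[LHS]FracField.pi_mul; apply/generic_quotient.eqmodP => /=.
rewrite /FracField.mulf /FracField.equivf /=.
rewrite !numden_Ratio ?mulr1 ?oner_neq0 ?denom_ratioP //.
by rewrite mulrC.
Qed.

(** By [fps_decomp] every denominator is a power of [eps] times a unit, so the fraction field of
    [fps k] is the field of Laurent series. *)
Lemma laurent_rep x : exists a f, x = eps ^- a * ofps f.
Proof.
set r := generic_quotient.repr x; have d0 : \d_r != 0 by rewrite denom_ratioP.
have [a [u [g [dE gu]]]] := fps_decomp d0.
exists a, (\n_r * g); rewrite [LHS]frac_numden -/r dE !tofracM tofracXn -epsE.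
have u0 : ofps u != 0.
  by rewrite tofrac_eq0; apply: contra_eq_neq gu => ->; rewrite mulr0 eq_sym oner_eq0.
have -> : ofps g = (ofps u)^-1.
  by apply: (mulIf u0); rewrite mulVf // -tofracM gu tofrac1.
by rewrite invfM mulrCA.
Qed.

Lemma coefz_neg f n : n < 0 -> coefz f n = 0. Proof. by case: n. Qed.

Lemma coefL_subproof :
  {c : L -> int -> k | forall a f n, c (eps ^- a * ofps f) n = coefz f (n + a%:Z)}.
Proof.
exists (fun x n => let: exist a h := cid (laurent_rep x) in
                   let: exist f _ := cid h in coefz f (n + a%:Z)).
move=> a f n; case: cid => b h; case: cid => g E.
have {}E : fps_eps k ^+ b * f = fps_eps k ^+ a * g.
  apply/eqP; rewrite -tofrac_eq !tofracM !tofracXn -!epsE; apply/eqP.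
  have ea : eps ^+ a != 0 by rewrite expf_neq0 ?eps_neq0.
  have eb : eps ^+ b != 0 by rewrite expf_neq0 ?eps_neq0.
  by apply: (canRL (mulVKf ea)); rewrite mulrCA E mulVKf.
have -> : n + b%:Z = n + a%:Z + b%:Z - a%:Z by lia.
by rewrite -coefzM_eps -E coefzM_eps addrK.
Qed.

(* The opacity of [coefL] keeps conversion tests between Laurent series cheap. *)
Definition coefL := sval coefL_subproof.

Lemma coefL_rep a f n : coefL (eps ^- a * ofps f) n = coefz f (n + a%:Z).
Proof. exact: (svalP coefL_subproof). Qed.

Lemma coefL_ofps f n : coefL (ofps f) n = coefz f n.
Proof. by have := coefL_rep 0 f n; rewrite expr0 invr1 mul1r addr0. Qed.

Lemma coefzD f g n : coefz (f + g) n = coefz f n + coefz g n.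
Proof. by case: n => //= n; rewrite addr0. Qed.

Lemma laurent_rep2 x y : exists a f g, x = eps ^- a * ofps f /\ y = eps ^- a * ofps g.
Proof.
have [a [f ->]] := laurent_rep x; have [b [g ->]] := laurent_rep y.
have ex c : eps ^+ c != 0 by rewrite expf_neq0 ?eps_neq0.
exists (a + b)%N, (fps_eps k ^+ b * f), (fps_eps k ^+ a * g).
rewrite !tofracM !tofracXn -!epsE exprD invfM; split.
  by rewrite mulrA; congr (_ * _); rewrite -mulrA mulVf ?mulr1.
by rewrite mulrA; congr (_ * _); rewrite mulrAC mulVf ?mul1r.
Qed.

Lemma coefLD x y n : coefL (x + y) n = coefL x n + coefL y n.
Proof.
have [a [f [g [-> ->]]]] := laurent_rep2 x y.
by rewrite -mulrDr -tofracD !coefL_rep coefzD.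
Qed.

Lemma coefL0 n : coefL 0 n = 0.
Proof. by rewrite -tofrac0 coefL_ofps; case: n. Qed.

Lemma coefLN x n : coefL (- x) n = - coefL x n.
Proof. by apply: (addrI (coefL x n)); rewrite -coefLD !subrr coefL0. Qed.

Lemma coefL_sum (I : Type) (r : seq I) (P : pred I) (F : I -> L) n :
  coefL (\sum_(i <- r | P i) F i) n = \sum_(i <- r | P i) coefL (F i) n.
Proof. by apply: (big_morph (fun x => coefL x n)) => [x y|]; rewrite ?coefLD ?coefL0. Qed.

Lemma coefL_inj x y : (forall n, coefL x n = coefL y n) -> x = y.
Proof.
have [a [f [g [-> ->]]]] := laurent_rep2 x y.
move=> E; congr (_ * ofps _); apply: fpsP => n.
by have := E (n%:Z - a%:Z); rewrite !coefL_rep subrK.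
Qed.

Lemma coefL_epsX x (a : nat) n : coefL (eps ^+ a * x) n = coefL x (n - a%:Z).
Proof.
have [b [f ->]] := laurent_rep x.
rewrite mulrCA.
have -> : eps ^+ a * ofps f = ofps (fps_eps k ^+ a * f) by rewrite tofracM tofracXn.
rewrite !coefL_rep coefzM_eps.
by congr coefz; lia.
Qed.

Lemma coefL_epsz x (a n : int) : coefL (eps ^ a * x) n = coefL x (n - a).
Proof.
case: a => a; first exact: coefL_epsX.
rewrite NegzE -exprnN -[in RHS](mulVKf (expf_neq0 a.+1 eps_neq0) x) coefL_epsX.
by congr coefL; lia.
Qed.

Definition inO (m : int) x := forall n, n < m -> coefL x n = 0.

Lemma inO_ofps f : inO 0 (ofps f).
Proof. by move=> n n0; rewrite coefL_ofps; case: n n0. Qed.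

Lemma inO0P x : inO 0 x -> exists f, x = ofps f.
Proof.
move=> x0; exists (Fps (fun n => coefL x n%:Z)); apply: coefL_inj => n.
by rewrite coefL_ofps; case: n => //= n; rewrite x0 //.
Qed.

Lemma inO_eps m a x : inO (m + a) (eps ^ a * x) <-> inO m x.
Proof.
split=> H n nm.
  by have := H (n + a); rewrite coefL_epsz addrK; apply; lia.
by rewrite coefL_epsz H //; lia.
Qed.

Lemma inOP m x : inO m x <-> exists f, x = eps ^ m * ofps f.
Proof.
split=> [|[f ->]]; last by rewrite -[m in inO m]add0r inO_eps; exact: inO_ofps.
have ez : eps ^ m != 0 by rewrite expfz_neq0 ?eps_neq0.
rewrite -[x in inO _ x](mulVKf ez) -[m in inO m]add0r inO_eps => /inO0P[f E].
by exists f; rewrite -E mulVKf.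
Qed.

Lemma inO_le m n x : m <= n -> inO n x -> inO m x.
Proof. by move=> mn xn p pm; apply: xn; lia. Qed.

Lemma inO_ex x : exists N : nat, inO (- N%:Z) x.
Proof.
have [a [f ->]] := laurent_rep x; exists a => n na; rewrite coefL_rep.
by apply: coefz_neg; lia.
Qed.

Lemma inO_add m x y : inO m x -> inO m y -> inO m (x + y).
Proof. by move=> xm ym n nm; rewrite coefLD xm ?ym ?addr0. Qed.

Lemma inO_opp m x : inO m x -> inO m (- x).
Proof. by move=> xm n nm; rewrite coefLN xm ?oppr0. Qed.

Lemma inO0 m : inO m 0. Proof. by move=> n _; rewrite coefL0. Qed.

Lemma inO_sum m (I : Type) (r : seq I) (P : pred I) (F : I -> L) :
  (forall i, P i -> inO m (F i)) -> inO m (\sum_(i <- r | P i) F i).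
Proof. by move=> H; apply: big_ind => //; [exact: inO0 | exact: inO_add]. Qed.

Lemma inO_mul_lead m n x y : inO m x -> inO n y ->
  inO (m + n) (x * y) /\ coefL (x * y) (m + n) = coefL x m * coefL y n.
Proof.
move=> /inOP[f ->] /inOP[g ->].
have -> : eps ^ m * ofps f * (eps ^ n * ofps g) = eps ^ (m + n) * ofps (f * g).
  by rewrite mulrACA -expfzDr ?eps_neq0 // tofracM.
split; first by rewrite -{1}[m + n]add0r inO_eps; exact: inO_ofps.
rewrite !coefL_epsz !subrr !coefL_ofps.
by rewrite -[LHS]/(coef (f * g) 0) coef_fpsM big_ord1.
Qed.

Lemma inO_mul m n x y : inO m x -> inO n y -> inO (m + n) (x * y).
Proof. by move=> xm yn; case: (inO_mul_lead xm yn). Qed.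

Lemma coefL_mul_lead m n x y : inO m x -> inO n y ->
  coefL (x * y) (m + n) = coefL x m * coefL y n.
Proof. by move=> xm yn; case: (inO_mul_lead xm yn). Qed.

(* [M] terms are enough as soon as [y] vanishes below [n - M + N]. *)
Lemma coefLM (N M : nat) x y n :
  inO (- N%:Z) x -> inO (n - M%:Z + N%:Z + 1) y ->
  coefL (x * y) n = \sum_(i < M) coefL x (i%:Z - N%:Z) * coefL y (n - i%:Z + N%:Z).
Proof.
move=> /inOP[f ->] yO.
have [b [g yE]] := laurent_rep y.
have -> : eps ^ (- N%:Z) * ofps f * y = eps ^ (- N%:Z - b%:Z) * ofps (f * g).
  by rewrite yE tofracM mulrACA expfzDr ?eps_neq0 // -!exprnN.
have yc p : coefL y p = coefz g (p + b%:Z) by rewrite yE coefL_rep.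
rewrite coefL_epsz coefL_ofps.
under eq_bigr do rewrite coefL_epsz coefL_ofps opprK subrK yc /=.
have -> : n - (- N%:Z - b%:Z) = n + N%:Z + b%:Z by lia.
set p := n + N%:Z + b%:Z.
pose F (i : nat) := coef f i * coefz g (p - i%:Z).
have FM i : (M <= i)%N -> F i = 0.
  move=> Mi; rewrite /F; have := yO (p - i%:Z - b%:Z).
  by rewrite yc subrK => ->; rewrite ?mulr0 // /p; lia.
have Fp i : p < i%:Z -> F i = 0.
  by move=> pi; rewrite /F coefz_neg ?mulr0 //; lia.
have -> : coefz (f * g) p = \sum_(i < `|p|.+1) F i.
  case: p @F {FM} Fp => [q|q] F Fp.
    rewrite /coefz coef_fpsM; apply: eq_bigr => i _; rewrite /F.
    by rewrite subzn ?leq_ord // -ltnS.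
  by rewrite big1 // => i _; apply: Fp; lia.
transitivity (\sum_(i < maxn M `|p|.+1) F i).
  rewrite (big_ord_widen (maxn M `|p|.+1)) ?leq_maxr // big_mkcond /=.
  by apply: eq_bigr => i _; case: ifP => // ip; rewrite Fp //; lia.
rewrite (big_ord_widen (maxn M `|p|.+1) (fun i => coef f i * coefz g (n - i%:Z + N%:Z + b%:Z))) ?leq_maxl //.
rewrite [RHS]big_mkcond /=; apply: eq_bigr => i _; case: ifP => iM.
  by rewrite /F; congr (_ * coefz _ _); rewrite /p; lia.
by rewrite FM //; lia.
Qed.

Definition constL (a : k) : L := ofps (Fps (fun n => a *+ (n == 0)%N)).

Lemma coefL_const a n : coefL (constL a) n = a *+ (n == 0).
Proof. by rewrite coefL_ofps; case: n. Qed.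

Lemma inO_const a : inO 0 (constL a). Proof. exact: inO_ofps. Qed.

Lemma constL_is_nmod : zmod_morphism constL.
Proof. by move=> a b; apply: coefL_inj => n; rewrite coefLD coefLN !coefL_const mulrnBl. Qed.

Lemma constL_is_monoid : monoid_morphism constL.
Proof.
split=> [|a b].
  by rewrite -(tofrac1 (fps k)); congr ofps; apply: fpsP => n; case: n.
rewrite -tofracM; congr ofps; apply: fpsP => n; rewrite coef_fpsM big_ord_recl /=.
by rewrite subn0 mulr1n mulrnAr big1 ?addr0 // => i _; rewrite mulr0n mul0r.
Qed.

HB.instance Definition _ := GRing.isZmodMorphism.Build k L constL constL_is_nmod.
HB.instance Definition _ := GRing.isMonoidMorphism.Build k L constL constL_is_monoid.

Lemma coefL_constM a x n : coefL (constL a * x) n = a * coefL x n.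
Proof.
have [b [f ->]] := laurent_rep x.
rewrite mulrCA -tofracM !coefL_rep; case: (n + b%:Z) => [m|m]; last by rewrite mulr0.
rewrite /coefz coef_fpsM big_ord_recl /= subn0 mulr1n big1 ?addr0 // => i _.
by rewrite mulr0n mul0r.
Qed.

Lemma coefL1 n : coefL 1 n = (n == 0)%:R.
Proof. by rewrite -(rmorph1 constL) coefL_const. Qed.

Lemma inO1 : inO 0 1. Proof. by rewrite -(rmorph1 constL); exact: inO_const. Qed.

Lemma coefL_epsp (a n : int) : coefL (eps ^ a) n = (n == a)%:R.
Proof. by rewrite -[eps ^ a]mulr1 coefL_epsz coefL1 subr_eq0. Qed.

Lemma inO_epsp (a : int) : inO a (eps ^ a).
Proof. by rewrite -[a in inO a]add0r -[eps ^ a]mulr1 inO_eps; exact: inO1. Qed.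

Lemma inO_prod (I : Type) (r : seq I) (P : pred I) (F : I -> L) :
  (forall i, P i -> inO 0 (F i)) -> inO 0 (\prod_(i <- r | P i) F i).
Proof.
by move=> H; apply: big_ind => //; [exact: inO1 | move=> x y; exact: inO_mul].
Qed.

(* [val x = n] *)
Definition hasval (n : int) x := inO n x /\ coefL x n != 0.

Lemma hasval_mul m n x y : hasval m x -> hasval n y -> hasval (m + n) (x * y).
Proof.
move=> [xm xm0] [yn yn0]; split; first exact: inO_mul.
by rewrite coefL_mul_lead // mulf_neq0.
Qed.

Lemma hasval_inj m n x : hasval m x -> hasval n x -> m = n.
Proof.
move=> [xm xm0] [xn xn0]; apply/eqP; rewrite eq_le; apply/andP; split.
  by rewrite leNgt; apply: contraNN xn0 => /xm ->.
by rewrite leNgt; apply: contraNN xm0 => /xn ->.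
Qed.

Lemma hasval1 : hasval 0 1.
Proof. by split; [exact: inO1 | rewrite coefL1 eqxx oner_eq0]. Qed.

Lemma hasval_eps (a : int) : hasval a (eps ^ a).
Proof. by split; [exact: inO_epsp | rewrite coefL_epsp eqxx oner_eq0]. Qed.

Lemma hasval_neq0 n x : hasval n x -> x != 0.
Proof. by case=> _; apply: contraNneq => ->; rewrite coefL0. Qed.

Lemma hasval_ex x : x != 0 -> exists n, hasval n x.
Proof.
have [a [f ->]] := laurent_rep x; rewrite exprnN.
rewrite mulf_eq0 (negPf (expfz_neq0 _ eps_neq0)) tofrac_eq0 => /= f0.
have [b [u [g [-> gu]]]] := fps_decomp f0.
have u0 : coef u 0 != 0.
  have := congr1 (fun h => coef h 0) gu; rewrite coef_fpsM big_ord1 /= => E.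
  by apply: contra_eq_neq E => ->; rewrite mulr0 eq_sym oner_eq0.
exists (- a%:Z + b%:Z); apply: hasval_mul; first exact: hasval_eps.
suff: hasval (b%:Z + 0) (ofps (fps_eps k ^+ b * u)) by rewrite addr0.
rewrite tofracM tofracXn -epsE exprnP.
apply: hasval_mul; first exact: hasval_eps.
by split; [exact: inO_ofps | rewrite coefL_ofps].
Qed.

Lemma hasvalV n x : hasval n x -> hasval (- n) x^-1.
Proof.
move=> xn; have x0 := hasval_neq0 xn.
have [m xm] : exists m, hasval m x^-1 by apply: hasval_ex; rewrite invr_neq0.
have := hasval_mul xn xm; rewrite mulfV // => /hasval_inj/(_ hasval1) E.
by rewrite (_ : - n = m) //; lia.
Qed.

End Laurent.

(** * The loop group *)

Section InverseMatrices.
Variables (F : fieldType) (n : nat).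
Implicit Types A B : 'M[F]_n.

Lemma invmxM A B : A \in unitmx -> B \in unitmx ->
  invmx (A *m B) = invmx B *m invmx A.
Proof.
move=> Au Bu; have ABu : A *m B \in unitmx by rewrite unitmx_mul Au.
apply: (can_inj (mulKmx ABu)); rewrite (mulmxV ABu) -mulmxA (mulmxA B) (mulmxV Bu).
by rewrite mul1mx mulmxV.
Qed.

Lemma mulmx1_unitl A B : A *m B = 1%:M -> A \in unitmx.
Proof. by move=> /mulmx1_unit[]. Qed.

Lemma mulmx1_invmx A B : A *m B = 1%:M -> invmx A = B.
Proof.
move=> AB; have Au := mulmx1_unitl AB.
by apply: (can_inj (mulKmx Au)); rewrite mulmxV.
Qed.

Lemma scaler_unitmx c A : c != 0 -> A \in unitmx -> c *: A \in unitmx.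
Proof. by move=> c0 Au; rewrite unitmxZ ?unitfE. Qed.

End InverseMatrices.

(** * The Frobenius on Laurent series and [sigma] on matrices *)

Section Frobenius.
Variables (k : fieldType) (q : nat) (qP : [pchar k].-nat q).
Local Notation K := (fps k).
Local Notation L := (laurent k).
Local Notation ofps := (@FracField.tofrac (fps k)).
Local Notation eps := (eps k).

Lemma q_gt0 : (0 < q)%N. Proof. by case/andP: qP. Qed.

Lemma expqD (x y : k) : (x + y) ^+ q = x ^+ q + y ^+ q.
Proof. exact: exprDn_pchar. Qed.

Lemma expq0 : (0 : k) ^+ q = 0.
Proof. by rewrite expr0n gtn_eqF ?q_gt0. Qed.

Lemma expq_sum (I : Type) (r : seq I) (P : pred I) (F : I -> k) :
  (\sum_(i <- r | P i) F i) ^+ q = \sum_(i <- r | P i) F i ^+ q.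
Proof.
by apply: (big_morph (fun x => x ^+ q)) => [x y|]; rewrite ?expqD // expq0.
Qed.

Lemma expqN (x : k) : (- x) ^+ q = - x ^+ q.
Proof.
by apply: (addrI (x ^+ q)); rewrite -expqD !subrr expq0.
Qed.

Lemma frob_fpsM (f g : K) : frob_fps q (f * g) = frob_fps q f * frob_fps q g.
Proof.
apply: fpsP => n; rewrite coef_fpsM -[LHS]/(coef (f * g) n ^+ q) coef_fpsM expq_sum.
by apply: eq_bigr => i _; rewrite exprMn.
Qed.

Lemma frob_fps_epsX a : frob_fps q (fps_eps k ^+ a) = fps_eps k ^+ a.
Proof.
apply: fpsP => n /=; rewrite fps_epsX_coef; case: eqP => _; first by rewrite expr1n.
by rewrite expq0.
Qed.

(** [frob] is defined through a chosen numerator and denominator. After clearing denominators the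
    choice disappears, because [frob_fps] is multiplicative and fixes the powers of [eps]. *)
Lemma coefL_frob (x : L) n : coefL (frob q x) n = coefL x n ^+ q.
Proof.
have [a [f E]] := laurent_rep x.
rewrite /frob [in RHS]E coefL_rep; set r := generic_quotient.repr x.
have d0 : \d_r != 0 by rewrite denom_ratioP.
have Fd0 : ofps (frob_fps q \d_r) != 0.
  rewrite tofrac_eq0; apply: contraNneq d0 => F0; apply/eqP/fpsP => m.
  by have := congr1 (fun h => coef h m) F0 => /= /eqP; rewrite expf_eq0 => /andP[_ /eqP].
have {}E : fps_eps k ^+ a * \n_r = f * \d_r.
  apply/eqP; rewrite -tofrac_eq !tofracM tofracXn -epsE.
  have := frac_numden x; rewrite -/r E => {}E.
  have nd0 : ofps \d_r != 0 by rewrite tofrac_eq0.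
  have -> : ofps \n_r = eps ^- a * ofps f * ofps \d_r by rewrite E divfK.
  by rewrite !mulrA mulfV ?mul1r ?expf_neq0 ?eps_neq0.
have {}E : fps_eps k ^+ a * frob_fps q \n_r = frob_fps q f * frob_fps q \d_r.
  by rewrite -frob_fpsM -E frob_fpsM frob_fps_epsX.
have -> : ofps (frob_fps q \n_r) / ofps (frob_fps q \d_r) = eps ^- a * ofps (frob_fps q f).
  apply: (canLR (mulfK Fd0)); apply: (mulfI (expf_neq0 a (eps_neq0 k))).
  rewrite mulrA [in RHS]mulrA mulfV ?mul1r ?expf_neq0 ?eps_neq0 // -tofracM -E.
  by rewrite tofracM tofracXn.
rewrite coefL_rep; case: (n + a%:Z) => //= _.
by rewrite expq0.
Qed.

(** The characteristic hypothesis is an argument so that the morphism structures, which need it, can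
    be attached to the function. *)
Definition frobH of [pchar k].-nat q : L -> L := frob q.

Lemma inO_frob m (x : L) : inO m x -> inO m (frob q x).
Proof.
by move=> xm n nm; rewrite coefL_frob xm // expq0.
Qed.

Lemma frob_is_nmod : zmod_morphism (frobH qP).
Proof.
by move=> x y; apply: coefL_inj => n; rewrite coefLD coefLN !coefL_frob coefLD coefLN expqD expqN.
Qed.

Lemma frob_is_monoid : monoid_morphism (frobH qP).
Proof.
split=> [|x y]; apply: coefL_inj => n.
  rewrite coefL_frob !coefL1; case: eqP => _; first by rewrite expr1n.
  by rewrite expq0.
rewrite coefL_frob.
have [N xN] := inO_ex x; have [N' yN] := inO_ex y.
have [M yO] : exists M : nat, inO (n - M%:Z + N%:Z + 1) y.
  by exists (absz (n + N%:Z + N'%:Z + 1)%R); apply: inO_le yN; lia.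
rewrite (coefLM xN yO) (coefLM (inO_frob xN) (inO_frob yO)) expq_sum.
by apply: eq_bigr => i _; rewrite exprMn !coefL_frob.
Qed.

HB.instance Definition _ := GRing.isZmodMorphism.Build L L (frobH qP) frob_is_nmod.
HB.instance Definition _ := GRing.isMonoidMorphism.Build L L (frobH qP) frob_is_monoid.

Lemma frobM (x y : L) : frob q (x * y) = frob q x * frob q y.
Proof. exact: (rmorphM (frobH qP)). Qed.

Lemma frob_nat n : frob q (n%:R : L) = n%:R.
Proof. exact: (rmorph_nat (frobH qP)). Qed.

Lemma hasval_frob n (x : L) : hasval n x -> hasval n (frob q x).
Proof. by move=> [xn x0]; split; [exact: inO_frob | rewrite coefL_frob expf_neq0]. Qed.

Lemma frob_const (a : k) : frob q (constL a) = constL (a ^+ q).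
Proof.
apply: coefL_inj => n; rewrite coefL_frob !coefL_const.
by case: eqP => _; rewrite ?mulr1n // !mulr0n expq0.
Qed.

Lemma frob_epsz (a : int) : frob q (eps ^ a) = eps ^ a.
Proof.
apply: coefL_inj => n; rewrite coefL_frob !coefL_epsp.
by case: eqP => _; rewrite ?expr1n // expq0.
Qed.

Local Notation J := (antidiag k).
Local Notation sigma := (@sigma k q).

Lemma antidiag2 : J *m J = 1%:M.
Proof.
apply/matrixP => i j; rewrite !mxE (bigD1 (rev_ord i)) //= !mxE eqxx mul1r.
rewrite rev_ordK big1 ?addr0 1?eq_sym // => l li.
by rewrite !mxE (negPf li) mul0r.
Qed.

Lemma antidiagE (A : 'M[L]_3) i j : (J *m A *m J) i j = A (rev_ord i) (rev_ord j).
Proof.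
rewrite mxE (bigD1 (rev_ord j)) //= mxE (bigD1 (rev_ord i)) //= !mxE eqxx rev_ordK eqxx.
rewrite mul1r mulr1 !big1 ?addr0 // => l li.
  by rewrite !mxE -(inj_eq rev_ord_inj) rev_ordK eq_sym (negPf li) mulr0.
by rewrite !mxE (negPf li) mul0r.
Qed.

Lemma sigmaE (g : 'M[L]_3) i j :
  sigma g i j = frob q (invmx g (rev_ord j) (rev_ord i)).
Proof.
rewrite /Defs.sigma antidiagE mxE.
by rewrite -[map_mx _ _]/(map_mx (frobH qP) g) -map_invmx mxE.
Qed.

Lemma sigmaM (g h : 'M[L]_3) : g \in unitmx -> h \in unitmx ->
  sigma (g *m h) = sigma g *m sigma h.
Proof.
move=> gu hu; apply/matrixP => i j; rewrite sigmaE mxE.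
rewrite (invmxM gu hu).
rewrite mxE -[frob q]/(frobH qP) rmorph_sum (reindex_inj rev_ord_inj) /=.
by apply: eq_bigr => l _; rewrite rmorphM mulrC; congr (_ * _); apply/esym/sigmaE.
Qed.

Lemma sigma1 : sigma 1%:M = 1%:M.
Proof.
apply/matrixP => i j; rewrite sigmaE invmx1 !mxE (inj_eq rev_ord_inj) eq_sym.
by rewrite -[frob q]/(frobH qP) rmorph_nat.
Qed.

Lemma det_antidiag2 : \det J * \det J = 1.
Proof. by rewrite -det_mulmx antidiag2 det1. Qed.

Lemma det_sigma (g : 'M[L]_3) : \det (sigma g) = frob q (\det g)^-1.
Proof.
rewrite /Defs.sigma !det_mulmx mulrC mulrA det_antidiag2 mul1r det_tr det_inv.
by rewrite -[frob q]/(frobH qP) det_map_mx fmorphV.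
Qed.

End Frobenius.

(** * Integral matrices and the Iwahori subgroup *)

Section Iwahori.
Variable k : fieldType.
Local Notation K := (fps k).
Local Notation L := (laurent k).
Local Notation ofps := (@FracField.tofrac (fps k)).
Local Notation eps := (eps k).

Definition fconst (f : K) : k := coef f 0.

Lemma fconst_is_nmod : zmod_morphism fconst. Proof. by []. Qed.
Lemma fconst_is_monoid : monoid_morphism fconst.
Proof. by split=> // f g; rewrite /fconst coef_fpsM big_ord1. Qed.
HB.instance Definition _ := GRing.isZmodMorphism.Build K k fconst fconst_is_nmod.
HB.instance Definition _ := GRing.isMonoidMorphism.Build K k fconst fconst_is_monoid.

Lemma coef0M (f g : K) : coef (f * g) 0 = coef f 0 * coef g 0.
Proof. exact: (rmorphM fconst). Qed.

Lemma fps_unitE (f : K) : (f \is a GRing.unit) = (coef f 0 != 0).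
Proof.
apply/idP/idP => [fu|/fps_unitP[g gf]].
  have := congr1 (fun h => coef h 0) (mulVr fu); rewrite coef0M /= => E.
  by apply: contra_eq_neq E => ->; rewrite mulr0 eq_sym oner_eq0.
by apply/unitrP; exists g; split; rewrite // mulrC.
Qed.

Lemma unitmx_fps n (h : 'M[K]_n) : (h \in unitmx) = (map_mx fconst h \in unitmx).
Proof. by rewrite !unitmxE fps_unitE det_map_mx unitfE. Qed.

(* [GL_3(O)] *)
Definition glO (X : 'M[L]_3) := exists2 h : 'M[K]_3, h \in unitmx & X = map_mx ofps h.

Lemma inO_mx m (X : 'M[L]_m) : (forall i j, inO 0 (X i j)) ->
  exists h : 'M[K]_m, X = map_mx ofps h.
Proof.
move=> XO; have /choice[h hE] : forall ij : 'I_m * 'I_m, exists f, X ij.1 ij.2 = ofps f.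
  by move=> ij; apply: inO0P.
by exists (\matrix_(i, j) h (i, j)); apply/matrixP => i j; rewrite !mxE -hE.
Qed.

Lemma map_ofps_unit (h : 'M[K]_3) : h \in unitmx -> map_mx ofps h \in unitmx.
Proof. by rewrite !unitmxE det_map_mx; exact: rmorph_unit. Qed.

Lemma glO_unit (X : 'M[L]_3) : glO X -> X \in unitmx.
Proof. by case=> h hu ->; exact: map_ofps_unit. Qed.

Lemma invmx_ofps (h : 'M[K]_3) : h \in unitmx ->
  invmx (map_mx ofps h) = map_mx ofps (invmx h).
Proof.
by move=> hu; apply: mulmx1_invmx; rewrite -map_mxM mulmxV // map_mx1.
Qed.

Lemma glO1 : glO 1%:M.
Proof. by exists 1%:M; rewrite ?unitmx1 // map_mx1. Qed.

Lemma glOM (X : 'M[L]_3) Y : glO X -> glO Y -> glO (X *m Y).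
Proof.
move=> [g gu ->] [h hu ->]; exists (g *m h); first by rewrite unitmx_mul gu.
by rewrite map_mxM.
Qed.

Lemma glOV (X : 'M[L]_3) : glO X -> glO (invmx X).
Proof.
by move=> [h hu ->]; exists (invmx h); rewrite ?unitmx_inv // invmx_ofps.
Qed.

Lemma glO_inO (X : 'M[L]_3) i j : glO X -> inO 0 (X i j).
Proof. by case=> h hu ->; rewrite mxE; exact: inO_ofps. Qed.

Lemma glO_det (X : 'M[L]_3) : glO X -> hasval 0 (\det X).
Proof.
case=> h; rewrite unitmxE fps_unitE => hu ->; rewrite det_map_mx.
by split; [exact: inO_ofps | rewrite coefL_ofps].
Qed.

Lemma glOP (X : 'M[L]_3) : (forall i j, inO 0 (X i j)) -> coefL (\det X) 0 != 0 -> glO X.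
Proof.
move=> /inO_mx[h ->]; rewrite det_map_mx coefL_ofps => h0.
by exists h => //; rewrite unitmxE fps_unitE.
Qed.

(** Induction on the row: the diagonal of [C] has no zero, so the [(i, j)] entry of [C C^-1 = 1]
    expresses [invmx C i j] through earlier rows. *)
Lemma trig_invmx n (C : 'M[k]_n) : C \in unitmx ->
  (forall i j : 'I_n, (i < j)%N -> C i j = 0) ->
  forall i j : 'I_n, (i < j)%N -> invmx C i j = 0.
Proof.
move=> Cu Ctrig.
have Cd i : C i i != 0.
  have : \det C != 0 by rewrite -unitfE -unitmxE.
  rewrite det_trig; last by apply/is_trig_mxP => i' j'; exact: Ctrig.
  by move/prodf_neq0 => /(_ i isT).
suff H m (i j : 'I_n) : (i < m)%N -> (i < j)%N -> invmx C i j = 0 by move=> i j; apply: (H i.+1).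
elim: m i j => // m IH i j im ij.
have /matrixP/(_ i j) := mulmxV Cu; rewrite !mxE -val_eqE (ltn_eqF ij).
rewrite (bigD1 i) //= big1 ?addr0 => [|l li].
  by move=> /eqP; rewrite mulf_eq0 (negPf (Cd i)) /= => /eqP.
have [il|li'] := ltnP i l; first by rewrite Ctrig ?mul0r.
have {li'}li : (l < i)%N by rewrite ltn_neqAle li' andbT; exact: li.
by rewrite IH ?mulr0 //; [exact: leq_trans li _ | exact: ltn_trans ij].
Qed.

Definition trig0 (h : 'M[K]_3) := forall i j : 'I_3, (i < j)%N -> coef (h i j) 0 = 0.

Lemma iwahoriGL_mul (X : 'M[L]_3) Y : iwahoriGL X -> iwahoriGL Y -> iwahoriGL (X *m Y).
Proof.
move=> [g [gu gt] <-] [h [hu ht] <-]; exists (g *m h); last by rewrite map_mxM.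
split; first by rewrite unitmx_mul gu.
move=> i j ij; rewrite mxE -[LHS]/(fconst _) rmorph_sum big1 // => l _.
rewrite -[LHS]/(coef (_ * _) 0) coef0M; have [il|li] := ltnP i l; first by rewrite gt ?mul0r.
by rewrite ht ?mulr0 //; exact: leq_ltn_trans ij.
Qed.

Lemma iwahoriGL_inv (X : 'M[L]_3) : iwahoriGL X -> iwahoriGL (invmx X).
Proof.
move=> [g [gu gt] <-]; exists (invmx g); last by rewrite invmx_ofps.
split; first by rewrite unitmx_inv.
have gu' := gu; rewrite unitmx_fps in gu'.
have E : invmx (map_mx fconst g) = map_mx fconst (invmx g).
  by apply: mulmx1_invmx; rewrite -map_mxM mulmxV // map_mx1.
move=> i j ij; have := trig_invmx gu' _ ij; rewrite E mxE; apply.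
by move=> i' j' ij'; rewrite mxE; exact: gt.
Qed.

Lemma iwahoriGL1 : iwahoriGL (1%:M : 'M[L]_3).
Proof.
exists 1%:M; last by rewrite map_mx1.
by split=> [|i j ij]; rewrite ?unitmx1 // mxE -val_eqE (ltn_eqF ij).
Qed.

Lemma iwahoriGL_glO (X : 'M[L]_3) : iwahoriGL X -> glO X.
Proof. by case=> h [hu _] <-; exists h. Qed.

Lemma iwahoriGL_unit (X : 'M[L]_3) : iwahoriGL X -> X \in unitmx.
Proof. by move=> /iwahoriGL_glO/glO_unit. Qed.

Lemma iwahoriGL_inO (X : 'M[L]_3) (i j : 'I_3) : iwahoriGL X -> inO (i < j)%N%:Z (X i j).
Proof.
case=> h [hu ht] <-; rewrite mxE => n; rewrite coefL_ofps.
case: (ltnP i j) => ij n1; last by rewrite coefz_neg.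
by case: n n1 => [[|]|] // _; rewrite /= ht.
Qed.

Lemma iwahoriGL_diag (X : 'M[L]_3) i : iwahoriGL X -> coefL (X i i) 0 != 0.
Proof.
case=> h [hu ht] <-; rewrite mxE coefL_ofps /=.
rewrite unitmx_fps unitmxE det_trig ?unitfE in hu.
  by move/prodf_neq0: hu => /(_ i isT); rewrite mxE.
by apply/is_trig_mxP => i' j' ij; rewrite mxE; exact: ht.
Qed.

Lemma iwahoriGLP (X : 'M[L]_3) : (forall i j : 'I_3, inO (i < j)%N%:Z (X i j)) ->
  (forall i, coefL (X i i) 0 != 0) -> iwahoriGL X.
Proof.
move=> XO Xd; have [|h E] := @inO_mx _ X.
  by move=> i j; apply: inO_le (XO i j); case: (_ < _)%N.
have ht : trig0 h.
  move=> i j ij; have := XO i j 0; rewrite E mxE coefL_ofps ij; exact.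
exists h => //; split=> //; rewrite unitmx_fps unitmxE unitfE det_trig.
  apply/prodf_neq0 => i _; rewrite mxE; have := Xd i; rewrite E mxE coefL_ofps; exact.
by apply/is_trig_mxP => i' j' ij; rewrite mxE; exact: ht.
Qed.

End Iwahori.

(** * The loop group and its quotient by the Iwahori subgroup *)

Section LoopGroup.
Variable k : fieldType.
Local Notation K := (fps k).
Local Notation L := (laurent k).
Local Notation ofps := (@FracField.tofrac (fps k)).
Local Notation eps := (eps k).

(* Carrying the inverse avoids [invmx] and the boolean [unitmx], whose
   conversion tests over [laurent k] do not terminate in practice. *)
Record lg := Lg { mx : 'M[L]_3; mxV : 'M[L]_3; lgP : mx *m mxV = 1%:M /\ mxV *m mx = 1%:M }.

Lemma lg_inj (g h : lg) : mx g = mx h -> g = h.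
Proof.
case: g h => [g g' [gg' g'g]] [h h' [hh' h'h]] /= E; subst h.
have E : g' = h' by rewrite -[g']mulmx1 -hh' mulmxA g'g mul1mx.
by subst h'; congr Lg; exact: Prop_irrelevance.
Qed.

HB.instance Definition _ := gen_eqMixin lg.
HB.instance Definition _ := gen_choiceMixin lg.

Definition lg1 : lg := Lg (conj (mulmx1 1%:M) (mulmx1 1%:M)).
Fact lg_mul_proof (g h : lg) : (mx g *m mx h) *m (mxV h *m mxV g) = 1%:M /\
  (mxV h *m mxV g) *m (mx g *m mx h) = 1%:M.
Proof.
case: g h => [g g' [gg' g'g]] [h h' [hh' h'h]] /=; split.
  by rewrite mulmxA -(mulmxA g) hh' mulmx1.
by rewrite mulmxA -(mulmxA h') g'g mulmx1.
Qed.
Definition lg_mul (g h : lg) : lg := Lg (lg_mul_proof g h).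
Definition lg_inv (g : lg) : lg := Lg (conj (lgP g).2 (lgP g).1).

Fact lg_mulA : associative lg_mul.
Proof. by move=> f g h; apply: lg_inj => /=; rewrite mulmxA. Qed.
Fact lg_mul1 : left_id lg1 lg_mul.
Proof. by move=> f; apply: lg_inj => /=; rewrite mul1mx. Qed.
Fact lg_1mul : right_id lg1 lg_mul.
Proof. by move=> f; apply: lg_inj => /=; rewrite mulmx1. Qed.
Fact lg_mulV : left_inverse lg1 lg_inv lg_mul.
Proof. by move=> f; apply: lg_inj => /=; case: (lgP f). Qed.
Fact lg_Vmul : right_inverse lg1 lg_inv lg_mul.
Proof. by move=> f; apply: lg_inj => /=; case: (lgP f). Qed.

HB.instance Definition _ := isGroup.Build lg
  lg_mulA lg_mul1 lg_1mul lg_mulV lg_Vmul.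

Lemma mxM (g h : lg) : mx (g * h)%g = mx g *m mx h. Proof. by []. Qed.
Lemma mx1 : mx 1%g = 1%:M. Proof. by []. Qed.
Lemma mxVE (g : lg) : mx g^-1%g = mxV g. Proof. by []. Qed.
Lemma mx_unit (g : lg) : mx g \in unitmx.
Proof. by case: (lgP g) => gg' _; exact: mulmx1_unitl gg'. Qed.
Lemma invmx_mx (g : lg) : invmx (mx g) = mx g^-1%g.
Proof. by apply: mulmx1_invmx; case: (lgP g). Qed.
Lemma lg_of (X : 'M[L]_3) : X \in unitmx -> exists g : lg, X = mx g.
Proof.
by move=> Xu; exists (Lg (conj (mulmxV Xu) (mulVmx Xu))).
Qed.

Definition Ig (g : lg) : Prop := iwahoriGL (mx g).
Definition Kg (g : lg) : Prop := glO (mx g).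

Lemma Ig1 : Ig 1%g. Proof. exact: iwahoriGL1. Qed.
Lemma IgM g h : Ig g -> Ig h -> Ig (g * h)%g. Proof. exact: iwahoriGL_mul. Qed.
Lemma IgV g : Ig g -> Ig g^-1%g. Proof. by move=> /iwahoriGL_inv; rewrite invmx_mx. Qed.
Lemma Kg1 : Kg 1%g. Proof. exact: glO1. Qed.
Lemma KgM g h : Kg g -> Kg h -> Kg (g * h)%g. Proof. exact: glOM. Qed.
Lemma KgV g : Kg g -> Kg g^-1%g. Proof. by move=> /glOV; rewrite invmx_mx. Qed.
Lemma Ig_Kg g : Ig g -> Kg g. Proof. exact: iwahoriGL_glO. Qed.

Lemma sc_proof (n : int) : (eps ^ n)%:M *m (eps ^ (- n))%:M = 1%:M :> 'M[L]_3.
Proof. by rewrite -scalar_mxM -expfzDr ?eps_neq0 // subrr expr0z. Qed.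

Definition sc (n : int) : lg :=
  Lg (conj (sc_proof n) (etrans (congr1 (fun m => _ *m (eps ^ m)%:M) (esym (opprK n))) (sc_proof (- n)))).

Lemma mx_sc n : mx (sc n) = (eps ^ n)%:M. Proof. by []. Qed.

Lemma scD m n : sc (m + n) = (sc m * sc n)%g.
Proof. by apply: lg_inj; rewrite mxM !mx_sc -scalar_mxM expfzDr ?eps_neq0. Qed.

Lemma sc0 : sc 0 = 1%g. Proof. by apply: lg_inj; rewrite mx_sc expr0z. Qed.

Lemma scN n : sc (- n) = (sc n)^-1%g.
Proof. by apply: (mulgI (sc n)); rewrite -scD subrr mulgV sc0. Qed.

Lemma scC n g : (sc n * g = g * sc n)%g.
Proof. by apply: lg_inj; rewrite !mxM mx_sc scalar_mxC. Qed.

Lemma mx_scM n g i j : mx (sc n * g)%g i j = eps ^ n * mx g i j.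
Proof. by rewrite mxM mx_sc mul_scalar_mx mxE. Qed.

(* [Iw] is the preimage of the Iwahori subgroup of [PGL_3]. *)
Definition Iw (g : lg) := exists n, Ig (sc n * g)%g.

Lemma hasval_iwahoriGL_scale (c : L) (h : 'M[L]_3) : hasval 0 c ->
  iwahoriGL h -> iwahoriGL (c *: h).
Proof.
move=> [cO c0] hI; apply: iwahoriGLP => [i j|i]; rewrite mxE.
  by rewrite -[X in inO X]add0r; apply: inO_mul => //; exact: iwahoriGL_inO.
have := coefL_mul_lead cO (@iwahoriGL_inO _ _ i i hI); rewrite ltnn addr0 => ->.
by rewrite mulf_neq0 // iwahoriGL_diag.
Qed.

(** A nonzero scalar is a power of [eps] times a unit, and the unit is absorbed by [iwahoriGL]; so
    powers of [eps] suffice. *)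
Lemma iwahoriE (g : lg) : iwahori (mx g) <-> Iw g.
Proof.
split=> [[c cnz [h hI E]]|[n gI]].
  have c0 : c <> 0 by move=> c0; move: cnz; rewrite /= c0 eqxx.
  have [m cm] := hasval_ex (introN eqP c0).
  exists (- m); rewrite /Ig mxM mx_sc mul_scalar_mx -E scalerA.
  apply: hasval_iwahoriGL_scale => //.
  by rewrite -[0](addNr m); apply: hasval_mul => //; exact: hasval_eps.
exists (eps ^ (- n)); first exact: expfz_neq0 (eps_neq0 k).
exists (mx (sc n * g)%g) => //.
by rewrite -mul_scalar_mx -mx_sc -mxM mulgA -scD addNr sc0 mul1g.
Qed.

Lemma Ig_Iw g : Ig g -> Iw g. Proof. by exists 0; rewrite sc0 mul1g. Qed.
Lemma Iw1 : Iw 1%g. Proof. exact/Ig_Iw/Ig1. Qed.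
Lemma IwM g h : Iw g -> Iw h -> Iw (g * h)%g.
Proof.
move=> [m gI] [n hI]; exists (m + n); rewrite scD -mulgA (mulgA (sc n)) (scC n g).
by rewrite -mulgA mulgA; exact: IgM.
Qed.
Lemma IwV g : Iw g -> Iw g^-1%g.
Proof. by move=> [m /IgV gI]; exists (- m); rewrite (scC (- m)) scN -invMg. Qed.
Lemma Iw_sc n : Iw (sc n).
Proof. by exists (- n); rewrite -scD addNr sc0; exact: Ig1. Qed.

Lemma iwahori_lg (X : 'M[L]_3) : iwahori X -> exists2 g : lg, Iw g & X = mx g.
Proof.
move=> XI; have [g gX] : exists g : lg, X = mx g.
  apply: lg_of; case: XI => c cnz [h /iwahoriGL_unit hu <-].
  have c0 : c <> 0 by move=> c0; move: cnz; rewrite /= c0 eqxx.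
  exact: (scaler_unitmx (introN eqP c0) hu).
by exists g => //; rewrite -iwahoriE -gX.
Qed.

Lemma icosetP (g : lg) X : icoset (mx g) X <-> exists2 i, Iw i & X = mx (g * i)%g.
Proof.
split=> [[Y /iwahori_lg[i iI ->] <-]|[i iI ->]]; first by exists i.
by exists (mx i) => //; exact/iwahoriE.
Qed.

Lemma icosetE (g h : lg) : icoset (mx g) = icoset (mx h) <-> Iw (g^-1 * h)%g.
Proof.
split=> [E|H].
  have /icosetP[i iI] : icoset (mx g) (mx h).
    by rewrite E; apply/icosetP; exists 1%g; rewrite ?mulg1 //; exact: Iw1.
  by move/lg_inj => ->; rewrite mulKg.
rewrite predeqE => X; rewrite !icosetP; split=> -[i iI ->].
  exists ((g^-1 * h)^-1 * i)%g; first exact: IwM (IwV H) iI.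
  by rewrite invMg invgK !mulgA mulgV mul1g.
by exists (g^-1 * h * i)%g; [exact: IwM | rewrite !mulgA mulgV mul1g].
Qed.

Definition fl (g : lg) : flag k :=
  Flag (asboolT (ex_intro2 _ _ (mx g) (mx_unit g) (erefl (icoset (mx g))))).

Lemma flE g h : fl g = fl h <-> Iw (g^-1 * h)%g.
Proof.
rewrite -icosetE; split=> [/(congr1 val)//|E]; exact: val_inj.
Qed.

Lemma fl_ex (x : flag k) : exists g, x = fl g.
Proof.
case: x => X XP; have := asboolW XP => -[g /lg_of[h ->] E].
by exists h; apply: val_inj.
Qed.

Lemma fl_icoset (x : flag k) (g : lg) : x = icoset (mx g) :> set _ <-> x = fl g.
Proof. by split=> [E|->//]; exact: val_inj. Qed.

Lemma fl_mulr g i : Iw i -> fl (g * i)%g = fl g.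
Proof. by move=> iI; apply/esym/flE; rewrite mulKg. Qed.

End LoopGroup.

(** * Representatives of Weyl elements, double cosets and the root subgroup of [s1] *)

Section WeylElements.
Variable k : fieldType.
Local Notation L := (laurent k).
Local Notation eps := (eps k).
Local Notation lg := (lg k).
Local Notation bary := (@barycentric int).
Local Open Scope group_scope.

Lemma ord3_case (P : 'I_3 -> 'I_3 -> Prop) :
  P 0%R 0%R -> P 0%R 1%R -> P 0%R 2%:R%R -> P 1%R 0%R -> P 1%R 1%R -> P 1%R 2%:R%R ->
  P 2%:R%R 0%R -> P 2%:R%R 1%R -> P 2%:R%R 2%:R%R -> forall i j, P i j.
Proof.
by move=> *; apply: (@ord3P (fun i => forall j, P i j)); apply: ord3P.
Qed.

Lemma repE (w : iwahoriWeyl) i j :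
  rep k w i j = (if lin w i == j then eps ^ bary (tr w) i else 0)%R.
Proof.
rewrite /rep mul_diag_mx !mxE; case: eqP => _; first by rewrite mulr1.
by rewrite mulr0.
Qed.

Lemma bary_wact (u : 'S_3) (x : int * int) i :
  (bary (wact u x) i = bary x (u i) - bary x (u 2%:R))%R.
Proof. by rewrite -wact_sub /barycentric /= subr0. Qed.

Lemma baryD (x y : int * int) i : (bary (x + y) i = bary x i + bary y i)%R.
Proof. by move: i; apply: ord3P; rewrite /barycentric /=; lia. Qed.

Lemma bary0 i : bary 0%R i = 0%R.
Proof. by move: i; apply: ord3P; rewrite /barycentric /= ?addr0. Qed.

(** Multiplicativity holds only up to a scalar, since [barycentric] normalises the last exponent to
    0. *)
Lemma rep_mul (v w : iwahoriWeyl) :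
  rep k (v * w) = (eps ^ (- bary (tr w) (lin v 2%:R)) *: (rep k v *m rep k w))%R.
Proof.
apply/matrixP => i j; rewrite repE !mxE (bigD1 (lin v i)) //= repE eqxx repE.
rewrite big1 => [|l li]; last by rewrite repE eq_sym (negPf li) mul0r.
rewrite addr0 permM; case: eqP => _; last by rewrite !mulr0.
rewrite baryD bary_wact -!expfzDr ?eps_neq0 //; congr (_ ^ _)%R; lia.
Qed.

Lemma rep_1 : rep k 1 = 1%:M%R.
Proof.
by apply/matrixP => i j; rewrite repE !mxE perm1 bary0 expr0z; case: eqP.
Qed.

Lemma rep_unit (w : iwahoriWeyl) : rep k w \in unitmx.
Proof.
have := rep_mul w w^-1; rewrite mulgV rep_1 scalemxAr => /esym; exact: mulmx1_unitl.
Qed.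

Fact rp_subproof w : {g : lg | mx g = rep k w}.
Proof. by exists (Lg (conj (mulmxV (rep_unit w)) (mulVmx (rep_unit w)))). Qed.

Definition rp w : lg := sval (rp_subproof w).

Lemma mx_rp w : mx (rp w) = rep k w. Proof. exact: svalP (rp_subproof w). Qed.

Lemma rpM v w : exists n, rp (v * w) = sc k n * (rp v * rp w).
Proof.
exists (- bary (tr w) (lin v 2%:R%R))%R; apply: lg_inj.
by rewrite !mxM !mx_rp rep_mul mx_sc mul_scalar_mx.
Qed.

Lemma rp1 : rp 1 = 1. Proof. by apply: lg_inj; rewrite mx_rp rep_1. Qed.

Lemma rpV w : exists n, rp w^-1 = sc k n * (rp w)^-1.
Proof.
have [n] := rpM w^-1 w; rewrite mulVg rp1 => E; exists (- n)%R.
by apply: (mulIg (rp w)); rewrite -mulgA mulVg mulg1 scN; apply: (mulgI (sc k n)); rewrite -E mulgV.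
Qed.

Definition D w (g : lg) := exists i j, [/\ Iw i, Iw j & g = i * rp w * j].

Lemma double_cosetE w (g : lg) : double_coset w (mx g) <-> D w g.
Proof.
split=> [[X /iwahori_lg[i iI ->] [Y /iwahori_lg[j jI ->] E]]|[i [j [iI jI ->]]]].
  by exists i, j; split=> //; apply: lg_inj; rewrite !mxM mx_rp E.
by exists (mx i); [exact/iwahoriE | exists (mx j); [exact/iwahoriE | by rewrite !mxM mx_rp]].
Qed.

Lemma D_rp w : D w (rp w).
Proof. by exists 1, 1; split; [exact: Iw1 | exact: Iw1 | rewrite mul1g mulg1]. Qed.

Lemma D_mull i w g : Iw i -> D w g -> D w (i * g).
Proof. by move=> iI [a [b [aI bI ->]]]; exists (i * a), b; split=> //; [exact: IwM | rewrite !mulgA]. Qed.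

Lemma D_mulr i w g : Iw i -> D w g -> D w (g * i).
Proof. by move=> iI [a [b [aI bI ->]]]; exists a, (b * i); split=> //; [exact: IwM | rewrite !mulgA]. Qed.

Lemma D_mullE i w g : Iw i -> D w (i * g) <-> D w g.
Proof.
move=> iI; split; last exact: D_mull.
by move=> /(D_mull (IwV iI)); rewrite mulKg.
Qed.

Lemma D_mulrE i w g : Iw i -> D w (g * i) <-> D w g.
Proof.
move=> iI; split; last exact: D_mulr.
by move=> /(D_mulr (IwV iI)); rewrite mulgK.
Qed.

Lemma D_rpM v w : D (v * w) (rp v * rp w).
Proof.
have [n E] := rpM v w; apply/(D_mullE _ _ (Iw_sc k n)); rewrite -E; exact: D_rp.
Qed.

Lemma DV w g : D w g -> D w^-1 g^-1.
Proof.
move=> [a [b [aI bI ->]]]; rewrite !invMg; apply: D_mull; first exact: IwV.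
apply: D_mulr; first exact: IwV.
have [n E] := rpV w; apply/(D_mullE _ _ (Iw_sc k n)); rewrite -E; exact: D_rp.
Qed.

Lemma D1 g : D 1 g <-> Iw g.
Proof.
split=> [[a [b [aI bI ->]]]|gI]; first by rewrite rp1 mulg1; exact: IwM.
by exists g, 1; split=> //; [exact: Iw1 | rewrite rp1 !mulg1].
Qed.

Lemma D_Ig w g : D w g -> exists n i j, [/\ Ig i, Ig j & g = sc k n * (i * rp w * j)].
Proof.
move=> [i [j [[m iI] [n jI] ->]]]; exists (- (m + n))%R, (sc k m * i), (sc k n * j); split=> //.
rewrite (scC n j) (mulgA _ j) -(scC n (sc k m * i * rp w * j)) !mulgA -!scD (_ : (- (m + n) + n + m = 0)%R).
  by rewrite sc0 mul1g.
lia.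
Qed.

Lemma rpVE w i j : mx (rp w)^-1 i j = (if i == lin w j then eps ^ (- bary (tr w) j) else 0)%R.
Proof.
have E : rep k w *m (\matrix_(i, j) (if i == lin w j then eps ^ (- bary (tr w) j) else 0)%R) = 1%:M%R.
  apply/matrixP => a b; rewrite !mxE (bigD1 (lin w a)) //= repE eqxx !mxE.
  rewrite big1 => [|l li]; last by rewrite repE eq_sym (negPf li) mul0r.
  rewrite addr0 (inj_eq perm_inj); case: eqP => [->|_]; last by rewrite mulr0.
  by rewrite -expfzDr ?eps_neq0 // subrr expr0z.
by rewrite -invmx_mx mx_rp (mulmx1_invmx E) mxE.
Qed.

Lemma mxME (g h : lg) i j : mx (g * h) i j = (\sum_l mx g i l * mx h l j)%R.
Proof. by rewrite mxM mxE. Qed.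

Lemma rp_mull w (g : lg) i j : mx (rp w * g) i j = (eps ^ bary (tr w) i * mx g (lin w i) j)%R.
Proof.
rewrite mxME (bigD1 (lin w i)) //= mx_rp repE eqxx big1 ?addr0 // => l li.
by rewrite repE eq_sym (negPf li) mul0r.
Qed.

Lemma rpV_mulr w (g : lg) i j : mx (g * (rp w)^-1) i j = (mx g i (lin w j) * eps ^ (- bary (tr w) j))%R.
Proof.
rewrite mxME (bigD1 (lin w j)) //= rpVE eqxx big1 ?addr0 // => l li.
by rewrite rpVE (negPf li) mulr0.
Qed.

Lemma conj_rpE w (g : lg) i j : mx (rp w * g * (rp w)^-1) i j =
  (eps ^ (bary (tr w) i - bary (tr w) j) * mx g (lin w i) (lin w j))%R.
Proof. by rewrite rpV_mulr rp_mull mulrAC -expfzDr ?eps_neq0. Qed.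

Lemma conj_rp_Ig w (g : lg) :
  (forall i j : 'I_3, inO ((i < j)%N%:Z + bary (tr w) j - bary (tr w) i)%R (mx g (lin w i) (lin w j))) ->
  (forall i, coefL (mx g i i) 0 != 0%R) -> Ig (rp w * g * (rp w)^-1).
Proof.
move=> gO gd; apply: iwahoriGLP => [i j|i]; rewrite conj_rpE.
  rewrite (_ : (i < j)%N%:Z = (i < j)%N%:Z + bary (tr w) j - bary (tr w) i + (bary (tr w) i - bary (tr w) j))%R; last lia.
  by rewrite inO_eps.
by rewrite subrr expr0z mul1r.
Qed.

Local Notation P := (rp tau).

Lemma lin_tauE : lin tau = tperm 0%R 1%R * tperm 1%R 2%:R%R.
Proof. exact: mul1g. Qed.

Lemma tr_tau : tr tau = (1, 0)%R.
Proof. by rewrite -[tr tau]/(omega1 + wact 1%g (0 + wact (tperm 0%R 1%R) 0))%R !(wact0, addr0). Qed.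

Lemma lin_tau : ((lin tau 0%R = 2%:R%R) * (lin tau 1%R = 0%R) * (lin tau 2%:R%R = 1%R))%type.
Proof.
rewrite lin_tauE !permM; do !split.
- by rewrite !tpermL.
- by rewrite tpermR tpermD.
- by rewrite [tperm 0%R _ _]tpermD // tpermR.
Qed.

Lemma bary_tau :
  ((bary (tr tau) 0%R = 1%R) * (bary (tr tau) 1%R = 0%R) * (bary (tr tau) 2%:R%R = 0%R))%type.
Proof. by rewrite tr_tau. Qed.

(** [tau] has length zero: it moves the basis [eps^n e_i], ordered by [3 n + i], by one position,
    and so normalises the Iwahori subgroup. *)
Lemma Ig_P (g : lg) : Ig g -> Ig (P * g * P^-1).
Proof.
move=> gI; apply: conj_rp_Ig => [|i]; last exact: iwahoriGL_diag.
have H a b := @iwahoriGL_inO _ _ a b gI.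
apply: ord3_case; rewrite ?lin_tau ?bary_tau.
all: by (apply: inO_le (H _ _)).
Qed.

Lemma lin_tauV : ((lin tau^-1 0%R = 1%R) * (lin tau^-1 1%R = 2%:R%R) * (lin tau^-1 2%:R%R = 0%R))%type.
Proof.
have [[a b] c] := lin_tau.
by do !split; apply: (@perm_inj _ (lin tau)); rewrite /= permKV ?a ?b ?c.
Qed.

Lemma Ig_PV (g : lg) : Ig g -> Ig (P^-1 * g * P).
Proof.
move=> gI; have [n E] := rpV tau.
have -> : P^-1 * g * P = rp tau^-1 * g * (rp tau^-1)^-1.
  rewrite E invMg invgK -scN -(scC (- n) P) (mulgA _ _ P) -(scC (- n) (sc k n * P^-1 * g)).
  by rewrite !mulgA -scD addNr sc0 mul1g.
have trV : tr tau^-1 = (0, 1)%R.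
  rewrite -[tr tau^-1]/(- wact (lin tau)^-1 (tr tau))%R tr_tau /wact.
  by rewrite -[(lin tau)^-1]/(lin tau^-1) !lin_tauV /barycentric.
apply: conj_rp_Ig => [|i]; last exact: iwahoriGL_diag.
have H a b := @iwahoriGL_inO _ _ a b gI.
apply: ord3_case; rewrite trV ?lin_tauV.
all: by (apply: inO_le (H _ _)).
Qed.

Lemma Iw_P (g : lg) : Iw g -> Iw (P * g * P^-1).
Proof. by move=> [n gI]; exists n; rewrite !mulgA (scC n P) -(mulgA P); exact: Ig_P. Qed.

Lemma Iw_PV (g : lg) : Iw g -> Iw (P^-1 * g * P).
Proof. by move=> [n gI]; exists n; rewrite !mulgA (scC n P^-1) -(mulgA P^-1); exact: Ig_PV. Qed.

Lemma D_mulP w g : D w g -> D (w * tau) (g * P).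
Proof.
move=> [i [j [iI jI ->]]].
rewrite -!mulgA (_ : j * P = P * (P^-1 * j * P)); last by rewrite !mulgA mulgV mul1g.
rewrite (mulgA (rp w)); apply: D_mull iI _; apply: D_mulr; [exact: Iw_PV | exact: D_rpM].
Qed.

Lemma D_mulPV w g : D w g -> D (w * tau^-1) (g * P^-1).
Proof.
move=> [i [j [iI jI ->]]].
rewrite -!mulgA (_ : j * P^-1 = P^-1 * (P * j * P^-1)); last by rewrite !mulgA mulVg mul1g.
rewrite (mulgA (rp w)); apply: D_mull iI _; apply: D_mulr; first exact: Iw_P.
have [n E] := rpV tau; apply/(D_mullE _ _ (Iw_sc k n)).
by rewrite mulgA (scC n (rp w)) -mulgA -E; exact: D_rpM.
Qed.

Lemma D_Pmul w g : D w g -> D (tau * w) (P * g).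
Proof.
move=> /DV/D_mulPV/DV; rewrite !invMg !invgK; exact.
Qed.

Lemma D_PVmul w g : D w g -> D (tau^-1 * w) (P^-1 * g).
Proof.
move=> /DV/D_mulP/DV; rewrite !invMg !invgK; exact.
Qed.

Lemma u_proof (x : k) : ((1%:M + constL x *: delta_mx 1 0) *m
  (1%:M - constL x *: delta_mx 1 0) = 1%:M :> 'M[L]_3)%R.
Proof.
rewrite mulmxBr mulmx1 mulmxDl mul1mx -scalemxAr -scalemxAl mul_delta_mx_0 // !scaler0.
by rewrite addr0 addrK.
Qed.

Lemma u_proof2 (x : k) : ((1%:M - constL x *: delta_mx 1 0) *m
  (1%:M + constL x *: delta_mx 1 0) = 1%:M :> 'M[L]_3)%R.
Proof.
rewrite mulmxDr mulmx1 mulmxBl mul1mx -scalemxAr -scalemxAl mul_delta_mx_0 // !scaler0.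
by rewrite subr0 subrK.
Qed.

Fact u_subproof x : {g : lg | mx g = 1%:M + constL x *: delta_mx 1 0 :> 'M[L]_3}%R.
Proof. by exists (Lg (conj (u_proof x) (u_proof2 x))). Qed.

(** The root subgroup of the simple root of [s1]. It lies below the diagonal because [Ig] is lower
    triangular modulo [eps]. *)
Definition u (x : k) : lg := sval (u_subproof x).

Lemma mx_u x : mx (u x) = (1%:M + constL x *: delta_mx 1 0)%R.
Proof. exact: svalP (u_subproof x). Qed.

Lemma uN x : u (- x)%R = (u x)^-1.
Proof.
apply: (mulgI (u x)); rewrite mulgV; apply: lg_inj.
rewrite mxM !mx_u mx1 rmorphN scaleNr; exact: u_proof. Qed.

Lemma uD x y : u (x + y)%R = u x * u y.
Proof.
apply: lg_inj; rewrite mxM !mx_u mulmxDr mulmx1 mulmxDl mul1mx -scalemxAr -scalemxAl.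
by rewrite mul_delta_mx_0 // !scaler0 addr0 rmorphD scalerDl addrA.
Qed.

Lemma u0 : u 0%R = 1. Proof. by apply: lg_inj; rewrite mx_u rmorph0 scale0r addr0. Qed.

Lemma mulu_mx (g : lg) x i j :
  mx (g * u x) i j = (mx g i j + (constL x * mx g i 1) *+ (j == 0))%R.
Proof.
rewrite mxM mx_u mulmxDr mulmx1 mxE -scalemxAr mxE; congr (_ + _)%R.
rewrite mxE (bigD1 1%R) //= mxE eqxx big1 ?addr0 => [|l li]; last first.
  by rewrite mxE (negPf li) mulr0.
by case: (j == 0%R); rewrite ?mulr1 ?mulr1n // !mulr0 mulr0n.
Qed.

Lemma umul_mx (g : lg) x i j :
  mx (u x * g) i j = (mx g i j + (constL x * mx g 0 j) *+ (i == 1))%R.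
Proof.
rewrite mxM mx_u mulmxDl mul1mx mxE -scalemxAl mxE; congr (_ + _)%R.
rewrite mxE (bigD1 0%R) //= mxE eqxx andbT big1 ?addr0 => [|l li]; last first.
  by rewrite mxE (negPf li) andbF mul0r.
by case: (i == 1%R); rewrite ?mul1r ?mulr1n // mul0r mulr0 mulr0n.
Qed.

Lemma Ig_u x : Ig (u x).
Proof.
rewrite -[u x]mul1g; apply: iwahoriGLP => [i j|i]; rewrite mulu_mx mx1.
  move: i j; apply: ord3_case; rewrite !mxE /= ?mulr0n ?mulr1n ?mulr0 ?mulr1 ?addr0 ?add0r; try exact: inO0; try exact: inO1.
  exact: inO_const.
by move: i; apply: ord3P; rewrite !mxE /= ?mulr0n ?mulr1n ?mulr0 ?addr0 coefL1 oner_eq0.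
Qed.

Local Notation n1 := (rp s1).

Lemma n1n1 : n1 * n1 = 1.
Proof.
apply: lg_inj; rewrite mxM !mx_rp mx1.
have := rep_mul s1 s1; rewrite (_ : s1 * s1 = 1) ?rep_1 ?bary0 ?oppr0 ?expr0z ?scale1r //.
by congr IW; rewrite /= ?wact0 ?addr0 // tperm2.
Qed.

Lemma n1V : n1^-1 = n1. Proof. by apply: (mulgI n1); rewrite mulgV n1n1. Qed.

Lemma conj_n1 (g : lg) i j :
  mx (n1 * g * n1) i j = mx g (tperm 0%R 1%R i) (tperm 0%R 1%R j).
Proof. by rewrite -{2}n1V conj_rpE !bary0 subrr expr0z mul1r. Qed.

Lemma Ig_conj_n1 (g : lg) : Ig g -> coefL (mx g 1 0)%R 0 = 0%R -> Ig (n1 * g * n1).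
Proof.
move=> gI g10; apply: iwahoriGLP => [i j|i]; rewrite conj_n1; last exact: iwahoriGL_diag.
have H a b := @iwahoriGL_inO _ _ a b gI.
move: i j; apply: ord3_case; rewrite ?tpermL ?tpermR ?tpermD //.
all: try by (apply: inO_le (H _ _)).
move=> m mlt; have {}mlt : (m < 1)%R by exact: mlt.
have [->//|m0] := eqVneq m 0%R; apply: (H 1%R 0%R).
by rewrite (_ : (1%R < 0%R)%N%:Z = 0%R) //; lia.
Qed.

(** The residue of the [(1, 0)] entry is the only obstruction to staying in [Ig] under conjugation
    by [n1], and a factor [u y] removes it. So the [u y * n1] represent all cosets in the cell of
    [s1]. *)
Lemma Ig_u_split (g : lg) : Ig g -> exists y g', [/\ g = u y * g', Ig g' & Ig (n1 * g' * n1)].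
Proof.
move=> gI; have H a b := @iwahoriGL_inO _ _ a b gI.
have d0 := iwahoriGL_diag 0%R gI.
pose y := (coefL (mx g 1 0)%R 0 / coefL (mx g 0 0)%R 0)%R.
exists y, (u (- y)%R * g); split; first by rewrite uN mulKVg.
  exact: IgM (Ig_u _) gI.
apply: Ig_conj_n1; first exact: IgM (Ig_u _) gI.
by rewrite umul_mx eqxx mulr1n coefLD coefL_constM mulNr divfK // subrr.
Qed.

(** The identity of [SL_2] that puts an opposite root element into the big cell. *)
Lemma n1_u_n1 x : x != 0%R -> exists2 b, Ig b & n1 * u x * n1 = u x^-1%R * n1 * b.
Proof.
move=> x0; exists (n1 * u (- x^-1)%R * (n1 * u x * n1)); last first.
  by rewrite !mulgA -(mulgA (u _) n1 n1) n1n1 mulg1 uN mulgV mul1g.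
have nu y i j : mx (n1 * u y * n1) i j = ((i == j)%:R + constL y *+ ((i == 0) && (j == 1)))%R.
  rewrite conj_n1 -[u y]mul1g mulu_mx mx1.
  by move: i j; apply: ord3_case; rewrite ?tpermL ?tpermR ?tpermD // !mxE /= ?mulr0n ?mulr1n ?mulr0 ?mulr1 ?addr0 ?add0r.
set g := n1 * _ * n1; have {}nu i j : mx g i j = _ := nu x i j.
have E i j : mx (n1 * u (- x^-1)%R * g) i j =
    (mx g (tperm 0 1 i) j - constL x^-1 * mx g 0 j *+ (i == 0))%R.
  rewrite -mulgA rp_mull bary0 expr0z mul1r umul_mx rmorphN mulNr mulNrn.
  by congr (_ - _ *+ _)%R; rewrite -(inj_eq (@perm_inj _ (tperm 0 1)%R)) tpermK tpermR.
have simp := (@mulr0n L, @mulr1n L, @mulr0 L, @mulr1 L, @addr0 L, @add0r L, @oppr0 L, @subr0 L).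
have xV : (constL x^-1 * constL x = 1 :> L)%R by rewrite -rmorphM mulVf // rmorph1.
apply: iwahoriGLP => [i j|i]; rewrite E !nu.
  move: i j; apply: ord3_case; rewrite ?tpermL ?tpermR ?tpermD //= ?simp ?xV ?subrr; try exact: inO0; try exact: inO1.
    by apply: inO_opp; exact: inO_const.
  exact: inO_const.
move: i; apply: ord3P; rewrite ?tpermL ?tpermR ?tpermD //= ?simp ?xV ?subrr.
- by rewrite coefLN coefL_const mulr1n oppr_eq0 invr_eq0.
- by rewrite coefL_const mulr1n.
- by rewrite coefL1 oner_eq0.
Qed.

(* The position in the [Z]-indexed basis [eps^n e_i], ordered by [3 n + i], of
   the image of [e_j] under [w]; [w s1 > w] iff it increases from [j = 0] to
   [j = 1]. *)
Definition fpos (w : iwahoriWeyl) (j : 'I_3) : int :=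
  let i := (lin w)^-1 j in (3 * bary (tr w) i + (i : nat)%:Z)%R.

Definition rasc w := (fpos w 0 < fpos w 1)%R.

(** For [w s1 > w] the root of [s1] stays positive under [w]; [rasc] expresses this through
    positions in the ordered basis. *)
Lemma rasc_conj w x : rasc w -> Ig (rp w * u x * (rp w)^-1).
Proof.
rewrite /rasc /fpos => ha; apply: conj_rp_Ig => [i j|i]; last exact: iwahoriGL_diag (Ig_u x).
rewrite -[u x]mul1g mulu_mx mx1 !mxE.
have [ij|ij] := eqVneq i j.
  rewrite ij ltnn eqxx add0r subrr; apply: inO_add; first exact: inO1.
  by case: (lin w j == 0)%R / eqP => [->|_] /=; rewrite ?mulr0 ?mulr0n ?mul0rn; exact: inO0.
rewrite (inj_eq perm_inj) (negPf ij) add0r.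
case: (lin w j =P 0)%R => [wj|_]; last exact: inO0.
case: (lin w i =P 1)%R => [wi|_]; last by rewrite mulr0; exact: inO0.
rewrite mulr1 mulr1n; apply: inO_le (inO_const x).
move: ha; rewrite -wj -wi !permK.
have := ltn_ord i; have := ltn_ord j; case: (ltnP i j); lia.
Qed.

(** The root factor [u y] passes to the left of [rp w] into the Iwahori subgroup, and the remaining
    factor stays in [Ig] under conjugation by [n1]. *)
Lemma D_up w g x : rasc w -> D w g -> D (w * s1) (g * u x * n1).
Proof.
move=> wa [i [j [iI [n jI] ->]]].
have [y [j' [E j'I nj']]] := Ig_u_split (IgM jI (Ig_u x)).
have {}E : j * u x = sc k (- n) * (u y * j') by rewrite -E mulgA mulgA -scD addNr sc0 mul1g.
rewrite -(mulgA _ j) E -!mulgA (mulgA (rp w)) -(scC (- n) (rp w)) -!mulgA (mulgA i) -(scC (- n) i).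
rewrite -!mulgA; apply: D_mull (Iw_sc _ _) _; apply: D_mull iI _.
have -> : rp w * (u y * (j' * n1)) = rp w * u y * (rp w)^-1 * (rp w * n1 * (n1 * j' * n1)).
  by rewrite !mulgA -(mulgA _ n1 n1) n1n1 mulg1 mulgKV.
apply: D_mull; first exact/Ig_Iw/rasc_conj.
by apply: D_mulr (D_rpM _ _); exact: Ig_Iw.
Qed.

(** A point of the line stays in the cell of [w] unless its coordinate [y] vanishes, when it falls
    into that of [w s1]. The case of nonzero [y] is [n1_u_n1]. *)
Lemma D_down w g x : rasc (w * s1) -> D w g ->
  D w (g * u x * n1) \/ D (w * s1) (g * u x * n1).
Proof.
move=> wa [i [j [iI [n jI] ->]]].
have [y [j' [E j'I nj']]] := Ig_u_split (IgM jI (Ig_u x)).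
have {}E : j * u x = sc k (- n) * (u y * j') by rewrite -E mulgA mulgA -scD addNr sc0 mul1g.
rewrite -(mulgA _ j) E -!mulgA (mulgA (rp w)) -(scC (- n) (rp w)) -!mulgA (mulgA i) -(scC (- n) i).
rewrite -!mulgA !(D_mullE _ _ (Iw_sc _ _)) !(D_mullE _ _ iI).
have -> : rp w * (u y * (j' * n1)) = rp w * u y * n1 * (n1 * j' * n1).
  by rewrite !mulgA -(mulgA _ n1 n1) n1n1 mulg1.
rewrite !(D_mulrE _ _ (Ig_Iw nj')).
have [y0|y0] := eqVneq y 0%R; [right|left]; first by rewrite y0 u0 mulg1; exact: D_rpM.
have [m Em] := rpM w s1; set v := w * s1 in wa Em.
have wE : rp w = sc k (- m) * (rp v * n1).
  by rewrite Em -(mulgA _ _ n1) -(mulgA _ n1 n1) n1n1 mulg1 mulgA -scD addNr sc0 mul1g.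
have [b bI Eb] := n1_u_n1 y0.
rewrite wE -!mulgA D_mullE ?(mulgA n1 (u y)) ?Eb; last exact: Iw_sc.
have -> : rp v * (u y^-1%R * n1 * b) = rp v * u y^-1%R * (rp v)^-1 * (rp v * n1 * b).
  by rewrite !mulgA mulgKV.
apply: D_mull; first exact/Ig_Iw/rasc_conj.
apply: D_mulr; first exact: Ig_Iw.
by apply/(D_mullE _ _ (Iw_sc k (- m))); rewrite -wE; exact: D_rp.
Qed.

Definition dv (n : int) (g : lg) := hasval n (\det (mx g)).

Lemma dvM m n g h : dv m g -> dv n h -> dv (m + n)%R (g * h).
Proof. by rewrite /dv mxM det_mulmx; exact: hasval_mul. Qed.

Lemma dv_inj m n g : dv m g -> dv n g -> m = n. Proof. exact: hasval_inj. Qed.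

Lemma dv1 : dv 0%R 1. Proof. by rewrite /dv mx1 det1; exact: hasval1. Qed.

Lemma dvK g : Kg g -> dv 0%R g. Proof. exact: glO_det. Qed.

Lemma dv_ex g : exists n, dv n g.
Proof. by apply: hasval_ex; rewrite -unitfE -unitmxE mx_unit. Qed.

Lemma dvV n g : dv n g -> dv (- n)%R g^-1.
Proof.
move=> gn; have [m gm] := dv_ex g^-1; have := dvM gn gm; rewrite mulgV.
by move=> /(dv_inj dv1) E; rewrite (_ : (- n)%R = m) //; lia.
Qed.

Lemma dv_sc n : dv (n * 3)%R (sc k n).
Proof. by rewrite /dv mx_sc det_scalar exprnP exprz_exp; exact: hasval_eps. Qed.

(** The determinant valuation of [rp w]. Scalars change it by multiples of 3, so its class modulo 3
    is the connected component of [w]. *)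
Definition wdeg (w : iwahoriWeyl) : int := (\sum_i bary (tr w) i)%R.

Lemma dv_rp w : dv (wdeg w) (rp w).
Proof.
rewrite /dv mx_rp /rep det_mulmx det_diag det_perm -[wdeg w]addr0.
apply: hasval_mul.
  rewrite /wdeg !big_ord_recl !big_ord0 !mxE mulr1 (addr0 (bary _ (lift ord0 (lift ord0 ord0)))).
  by apply: hasval_mul; last apply: hasval_mul; exact: hasval_eps.
have h1 := hasval1 k; case: (odd_perm _); rewrite ?expr0 // expr1.
by split; [apply: inO_opp h1.1 | rewrite coefLN oppr_eq0; exact: h1.2].
Qed.

Lemma dv_D w c i j : Ig i -> Ig j -> dv (c * 3 + wdeg w)%R (sc k c * (i * rp w * j)).
Proof.
move=> /Ig_Kg/dvK di /Ig_Kg/dvK dj; apply: dvM (dv_sc c) _.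
by rewrite -[wdeg w]add0r -[X in dv X]addr0; exact: dvM (dvM di (dv_rp w)) dj.
Qed.

Lemma coefL_sum_lead (F : 'I_3 -> L) r e :
  (forall p, p != r -> inO (e + 1)%R (F p)) -> coefL (\sum_p F p)%R e = coefL (F r) e.
Proof.
move=> H; rewrite (bigD1 r) //= coefLD coefL_sum big1 ?addr0 // => p pr.
by apply: H => //; lia.
Qed.

(** Position [fpos w 1] is the lowest of the three, so in row [r] only one product of entries
    reaches the leading order, and this row displays row 1 of [j]. *)
Lemma lead_pos w c (i j : lg) (q : 'I_3) : (fpos w 1 < fpos w 0)%R -> (fpos w 1 < fpos w 2%:R)%R ->
  Ig i -> Ig j -> let r := (lin w)^-1 1%R in
  coefL (mx (sc k c * (i * rp w * j)) r q) (c + bary (tr w) r)%R =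
  (coefL (mx i r r) 0 * coefL (mx j 1 q) 0)%R.
Proof.
move=> f10 f12 iI jI r; have wr : lin w r = 1%R by rewrite permKV.
have iH a b := @iwahoriGL_inO _ _ a b iI; have jH a b := @iwahoriGL_inO _ _ a b jI.
rewrite mx_scM coefL_epsz (_ : (c + bary (tr w) r - c = bary (tr w) r)%R); last lia.
rewrite -mulgA mxME (@coefL_sum_lead _ r) => [|p pr].
  rewrite rp_mull wr mulrCA coefL_epsz subrr.
  have jO : inO 0 (mx j 1%R q) by apply: inO_le (jH _ _); case: (_ < _)%N.
  by have := coefL_mul_lead (iH r r) jO; rewrite ltnn addr0.
rewrite rp_mull mulrCA.
apply: (@inO_le _ _ ((r < p)%N%:Z + (lin w p < q)%N%:Z + bary (tr w) p)%R); last first.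
  by rewrite inO_eps; apply: inO_mul.
have : (fpos w 1 < fpos w (lin w p))%R.
  have : lin w p != 1%R by rewrite -wr (inj_eq perm_inj).
  by move: (lin w p); apply: ord3P.
rewrite /fpos permK -/r; have := ltn_ord r; have := ltn_ord p; case: (ltnP r p); lia.
Qed.

(** If position 1 is not the lowest, the residues of [j] are read from the inverse matrix: in column
    [r] only the term with column 0 of [j^-1] reaches the leading order. *)
Lemma lead_neg w c (i j : lg) (q : 'I_3) : (fpos w 1 < fpos w 0)%R -> (fpos w 2%:R < fpos w 0 + 3)%R ->
  Ig i -> Ig j -> (q <= 1)%N -> let r := (lin w)^-1 0%R in
  coefL (mx (sc k c * (i * rp w * j))^-1%g q r) (- c - bary (tr w) r)%R =
  (coefL (mx j^-1%g q 0) 0 * coefL (mx i^-1%g r r) 0)%R.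
Proof.
move=> f10 f20 iI jI q1 r; have wr : lin w r = 0%R by rewrite permKV.
have iH a b := @iwahoriGL_inO _ _ a b (IgV iI); have jH a b := @iwahoriGL_inO _ _ a b (IgV jI).
rewrite invMg -scN -scC mx_scM coefL_epsz (_ : (- c - bary (tr w) r - - c = - bary (tr w) r)%R); last lia.
have E p : mx (j^-1 * (rp w)^-1) q p = (eps ^ (- bary (tr w) p) * mx j^-1%g q (lin w p))%R.
  by rewrite rpV_mulr mulrC.
rewrite !invMg mulgA mxME (@coefL_sum_lead _ r) => [|p pr].
  rewrite E wr -mulrA coefL_epsz subrr.
  have jO : inO 0 (mx j^-1%g q 0%R) by apply: inO_le (jH _ _); case: (_ < _)%N.
  by have := coefL_mul_lead jO (iH r r); rewrite ltnn addr0.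
rewrite E -mulrA.
apply: (@inO_le _ _ ((q < lin w p)%N%:Z + (p < r)%N%:Z - bary (tr w) p)%R); last first.
  by rewrite inO_eps; apply: inO_mul.
have : lin w p != 0%R by rewrite -wr (inj_eq perm_inj).
have := permK (lin w) p; move: f10 f20; rewrite /fpos -/r.
have := ltn_ord r; have := ltn_ord p.
move: (lin w p); apply: ord3P => // lp lr f10 f20 E1 _; move: f10 f20; rewrite E1.
  by case: (ltnP p r) => ? ? ? /=; case: (q : nat) q1 => [|[|]] //=; lia.
by case: (ltnP p r) => ? ? ? /=; case: (q : nat) q1 => [|[|]] //=; lia.
Qed.

Lemma Ig_inv_lead (j : lg) : Ig j ->
  (coefL (mx j 1 0) 0 * coefL (mx j^-1%g 0 0) 0 + coefL (mx j 1 1) 0 * coefL (mx j^-1%g 1 0) 0 = 0)%R.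
Proof.
move=> jI; have jH a b := @iwahoriGL_inO _ _ a b jI.
have jH' a b := @iwahoriGL_inO _ _ a b (IgV jI).
have := congr1 (fun g => coefL (mx g 1 0)%R 0) (mulgV j).
rewrite mxME mx1 mxE coefL0 => <-; rewrite big_ord_recl big_ord_recl big_ord1 !coefLD.
rewrite addrA.
have c (a b c d : 'I_3) : (b <= a)%N -> (d <= c)%N ->
    coefL (mx j a b * mx j^-1%g c d)%R 0 = (coefL (mx j a b) 0 * coefL (mx j^-1%g c d) 0)%R.
  move=> ba dc; have := coefL_mul_lead (jH a b) (jH' c d).
  by rewrite !ltnNge ba dc addr0.
rewrite (_ : ord0 = 0%R); last exact: val_inj.
rewrite (_ : lift 0%R ord0 = 1%R); last exact: val_inj.
rewrite (c _ 0%R) // (c _ 1%R 1%R) //.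
set z := coefL (_ * _)%R 0; rewrite (_ : z = 0%R) ?addr0 //.
by have := inO_mul (jH 1%R (lift 0%R (lift ord0 ord0))) (jH' (lift 0%R (lift ord0 ord0)) 0%R); apply.
Qed.

Definition rat_a (b : bool) (r : 'I_3) (e : int) (g : lg) : k :=
  (if b then coefL (mx g r 1) e else - coefL (mx g^-1%g 0 r) e)%R.
Definition rat_b (b : bool) (r : 'I_3) (e : int) (g : lg) : k :=
  (if b then coefL (mx g r 0) e else coefL (mx g^-1%g 1 r) e)%R.

(** On the line at [g] exactly one parameter leads to the shorter cell of [w s1]. It is
    [- rat_b / rat_a], a quotient of coefficients of [g] or of [g^-1], so it depends algebraically
    on [g]; this makes the projections of the reduction step continuous. Fixing [N] fixes the scalar
    in the decomposition of [g], and with it the order [e]. *)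
Lemma ratio w N : (fpos w 1 < fpos w 0)%R -> rasc (w * s1) ->
  exists b r e, forall g, D w g -> dv N g -> rat_a b r e g != 0%R /\
    forall x, D (w * s1) (g * u x * n1) <-> (rat_b b r e g + x * rat_a b r e g = 0)%R.
Proof.
move=> wd wa; have ws : w * s1 * s1 = w.
  rewrite -mulgA (_ : s1 * s1 = 1) ?mulg1 //.
  by congr IW; rewrite /= ?wact0 ?addr0 // tperm2.
pose c := ((N - wdeg w) %/ 3)%Z.
have [b [r [e H]]] : exists b r e, forall i j, Ig i -> Ig j ->
    let g := sc k c * (i * rp w * j) in rat_a b r e g != 0%R /\
    forall x, (rat_b b r e g + x * rat_a b r e g = 0 <->
               coefL (mx j 1 0) 0 + x * coefL (mx j 1 1) 0 = 0)%R.
  have d0 (i : lg) p : Ig i -> coefL (mx i p p) 0 != 0%R by exact: iwahoriGL_diag.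
  have [f12|f21] := ltP (fpos w 1%R) (fpos w 2%:R%R).
    exists true, ((lin w)^-1 1%R), (c + bary (tr w) ((lin w)^-1%g 1))%R.
    move=> i j iI jI; have E q := @lead_pos w c i j q wd f12 iI jI.
    split; first by rewrite /rat_a E mulf_neq0 ?d0.
    move=> x; rewrite /rat_a /rat_b !E.
    rewrite mulrCA -mulrDr; split=> [/eqP|->]; last by rewrite mulr0.
    by rewrite mulf_eq0 (negPf (d0 _ _ iI)) => /eqP.
  exists false, ((lin w)^-1 0%R), (- c - bary (tr w) ((lin w)^-1%g 0))%R.
  have f20 : (fpos w 2%:R < fpos w 0 + 3)%R by lia.
  move=> i j iI jI; have E (q : 'I_3) (q1 : (q <= 1)%N) := @lead_neg w c i j q wd f20 iI jI q1.
  split; first by rewrite /rat_a E // oppr_eq0 mulf_neq0 ?d0 //; exact: IgV.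
  move=> x; rewrite /rat_a /rat_b !E //.
  have jE := Ig_inv_lead jI; have j11 := d0 _ 1%R jI; have j00 := d0 _ 0%R (IgV jI).
  have i0 := d0 _ ((lin w)^-1 0%R) (IgV iI).
  rewrite mulrN mulrA -mulrBl.
  move: (coefL (mx j 1 0)%R 0) (coefL (mx j 1 1)%R 0) (coefL (mx j^-1%g 0 0)%R 0)
    (coefL (mx j^-1%g 1 0)%R 0) (coefL (mx i^-1%g _ _)%R 0) jE j11 j00 i0.
  move=> A A1 B B1 I jE A10 B0 I0.
  have {}E : (A1 * (B1 - x * B) = - (B * (A + x * A1)))%R.
    by apply/eqP; rewrite -addr_eq0 -jE; apply/eqP; ring.
  split=> [/eqP|AA].
    rewrite mulf_eq0 (negPf I0) orbF => /eqP B1E; move: E; rewrite B1E mulr0 => /esym/eqP.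
    by rewrite oppr_eq0 mulf_eq0 (negPf B0) => /eqP.
  move: E; rewrite AA mulr0 oppr0 => /eqP; rewrite mulf_eq0 (negPf A10) => /eqP ->.
  by rewrite mul0r.
exists b, r, e => g Dg gN; have [c' [i [j [iI jI gE]]]] := D_Ig Dg.
(* The determinant valuation determines the scalar, so every decomposition of [g] uses the same
   [c]. *)
have cc (c1 : int) (i1 j1 : lg) : Ig i1 -> Ig j1 -> g = sc k c1 * (i1 * rp w * j1) -> c1 = c.
  move=> i1I j1I E1; have := dv_D w c1 i1I j1I; rewrite -E1 => /(dv_inj gN) NE.
  by rewrite /c NE addrK mulzK.
have u10 (h : lg) x : coefL (mx (h * u x)%g 1 0)%R 0 = (coefL (mx h 1 0) 0 + x * coefL (mx h 1 1) 0)%R.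
  by rewrite mulu_mx mulr1n coefLD coefL_constM.
have c'E := cc _ _ _ iI jI gE; rewrite c'E in gE.
have [a0 Hx] := H _ _ iI jI; rewrite -gE in a0 Hx; split=> // x; split; last first.
  move=> /Hx jx; have jI' := IgM jI (Ig_u x).
  have nj : Ig (n1 * (j * u x) * n1) by apply: Ig_conj_n1 => //; rewrite u10.
  have -> : g * u x * n1 = sc k c * (i * (rp w * n1) * (n1 * (j * u x) * n1)).
    by rewrite gE !mulgA -(mulgA _ n1 n1) n1n1 mulg1.
  apply: D_mull (Iw_sc _ _) _; apply: D_mulr; first exact: Ig_Iw.
  by apply: D_mull (D_rpM _ _); exact: Ig_Iw.
move=> /D_Ig[c1 [i1 [j1 [i1I j1I E1]]]].
have [y [j3 [j1E j3I nj3]]] := Ig_u_split j1I.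
have [m Em] := rpM (w * s1) s1; rewrite ws in Em.
set v := w * s1 in wa E1 Em.
pose i4 := i1 * (rp v * u y * (rp v)^-1); pose j4 := n1 * j3 * n1.
have i4I : Ig i4 by apply: IgM i1I (rasc_conj _ wa).
have {E1} E1 : g = sc k (c1 - m)%R * (i4 * rp w * (j4 * u (- x)%R)).
  have -> : g = sc k c1 * (i1 * rp v * j1) * n1 * u (- x)%R.
    by rewrite -E1 -(mulgA _ n1 n1) n1n1 mulg1 uN mulgK.
  have -> : i4 * rp w = sc k m * (i4 * (rp v * n1)) by rewrite Em mulgA -scC -mulgA.
  rewrite scD scN j1E /i4 /j4 !mulgA !mulgKV.
  by rewrite -(mulgA _ n1 n1) n1n1 mulg1.
have j5I : Ig (j4 * u (- x)%R) by apply: IgM nj3 (Ig_u _).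
have c1E := cc _ _ _ i4I j5I E1; rewrite c1E in E1.
have [_ H5] := H _ _ i4I j5I; rewrite -E1 in H5; apply/H5.
rewrite -u10 -mulgA -uD addNr u0 mulg1 /j4 conj_n1 tpermL tpermR.
by apply: (iwahoriGL_inO (i := 0%R) (j := 1%R) j3I).
Qed.

End WeylElements.

(** * The action of [sigma] on the Iwahori subgroup, on Weyl elements and on the root subgroup *)

Section Sigma.
Variables (k : fieldType) (q : nat) (qP : [pchar k].-nat q).
Local Notation L := (laurent k).
Local Notation eps := (eps k).
Local Notation lg := (lg k).
Local Notation bary := (@barycentric int).
Local Notation rp := (@rp k).
Local Notation sc := (@sc k).

Fact sg_subproof (g : lg) : {h : lg | mx h = sigma q (mx g)}.
Proof.
have E (f h : lg) : (f * h = 1)%g -> sigma q (mx f) *m sigma q (mx h) = 1%:M.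
  by move=> fh; rewrite -(sigmaM qP (mx_unit f) (mx_unit h)) -mxM fh mx1 (sigma1 qP).
by exists (Lg (conj (E g g^-1%g (mulgV g)) (E g^-1%g g (mulVg g)))).
Qed.

Definition sg (g : lg) : lg := sval (sg_subproof g).

Lemma mx_sg g : mx (sg g) = sigma q (mx g). Proof. exact: svalP (sg_subproof g). Qed.

Lemma sgE g i j : mx (sg g) i j = frob q (mx g^-1%g (rev_ord j) (rev_ord i)).
Proof. by rewrite mx_sg (sigmaE qP) invmx_mx. Qed.

Lemma sgM g h : sg (g * h)%g = (sg g * sg h)%g.
Proof.
apply: lg_inj; apply: etrans (mx_sg _) _; rewrite [mx (g * h)%g]mxM.
apply: etrans (sigmaM qP (mx_unit g) (mx_unit h)) _.
by rewrite [RHS]mxM; congr (_ *m _); apply/esym/mx_sg.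
Qed.

Lemma frob0 : frob q (0 : L) = 0. Proof. exact: (rmorph0 (frobH qP)). Qed.
Lemma frob1 : frob q (1 : L) = 1. Proof. exact: (rmorph1 (frobH qP)). Qed.

Lemma sg1 : sg 1%g = 1%g.
Proof. by apply: (mulgI (sg 1%g)); rewrite -sgM !mulg1. Qed.

Lemma sgV g : sg g^-1%g = (sg g)^-1%g.
Proof. by apply: (mulgI (sg g)); rewrite -sgM !mulgV sg1. Qed.

Lemma sgVE g i j : mx (sg g)^-1%g i j = frob q (mx g (rev_ord j) (rev_ord i)).
Proof. by rewrite -sgV sgE invgK. Qed.

Lemma sg_Ig g : Ig g -> Ig (sg g).
Proof.
move=> /IgV gI; apply: iwahoriGLP => [i j|i]; rewrite sgE.
  apply: (inO_frob qP); apply: inO_le (iwahoriGL_inO gI).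
  by have := ltn_ord i; have := ltn_ord j; rewrite /=; case: ltnP => // ? ?; case: ltnP; lia.
by rewrite coefL_frob // expf_neq0 // iwahoriGL_diag.
Qed.

Lemma sg_sc n : sg (sc n) = sc (- n).
Proof.
apply: lg_inj; apply/matrixP => i j; rewrite sgE -scN !mx_sc !mxE (inj_eq rev_ord_inj) eq_sym.
by rewrite -[X in frob q X]mulr_natr frobM // frob_epsz // frob_nat // mulr_natr.
Qed.

Lemma sg_Iw g : Iw g -> Iw (sg g).
Proof. by move=> [n gI]; exists (- n); rewrite -sg_sc -sgM; exact: sg_Ig. Qed.

Lemma dv_sg n g : dv n g -> dv (- n) (sg g).
Proof.
by move=> gn; rewrite /dv mx_sg (det_sigma qP); apply: (hasval_frob qP); exact: hasvalV.
Qed.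

Definition rho : 'S_3 := perm (@rev_ord_inj 3).

Definition delta (w : iwahoriWeyl) : iwahoriWeyl :=
  IW ((tr w).2, (tr w).1) (rho * lin w * rho)%g.

Lemma sg_rp w : sg (rp w) = (sc (- ((tr w).1 + (tr w).2)) * rp (delta w))%g.
Proof.
apply: lg_inj; apply/matrixP => i j.
rewrite sgE rpVE mx_scM mx_rp repE /= !permM !permE (can2_eq rev_ordK rev_ordK) eq_sym.
case: eqP => _; last by rewrite mulr0 frob0.
rewrite frob_epsz // -expfzDr ?eps_neq0 //; congr (_ ^ _).
by move: i; apply: ord3P; rewrite /barycentric /=; lia.
Qed.

Lemma sg_D w g : D w g -> D (delta w) (sg g).
Proof.
move=> [i [j [iI jI ->]]]; rewrite !sgM sg_rp; apply: D_mulr; first exact: sg_Iw.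
by apply: D_mull; [exact: sg_Iw | apply: D_mull (Iw_sc _ _) (D_rp _ _)].
Qed.

Local Notation P := (rp tau).

(** [sigma] exchanges the roots of [s1] and [s2], and [tau] carries [s1] to [s2]. Writing the result
    with [P] keeps all computations in the single root subgroup [u]. *)
Lemma sg_u x : sg (u x) = (P * u (- x ^+ q)%R * P^-1)%g.
Proof.
apply: lg_inj; apply/matrixP => i j; rewrite sgE -uN conj_rpE.
have uE y a b : mx (u y) a b = (a == b)%:R + constL y *+ ((b == 0) && (a == 1)) :> L.
  rewrite -[u y]mul1g mulu_mx mx1 !mxE mulr_natr.
  by case: (b == 0); case: (a == 1).
rewrite !uE.
have fc : frob q (constL (- x)) = constL (- x ^+ q).
  by rewrite frob_const // expqN.
have [f1 f0] := (frob1, frob0).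
have T := (@lin_tau, @bary_tau).
move: i j; apply: ord3_case; rewrite ?T //= ?f1 ?f0 ?mulr0n ?mulr1n ?addr0 ?add0r ?f1 ?f0 ?fc.
all: by rewrite ?expr0z ?mulr0 ?mul1r ?mulr1.
Qed.

Lemma delta_s1 : delta s1 = (tau * s1 * tau^-1)%g.
Proof.
suff -> : delta s1 = s2 by rewrite tau_s1 mulgK.
congr IW; apply/permP; apply: ord3P; rewrite !permM !permE /= ?permE /=; exact: val_inj.
Qed.

Lemma delta_tau : delta tau = tau^-1%g.
Proof.
have tl := lin_tau; have tV := lin_tauV.
have -> : tau^-1%g = IW (0, 1) (lin tau)^-1%g.
  congr IW; rewrite -[LHS]/(- wact (lin tau)^-1%g (tr tau)) tr_tau /wact.
  by rewrite -[((lin tau)^-1)%g]/(lin tau^-1%g) !lin_tauV.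
rewrite /delta tr_tau; congr IW; apply/permP => i; rewrite !permM -[((lin tau)^-1)%g]/(lin tau^-1%g).
move: i; apply: ord3P; rewrite ?tV !permE.
- by rewrite (_ : rev_ord 0 = 2%:R) ?tl; apply: val_inj; rewrite /= ?permE.
- by rewrite (_ : rev_ord 1 = 1) ?tl; apply: val_inj; rewrite /= ?permE.
- by rewrite (_ : rev_ord 2%:R = 0) ?tl; apply: val_inj; rewrite /= ?permE.
Qed.

End Sigma.

(** * Growth of functions of bounded degree *)

Section FunctionSpaces.
Variables (k : fieldType) (T : Type).
Implicit Types (W : set (T -> k)) (Z : set T) (f g : T -> k).

(* For functions restricted to [Z]. *)
Definition spanle Z W (n : nat) := exists b : 'I_n -> T -> k,
  forall f, W f -> exists a : 'I_n -> k, forall t, Z t -> f t = \sum_i a i * b i t.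

Definition indge Z W (n : nat) := exists b : 'I_n -> T -> k, (forall i, W (b i)) /\
  forall a : 'I_n -> k, (forall t, Z t -> \sum_i a i * b i t = 0) -> forall i, a i = 0.

Lemma indge_spanle Z W m n : indge Z W m -> spanle Z W n -> (m <= n)%N.
Proof.
move=> [b [bW bind]] [c cP]; have /choice[A AP] := fun i => cP _ (bW i).
rewrite leqNgt; apply/negP => nm.
pose M : 'M[k]_(m, n) := \matrix_(i, j) A i j.
have : kermx M != 0.
  rewrite -mxrank_eq0 mxrank_ker -lt0n subn_gt0.
  exact: leq_ltn_trans (rank_leq_col M) nm.
case/rowV0Pn => v /sub_kermxP vM /eqP; apply; apply/rowP => i; rewrite mxE.
apply: (bind (fun i => v 0 i)) => t Zt.
under eq_bigr => l _ do rewrite AP // mulr_sumr.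
rewrite exchange_big big1 // => j _.
have /rowP/(_ j) := vM; rewrite !mxE => E.
under eq_bigr => l _ do rewrite mulrA.
rewrite -mulr_suml (_ : \sum_l _ = 0) ?mul0r // -[RHS]E.
by apply: eq_bigr => l _; rewrite mxE.
Qed.

(** A maximal independent family spans, and [n] bounds the size of independent families. *)
Lemma spanle_of_indge Z W n : (forall m, indge Z W m -> (m <= n)%N) -> spanle Z W n.
Proof.
move=> H; have ex0 : exists m, `[< indge Z W m >].
  by exists 0%N; apply/asboolP; exists (fun=> fun=> 0); split=> [[]//|a _ []//].
have [m /asboolP mI mmax] := ex_maxnP ex0 (fun m mI => H m (asboolW mI)).
have [b [bW bind]] := mI.
suff [c cP] : spanle Z W m.
  have mn := H _ mI.
  exists (fun i => if insub (i : nat) is Some j then c j else fun=> 0) => f /cP[a aE].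
  exists (fun i => if insub (i : nat) is Some j then a j else 0) => t Zt; rewrite aE //.
  rewrite [RHS](bigID (fun j : 'I_n => (j < m)%N)) /= [X in _ + X]big1 ?addr0 => [|j]; last first.
    by move=> jm; case: insubP => [? ij|_]; [rewrite ij in jm | rewrite mul0r].
  by rewrite (big_ord_narrow mn) /=; apply: eq_bigr => j _; rewrite valK.
exists b => f Wf; apply: contrapT => nf.
suff /asboolT/mmax : indge Z W m.+1 by rewrite ltnn.
exists (fun i : 'I_m.+1 => if unlift ord0 i is Some j then b j else f); split.
  by move=> i; case: unlift.
move=> a H'; have E t : Z t -> a ord0 * f t + \sum_(i < m) a (lift ord0 i) * b i t = 0.
  move=> Zt; rewrite -[RHS](H' t Zt) big_ord_recl unlift_none; congr (_ + _).
  by apply: eq_bigr => i _; rewrite liftK.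
have a0 : a ord0 = 0.
  apply: contrapT => /eqP a0; apply: nf; exists (fun i => - a (lift ord0 i) / a ord0) => t Zt.
  apply: (mulfI a0); rewrite mulr_sumr; apply/eqP; rewrite -subr_eq0 -[X in _ == X](E t Zt).
  rewrite -sumrN; apply/eqP; congr (_ + _); apply: eq_bigr => i _.
  by field.
move=> i; case: (unliftP ord0 i) => [j ->|-> //].
apply: (bind (fun j => a (lift ord0 j))) => t Zt.
by rewrite -[RHS](E t Zt) a0 mul0r add0r.
Qed.

Lemma spanle_le Z W m n : (m <= n)%N -> spanle Z W m -> spanle Z W n.
Proof.
move=> mn H; apply: spanle_of_indge => p pI.
exact: leq_trans (indge_spanle pI H) mn.
Qed.

Lemma spanle_sub Z Z' W W' n : Z `<=` Z' -> W `<=` W' -> spanle Z' W' n -> spanle Z W n.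
Proof.
move=> ZZ' WW' [b bP]; exists b => f /WW'/bP[a aP]; exists a => t /ZZ'; exact: aP.
Qed.

Lemma spanleU Z Z' W m n : spanle Z W m -> spanle Z' W n -> spanle (Z `|` Z') W (m + n).
Proof.
move=> [b bP] [c cP].
exists (fun i t => match split i with inl j => if `[< Z t >] then b j t else 0
                                 | inr j => if `[< Z t >] then 0 else c j t end).
move=> f Wf; have [a aP] := bP f Wf; have [d dP] := cP f Wf.
exists (fun i => match split i with inl j => a j | inr j => d j end) => t Zt.
have lE i : split (lshift n i : 'I_(m + n)) = inl i by rewrite (unsplitK (inl i)).
have rE i : split (rshift m i : 'I_(m + n)) = inr i by rewrite (unsplitK (inr i)).
rewrite big_split_ord /=; under eq_bigr do rewrite lE.
under [X in _ + X]eq_bigr do rewrite rE.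
case: asboolP => [Zt'|nZ].
  by rewrite aP // [X in _ + X]big1 ?addr0 // => i _; rewrite mulr0.
case: Zt => // Z't; rewrite dP // [X in _ = X + _]big1 ?add0r // => i _; by rewrite mulr0.
Qed.

Lemma spanle0 W n : spanle set0 W n.
Proof. by exists (fun=> fun=> 0) => f _; exists (fun=> 0). Qed.

(* If [f] vanishes on [Z'] but multiplication by [f] is injective on [Z], the
   functions of [W'] times [f] are independent from lifts of independent
   functions on [Z']. *)
Lemma indge_drop Z Z' W W' f m n : Z' `<=` Z ->
  (forall g, W' g -> W (fun t => f t * g t)) ->
  (forall t, Z' t -> f t = 0) ->
  (forall (p : nat) (b : 'I_p -> T -> k) (a : 'I_p -> k), (forall i, W' (b i)) ->
    (forall t, Z t -> f t * (\sum_i a i * b i t) = 0) -> forall t, Z t -> \sum_i a i * b i t = 0) ->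
  indge Z' W m -> indge Z W' n -> indge Z W (m + n).
Proof.
move=> Z'Z W'W f0 finj [b [bW bind]] [c [cW cind]].
exists (fun i => match split i with inl j => b j | inr j => fun t => f t * c j t end).
split=> [i|a aP]; first by case: split => // j; exact: W'W.
have lE i : split (lshift n i : 'I_(m + n)) = inl i by rewrite (unsplitK (inl i)).
have rE i : split (rshift m i : 'I_(m + n)) = inr i by rewrite (unsplitK (inr i)).
have E t : Z t -> \sum_i a (lshift n i) * b i t + f t * (\sum_i a (rshift m i) * c i t) = 0.
  move=> Zt; rewrite -[RHS](aP t Zt) big_split_ord; congr (_ + _).
    by apply: eq_bigr => i _; rewrite lE.
  rewrite mulr_sumr; apply: eq_bigr => i _; rewrite rE.
  by rewrite mulrCA.
have al i : a (lshift n i) = 0.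
  apply: (bind (fun i => a (lshift n i))) => t Z't.
  by have := E t (Z'Z _ Z't); rewrite f0 // mul0r addr0.
have ar i : a (rshift m i) = 0.
  apply: (cind (fun i => a (rshift m i))) => t; apply: (finj _ _ _ cW) => {}t Zt.
  rewrite -[RHS](E t Zt) [X in _ = X + _]big1 ?add0r // => j _.
  by rewrite al mul0r.
by move=> i; rewrite -[i]splitK; case: split => j; rewrite /= ?al ?ar.
Qed.

Lemma indge_sub Z Z' W W' n : Z `<=` Z' -> W `<=` W' -> indge Z W n -> indge Z' W' n.
Proof.
move=> ZZ' WW' [b [bW bind]]; exists b; split=> [i|a aP]; first exact: WW'.
by apply: bind => t /ZZ'; exact: aP.
Qed.

(** Functions of degree at most [s] in the generators [G]; the dimension of this space, as [s]
    varies, is the Hilbert function. Polynomials that agree on [T] give one function, so relations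
    on [T] are built in. *)
Inductive fil (G : set (T -> k)) : nat -> (T -> k) -> Prop :=
| fil_const c s : fil G s (fun=> c)
| fil_gen f s : G f -> fil G s.+1 f
| fil_add s f g : fil G s f -> fil G s g -> fil G s (fun t => f t + g t)
| fil_mul s s' f g : fil G s f -> fil G s' g -> fil G (s + s') (fun t => f t * g t).

Definition alg (G : set (T -> k)) : set (T -> k) := fun f => exists s, fil G s f.

Variable G : set (T -> k).

Lemma fil_ext s f g : f =1 g -> fil G s f -> fil G s g.
Proof. by move=> /funext ->. Qed.

Lemma fil_le s s' f : (s <= s')%N -> fil G s f -> fil G s' f.
Proof.
move=> ss' fs; have := fil_mul fs (fil_const G 1 (s' - s)); rewrite subnKC //.
by apply: fil_ext => t; rewrite mulr1.
Qed.

Lemma fil_scale c s f : fil G s f -> fil G s (fun t => c * f t).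
Proof. by move=> fs; have := fil_mul (fil_const G c 0) fs. Qed.

Lemma fil_sum s (I : Type) (r : seq I) (P : pred I) (F : I -> T -> k) :
  (forall i, P i -> fil G s (F i)) -> fil G s (fun t => \sum_(i <- r | P i) F i t).
Proof.
move=> H; elim: r => [|i r IH].
  by apply: fil_ext (fil_const G 0 s) => t; rewrite big_nil.
have [Pi|nPi] := boolP (P i).
  by apply: fil_ext (fil_add (H i Pi) IH) => t; rewrite big_cons Pi.
by apply: fil_ext IH => t; rewrite big_cons (negPf nPi).
Qed.

Lemma fil_exp n s f : fil G s f -> fil G (n * s) (fun t => f t ^+ n).
Proof.
move=> fs; elim: n => [|n IH]; first exact: (fil_const G 1 0).
by rewrite mulSn; apply: fil_ext (fil_mul fs IH) => t; rewrite exprS.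
Qed.

Lemma alg_const c : alg G (fun=> c). Proof. by exists 0%N; exact: fil_const. Qed.
Lemma alg_gen f : G f -> alg G f. Proof. by exists 1%N; exact: fil_gen. Qed.
Lemma alg_add f g : alg G f -> alg G g -> alg G (fun t => f t + g t).
Proof.
move=> [s fs] [s' gs]; exists (maxn s s').
by apply: fil_add; [apply: fil_le fs | apply: fil_le gs]; rewrite ?leq_maxl ?leq_maxr.
Qed.
Lemma alg_mul f g : alg G f -> alg G g -> alg G (fun t => f t * g t).
Proof. by move=> [s fs] [s' gs]; exists (s + s')%N; exact: fil_mul. Qed.
Lemma alg_ext f g : f =1 g -> alg G f -> alg G g. Proof. by move=> /funext ->. Qed.
Lemma alg_opp f : alg G f -> alg G (fun t => - f t).
Proof.
by move=> fG; apply: alg_ext (alg_mul (alg_const (-1)) fG) => t; rewrite mulN1r.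
Qed.
Lemma alg_exp n f : alg G f -> alg G (fun t => f t ^+ n).
Proof. by move=> [s fs]; exists (n * s)%N; exact: fil_exp. Qed.

End FunctionSpaces.

Lemma fil_comp (k : fieldType) (T T' : Type) (phi : T' -> T) (G : set (T -> k))
    (G' : set (T' -> k)) K s f :
  (forall c, G c -> fil G' K (c \o phi)) -> fil G s f -> fil G' (s * K) (f \o phi).
Proof.
move=> H; elim=> [c {}s|g {}s Gg|{}s g h _ IHg _ IHh|{}s s' g h _ IHg _ IHh].
- exact: fil_const.
- by apply: fil_le (H g Gg); rewrite mulSn leq_addr.
- exact: fil_add.
- by rewrite mulnDl; exact: fil_mul.
Qed.

Lemma alg_comp (k : fieldType) (T T' : Type) (phi : T' -> T) (G : set (T -> k))
    (G' : set (T' -> k)) f :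
  (forall c, G c -> alg G' (c \o phi)) -> alg G f -> alg G' (f \o phi).
Proof.
move=> H [s fs]; elim: fs => [c {}s|g {}s Gg|{}s g h _ IHg _ IHh|{}s s' g h _ IHg _ IHh].
- exact: alg_const.
- exact: H.
- exact: alg_add.
- exact: alg_mul.
Qed.

Section FiniteIndex.
Variables (k : fieldType) (T : Type) (I : finType).

Lemma spanle_fin (Z : set T) (W : set (T -> k)) (b : I -> T -> k) :
  (forall f, W f -> exists a : I -> k, forall t, Z t -> f t = \sum_i a i * b i t) ->
  spanle Z W #|I|.
Proof.
move=> H; exists (fun i => b (enum_val i)) => f /H[a aP].
exists (fun i => a (enum_val i)) => t /aP ->.
by rewrite (reindex (@enum_val I predT)) //=; apply: onW_bij; exact: enum_val_bij.
Qed.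

Lemma indge_fin (Z : set T) (W : set (T -> k)) (b : I -> T -> k) :
  (forall i, W (b i)) ->
  (forall a : I -> k, (forall t, Z t -> \sum_i a i * b i t = 0) -> forall i, a i = 0) ->
  indge Z W #|I|.
Proof.
move=> bW bind; exists (fun i => b (enum_val i)); split=> [i//|a aP i].
rewrite -(enum_valK i); apply: (bind (fun i => a (enum_rank i))) => t Zt.
rewrite -[RHS](aP t Zt) (reindex (@enum_val I predT)) /=; last first.
  by apply: onW_bij; exact: enum_val_bij.
by apply: eq_bigr => j _; rewrite enum_valK.
Qed.
End FiniteIndex.

Lemma leq_expl m n e : (m <= n)%N -> (m ^ e <= n ^ e)%N.
Proof. by move=> mn; elim: e => // e IH; rewrite !expnS leq_mul. Qed.

Section Growth.
Variable k : closedFieldType.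

(** For the coordinate functions of a variety this says that its dimension is at most [d]. *)
Definition gr (T : Type) (G : set (T -> k)) d :=
  exists C, forall s, spanle setT (fil G s) (C * s.+1 ^ d).

Lemma gr_le T (G : set (T -> k)) d d' : (d <= d')%N -> gr G d -> gr G d'.
Proof.
move=> dd' [C H]; exists C => s; apply: spanle_le (H s).
by rewrite leq_mul2l leq_pexp2l ?orbT.
Qed.

Lemma root_ex (Q : nat) : (0 < Q)%N -> exists r : k -> k, forall x, r x ^+ Q = x.
Proof.
move=> Q0; have /choice[r rP] : forall x : k, exists y, y ^+ Q = x.
  move=> x; have : size ('X^Q - x%:P) != 1%N by rewrite size_XnsubC //; case: Q Q0.
  move/closed_rootP => [y]; rewrite rootE !hornerE subr_eq0 => /eqP yx.
  by exists y.
by exists r.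
Qed.

(** Growth does not increase when [a] is inverted and [Q]-th roots are extracted. For [f] of degree
    [s] in the new functions, [f ^ Q * a ^ s] has degree [s * K] in the old ones; since [x ^ Q] is
    additive, the root of an expansion is taken term by term. *)
Lemma gr_dom (T T' : Type) (G : set (T -> k)) (G' : set (T' -> k)) (phi : T' -> T)
    (a : T -> k) K Q d : [pchar k].-nat Q ->
  fil G K a -> (forall t, a (phi t) != 0) ->
  (forall c, G' c -> exists2 e, fil G K e & forall t, c t ^+ Q * a (phi t) = e (phi t)) ->
  gr G d -> gr G' d.
Proof.
move=> Qp aK a0 G'P [C CP]; have Q0 : (0 < Q)%N by case/andP: Qp.
have pw s f : fil G' s f ->
    exists2 F, fil G (s * K) F & forall t, f t ^+ Q * a (phi t) ^+ s = F (phi t).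
  elim=> [c {}s|g {}s Gg|{}s g h _ [A As AP] _ [B Bs BP]|{}s s' g h _ [A As AP] _ [B Bs BP]].
  - exists (fun t => c ^+ Q * a t ^+ s) => //.
    by apply: fil_scale; apply: fil_exp.
  - have [e eK eP] := G'P _ Gg; exists (fun t => e t * a t ^+ s) => [|t].
      by rewrite mulSn; apply: fil_mul => //; apply: fil_exp.
    by rewrite exprS mulrA eP.
  - exists (fun t => A t + B t) => [|t]; first exact: fil_add.
    by rewrite exprDn_pchar // mulrDl AP BP.
  - exists (fun t => A t * B t) => [|t]; first by rewrite mulnDl; exact: fil_mul.
    by rewrite exprMn exprD mulrACA AP BP.
have [r rP] := root_ex Q0.
exists (C * K.+1 ^ d)%N => s.
apply: (@spanle_le _ _ _ _ (C * (s * K).+1 ^ d)%N).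
  by rewrite -mulnA -expnMn leq_mul2l leq_expl ?orbT //; nia.
have [b bP] := CP (s * K)%N.
exists (fun i t => r (b i (phi t) / a (phi t) ^+ s)) => f /pw[F /bP[al alP] FP].
exists (fun i => r (al i)) => t _.
have sum_exp (I : finType) (h : I -> k) : (\sum_i h i) ^+ Q = \sum_i h i ^+ Q.
  apply: (big_morph (fun x => x ^+ Q)) => [x y|]; first exact: exprDn_pchar.
  by rewrite expr0n gtn_eqF.
have inj (x y : k) : x ^+ Q = y ^+ Q -> x = y.
  move=> xy; apply/eqP; rewrite -subr_eq0; apply/eqP.
  have : (x - y) ^+ Q = 0.
    apply: (addIr (y ^+ Q)); rewrite -exprDn_pchar // subrK xy add0r //.
  by move/eqP; rewrite expf_eq0 Q0 => /eqP.
apply: inj; rewrite sum_exp; under eq_bigr do rewrite exprMn !rP mulrA.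
rewrite -mulr_suml -alP // -FP mulfK // expf_neq0 //.
Qed.

Lemma gr_surj (S T : Type) (G : set (T -> k)) (GS : set (S -> k)) (Psi : (S -> k) -> T -> k) K d :
  (forall c, GS c -> fil G K (Psi c)) ->
  (forall s, exists t, forall c, GS c -> c s = Psi c t) ->
  gr G d -> gr GS d.
Proof.
move=> PsiK /choice[phi phiP]; apply: (@gr_dom _ _ _ _ phi (fun=> 1) K 1) => //.
- exact: fil_const.
- by move=> t; exact: oner_neq0.
- move=> c Gc; exists (Psi c); first exact: PsiK.
  by move=> s; rewrite mulr1 expr1 phiP.
Qed.

Lemma gr_unit (T : Type) (G : set (T -> k)) : (forall t t' : T, t = t') -> gr G 0.
Proof.
move=> T1; exists 1%N => s; exists (fun _ _ => 1) => f _.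
have [[t0 _]|nT] := pselect (exists t : T, True).
  exists (fun=> f t0) => t _; rewrite (T1 t t0).
  by rewrite (eq_bigr (fun=> f t0)) => [|i _]; rewrite ?mulr1 // sumr_const card_ord.
by exists (fun=> 0) => t; case: nT; exists t.
Qed.

Definition gen_prod (T : Type) (G : set (T -> k)) : set (T * k -> k) :=
  [set (c \o fst) | c in G] `|` [set snd].

Lemma fil_prod (T : Type) (G : set (T -> k)) s f : fil (gen_prod G) s f ->
  exists P : T -> {poly k}, [/\ forall t, (size (P t) <= s.+1)%N,
    forall j, fil G s (fun t => (P t)`_j) & forall t, f t = (P t.1).[t.2]].
Proof.
elim=> [c {}s|g {}s Gg|{}s g h _ [A [As Ac AP]] _ [B [Bs Bc BP]]|{}s s' g h _ [A [As Ac AP]] _ [B [Bs Bc BP]]].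
- exists (fun=> c%:P); split=> [t|j|t].
  + by rewrite size_polyC; case: (c == 0).
  + by apply: fil_ext (fil_const _ (c%:P)`_j _).
  + by rewrite hornerC.
- case: Gg => [[c Gc <-]|->].
    exists (fun t => (c t)%:P); split=> [t|j|t].
    + by rewrite size_polyC; case: (c t == 0).
    + case: j => [|j]; first by apply: fil_ext (fil_gen _ Gc) => t; rewrite coefC.
      by apply: fil_ext (fil_const _ 0 _) => t; rewrite coefC.
    + by rewrite hornerC.
  exists (fun=> 'X); split=> [t|j|t].
  + by rewrite size_polyX.
  + exact: fil_const.
  + by rewrite hornerX.
- exists (fun t => A t + B t); split=> [t|j|t].
  + by apply: leq_trans (size_polyD _ _) _; rewrite geq_max As Bs.
  + by apply: fil_ext (fil_add (Ac j) (Bc j)) => t; rewrite coefD.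
  + by rewrite hornerD AP BP.
- exists (fun t => A t * B t); split=> [t|j|t].
  + apply: leq_trans (size_polyMleq _ _) _.
    by have := As t; have := Bs t; lia.
  + have H := @fil_sum k T G (s + s') _ (index_enum 'I_j.+1) xpredT
      (fun i t => (A t)`_i * (B t)`_(j - i)) (fun i _ => fil_mul (Ac i) (Bc (j - i)%N)).
    by apply: fil_ext H => t; rewrite coefM.
  + by rewrite hornerM AP BP.
Qed.

Lemma gr_prod (T : Type) (G : set (T -> k)) d : gr G d -> gr (gen_prod G) d.+1.
Proof.
move=> [C CP]; exists C => s; have [b bP] := CP s.
have -> : (C * s.+1 ^ d.+1)%N = #|{: 'I_(C * s.+1 ^ d) * 'I_s.+1}|.
  by rewrite card_prod !card_ord expnSr mulnA.
apply: (@spanle_fin _ _ _ _ _ (fun (ij : 'I_(C * s.+1 ^ d) * 'I_s.+1) t => b ij.1 t.1 * t.2 ^+ ij.2)) => f /fil_prod[P [Ps Pc PE]].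
have /choice[a aP] := fun j : nat => bP _ (Pc j).
exists (fun ij : 'I_(C * s.+1 ^ d) * 'I_s.+1 => a ij.2 ij.1) => t _.
rewrite PE (horner_coef_wide _ (Ps t.1)) -(pair_bigA _ (fun (i : 'I_(C * s.+1 ^ d)) (j : 'I_s.+1) => a j i * (b i t.1 * t.2 ^+ j))) /=.
rewrite exchange_big /=; apply: eq_bigr => j _; rewrite aP // mulr_suml.
by apply: eq_bigr => i _; rewrite mulrA.
Qed.

Lemma gr_pow (T : Type) (G : set (T -> k)) d n : gr G d ->
  gr ([set (c \o fst) | c in G] `|` [set (fun t : T * ('I_n -> k) => t.2 i) | i in setT]) (d + n).
Proof.
elim: n => [|n IH] Gd.
  rewrite addn0; apply: (@gr_surj _ T G _ (fun c t => c (t, fun i : 'I_0 => 0)) 1) Gd.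
    by move=> c [[e Ge <-]|[[]//]]; exact: fil_gen.
  by move=> s; exists s.1 => c [[e Ge <-]|[[]//]].
rewrite addnS; apply: (@gr_surj _ _ _ _
  (fun c t => c (t.1.1, fun i : 'I_n.+1 => if unlift ord0 i is Some j then t.1.2 j else t.2)) 1)
  (gr_prod (IH Gd)).
  move=> c [[e Ge <-]|[i _ <-]].
    by apply: fil_gen; left; exists (e \o fst) => //; left; exists e.
  apply: fil_gen; rewrite /=; case: unliftP => [j _|_]; last by right.
  by left; exists (fun t : T * ('I_n -> k) => t.2 j) => //; right; exists j.
move=> s; exists (s.1, fun j => s.2 (lift ord0 j), s.2 ord0) => c [[e Ge <-] //|[i _ <-]] /=.
by case: unliftP => [j ->|->].
Qed.

(* The functions of [alg G] form an integral domain: [T] is irreducible. *)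
Definition dom (T : Type) (G : set (T -> k)) := forall f g, alg G f -> alg G g ->
  (exists t, f t != 0) -> (exists t, g t != 0) -> exists t, f t != 0 /\ g t != 0.

Lemma poly_nonroot2 (P Q : {poly k}) : P != 0 -> Q != 0 -> exists x, P.[x] != 0 /\ Q.[x] != 0.
Proof.
move=> P0 Q0; have /closed_nonrootP[x] : P * Q != 0 by rewrite mulf_neq0.
by rewrite rootE hornerM mulf_eq0 negb_or => /andP[]; exists x.
Qed.

(** With the last coordinate fixed suitably for each, both functions are nonzero at a common point
    [u] of the base; on the fibre over [u] they are then nonzero polynomials in one variable. *)
Lemma dom_prod (T : Type) (G : set (T -> k)) : dom G -> dom (gen_prod G).
Proof.
move=> Gdom.
have ev f z : alg (gen_prod G) f -> alg G (fun t => f (t, z)).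
  apply: alg_comp => c [[e Ge <-]|->]; [exact: alg_gen | exact: alg_const].
move=> f g fa ga [[t x] fx] [[t' y] gy].
have [u [fu gu]] := Gdom _ _ (ev f x fa) (ev g y ga) (ex_intro _ t fx) (ex_intro _ t' gy).
have [[s /fil_prod[P [_ _ PE]]] [s' /fil_prod[Q [_ _ QE]]]] := (fa, ga).
have [||z [Pz Qz]] := @poly_nonroot2 (P u) (Q u).
- by apply: contraNneq fu => P0; rewrite PE P0 horner0.
- by apply: contraNneq gu => Q0; rewrite QE Q0 horner0.
by exists (u, z); rewrite PE QE.
Qed.

Lemma dom_unit (T : Type) (G : set (T -> k)) : (forall t t' : T, t = t') -> dom G.
Proof. by move=> T1 f g _ _ [t ft] [t' gt]; exists t; rewrite {2}(T1 t t'). Qed.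

(* Transfer along a map whose image is [{p != 0}]. *)
Lemma dom_open (T T' : Type) (G : set (T -> k)) (G' : set (T' -> k)) (phi : T' -> T) p :
  dom G -> alg G p -> (forall t', p (phi t') != 0) ->
  (forall t, p t != 0 -> exists t', phi t' = t) ->
  (forall c, G' c -> exists2 e, alg G e & c = e \o phi) -> dom G'.
Proof.
move=> Gdom pG p0 phis H.
have H' f : alg G' f -> exists2 e, alg G e & f = e \o phi.
  case=> s; elim=> [c {}s|g {}s Gg|{}s g h _ [A As ->] _ [B Bs ->]|{}s s' g h _ [A As ->] _ [B Bs ->]].
  - by exists (fun=> c) => //; exact: alg_const.
  - exact: H.
  - by exists (fun t => A t + B t) => //; exact: alg_add.
  - by exists (fun t => A t * B t) => //; exact: alg_mul.
move=> _ _ /H'[f fG ->] /H'[g gG ->] [t ft] [t' gt].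
have [u [fu]] : exists u, f u != 0 /\ p u * g u != 0.
  apply: Gdom => //; first exact: alg_mul.
    by exists (phi t).
  by exists (phi t'); rewrite mulf_neq0.
rewrite mulf_eq0 negb_or => /andP[/phis[u' uE] gu].
by exists u'; rewrite /= uE.
Qed.

Definition gen2 : set (k * k -> k) := [set fst; snd].

Lemma dom2 : dom gen2.
Proof.
have d1 : dom (gen_prod (set0 : set (unit -> k))).
  by apply: dom_prod; apply: dom_unit => -[] [].
apply: (@dom_open _ _ _ _ (fun t => (tt, t.1, t.2)) (fun=> 1)
   (dom_prod d1)) => [|t|[[[] x] y] _|c [->|->]].
- exact: alg_const.
- exact: oner_neq0.
- by exists (x, y).
- by exists (fun t => t.1.2) => //; apply: alg_gen; left; exists snd => //; right.
- by exists snd => //; apply: alg_gen; right.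
Qed.

(** The products of [m] functions independent on [Z] with [1, f, ..., f^J] are independent on the
    whole space, as [f] vanishes on [Z] and is no zero divisor. *)
Lemma indge_iter (T : Type) (G : set (T -> k)) (Z : set T) f e s m J : dom G ->
  fil G e f -> (exists t, f t != 0) -> (forall t, Z t -> f t = 0) ->
  indge Z (fil G s) m -> indge setT (fil G (s + J * e)) (m * J.+1).
Proof.
move=> Gdom fe f0 fZ mI; elim: J => [|J IH].
  by rewrite addn0 muln1; apply: indge_sub mI.
rewrite mulnS; apply: (@indge_drop _ _ _ Z _ (fil G (s + J * e)) f) => //.
- move=> g gs; rewrite mulSn addnCA; exact: fil_mul.
- move=> p b a bW H t _; apply: contrapT => /eqP st.
  have [||u [fu]] := Gdom f (fun t => \sum_i a i * b i t) _ _ f0 (ex_intro _ t st).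
  + by exists e.
  + by exists (s + J * e)%N; apply: fil_sum => i _; exact: fil_scale.
  by move/negP; apply; have /eqP := H u I; rewrite mulf_eq0 (negPf fu).
- by apply: indge_sub mI => // g; apply: fil_le; rewrite leq_addr.
Qed.

(** A hypersurface loses one dimension: [indge_iter] with [J = s] gives [m (s + 1)] independent
    functions of degree [O(s)] on the whole space, where there are only [O(s^(d+1))]. *)
Lemma gr_hyper (T : Type) (G : set (T -> k)) f d : dom G -> alg G f ->
  (exists t, f t != 0) -> gr G d.+1 ->
  gr [set (c \o (@sval T (fun t => f t = 0))) | c in G] d.
Proof.
move=> Gdom [e fe] f0 [C CP]; exists (C * e.+1 ^ d.+1)%N => s.
suff [b bP] : spanle [set t | f t = 0] (fil G s) (C * e.+1 ^ d.+1 * s.+1 ^ d).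
  exists (fun i t => b i (sval t)) => g gs.
  have [F Fs ->] : exists2 F, fil G s F & g = F \o sval.
    clear b bP; elim: gs => [c {}s|_ {}s [c Gc <-]|{}s _ _ _ [A As ->] _ [B Bs ->]|{}s s' _ _ _ [A As ->] _ [B Bs ->]].
    - by exists (fun=> c) => //; exact: fil_const.
    - by exists c => //; exact: fil_gen.
    - by exists (fun t => A t + B t) => //; exact: fil_add.
    - by exists (fun t => A t * B t) => //; exact: fil_mul.
  have [a aP] := bP F Fs; exists a => -[t ft] _; exact: aP.
apply: spanle_of_indge => m mI.
have := @indge_iter _ _ _ _ _ _ _ s Gdom fe f0 (fun t (H : [set t | f t = 0] t) => H) mI.
move=> /indge_spanle/(_ (CP _)); rewrite mulnC => H.
rewrite -(leq_pmul2l (ltn0Sn s)); apply: leq_trans H _.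
rewrite mulnCA -(mulnA C) leq_mul2l -expnS -expnMn leq_expl ?orbT //.
by nia.
Qed.

Lemma gr2 : gr gen2 2.
Proof.
have g0 : gr (set0 : set (unit -> k)) 0 by apply: gr_unit => -[] [].
apply: (@gr_surj _ _ _ _ (fun c t => c (t.1.2, t.2)) 1) (gr_prod (gr_prod g0)) => [c|[x y]].
  case=> ->; apply: fil_gen; last by right.
  by left; exists snd => //; right.
by exists (tt, x, y).
Qed.

Lemma gr_curve f : alg gen2 f -> (exists t, f t != 0) ->
  gr [set (c \o (@sval _ (fun t => f t = 0))) | c in gen2] 1.
Proof. by move=> fa f0; apply: (gr_hyper dom2 fa f0); exact: gr2. Qed.

(* Along a strictly increasing chain of irreducible sets the growth exponent
   increases at each step. *)
Lemma chain_growth (T : Type) (G : set (T -> k)) (Z : nat -> set T) (f : nat -> T -> k) (e n b c K : nat) :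
  (forall i, (i < n)%N -> Z i `<=` Z i.+1) ->
  (forall i, (i <= n)%N -> forall g h, alg G g -> alg G h ->
     (exists2 t, Z i t & g t != 0) -> (exists2 t, Z i t & h t != 0) ->
     exists2 t, Z i t & g t * h t != 0) ->
  (forall i, (i < n)%N -> [/\ fil G e (f i), forall t, Z i t -> f i t = 0 & exists2 t, Z i.+1 t & f i t != 0]) ->
  (0 < K)%N -> (forall s, indge (Z 0%N) (fil G (K * s)) (s.+1 ^ c)) ->
  (exists C, forall s, spanle (Z n) (fil G s) (C * s.+1 ^ b)) -> (n + c <= b)%N.
Proof.
move=> Zm Zirr fP K0 Z0 [C CP].
have H i : (i <= n)%N -> forall s, indge (Z i) (fil G (K * (e.+1) ^ i * s)) (s.+1 ^ (i + c)).
  elim: i => [|i IH] ile s; first by rewrite muln1 add0n; exact: Z0.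
  (* Powers of [f i], which vanishes on [Z i] but is no zero divisor on [Z i.+1], give [J.+1]
     independent copies of the functions found on [Z i]; taking [J = s] raises the exponent by
     one. *)
  have step J : indge (Z i.+1) (fil G (K * e.+1 ^ i * s + J * e)) (s.+1 ^ (i + c) * J.+1).
    have [fe f0 [t0 Zt0 ft0]] := fP i ile.
    elim: J => [|J IHJ]; first by rewrite addn0 muln1; apply: indge_sub (IH (ltnW ile) s); [exact: Zm|].
    rewrite mulnS; apply: (@indge_drop _ _ _ (Z i) _ (fil G (K * e.+1 ^ i * s + J * e)) (f i)) => //.
    - exact: Zm.
    - by move=> g gs; rewrite mulSn addnCA; exact: fil_mul.
    - move=> p u a uW HZ t Zt; apply: contrapT => /eqP st.
      have [||||t1 Zt1] := Zirr i.+1 ile (f i) (fun t => \sum_i a i * u i t).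
      + by exists e.
      + by exists (K * e.+1 ^ i * s + J * e)%N; apply: fil_sum => j _; exact: fil_scale.
      + by exists t0.
      + by exists t.
      by rewrite HZ ?eqxx.
    - by apply: indge_sub (IH (ltnW ile) s) => // g; apply: fil_le; rewrite leq_addr.
  rewrite addSn (expnSr s.+1); apply: (@indge_sub _ _ _ _ _ _ _ _ _ (step s)) => // g; apply: fil_le.
  have X0 : (0 < K * e.+1 ^ i)%N by rewrite muln_gt0 K0 expn_gt0.
  rewrite expnSr mulnA; move: (K * e.+1 ^ i)%N X0 => X X0.
  by rewrite mulnS mulnDl leq_add2l -mulnA mulnC; nia.
have {}H s : (s.+1 ^ (n + c) <= C * (K * e.+1 ^ n * s).+1 ^ b)%N.
  exact: indge_spanle (H n (leqnn n) s) (CP _).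
rewrite leqNgt; apply/negP => bn.
pose A := (K * e.+1 ^ n)%N; have A0 : (0 < A)%N by rewrite muln_gt0 K0 expn_gt0.
(* If [b < n + c], then [s.+1 ^ b.+1] exceeds [C * (A * s.+1) ^ b] as soon as [s.+1] exceeds
   [C * A ^ b]. *)
pose s := (C * A ^ b)%N; have := H s; rewrite -/A.
apply/negP; rewrite -ltnNge.
apply: (@leq_ltn_trans (C * (A * s.+1) ^ b)); first by rewrite leq_mul2l leq_expl ?orbT //; nia.
rewrite expnMn mulnA -/s.
apply: (@leq_trans (s.+1 ^ b.+1)); first by rewrite expnS ltn_pmul2r ?expn_gt0.
by rewrite leq_pexp2l.
Qed.

End Growth.

(** * Regular maps to Laurent series and to the loop group *)

Section Regular.
Variables (k : fieldType) (S : Type).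
Local Notation L := (laurent k).
Local Notation eps := (eps k).
Local Notation lg := (lg k).

Definition isalg (A : set (S -> k)) := [/\ forall c, A (fun=> c),
  forall f g, A f -> A g -> A (fun s => f s + g s) &
  forall f g, A f -> A g -> A (fun s => f s * g s)].

Variables (A : set (S -> k)) (hA : isalg A).

Lemma isalg_sum (I : Type) (r : seq I) (P : pred I) (F : I -> S -> k) :
  (forall i, P i -> A (F i)) -> A (fun t => \sum_(i <- r | P i) F i t).
Proof.
case: hA => Ac AD AM H; elim: r => [|i r IH].
  by rewrite (_ : (fun t => _) = fun=> 0) //; apply: funext => t; rewrite big_nil.
rewrite (_ : (fun t => _) = fun t => (if P i then F i t else 0) + \sum_(j <- r | P j) F j t).
  by apply: (AD _ _ _ IH); case Pi: (P i) => //; exact: H.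
by apply: funext => t; rewrite big_cons; case: ifP => // _; rewrite add0r.
Qed.

Lemma isalg_exp f n : A f -> A (fun s => f s ^+ n).
Proof.
case: hA => Ac AD AM Af; elim: n => [|n IH]; first exact: Ac.
rewrite (_ : (fun s => _) = fun s => f s * f s ^+ n); first exact: AM.
by apply: funext => s; rewrite exprS.
Qed.

Lemma isalg_opp f : A f -> A (fun s => - f s).
Proof.
case: hA => Ac AD AM Af; rewrite (_ : (fun s => _) = fun s => -1 * f s); first exact: AM.
by apply: funext => s; rewrite mulN1r.
Qed.

(* Regular maps to the ind-scheme of Laurent series. *)
Definition reg (F : S -> L) :=
  (exists m, forall s, inO m (F s)) /\ forall n, A (fun s => coefL (F s) n).

Lemma reg_ext F G : F =1 G -> reg F -> reg G.
Proof. by move=> /funext ->. Qed.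

Lemma reg_const x : reg (fun=> x).
Proof.
case: hA => Ac AD AM; have [N xN] := inO_ex x.
by split=> [|n]; [exists (- N%:Z) | exact: Ac].
Qed.

Lemma regD F G : reg F -> reg G -> reg (fun s => F s + G s).
Proof.
case: hA => Ac AD AM [[m Fm] FA] [[m' Gm] GA]; split=> [|n].
  exists (Num.min m m') => s; apply: inO_add.
    by apply: inO_le (Fm s); rewrite ge_min lexx.
  by apply: inO_le (Gm s); rewrite ge_min lexx orbT.
by rewrite (_ : (fun s => _) = fun s => coefL (F s) n + coefL (G s) n); [exact: AD | apply: funext => s; rewrite coefLD].
Qed.

Lemma regM F G : reg F -> reg G -> reg (fun s => F s * G s).
Proof.
case: hA => Ac AD AM [[m Fm] FA] [[m' Gm] GA]; split=> [|n].
  by exists (m + m') => s; exact: inO_mul.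
pose N := absz m; pose M := absz (n - m' + N%:Z + 1)%R.
rewrite (_ : (fun s => _) = fun s => \sum_(i < M) coefL (F s) (i%:Z - N%:Z) * coefL (G s) (n - i%:Z + N%:Z)).
  by apply: isalg_sum => i _; exact: AM.
apply: funext => s; apply: coefLM; first by apply: inO_le (Fm s); rewrite /N; lia.
by apply: inO_le (Gm s); rewrite /M; lia.
Qed.

Lemma reg_sum (I : Type) (r : seq I) (P : pred I) (F : I -> S -> L) :
  (forall i, P i -> reg (F i)) -> reg (fun t => \sum_(i <- r | P i) F i t).
Proof.
move=> H; elim: r => [|i r IH].
  by apply: reg_ext (reg_const 0) => t; rewrite big_nil.
have : reg (fun t => (if P i then F i t else 0) + \sum_(j <- r | P j) F j t).
  by apply: (regD _ IH); case Pi: (P i); [exact: H | exact: reg_const].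
by apply: reg_ext => t; rewrite big_cons; case: ifP => // _; rewrite add0r.
Qed.

Lemma reg_prod (I : Type) (r : seq I) (F : I -> S -> L) :
  (forall i, reg (F i)) -> reg (fun t => \prod_(i <- r) F i t).
Proof.
move=> H; elim: r => [|i r IH].
  by apply: reg_ext (reg_const 1) => t; rewrite big_nil.
by apply: reg_ext (regM (H i) IH) => t; rewrite big_cons.
Qed.

Lemma reg_constL f : A f -> reg (fun s => constL (f s)).
Proof.
case: hA => Ac AD AM Af; split=> [|n]; first by exists 0 => s; exact: inO_const.
rewrite (_ : (fun s => _) = fun s => (n == 0)%:R * f s); first exact: AM.
by apply: funext => s; rewrite coefL_const mulr_natl.
Qed.

Lemma reg_frob q F : [pchar k].-nat q -> reg F -> reg (fun s => frob q (F s)).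
Proof.
move=> qP [[m Fm] FA]; split=> [|n]; first by exists m => s; exact: inO_frob.
rewrite (_ : (fun s => _) = fun s => coefL (F s) n ^+ q); first exact: isalg_exp.
by apply: funext => s; rewrite coefL_frob.
Qed.

(** The coefficients of the inverse satisfy a recursion whose only denominator is the leading
    coefficient of [F]. *)
Lemma reg_inv c F : (forall s, hasval c (F s)) -> A (fun s => (coefL (F s) c)^-1) ->
  reg F -> reg (fun s => (F s)^-1).
Proof.
case: hA => Ac AD AM Fc FVA [_ FA]; split=> [|n].
  by exists (- c) => s; case: (hasvalV (Fc s)).
have [nc|nc] := ltP n (- c).
  rewrite (_ : (fun s => _) = fun=> 0) //; apply: funext => s.
  by case: (hasvalV (Fc s)) => H _; exact: H.
have [m ->] : exists m : nat, n = m%:Z - c by exists (absz (n + c)%R); lia.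
elim/ltn_ind: m {nc n} => m IH.
have E s : coefL (F s)^-1 (m%:Z - c) = (coefL (F s) c)^-1 *
    ((m == 0%N)%:R + - \sum_(i < m) coefL (F s) (c + i.+1%:Z) * coefL (F s)^-1 ((m - i.+1)%N%:Z - c)).
  have := @coefLM _ 0 m.+1 (eps ^ (- c) * F s) (F s)^-1 (m%:Z - c).
  have -> : eps ^ (- c) * F s * (F s)^-1 = eps ^ (- c) * 1.
    by rewrite -mulrA mulfV // (hasval_neq0 (Fc s)).
  rewrite big_ord_recl !coefL_epsz coefL1 !oppr0 !addr0.
  rewrite (_ : (_ - c - - c == 0)%R = (m == 0%N)); last by lia.
  have F0 : inO 0 (eps ^ (- c) * F s).
    by have := (inO_eps c (- c) (F s)).2 (Fc s).1; rewrite subrr.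
  have Fi : inO (m%:Z - c - m.+1%:Z + 1) (F s)^-1.
    by case: (hasvalV (Fc s)) => H _; apply: inO_le H; lia.
  rewrite (_ : (ord0 : 'I_m.+1)%:Z - - c = c); last by rewrite opprK add0r.
  move=> /(_ F0 Fi) ->; rewrite mulrDr mulrDr mulKf; last by case: (Fc s).
  rewrite -[LHS]addr0 -addrA; congr (_ + _); rewrite -mulrDr (eq_bigr (fun i : 'I_m => coefL (F s) (c + i.+1%:Z) * coefL (F s)^-1 ((m - i.+1)%N%:Z - c))) ?subrr ?mulr0 //.
  move=> i _; rewrite lift0 coefL_epsz; congr (coefL _ _ * coefL _ _); have := ltn_ord i; lia.
rewrite (funext E); apply: (AM _ _ FVA); apply: (AD _ _ (Ac _)); apply: isalg_opp.
by apply: isalg_sum => i _; apply: AM; [exact: FA | apply: IH; have := ltn_ord i; lia].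
Qed.

Definition regmx (g : S -> lg) := forall i j,
  reg (fun s => mx (g s) i j) /\ reg (fun s => mx (g s)^-1%g i j).

Lemma regmx_const g : regmx (fun=> g).
Proof. by move=> i j; split; exact: reg_const. Qed.

Lemma regmxV g : regmx g -> regmx (fun s => (g s)^-1%g).
Proof. by move=> H i j; have [a b] := H i j; split=> //; apply: reg_ext a => s; rewrite invgK. Qed.

Lemma regmxM g h : regmx g -> regmx h -> regmx (fun s => (g s * h s)%g).
Proof.
have H a b i j : (forall i j, reg (fun s => mx (a s) i j)) -> (forall i j, reg (fun s => mx (b s) i j)) ->
    reg (fun s => mx (a s * b s)%g i j).
  move=> Ha Hb; apply: (@reg_ext (fun s => \sum_l mx (a s) i l * mx (b s) l j)) => [s|]; first by rewrite mxME.
  by apply: reg_sum => l _; exact: regM.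
move=> Hg Hh i j; split; first by apply: H => i' j'; [case: (Hg i' j')| case: (Hh i' j')].
apply: (@reg_ext (fun s => mx ((h s)^-1 * (g s)^-1)%g i j)) => [s|]; first by rewrite invMg.
by apply: (H (fun s => (h s)^-1)%g (fun s => (g s)^-1)%g) => i' j'; [case: (Hh i' j')| case: (Hg i' j')].
Qed.

Lemma regmx_u f : A f -> regmx (fun s => u (f s)).
Proof.
have H f' i j : A f' -> reg (fun s => mx (u (f' s)) i j).
  move=> Af; apply: (@reg_ext (fun s => (1%:M : 'M[L]_3) i j + constL (f' s) * (delta_mx 1 0 : 'M[L]_3) i j)) => [s|].
    by rewrite mx_u !mxE.
  by apply: regD; [exact: reg_const | apply: regM; [exact: reg_constL | exact: reg_const]].
move=> Af i j; split; first exact: H.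
by apply: reg_ext (H _ i j (isalg_opp Af)) => s; rewrite uN.
Qed.

Lemma regmx_sg q (qP : [pchar k].-nat q) g : regmx g -> regmx (fun s => sg qP (g s)).
Proof.
move=> H i j; have [a b] := H (rev_ord j) (rev_ord i); split.
  by apply: reg_ext (reg_frob qP b) => s; rewrite sgE.
by apply: reg_ext (reg_frob qP a) => s; rewrite sgVE.
Qed.

(** The [N]-th piece of the ind-scheme: poles of order at most [N] in the matrix and in its
    inverse. *)
Definition pc (N : nat) (g : lg) := forall i j, inO (- N%:Z) (mx g i j) /\ inO (- N%:Z) (mx g^-1%g i j).

Lemma regmx_pc g : regmx g -> exists N, forall s, pc N (g s).
Proof.
move=> H; have /choice[b bP] : forall ij : 'I_3 * 'I_3, exists m : int, forall s,
    inO m (mx (g s) ij.1 ij.2) /\ inO m (mx (g s)^-1%g ij.1 ij.2).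
  move=> [i j]; have [[[m Hm] _] [[m' Hm'] _]] := H i j; exists (Num.min m m') => s; split.
    by apply: inO_le (Hm s); rewrite ge_min lexx.
  by apply: inO_le (Hm' s); rewrite ge_min lexx orbT.
exists (\sum_ij `|b ij|)%N => s i j.
have : (`|b (i, j)| <= \sum_ij `|b ij|)%N by rewrite (bigD1 (i, j)) //= leq_addr.
by move=> ?; split; [apply: inO_le (bP (i, j) s).1 | apply: inO_le (bP (i, j) s).2]; lia.
Qed.

End Regular.

Lemma alg_isalg (k : fieldType) (T : Type) (G : set (T -> k)) : isalg (alg G).
Proof. by split=> *; [exact: alg_const | exact: alg_add | exact: alg_mul]. Qed.
Arguments alg_isalg {k T G}.

(** * The quotient topology, described on the loop group *)

Section LoopTopology.
Variable k : fieldType.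
Local Notation L := (laurent k).
Local Notation eps := (eps k).
Local Notation lg := (lg k).
Local Notation ofps := (@FracField.tofrac (fps k)).
Implicit Types (g h x : lg) (O : set lg) (U : set (flag k)).

Definition lgen : set (lg -> k) := [set f | exists i j n,
  f = (fun g => coefL (mx g i j) n) \/ f = (fun g => coefL (mx g^-1%g i j) n)].

Lemma alg_regmx (S : Type) (A : set (S -> k)) (phi : S -> lg) f : isalg A -> regmx A phi ->
  alg lgen f -> A (f \o phi).
Proof.
move=> [Ac AD AM] H [s]; elim=> [c _|_ _ [i [j [n [->|->]]]]|_ g h _ IHg _ IHh|_ _ g h _ IHg _ IHh].
- exact: Ac.
- by have [[_ Hn] _] := H i j; exact: Hn.
- by have [_ [_ Hn]] := H i j; exact: Hn.
- exact: (AD _ _ IHg IHh).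
- exact: (AM _ _ IHg IHh).
Qed.

Definition lopen O := forall N, exists2 S : set (lg -> k), S `<=` alg lgen &
  forall g, pc N g -> O g <-> exists2 f, S f & f g != 0.

Lemma pc_ex g : exists N, pc N g.
Proof.
have [N H] := @regmx_pc k unit setT (fun=> g) (@regmx_const _ _ _ (And3 (fun=> I) (fun _ _ _ _ => I) (fun _ _ _ _ => I)) g).
by exists N; exact: (H tt).
Qed.

Lemma piece (N : nat) (A B : 'M[fps k]_3) : A *m B = (fps_eps k ^+ N.*2)%:M ->
  exists g : lg, [/\ mx g = eps ^- N *: map_mx ofps A, mx g^-1%g = eps ^- N *: map_mx ofps B & pc N g].
Proof.
move=> AB; have e0 := eps_neq0 k.
have E : (eps ^- N *: map_mx ofps A) *m (eps ^- N *: map_mx ofps B) = 1%:M :> 'M[L]_3.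
  rewrite -scalemxAl -scalemxAr -map_mxM AB map_scalar_mx scalerA -invfM -exprD.
  by rewrite addnn rmorphXn scale_scalar_mx mulVf ?expf_neq0.
have [g gE] := lg_of (mulmx1_unitl E).
have gV : mx g^-1%g = eps ^- N *: map_mx ofps B.
  by rewrite -invmx_mx -gE; apply: mulmx1_invmx.
have H (C : 'M[fps k]_3) i j : inO (- N%:Z) ((eps ^- N *: map_mx ofps C) i j).
  by rewrite !mxE exprnN -[X in inO X]add0r; apply/inO_eps; exact: inO_ofps.
by exists g; split=> // i j; rewrite gV -gE.
Qed.

Definition fpsm (N : nat) (X : 'M[L]_3) : 'M[fps k]_3 :=
  \matrix_(i, j) Fps (fun n => coefL (X i j) (n%:Z - N%:Z)).

Lemma fpsmE N (X : 'M[L]_3) : (forall i j, inO (- N%:Z) (X i j)) ->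
  X = eps ^- N *: map_mx ofps (fpsm N X).
Proof.
move=> XO; apply/matrixP => i j; apply: coefL_inj => n.
rewrite !mxE coefL_rep /=; case E: (n + N%:Z) => [m|m] /=.
- by congr coefL; lia.
- by rewrite (XO i j) //; lia.
Qed.

Lemma fpsmM N g : pc N g -> fpsm N (mx g) *m fpsm N (mx g^-1%g) = (fps_eps k ^+ N.*2)%:M.
Proof.
move=> gN; have e0 := eps_neq0 k.
have E1 := fpsmE (fun i j => (gN i j).1); have E2 := fpsmE (fun i j => (gN i j).2).
have inj (X Y : 'M[fps k]_3) : map_mx ofps X = map_mx ofps Y -> X = Y.
  by move=> /matrixP XY; apply/matrixP => i j; apply: fpsP => n; have := congr1 (fun z => coefL z n%:Z) (XY i j); rewrite !mxE !coefL_ofps.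
apply: inj.
rewrite map_mxM map_scalar_mx rmorphXn /=.
have E : mx g *m mx g^-1%g = 1%:M by rewrite -mxM mulgV mx1.
rewrite {}E1 {}E2 -scalemxAl -scalemxAr scalerA -invfM -exprD addnn in E.
move/(congr1 (fun X : 'M[L]_3 => eps ^+ N.*2 *: X)): E.
by rewrite scalerA mulfV ?expf_neq0 // scale1r scale_scalar_mx mulr1 => ->.
Qed.

Lemma regular_alg N f : regular_fun f -> exists2 f', alg lgen f' &
  forall g, f' g = f (fpsm N (mx g)) (fpsm N (mx g^-1%g)).
Proof.
elim=> [c|i j n|i j n|f1 f2 _ [g1 ? E1] _ [g2 ? E2]|f1 f2 _ [g1 ? E1] _ [g2 ? E2]].
- by exists (fun=> c) => //; exact: alg_const.
- exists (fun g => coefL (mx g i j) (n%:Z - N%:Z)) => [|g]; last by rewrite mxE.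
  by apply: alg_gen; exists i, j, (n%:Z - N%:Z); left.
- exists (fun g => coefL (mx g^-1%g i j) (n%:Z - N%:Z)) => [|g]; last by rewrite mxE.
  by apply: alg_gen; exists i, j, (n%:Z - N%:Z); right.
- by exists (fun g => g1 g + g2 g) => [|g]; [exact: alg_add | rewrite E1 E2].
- by exists (fun g => g1 g * g2 g) => [|g]; [exact: alg_mul | rewrite E1 E2].
Qed.

Lemma alg_regular N f' : alg lgen f' -> exists2 f, regular_fun f &
  forall A B g, mx g = eps ^- N *: map_mx ofps A -> mx g^-1%g = eps ^- N *: map_mx ofps B ->
  f' g = f A B.
Proof.
have H (f : 'M[fps k]_3 -> 'M[fps k]_3 -> k) (n : int) :
    (forall m : nat, n + N%:Z = m%:Z -> regular_fun f) ->
    (n + N%:Z < 0 -> f = fun _ _ => 0) -> regular_fun f.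
  move=> f1 f2; case E: (n + N%:Z) => [m|m].
  - exact: (f1 m).
  - by rewrite f2 ?E //; exact: regular_const.
move=> [s]; elim=> [c _|_ _ [i [j [n [->|->]]]]|_ g h _ [f1 r1 E1] _ [f2 r2 E2]|_ _ g h _ [f1 r1 E1] _ [f2 r2 E2]].
- by exists (fun _ _ => c) => //; exact: regular_const.
- exists (fun A _ => coefz (A i j) (n + N%:Z)) => [|A B g -> _]; last by rewrite !mxE coefL_rep.
  apply: (H _ n) => [m ->|n0]; first exact: regular_coefl.
  by apply: funext => A; apply: funext => B; rewrite coefz_neg.
- exists (fun _ B => coefz (B i j) (n + N%:Z)) => [|A B g _ ->]; last by rewrite !mxE coefL_rep.
  apply: (H _ n) => [m ->|n0]; first exact: regular_coefr.
  by apply: funext => A; apply: funext => B; rewrite coefz_neg.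
- exists (fun A B => f1 A B + f2 A B) => [|A B ? ? ?]; first exact: regular_add.
  by rewrite (E1 A B) ?(E2 A B).
- exists (fun A B => f1 A B * f2 A B) => [|A B ? ? ?]; first exact: regular_mul.
  by rewrite (E1 A B) ?(E2 A B).
Qed.

(** [loop_closed] speaks of pairs of integral matrices, [lopen] of group elements. Multiplication by
    [eps^N] identifies the two descriptions of a piece and, coefficient by coefficient, their
    regular functions. *)
Lemma openE U : open U <-> lopen [set g | U (fl g)].
Proof.
have neg g : (exists2 x : flag k, ~ U x & x = icoset (mx g) :> set _) <-> ~ U (fl g).
  by split=> [[x nx /fl_icoset <-]|nU] //; exists (fl g).
change (flag_open U <-> lopen [set g | U (fl g)]); split=> [oU N|oU N].
- have [S Sr SP] := oU N.
  exists [set f' | alg lgen f' /\ exists2 f, S f &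
      forall g, f' g = f (fpsm N (mx g)) (fpsm N (mx g^-1%g))]; first by move=> f' [].
  move=> g gN; have := SP _ _ (fpsmM gN); rewrite -(fpsmE (fun i j => (gN i j).1)) => SPg.
  split=> [Ug|[f' [_ [f Sf fE]] f'g]].
    apply: contrapT => no; apply: (neg g).1 Ug; apply/SPg => f Sf.
    have [f' af' fE] := regular_alg N (Sr _ Sf).
    by apply: contrapT => /eqP fne; apply: no; exists f'; [split=> //; exists f | rewrite fE].
  apply: contrapT => nU; move: f'g; rewrite fE (SPg.1 _ _ Sf) ?eqxx //; exact/neg.
- have [S Sr SP] := oU N.
  exists [set f | regular_fun f /\ exists2 f', S f' & forall A B g,
    mx g = eps ^- N *: map_mx ofps A -> mx g^-1%g = eps ^- N *: map_mx ofps B -> f' g = f A B].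
    by move=> f [].
  move=> A B AB; have [g [gA gB gN]] := piece AB; rewrite -gA.
  split=> [/neg nU f [_ [f' Sf' fE]]|H].
    rewrite -(fE A B g) //; apply: contrapT => /eqP f0; apply: nU.
    by apply/(SP g gN); exists f'.
  apply/neg => /(SP g gN)[f' Sf' /eqP]; apply.
  have [f rf fE] := alg_regular N (Sr _ Sf').
  by rewrite (fE A B) //; apply: H; split=> //; exists f'.
Qed.

End LoopTopology.

Section OpenSets.
Variable k : fieldType.
Local Notation L := (laurent k).
Local Notation eps := (eps k).
Local Notation lg := (lg k).
Local Notation sc := (@sc k).
Implicit Types (g h x : lg) (O : set lg) (U : set (flag k)).

Definition PC N := {g : lg | pc N g}.
Definition locA N : set (PC N -> k) := [set f \o sval | f in alg (@lgen k)].

Lemma isalg_loc N : isalg (@locA N).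
Proof.
split=> [c|_ _ [f fa <-] [g ga <-]|_ _ [f fa <-] [g ga <-]].
- by exists (fun=> c) => //; exact: alg_const.
- by exists (fun s => f s + g s) => //; exact: alg_add.
- by exists (fun s => f s * g s) => //; exact: alg_mul.
Qed.

Lemma regmx_loc N : regmx (@locA N) sval.
Proof.
move=> i j; split; split.
- by exists (- N%:Z) => -[g gN]; case: (gN i j).
- by move=> n; exists (fun g => coefL (mx g i j) n) => //; apply: alg_gen; exists i, j, n; left.
- by exists (- N%:Z) => -[g gN]; case: (gN i j).
- by move=> n; exists (fun g => coefL (mx g^-1%g i j) n) => //; apply: alg_gen; exists i, j, n; right.
Qed.

(* Morphisms from the loop group, given by a formula valid on all pieces. *)
Definition lmor (phi : lg -> lg) := forall N, regmx (@locA N) (phi \o sval).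
Definition lfun (F : lg -> L) := forall N, reg (@locA N) (F \o sval).

Lemma lmor_id : lmor id. Proof. exact: regmx_loc. Qed.
Lemma lmor_const x : lmor (fun=> x).
Proof. by move=> N; apply: (regmx_const (isalg_loc N)). Qed.
Lemma lmorM phi psi : lmor phi -> lmor psi -> lmor (fun g => (phi g * psi g)%g).
Proof. by move=> a b N; apply: (regmxM (isalg_loc N) (a N) (b N)). Qed.
Lemma lmorV phi : lmor phi -> lmor (fun g => (phi g)^-1%g).
Proof. by move=> a N; apply: (regmxV (a N)). Qed.
Lemma lmor_sg q (qP : [pchar k].-nat q) phi : lmor phi -> lmor (fun g => sg qP (phi g)).
Proof. by move=> a N; apply: (regmx_sg (isalg_loc N) qP (a N)). Qed.
Lemma lfun_mx phi i j : lmor phi -> lfun (fun g => mx (phi g) i j).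
Proof. by move=> a N; case: (a N i j). Qed.
Lemma lfunM F G : lfun F -> lfun G -> lfun (fun g => F g * G g).
Proof. by move=> a b N; apply: (regM (isalg_loc N) (a N) (b N)). Qed.

Lemma lopen_pre phi O : lmor phi -> lopen O -> lopen [set g | O (phi g)].
Proof.
move=> H oO N; have [M HM] := regmx_pc (H N); have [S Sr SP] := oO M.
exists [set f | alg (@lgen k) f /\ exists2 f', S f' & forall g, pc N g -> f g = f' (phi g)].
  by move=> f [].
move=> g gN; have := SP _ (HM (exist _ g gN)) => /= ->; split=> [[f' Sf' f'g]|[f [fa [f' Sf' E]] fg]].
  have [f fa fE] := alg_regmx (isalg_loc N) (H N) (Sr _ Sf').
  have E h : pc N h -> f h = f' (phi h).
    by move=> hN; exact: (congr1 (fun F => F (exist _ h hN)) fE).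
  by exists f; [split=> //; exists f' | rewrite E].
by exists f' => //; rewrite -E.
Qed.

Lemma lopen_lfun F n : lfun F -> lopen [set g | coefL (F g) n != 0].
Proof.
move=> H N; have [_ /(_ n)[f fa fE]] := H N; exists [set f]; first by move=> _ ->.
move=> g gN; have E : f g = coefL (F g) n by exact: (congr1 (fun F => F (exist _ g gN)) fE).
by split=> [Fg|[_ -> ]]; [exists f; rewrite ?E | rewrite E].
Qed.

Lemma lopenI O O' : lopen O -> lopen O' -> lopen (O `&` O').
Proof.
move=> oO oO' N; have [S Sr SP] := oO N; have [S' Sr' SP'] := oO' N.
exists [set f | exists a b : lg -> k, [/\ S a, S' b & f = fun x => a x * b x]].
  by move=> _ [g [h [/Sr ga /Sr' ha ->]]]; exact: alg_mul.
move=> g gN; split=> [[/(SP _ gN)[f Sf fg] /(SP' _ gN)[f' Sf' f'g]]|].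
  by exists (fun x => f x * f' x); [exists f, f' | rewrite mulf_neq0].
move=> [_ [f [f' [Sf Sf' ->]]]]; rewrite mulf_eq0 negb_or => /andP[fg f'g].
by split; [apply/(SP _ gN); exists f | apply/(SP' _ gN); exists f'].
Qed.

Lemma lopenU (I : Type) (D : set I) (O : I -> set lg) :
  (forall i, D i -> lopen (O i)) -> lopen (\bigcup_(i in D) O i).
Proof.
move=> H N; have /choice[S HS] : forall i, exists S : set (lg -> k), D i -> S `<=` alg (@lgen k) /\
    forall g, pc N g -> O i g <-> exists2 f, S f & f g != 0.
  move=> i; have [Di|nD] := pselect (D i); last by exists set0.
  by have [S ? ?] := H i Di N; exists S.
exists (\bigcup_(i in D) S i); first by move=> f [i Di Sf]; have [+ _] := HS i Di; apply.
move=> g gN; split=> [[i Di Oi]|[f [i Di Sf] fg]].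
  by have [_ /(_ g gN)[/(_ Oi)[f Sf fg] _]] := HS i Di; exists f => //; exists i.
by exists i => //; have [_ /(_ g gN)[_]] := HS i Di; apply; exists f.
Qed.

(** The projection to the flag variety is open: the saturation of [O] is the union of its right
    translates by elements of [Iw]. *)
Lemma open_sat O : lopen O -> open [set fl g | g in O].
Proof.
move=> oO; apply/openE.
rewrite (_ : [set g | _] = \bigcup_(x in Iw (k := k)) [set g | O (g * x)%g]); last first.
  apply/seteqP; split=> [g [h Oh /flE H]|g [x xI Ox]].
    by exists (g^-1 * h)%g; rewrite /= ?mulKVg //; have := IwV H; rewrite invMg invgK.
  by exists (g * x)%g => //; exact: fl_mulr.
apply: lopenU => x _; apply: lopen_pre oO; apply: lmorM; [exact: lmor_id | exact: lmor_const].
Qed.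

Lemma lopen_open U : open U -> lopen [set g | U (fl g)].
Proof. by move/openE. Qed.

Lemma closedE (C : set (flag k)) : closed C <-> lopen [set g | ~ C (fl g)].
Proof. by rewrite -openC openE. Qed.

Lemma lopen_notin F m : lfun F -> lopen [set g | ~ inO m (F g)].
Proof.
move=> H; rewrite (_ : [set g | _] = \bigcup_(n in [set n | n < m]) [set g | coefL (F g) n != 0]).
  by apply: lopenU => n _; exact: lopen_lfun.
apply/seteqP; split=> [g /existsNP[n /not_implyP[nm /eqP Fn]]|g [n nm Fn] H']; first by exists n.
by move: Fn; rewrite /= H' ?eqxx.
Qed.

(* Invariant under scalars, unlike bounds on the entries of [g] and [g^-1]. *)
Definition bd (m : 'I_3 -> 'I_3 -> 'I_3 -> 'I_3 -> int) g := forall i j i' j',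
  inO (m i j i' j') (mx g i j * mx g^-1%g i' j').

Lemma lopen_bdN m phi : lmor phi -> lopen [set g | ~ bd m (phi g)].
Proof.
move=> H; rewrite (_ : [set g | _] = \bigcup_(t in [set: 'I_3 * 'I_3 * 'I_3 * 'I_3])
    [set g | ~ inO (m t.1.1.1 t.1.1.2 t.1.2 t.2) (mx (phi g) t.1.1.1 t.1.1.2 * mx (phi g)^-1%g t.1.2 t.2)]).
  apply: lopenU => t _; apply: lopen_notin; apply: lfunM; apply: lfun_mx => //; exact: lmorV.
apply/seteqP; split=> [g|g [t _ Ft] H']; last exact: Ft (H' _ _ _ _).
move=> /existsNP[i /existsNP[j /existsNP[i' /existsNP[j' Ft]]]].
by exists (i, j, i', j').
Qed.

Lemma bd_sc m n g : bd m (sc n * g)%g <-> bd m g.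
Proof.
have E i j i' j' : mx (sc n * g)%g i j * mx (sc n * g)^-1%g i' j' = mx g i j * mx g^-1%g i' j' :> L.
  by rewrite invMg -scN -scC !mx_scM mulrACA -expfzDr ?eps_neq0 // subrr expr0z mul1r.
by split=> H i j i' j'; move: (H i j i' j'); rewrite E.
Qed.

Lemma minval (g : lg) : exists m i j, hasval m (mx g i j) /\ forall i j, inO m (mx g i j).
Proof.
have [i [j ij0]] : exists i j, mx g i j <> 0.
  apply: contrapT => no; have g0 : mx g = 0.
    by apply/matrixP => i j; rewrite mxE; apply: contrapT => ij; apply: no; exists i, j.
  have : mx g *m mx g^-1%g = 1%:M :> 'M[L]_3 by rewrite -mxM mulgV mx1.
  rewrite g0 mul0mx => /(congr1 (fun X : 'M[L]_3 => coefL (X 0 0) 0)).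
  by rewrite !mxE coefL0 coefL1 => /eqP; rewrite eq_sym oner_eq0.
have [N gN] := pc_ex g.
have ex : exists n, [exists ij : 'I_3 * 'I_3, coefL (mx g ij.1 ij.2) (n%:Z - N%:Z) != 0].
  have [m mP] : exists m, coefL (mx g i j) m != 0.
    apply: contrapT => no; apply: ij0; apply: coefL_inj => n; rewrite coefL0.
    by apply: contrapT => /eqP n0; apply: no; exists n.
  have [mN|mN] := ltP m (- N%:Z); first by rewrite (gN i j).1 ?eqxx in mP.
  exists (absz (m + N%:Z)); apply/existsP; exists (i, j) => /=.
  by rewrite (_ : (absz (m + N%:Z))%:Z - N%:Z = m) //; lia.
have [n /existsP[[a b] /= nP] nmin] := ex_minnP ex.
have H i' j' : inO (n%:Z - N%:Z) (mx g i' j').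
  move=> l ln; have [lN|lN] := ltP l (- N%:Z); first exact: (gN i' j').1.
  apply: contrapT => /eqP l0; have := nmin (absz (l + N%:Z)); rewrite leqNgt.
  move/(_ _)/negP; apply; last by lia.
  apply/existsP; exists (i', j') => /=.
  by rewrite (_ : (absz (l + N%:Z))%:Z - N%:Z = l) //; lia.
by exists (n%:Z - N%:Z), a, b.
Qed.

Lemma hasvalM_inO m n (x y : L) : hasval m x -> inO n (x * y) -> inO (n - m) y.
Proof.
move=> xm; have x0 := hasval_neq0 xm; have [xV _] := hasvalV xm => xyn.
have -> : y = x^-1 * (x * y) by rewrite mulKf.
by rewrite addrC; exact: inO_mul.
Qed.

(** This turns membership in [Iw] into a closed condition. For the converse, [g] is scaled so that
    its least valuation is 0; then the conditions make [g^-1] integral and triangular modulo [eps],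
    and integrality of both matrices forces their determinants to have valuation 0. *)
Lemma bd_Iw g : Iw g <-> bd (fun i j i' j' => (i < j)%N%:Z + (i' < j')%N%:Z) g.
Proof.
split=> [[n gI]|].
  apply/(bd_sc _ n) => i j i' j'; apply: inO_mul; first exact: iwahoriGL_inO.
  by apply: iwahoriGL_inO; exact: IgV.
move=> H; have [m [a [b [gab gm]]]] := minval g.
exists (- m); have {}H := (bd_sc _ (- m) g).2 H; move: (sc (- m) * g)%g H (fun i j => etrans (mx_scM (- m) g i j) erefl) => h H hE.
have ha : hasval 0 (mx h a b) by rewrite hE; have := hasval_mul (hasval_eps k (- m)) gab; rewrite addNr.
have h0 i j : inO 0 (mx h i j).
  by rewrite hE; have := inO_mul (@inO_epsp k (- m)) (gm i j); rewrite addNr.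
have hV (i j : 'I_3) : inO (i < j)%N%:Z (mx h^-1%g i j).
  have := hasvalM_inO ha (H a b i j); apply: inO_le; lia.
have d0 : dv 0 h.
  have [n hn] := dv_ex h; have hn' := dvV hn.
  have detO (x : lg) : (forall i j, inO 0 (mx x i j)) -> forall l, dv l x -> 0 <= l.
    move=> xO l [_ xl]; have : inO 0 (\det (mx x)).
      apply: inO_sum => s _; rewrite -[X in inO X]add0r; apply: inO_mul.
        by rewrite -signr_odd; case: (odd _); rewrite ?expr1 ?expr0; [apply: inO_opp|]; exact: inO1.
      by apply: inO_prod => i _.
    by move=> xO'; rewrite leNgt; apply: contraNN xl => /xO' ->.
  have := detO _ h0 _ hn; have := detO _ (fun i j => inO_le _ (hV i j)) _ hn'.
  by move=> /(_ (fun i j => isT)); rewrite oppr_ge0 => ? ?; rewrite (_ : 0 = n) //; lia.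
have KV : glO (mx h^-1%g).
  apply: glOP => [i j|]; first by apply: inO_le (hV i j).
  by have [_] := dvV d0; rewrite oppr0.
have IV : Ig h^-1%g.
  apply: iwahoriGLP => // i.
  have [f fu fE] := KV; have := fu; rewrite unitmx_fps unitmxE det_trig ?unitfE => [/prodf_neq0 /(_ i isT)|]; last first.
    apply/is_trig_mxP => i' j' ij; rewrite !mxE; have := hV i' j' 0; rewrite fE ij mxE coefL_ofps; exact.
  by rewrite fE !mxE coefL_ofps.
by rewrite -[h]invgK; exact: IgV.
Qed.

Lemma closed_fl g : closed [set fl g].
Proof.
apply/closedE; rewrite (_ : [set h | _] = [set h | ~ bd (fun i j i' j' => (i < j)%N%:Z + (i' < j')%N%:Z) (g^-1 * h)%g]).
  by apply: lopen_bdN; apply: lmorM; [exact: lmor_const | exact: lmor_id].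
by apply/seteqP; split=> h H E; apply: H; [move/bd_Iw/flE: E | apply/bd_Iw/flE].
Qed.

Lemma inO_det m (x : lg) : (forall i j, inO m (mx x i j)) -> inO (m *+ 3) (\det (mx x)).
Proof.
move=> xm; have [f fE] : exists f : 'M[fps k]_3, mx (sc (- m) * x)%g = map_mx (@FracField.tofrac _) f.
  apply: inO_mx => i j; rewrite mx_scM; have := inO_mul (@inO_epsp k (- m)) (xm i j).
  by rewrite addNr.
have -> : \det (mx x) = eps ^ (m *+ 3) * \det (mx (sc (- m) * x)%g).
  rewrite mxM det_mulmx mx_sc det_scalar mulrA exprnP exprz_exp.
  by rewrite -expfzDr ?eps_neq0 // (_ : (_ + _)%R = 0) ?expr0z ?mul1r //; lia.
rewrite fE det_map_mx -[X in inO X]add0r; apply/inO_eps; exact: inO_ofps.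
Qed.

Lemma lfun_det : lfun (fun g => \det (mx g)).
Proof.
move=> N; apply: (@reg_ext _ _ _ (fun s : PC N => \sum_(s0 : 'S_3) (-1) ^+ s0 * \prod_i mx (sval s) i (s0 i))) => //.
apply: (reg_sum (isalg_loc N)) => s0 _; apply: (regM (isalg_loc N)); first exact: (reg_const (isalg_loc N)).
by apply: (reg_prod (isalg_loc N)) => i; case: (regmx_loc N i (s0 i)).
Qed.

Lemma lfun_detV : lfun (fun g => \det (mx g^-1%g)).
Proof.
move=> N; apply: (@reg_ext _ _ _ (fun s : PC N => \sum_(s0 : 'S_3) (-1) ^+ s0 * \prod_i mx (sval s)^-1%g i (s0 i))) => //.
apply: (reg_sum (isalg_loc N)) => s0 _; apply: (regM (isalg_loc N)); first exact: (reg_const (isalg_loc N)).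
by apply: (reg_prod (isalg_loc N)) => i; case: (regmx_loc N i (s0 i)).
Qed.

(** The coefficient of [\det g] at [c] bounds the valuation from above, and the one of [\det g^-1]
    at [- c] bounds it from below. *)
Lemma lopen_dv c : lopen (dv c (k := k)).
Proof.
rewrite (_ : dv c (k := k) = [set g | coefL (\det (mx g)) c != 0] `&` [set g | coefL (\det (mx g^-1%g)) (- c) != 0]).
  by apply: lopenI; apply: lopen_lfun; [exact: lfun_det | exact: lfun_detV].
apply/seteqP; split=> [g gc|g [/= gc gVc]]; first by case: gc (dvV gc) => _ ? [].
have [n gn] := dv_ex g; have [H _] := gn; have [H' _] := dvV gn.
suff -> : c = n by [].
apply/eqP; rewrite eq_le; apply/andP; split; rewrite leNgt.
  by apply: contraNN gVc => cn; rewrite H' //; lia.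
by apply: contraNN gc => /H ->.
Qed.

End OpenSets.

(** * Chains of irreducible sets along fibrations *)

Section Topology.
Variable T : topologicalType.
Implicit Types X Y Z C U V : set T.

Lemma irrP Y : irreducible Y <-> Y !=set0 /\
  forall U V, open U -> open V -> Y `&` U !=set0 -> Y `&` V !=set0 -> Y `&` (U `&` V) !=set0.
Proof.
split=> -[Y0 H]; split=> //.
  move=> U V oU oV [y [Yy Uy]] [z [Yz Vz]].
  apply: contrapT => no; have [|||YU|YV] := H (~` U) (~` V); [| | |exact: (YU _ Yy)|exact: (YV _ Yz)].
  - exact: open_closedC.
  - exact: open_closedC.
  - move=> x Yx; have [Ux|] := pselect (U x); last by left.
    by right => Vx; apply: no; exists x.
move=> A B cA cB YAB; apply: contrapT => /not_orP[/existsNP[y /not_implyP[Yy nA]] /existsNP[z /not_implyP[Yz nB]]].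
have [||||x [Yx [nAx nBx]]] := H (~` A) (~` B).
- exact: closed_openC.
- exact: closed_openC.
- by exists y.
- by exists z.
by case: (YAB _ Yx).
Qed.

Lemma irr_closure Y X : Y `<=` X -> irreducible Y -> irreducible (X `&` closure Y).
Proof.
move=> YX [[y Yy] H]; split; first by exists y; split; [exact: YX | exact: subset_closure].
move=> A B cA cB sub; have [|/closure_subset YA|/closure_subset YB] := H A B cA cB.
- by move=> z Yz; apply: sub; split; [exact: YX | exact: subset_closure].
- by left=> z [_ /YA]; rewrite -(closure_id A).1.
- by right=> z [_ /YB]; rewrite -(closure_id B).1.
Qed.

(** The members need not be closed in [X]: their closures form the chain, and the closed sets [C]
    keep these closures distinct. *)
Lemma chain_of X (Z : nat -> set T) d : (forall i, (i <= d)%N -> irreducible (Z i)) ->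
  (forall i, (i < d)%N -> Z i `<=` Z i.+1) -> (forall i, (i <= d)%N -> Z i `<=` X) ->
  (forall i, (i < d)%N -> exists C, [/\ closed C, Z i `<=` C & ~ Z i.+1 `<=` C]) ->
  has_irreducible_chain X d.
Proof.
move=> Zirr Zm ZX Zs; exists (fun i => X `&` closure (Z i)); split=> [i id|i id].
  split; last by apply: irr_closure; [exact: ZX | exact: Zirr].
  by exists (closure (Z i)) => //; exact: closed_closure.
split; first by apply: setIS; apply: closure_subset; exact: Zm.
move=> H; have [C [cC ZC nC]] := Zs i id; apply: nC => z Zz.
have [] : (X `&` closure (Z i)) z by apply: H; split; [exact: (ZX _ id) | exact: subset_closure].
by move=> _ /(closure_subset ZC); rewrite -(closure_id C).1.
Qed.

Lemma irr1 (x : T) : irreducible [set x].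
Proof.
split=> [|A B _ _ sub]; first by exists x.
by case: (sub x erefl) => ?; [left|right] => _ ->.
Qed.

(** The graph of a continuous open map from a part of [X] onto [Y], with irreducible fibres. A
    relation suits the reduction steps, where pairs are given by representatives in the loop
    group. *)
Definition fibration X Y (R : T -> T -> Prop) := [/\
  forall x y, R x y -> X x /\ Y y,
  forall V, open V -> exists2 U, open U & forall x y, R x y -> (U x <-> V y),
  forall U, open U -> exists2 V, open V & forall y, Y y -> V y <-> (exists2 x, R x y & U x) &
  forall y, Y y -> irreducible [set x | R x y]].

Lemma fib_chain X Y R d : fibration X Y R -> has_irreducible_chain Y d ->
  exists Z : nat -> set T, [/\ forall i, (i <= d)%N -> irreducible (Z i),
    forall i, (i < d)%N -> Z i `<=` Z i.+1, forall i, (i <= d)%N -> Z i `<=` X,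
    forall i, (i < d)%N -> exists C, [/\ closed C, Z i `<=` C & ~ Z i.+1 `<=` C] &
    exists2 y, Y y & [set x | R x y] `<=` Z 0%N].
Proof.
move=> [RXY cont opn fib] [Z [ZP Zm]].
have ZY i : (i <= d)%N -> Z i `<=` Y by move=> /ZP[[C cC ->] _] x [].
exists (fun i => [set x | exists2 y, Z i y & R x y]); split.
- move=> i id; have [_ /irrP[[z Zz] H]] := ZP i id; apply/irrP; split.
    by have [[x Rx] _] := fib z (ZY i id z Zz); exists x; exists z.
  move=> U V oU oV [x [[y Zy Rxy] Ux]] [x' [[y' Zy' Rxy'] Vx']].
  have [U' oU' U'P] := opn U oU; have [V' oV' V'P] := opn V oV.
  have Yz v : Z i v -> Y v by exact: ZY.
  have [w [Zw [Uw Vw]]] : Z i `&` (U' `&` V') !=set0.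
    apply: H => //; [exists y; split=> //|exists y'; split=> //].
      by apply/(U'P y (Yz _ Zy)); exists x.
    by apply/(V'P y' (Yz _ Zy')); exists x'.
  have [x1 Rx1 Ux1] := (U'P w (Yz _ Zw)).1 Uw; have [x2 Rx2 Vx2] := (V'P w (Yz _ Zw)).1 Vw.
  have /irrP[_ /(_ U V oU oV)[]] := fib w (Yz _ Zw); try by [exists x1 | exists x2].
  by move=> v [Rv UVv]; exists v; split=> //; exists w.
- by move=> i id x [y Zy Rxy]; exists y => //; have [+ _] := Zm i id; exact.
- by move=> i id x [y Zy /RXY[]].
- move=> i id; have [[C cC ZC] _] := ZP i (ltnW id); have [U oU UP] := cont (~` C) (closed_openC cC).
  exists (~` U); split; first exact: open_closedC.
    by move=> x [y Zy Rxy] /(UP x y Rxy); apply; move: Zy; rewrite ZC => -[].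
  have [_ nsub] := Zm i id => H; apply: nsub => y Zy.
  have Yy := ZY _ id _ Zy; rewrite ZC; split=> //.
  have [[x Rxy] _] := fib y Yy; apply: contrapT => nC.
  by apply: (H x); [exists y | apply/(UP x y Rxy)].
- have [_ [[y Zy] _]] := ZP 0%N (leq0n d); exists y; first exact: ZY Zy.
  by move=> x Rxy; exists y.
Qed.

Lemma chain_fib X Y R d : fibration X Y R -> has_irreducible_chain Y d -> has_irreducible_chain X d.
Proof. by move=> fXY /(fib_chain fXY)[Z [a b c e _]]; exact: (@chain_of X Z). Qed.

(** The preimages of a chain have its length, and a point in the fibre over a point of the smallest
    member adds one term at the bottom, because fibres have more than one point. *)
Lemma chain_fibS X Y R d : fibration X Y R -> (forall x : T, closed [set x]) ->
  (forall y, Y y -> forall x, exists2 x', R x' y & x' <> x) ->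
  has_irreducible_chain Y d -> has_irreducible_chain X d.+1.
Proof.
move=> fXY cl ne /(fib_chain fXY)[Z [a b c e [y Yy yZ]]].
have [_ _ _ fib] := fXY; have [[x0 Rx0] _] := fib y Yy.
apply: (@chain_of X (fun i => if i is j.+1 then Z j else [set x0])).
- by move=> [|i] id; [exact: irr1 | exact: a].
- by move=> [|i] id; [move=> _ ->; exact: yZ | exact: b].
- by move=> [|i] id; [move=> _ ->; apply: (c 0%N) => //; exact: yZ | exact: c].
- move=> [|i] id; last exact: e.
  exists [set x0]; split=> // sub; have [x' Rx' nx] := ne y Yy x0.
  by apply: nx; apply: sub; exact: yZ.
Qed.

End Topology.

Lemma alg_of_isalg (k : fieldType) (S : Type) (A : set (S -> k)) f : isalg A -> alg A f -> A f.
Proof.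
move=> [Ac AD AM] [s]; elim=> [c _|//|_ g h _ ? _ ?|_ _ g h _ ? _ ?]; [exact: Ac | exact: AD | exact: AM].
Qed.

(** * Irreducible families, and open conditions involving roots *)

Section Families.
Variable k : fieldType.
Local Notation L := (laurent k).
Local Notation lg := (lg k).

Definition domA (S : Type) (A : set (S -> k)) := forall f g, A f -> A g ->
  (exists t, f t != 0) -> (exists t, g t != 0) -> exists t, f t != 0 /\ g t != 0.

Lemma lopen_family (S : Type) (A : set (S -> k)) (phi : S -> lg) (O : set lg) :
  isalg A -> regmx A phi -> lopen O ->
  exists2 F : set (S -> k), F `<=` A & forall s, O (phi s) <-> exists2 f, F f & f s != 0.
Proof.
move=> hA H oO; have [N HN] := regmx_pc H; have [F Fr FP] := oO N.
exists [set f \o phi | f in F]; first by move=> _ [f /Fr fa <-]; exact: (alg_regmx hA H).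
move=> s; rewrite (FP _ (HN s)); split=> [[f Ff fs]|[_ [f Ff <-] fs]]; last by exists f.
by exists (f \o phi) => //; exists f.
Qed.

Lemma family_irr (S : Type) (A : set (S -> k)) (phi : S -> lg) (s0 : S) :
  isalg A -> domA A -> regmx A phi -> irreducible [set fl (phi s) | s in setT].
Proof.
move=> hA dA H; apply/irrP; split; first by exists (fl (phi s0)); exists s0.
move=> U V /lopen_open oU /lopen_open oV [_ [[s _ <-] Us]] [_ [[t _ <-] Vt]].
have [F FA FP] := lopen_family hA H oU; have [F' FA' FP'] := lopen_family hA H oV.
have [f Ff fs] := (FP s).1 Us; have [f' Ff' ft] := (FP' t).1 Vt.
have [r [fr f'r]] := dA f f' (FA _ Ff) (FA' _ Ff') (ex_intro _ s fs) (ex_intro _ t ft).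
exists (fl (phi r)); split; first by exists r.
by split; [apply/FP; exists f | apply/FP'; exists f'].
Qed.

End Families.

Section RootSubstitution.
Variable k : closedFieldType.
Local Notation lg := (lg k).
Local Notation n1 := (rp k s1).

Definition locfun (f : lg -> k) := forall N, @locA k N (f \o sval).

Lemma lfun_locfun F n : lfun F -> locfun (fun g => coefL (F g) n).
Proof. by move=> H N; have [_] := H N; apply. Qed.

Lemma lopen_locfun f : locfun f -> lopen [set g | f g != 0].
Proof.
move=> H N; have [f' fa fE] := H N; exists [set f']; first by move=> _ ->.
move=> g gN; have E : f' g = f g by exact: (congr1 (fun F => F (exist _ g gN)) fE).
by split=> [fg|[_ -> ]]; [exists f'; rewrite ?E | rewrite E].
Qed.

Lemma root_mul (c A B x : k) Q i s : (i <= s)%N -> x ^+ Q * A = B ->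
  c ^+ Q * (B ^+ i * A ^+ (s - i)) = A ^+ s * (c * x ^+ i) ^+ Q.
Proof.
move=> ile <-; have -> : A ^+ s = A ^+ i * A ^+ (s - i) by rewrite -exprD subnKC.
by rewrite !exprMn -!exprM (mulnC i Q); ring.
Qed.

(** The parameter [x] is a [Q]-th root of [b / a] and not a regular function of [g]. But for a
    polynomial [f] of degree at most [s] in [x], the product [a ^ s * f ^ Q] is regular in [g], as
    [Q] is a power of the characteristic, and where [a] is nonzero it vanishes exactly where [f]
    does. *)
Lemma lopen_root (a b : lg -> k) Q O : [pchar k].-nat Q -> locfun a -> locfun b -> lopen O ->
  lopen [set g | a g != 0 /\ exists2 x, x ^+ Q * a g = b g & O (g * u x * n1)%g].
Proof.
move=> Qp la lb oO N; have Q0 : (0 < Q)%N by case/andP: Qp.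
have hA := @isalg_loc k N; have [Ac AD AM] := hA.
pose psi (t : @PC k N * k) := (sval t.1 * u t.2 * n1)%g.
have H : regmx (alg (gen_prod (@locA k N))) psi.
  have iA := @alg_isalg _ _ (gen_prod (@locA k N)).
  apply: (regmxM iA _ (regmx_const iA _)); apply: (regmxM iA).
    move=> i j; have [[[m Hm] Hc] [[m' Hm'] Hc']] := @regmx_loc k N i j; split; split.
    - by exists m => -[].
    - by move=> n; apply: alg_gen; left; exists (fun s => coefL (mx (sval s) i j) n).
    - by exists m' => -[].
    - by move=> n; apply: alg_gen; left; exists (fun s => coefL (mx (sval s)^-1%g i j) n).
  by apply: (regmx_u iA); apply: alg_gen; right.
have [F FA FP] := lopen_family alg_isalg H oO.
have key f : alg (gen_prod (@locA k N)) f -> exists G : @PC k N -> k, [/\ @locA k N G,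
    (forall g, a (sval g) = 0 -> G g = 0) &
    forall g x, a (sval g) != 0 -> x ^+ Q * a (sval g) = b (sval g) -> (G g != 0) = (f (g, x) != 0)].
  move=> [s /fil_prod[P [Ps Pc PE]]].
  have PA j : @locA k N (fun t => (P t)`_j) by apply: alg_of_isalg => //; exists s.
  (* The extra factor [a] makes [G] vanish where the root is not defined. *)
  exists (fun g => a (sval g) * \sum_(i < s.+1) (P g)`_i ^+ Q * (b (sval g) ^+ i * a (sval g) ^+ (s - i))).
  split=> [|g ->|g x a0 E]; last 1 first.
  - have -> : \sum_(i < s.+1) (P g)`_i ^+ Q * (b (sval g) ^+ i * a (sval g) ^+ (s - i)) =
        a (sval g) ^+ s * f (g, x) ^+ Q.
      rewrite PE (horner_coef_wide _ (Ps g)) (expq_sum Qp) mulr_sumr; apply: eq_bigr => i _.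
      by apply: root_mul E; rewrite -ltnS.
    by rewrite !mulf_eq0 !expf_eq0 (negPf a0) andbF /= Q0.
  - apply: (AM _ _ (la N)); apply: (isalg_sum hA) => i _.
    exact: (AM _ _ (isalg_exp hA Q (PA i)) (AM _ _ (isalg_exp hA i (lb N)) (isalg_exp hA (s - i)%N (la N)))).
  - by rewrite mul0r.
exists [set G' | alg (@lgen k) G' /\ exists2 f, F f & exists2 G : @PC k N -> k, G' \o sval = G &
   (forall g, a (sval g) = 0 -> G g = 0) /\
   forall g x, a (sval g) != 0 -> x ^+ Q * a (sval g) = b (sval g) -> (G g != 0) = (f (g, x) != 0)].
  by move=> G' [].
move=> g gN; pose g' : @PC k N := exist _ g gN.
split=> [[a0 [x xE Ox]]|[G' [_ [f Ff [G GE [G0 GP]]]] Gg]].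
  have [f Ff fgx] := (FP (g', x)).1 Ox; have [G [[G' aG' GE] G0 GP]] := key f (FA _ Ff).
  exists G'; first by split=> //; exists f => //; exists G.
  by rewrite -[G' g]/((G' \o sval) g') GE (GP g' x).
have GE' : G g' = G' g by rewrite -GE.
have a0 : a g != 0 by apply: contraNneq Gg => ag; rewrite -GE' G0.
split=> //; have [r rP] := @root_ex k Q Q0; exists (r (b g / a g)); first by rewrite rP divfK.
by apply/(FP (g', r (b g / a g))); exists f => //; rewrite -(GP g') ?GE' ?rP ?divfK.
Qed.

End RootSubstitution.

(** * The Bruhat decomposition *)

Lemma lup_ex (F : fieldType) n (A : 'M[F]_n.+1) : exists (s : 'S_n.+1) (l r : 'M[F]_n.+1),
  [/\ perm_mx s *m A = l *m r, forall i j : 'I_n.+1, (i <= j)%N -> l i j = (i == j)%:R &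
   forall i j : 'I_n.+1, (j < i)%N -> r i j = 0].
Proof.
have := cormen_lup_correct A; have := cormen_lup_perm A.
have := @cormen_lup_lower F n A; have := @cormen_lup_upper F n A.
case: (cormen_lup A) => -[Pm Lm] Um /= Uup Llow /is_perm_mxP[s Ps] E; exists s, Lm, Um.
by split=> //; rewrite -Ps; exact: E.
Qed.

Section Bruhat.
Variable k : fieldType.
Local Notation L := (laurent k).
Local Notation eps := (eps k).
Local Notation lg := (lg k).
Local Notation rp := (@rp k).
Local Notation sc := (@sc k).
Local Notation bary := (@barycentric int).

Lemma fpos_s1 w j : fpos (w * s1)%g j = fpos w (tperm 0 1 j).
Proof.
rewrite /fpos; have -> : tr (w * s1)%g = tr w by rewrite -[LHS]/(tr w + wact (lin w) 0) wact0 addr0.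
have -> // : ((lin (w * s1)%g)^-1 j)%g = ((lin w)^-1 (tperm 0%R 1%R j))%g.
by rewrite -[lin (w * s1)%g]/(lin w * tperm 0%R 1%R)%g invMg permM tpermV.
Qed.

Lemma fpos_inj w : injective (fpos w).
Proof.
move=> i j; rewrite /fpos; set a := ((lin w)^-1)%g i; set b := ((lin w)^-1)%g j => E.
apply: (@perm_inj _ ((lin w)^-1)%g); apply: val_inj => /=; rewrite -/a -/b.
by have := ltn_ord a; have := ltn_ord b; lia.
Qed.

Lemma rasc_s1 w : rasc w || rasc (w * s1)%g.
Proof.
rewrite /rasc !fpos_s1 tpermL tpermR.
by case: ltgtP => // /fpos_inj.
Qed.

Lemma rasc_s1N w : rasc (w * s1)%g = ~~ rasc w.
Proof.
rewrite /rasc !fpos_s1 tpermL tpermR.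
by case: ltgtP => // /fpos_inj.
Qed.

(** Right multiplications that preserve the union of all double cosets. They include [Iw], the Weyl
    elements by [D_up] and [D_down], and triangular matrices; a factorisation into triangular and
    permutation matrices then gives every [g]. *)
Let St (x : lg) := forall g v, D v g -> exists v', D v' (g * x)%g.

Let StM x y : St x -> St y -> St (x * y)%g.
Proof. by move=> Sx Sy g v /Sx[v1 /Sy[v2]]; rewrite mulgA; exists v2. Qed.

Let St_Iw x : Iw x -> St x.
Proof. by move=> xI g v gv; exists v; exact: D_mulr. Qed.

Let Stw_M v w : St (rp v) -> St (rp w) -> St (rp (v * w)%g).
Proof.
move=> Sv Sw; have [n ->] := rpM k v w.
by apply: StM; [exact/St_Iw/Iw_sc | exact: StM].
Qed.

Let Stw_s1 : St (rp s1).
Proof.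
move=> g v gv; rewrite -[g]mulg1 -(u0 k).
case/orP: (rasc_s1 v) => va; first by exists (v * s1)%g; exact: D_up.
by case: (D_down 0 va gv); eexists; eauto.
Qed.

Let Stw_tau : St (rp tau).
Proof. by move=> g v gv; exists (v * tau)%g; exact: D_mulP. Qed.

Let Stw_tauV : St (rp tau^-1%g).
Proof.
have [n ->] := rpV k tau; apply: StM; first exact/St_Iw/Iw_sc.
by move=> g v gv; exists (v * tau^-1)%g; exact: D_mulPV.
Qed.

Let Stw w : St (rp w).
Proof.
have [n /existsP[us /existsP[j /eqP ->]]] := expressible_ex w.
apply: Stw_M; last first.
  elim: (nat_of_ord j) => [|m IH]; first by rewrite expg0 rp1; exact/St_Iw/Iw1.
  by rewrite expgS; apply: Stw_M.
elim: (tval us) => [|i r IH]; first by rewrite /word big_nil rp1; exact/St_Iw/Iw1.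
rewrite /word big_cons; apply: Stw_M IH.
have E0 : s0 = (tau^-1 * s1 * tau)%g by rewrite -mulgA -tau_s0 mulKg.
have E2 : s2 = (tau * s1 * tau^-1)%g by rewrite tau_s1 mulgK.
elim/ord3P: i; rewrite /simple_refl /=.
- rewrite E0; exact: (Stw_M (Stw_M Stw_tauV Stw_s1) Stw_tau).
- exact: Stw_s1.
- rewrite E2; exact: (Stw_M (Stw_M Stw_tau Stw_s1) Stw_tauV).
Qed.

Let StwV w : St (rp w)^-1%g.
Proof.
have [n E] := rpV k w; rewrite (_ : (rp w)^-1%g = (sc (- n) * rp w^-1)%g).
  by apply: StM; [exact/St_Iw/Iw_sc | exact: Stw].
by rewrite E mulgA -scD addNr sc0 mul1g.
Qed.

Let St_low1 (g : lg) : (forall i j : 'I_3, (i < j)%N -> mx g i j = 0) ->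
  (forall i, hasval 0 (mx g i i)) -> St g.
Proof.
move=> gt gd; have [N gN] := pc_ex g.
(* Conjugation by this translation multiplies the entries below the diagonal by at least [eps^N], so
   that they become integral. *)
pose w := IW (- N%:Z, - N%:Z) 1%g; have gI : Ig (rp w * g * (rp w)^-1)%g.
  apply: conj_rp_Ig => [i j|i]; last by case: (gd i).
  rewrite perm1 perm1; have [ij|ji|/val_inj ->] := ltngtP i j.
  - by rewrite gt // => n _; rewrite coefL0.
  - apply: inO_le (gN i j).1; move: i j ji; apply: ord3_case => //= _.
    + by rewrite /barycentric /=; lia.
    + by rewrite /barycentric /=; lia.
    + by rewrite /barycentric /=; lia.
  - by rewrite add0r subrr; case: (gd j).
have -> : g = ((rp w)^-1 * (rp w * g * (rp w)^-1) * rp w)%g by rewrite !mulgA mulVg mul1g mulgKV.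
apply: StM; last exact: Stw.
by apply: StM; [exact: StwV | exact/St_Iw/Ig_Iw].
Qed.

Let St_low (g : lg) : (forall i j : 'I_3, (i < j)%N -> mx g i j = 0) ->
  (forall i, exists n, hasval n (mx g i i)) -> St g.
Proof.
move=> gt gd; have /choice[n nP] := gd.
pose w := IW (- (n 0 - n 1), - (n 1 - n 2%:R)) 1%g.
have E i j : mx (sc (- n 2%:R) * (rp w * g))%g i j = eps ^ (- n i) * mx g i j.
  rewrite mx_scM rp_mull perm1 mulrA -expfzDr ?eps_neq0 //; congr (_ ^ _ * _).
  by move: i {j}; apply: ord3P; rewrite /barycentric /=; lia.
have -> : g = ((rp w)^-1 * (sc (n 2%:R)%R * (sc (- n 2%:R)%R * (rp w * g))))%g.
  by rewrite (mulgA (sc _)) -scD subrr sc0 mul1g mulKg.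
apply: StM; first exact: StwV.
apply: StM; first exact/St_Iw/Iw_sc.
apply: St_low1 => [i j ij|i]; rewrite E; first by rewrite gt ?mulr0.
by have := hasval_mul (hasval_eps k (- n i)) (nP i); rewrite addNr.
Qed.

Let St_up (g : lg) : (forall i j : 'I_3, (j < i)%N -> mx g i j = 0) ->
  (forall i, exists n, hasval n (mx g i i)) -> St g.
Proof.
move=> gt gd; pose w := IW 0 rho.
have -> : g = ((rp w)^-1 * (rp w * g * (rp w)^-1) * rp w)%g by rewrite !mulgA mulVg mul1g mulgKV.
apply: StM; last exact: Stw.
apply: StM; first exact: StwV.
have cE i j : mx (rp w * g * (rp w)^-1)%g i j = mx g (rev_ord i) (rev_ord j).
  by rewrite conj_rpE !bary0 subrr expr0z mul1r !permE.
apply: St_low => [i j ij|i]; rewrite cE //.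
by apply: gt; rewrite /=; have := ltn_ord j; lia.
Qed.

Lemma bruhat (g : lg) : exists v, D v g.
Proof.
suff H : St g by have [|v] := H 1%g 1%g; [apply/D1; exact: Iw1 | rewrite mul1g; exists v].
have [s [Lm [Um [E Llow Uup]]]] := lup_ex (mx g).
have Lu : Lm \in unitmx.
  rewrite unitmxE det_trig; last by apply/is_trig_mxP => i j ij; rewrite Llow // ?(ltnW ij) // -val_eqE ltn_eqF.
  by rewrite big1 ?unitr1 // => i _; rewrite Llow // eqxx.
have [l lE] := lg_of Lu.
pose p := rp (IW 0 s).
have pE : mx p = perm_mx s.
  rewrite mx_rp /rep /= (_ : diag_mx _ = 1%:M) ?mul1mx //.
  by apply/matrixP => i j; rewrite !mxE bary0 expr0z.
have UE : mx (l^-1 * (p * g))%g = Um.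
  by rewrite !mxM pE E lE mulmxA -mxM mulVg mx1 mul1mx.
have -> : g = (p^-1 * (l * (l^-1 * (p * g))))%g by rewrite mulKVg mulKg.
apply: StM; first exact: StwV.
apply: StM.
  apply: St_low => [i j ij|i]; rewrite -lE Llow ?(ltnW ij) // -?val_eqE ?(ltn_eqF ij) // eqxx.
  by exists 0; exact: hasval1.
move: (l^-1 * (p * g))%g UE => x xE; apply: St_up => [i j ji|i]; first by rewrite xE Uup.
have [n xn] := dv_ex x; apply: hasval_ex; apply/negP => /eqP x0.
have : \det (mx x) = 0.
  rewrite -det_tr det_trig; last by apply/is_trig_mxP => a b ab; rewrite mxE xE Uup.
  by rewrite (bigD1 i) //= mxE x0 mul0r.
by move=> d0; case: xn => _; rewrite d0 coefL0 eqxx.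
Qed.

End Bruhat.

(** * Independent functions on affine space and on the Iwahori subgroup *)

Section Coordinates.
Variable k : closedFieldType.

Definition coords n : set (('I_n -> k) -> k) := [set (fun y => y i) | i in [set: 'I_n]].

Lemma indge_gen_prod (T : Type) (G : set (T -> k)) r s m :
  indge setT (fil G r) m -> indge setT (fil (gen_prod G) (r + s)) (m * s.+1).
Proof.
move=> [b [bW bi]].
have -> : (m * s.+1)%N = #|{: 'I_m * 'I_s.+1}| by rewrite card_prod !card_ord.
apply: (@indge_fin _ _ _ _ _ (fun (ij : 'I_m * 'I_s.+1) (t : T * k) => b ij.1 t.1 * t.2 ^+ ij.2)) => [[i j]|a aP [i j]] /=.
  apply: fil_mul.
    have := @fil_comp k T _ fst G (gen_prod G) 1 r (b i); rewrite muln1; apply => // c Gc.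
    by apply: fil_gen; left; exists c.
  apply: fil_le (fil_exp j (fil_gen 0 _)); first by rewrite muln1 -ltnS.
  by right.
pose P t : {poly k} := \poly_(j < s.+1) (\sum_i a (i, inord j) * b i t).
have P0 t : P t = 0.
  apply/eqP/negPn/negP => /closed_nonrootP[x]; rewrite rootE horner_poly.
  have E : \sum_i \sum_(j < s.+1) a (i, j) * (b i t * x ^+ j) = 0.
    by rewrite pair_bigA -[RHS](aP (t, x) I); apply: eq_bigr => -[].
  move/negP; apply; apply/eqP; rewrite -[RHS]E exchange_big /=.
  apply: eq_bigr => j' _; rewrite mulr_suml; apply: eq_bigr => i' _.
  by rewrite inord_val mulrA.
apply: (bi (fun i => a (i, j))) => t _.
have := congr1 (fun p : {poly k} => p`_j) (P0 t); rewrite coef_poly ltn_ord coef0 => E; rewrite -[RHS]E.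
by apply: eq_bigr => i' _; rewrite inord_val.
Qed.

Lemma indge_pull (T T' : Type) (G : set (T -> k)) (G' : set (T' -> k)) (phi : T' -> T) s m :
  (forall t, exists t', phi t' = t) -> (forall c, G c -> G' (c \o phi)) ->
  indge setT (fil G s) m -> indge setT (fil G' s) m.
Proof.
move=> sur HG [b [bW bi]]; exists (fun i => b i \o phi); split=> [i|a aP].
  have := @fil_comp k T T' phi G G' 1 s (b i); rewrite muln1; apply => // c Gc.
  by apply: fil_gen; exact: HG.
by apply: bi => t _; have [t' <-] := sur t; exact: aP.
Qed.

Lemma coords_dom_indge n : dom (@coords n) /\ forall s, indge setT (fil (@coords n) (n * s)) (s.+1 ^ n).
Proof.
elim: n => [|n [dn In]].
  have u0 (t t' : 'I_0 -> k) : t = t' by apply: funext => -[].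
  split=> [|s]; first exact: dom_unit.
  exists (fun _ _ => 1); split=> [i|a /(_ (fun=> 0) I)]; first exact: fil_const.
  by rewrite big_ord_recl big_ord0 mulr1 addr0 => a0 i; rewrite ord1.
pose phi (y : 'I_n.+1 -> k) := ((fun j => y (lift ord0 j)), y ord0).
have sur t : exists y, phi y = t.
  exists (fun i => if unlift ord0 i is Some j then t.1 j else t.2).
  case: t => t x; rewrite /phi unlift_none; congr (_, _); apply: funext => j /=.
  by rewrite liftK.
split=> [|s].
  apply: (@dom_open _ _ _ _ _ phi (fun=> 1) (dom_prod dn)) => [|t|t _|c [i _ <-]].
  - exact: alg_const.
  - exact: oner_neq0.
  - exact: sur.
  - case: (unliftP ord0 i) => [j ->|->]; last by exists snd => //; apply: alg_gen; right.
    by exists (fun t => t.1 j) => //; apply: alg_gen; left; exists (fun y => y j) => //; exists j.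
rewrite expnSr mulSn addnC; apply: (@indge_pull _ _ (gen_prod (@coords n)) _ phi) => //.
  by move=> c [[_ [i _ <-] <-]|->]; [exists (lift ord0 i) | exists ord0].
exact: indge_gen_prod.
Qed.

Lemma spanle_big (T : Type) (I : finType) (Z : I -> set T) (W : set (T -> k)) (n : I -> nat) :
  (forall i, spanle (Z i) W (n i)) -> spanle [set t | exists i, Z i t] W (\sum_i n i).
Proof.
move=> H; apply: (@spanle_sub k T _ [set t | exists2 i, i \in index_enum I & Z i t] W W) => //.
  by move=> t [i Zi]; exists i => //; rewrite mem_index_enum.
elim: (index_enum I) => [|i r IH].
  by rewrite big_nil; apply: (@spanle_sub k T _ set0 W W) (spanle0 W 0) => // t [].
rewrite big_cons; apply: spanle_sub (spanleU (H i) IH) => // t [j].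
by rewrite inE => /orP[/eqP -> Zj|jr Zj]; [left | right; exists j].
Qed.

(** All rows lie in the span of at most [C] functions, so at most [C] of them span the rest. The
    choice is recorded in a finite type, padded by [None], so that a family later splits into
    finitely many parts with a uniform choice. *)
Lemma steinitz (X : Type) (R P : finType) (r : R -> X -> k) (c : R -> P -> k) (B : P -> X -> k) C :
  (#|P| <= C)%N -> (forall p x, r p x = \sum_i c p i * B i x) ->
  exists f : {ffun 'I_C -> option R}, forall p, exists z : 'I_C -> k,
    forall x, r p x = \sum_j z j * (if f j is Some p' then r p' x else 0).
Proof.
move=> PC rE.
have sp : spanle setT (range r) #|P|.
  by apply: spanle_fin => _ [p _ <-]; exists (c p) => x _; exact: rE.
pose ind m (f : 'I_m -> R) := forall a : 'I_m -> k, (forall x, \sum_i a i * r (f i) x = 0) -> forall i, a i = 0.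
have ex0 : exists m, `[< exists f : 'I_m -> R, ind m f >].
  exists 0%N; apply/asboolP; have f0 : 'I_0 -> R by case.
  by exists f0 => a _ [].
have ub m : `[< exists f : 'I_m -> R, ind m f >] -> (m <= #|P|)%N.
  move=> /asboolP[f fi]; apply: (indge_spanle (W := range r) _ sp).
  exists (fun i => r (f i)); split=> [i|a aP]; first by exists (f i).
  by apply: fi => x; exact: aP.
have [m /asboolP[f fi] mmax] := ex_maxnP ex0 ub.
have mC : (m <= C)%N by apply: leq_trans PC; apply: ub; apply/asboolP; exists f.
exists [ffun j : 'I_C => omap f (insub (j : nat))] => p.
suff [z zP] : exists z : 'I_m -> k, forall x, r p x = \sum_i z i * r (f i) x.
  exists (fun j => if insub (j : nat) is Some i then z i else 0) => x.
  rewrite zP [RHS](bigID (fun j : 'I_C => (j < m)%N)) /= [X in _ + X]big1 ?addr0 => [|j jm]; last first.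
    by rewrite ffunE; case: insubP => [? ij|_] /=; [rewrite ij in jm | rewrite mul0r].
  by rewrite (big_ord_narrow mC) /=; apply: eq_bigr => j _; rewrite ffunE /= valK.
apply: contrapT => no.
have /(mmax m.+1) : `[< exists f : 'I_m.+1 -> R, ind m.+1 f >]; last by rewrite ltnn.
apply/asboolP; exists (fun i => if unlift ord0 i is Some j then f j else p) => a aP.
have {}aP x : a ord0 * r p x + \sum_i a (lift ord0 i) * r (f i) x = 0.
  have := aP x; rewrite big_ord_recl unlift_none => E; rewrite -[RHS]E; congr (_ + _).
  by apply: eq_bigr => i _; rewrite liftK.
have a0 : a ord0 = 0.
  apply/eqP/negPn/negP => a0; apply: no; exists (fun i => - (a ord0)^-1 * a (lift ord0 i)) => x.
  apply: (mulfI a0); rewrite -[LHS]addr0 mulr_sumr (eq_bigr (fun i => - (a (lift ord0 i) * r (f i) x))).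
    by rewrite sumrN addr0; apply/eqP; rewrite -subr_eq0 opprK aP.
  by move=> i _; rewrite -!mulrA mulNr mulrN mulVKf.
move=> i; case: (unliftP ord0 i) => [j ->|-> //].
apply: (fi (fun i => a (lift ord0 i))) => x; have := aP x.
by rewrite a0 mul0r add0r.
Qed.

End Coordinates.

Section Growth.
Variable k : closedFieldType.
Local Notation L := (laurent k).
Local Notation eps := (eps k).
Local Notation lg := (lg k).
Local Notation rp := (@rp k).
Local Notation sc := (@sc k).
Local Notation bary := (@barycentric int).

(* The coefficients of order less than [M]; on [Ig] there are [9 M - 3] free ones. *)
Definition gc (M : nat) : set (lg -> k) := [set f | exists i j n,
  n < M%:Z /\ f = (fun g => coefL (mx g i j) n)].

(** Positions of matrix coefficients whose order runs from [thr i j] up to [M], counted from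
    [thr i j]. *)
Definition pos (M : int) (thr : 'I_3 -> 'I_3 -> int) :=
  {ij : 'I_3 * 'I_3 & 'I_(absz (M - thr ij.1 ij.2))}.

Lemma card_pos M thr : (forall i j, thr i j <= M) ->
  (#|{: pos M thr}|)%:Z = \sum_i \sum_j (M - thr i j).
Proof.
move=> H; rewrite card_tagged sumnE big_map big_enum /=.
rewrite (eq_bigr (fun ij : 'I_3 * 'I_3 => absz (M - thr ij.1 ij.2))); last by move=> ij _; rewrite card_ord.
rewrite pair_bigA /= (big_morph Posz PoszD (erefl _)); apply: eq_bigr => ij _.
by rewrite gez0_abs // subr_ge0.
Qed.

(** The 3 counts the pairs with [s i < j], which is the same for every permutation. Hence all cosets
    of [Ig] of determinant valuation 0 have the same number of free truncated coefficients. *)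
Lemma thr_sum (A : 'I_3 -> int) (s : 'S_3) (M : int) :
  \sum_i \sum_(j < 3) (M - (A i + (s i < j)%N%:Z)) = 9 * M - 3 - 3 * \sum_i A i.
Proof.
have E : \sum_(i < 3) \sum_(j < 3) ((s i < j)%N%:Z) = 3 :> int.
  by rewrite (reindex_inj (@perm_inj _ s^-1%g)) /= !big_ord_recl !big_ord0 !permKV.
have -> : \sum_i \sum_(j < 3) (M - (A i + (s i < j)%N%:Z)) =
    \sum_(i < 3) (3 * M - 3 * A i) - \sum_(i < 3) \sum_(j < 3) (s i < j)%N%:Z.
  rewrite -sumrB; apply: eq_bigr => i _; rewrite !big_ord_recl !big_ord0; lia.
by rewrite E !big_ord_recl !big_ord0; lia.
Qed.

Lemma coefLMz (a : int) (B : nat) (x y : L) n : inO a x -> inO 0 y -> n < a + B%:Z ->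
  coefL (x * y) n = \sum_(i < B) coefL x (a + i%:Z) * coefL y (n - a - i%:Z).
Proof.
move=> xa y0 nB; have e0 : eps ^ a != 0 by rewrite expfz_neq0 ?eps_neq0.
have xE : x = eps ^ a * (eps ^ (- a) * x) by rewrite mulrA -expfzDr ?eps_neq0 // subrr expr0z mul1r.
rewrite {1}xE -mulrA coefL_epsz (@coefLM _ 0 B).
- apply: eq_bigr => i _; rewrite coefL_epsz; congr (coefL _ _ * coefL _ _); lia.
- by have := (inO_eps a (- a) x).2 xa; rewrite subrr oppr0.
- by apply: inO_le y0; lia.
Qed.

Lemma Iw_ex (x : 'M[L]_3) : iwahoriGL x -> exists2 g : lg, Ig g & x = mx g.
Proof.
by move=> xI; have [g E] := lg_of (iwahoriGL_unit xI); exists g => //; rewrite /Ig -E.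
Qed.

Definition thr0 (i j : 'I_3) : int := (i < j)%N%:Z.

Lemma card_pos0 (M : nat) : (0 < M)%N -> (#|{: pos M thr0}|)%:Z = 9 * M%:Z - 3.
Proof.
move=> M0; rewrite card_pos => [|i j]; last by rewrite /thr0; case: (i < j)%N; lia.
have E0 : \sum_(i < 3) (0 : int) = 0 by rewrite big1.
have := thr_sum (fun=> 0) 1%g M%:Z; rewrite E0 mulr0 subr0 => <-.
by apply: eq_bigr => i _; apply: eq_bigr => j _; rewrite perm1 add0r.
Qed.

(** The free coefficients take on [Ig] all values with nonzero residues on the diagonal. This is a
    nonempty open part of affine space, so a polynomial that vanishes there vanishes identically. *)
Lemma indge_Ig (M : nat) : (0 < M)%N ->
  forall s, indge [set g : lg | Ig g] (fil (gc M) (#|{: pos M thr0}| * s)) (s.+1 ^ #|{: pos M thr0}|).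
Proof.
move=> M0 s; set P := pos M thr0; set n := #|{: P}|.
have [dn In] := @coords_dom_indge k n; have [b [bW bi]] := In s.
have pl (p : P) : thr0 (tag p).1 (tag p).2 + (tagged p)%:Z < M%:Z.
  case: p => -[i j] /= l; have := ltn_ord l; rewrite /= /thr0; lia.
pose crd (p : P) (g : lg) := coefL (mx g (tag p).1 (tag p).2) (thr0 (tag p).1 (tag p).2 + (tagged p)%:Z).
pose vec (g : lg) := fun i : 'I_n => crd (enum_val i) g.
exists (fun i => b i \o vec); split=> [i|a aP].
  have := @fil_comp k _ _ vec (@coords k n) (gc M) 1 (n * s) (b i); rewrite muln1; apply => // c [j _ <-].
  apply: fil_gen; exists (tag (enum_val j)).1, (tag (enum_val j)).2, (thr0 (tag (enum_val j)).1 (tag (enum_val j)).2 + (tagged (enum_val j))%:Z).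
  by split; first exact: pl.
pose y2m (y : 'I_n -> k) : 'M[L]_3 := \matrix_(i, j) \sum_(p : P | tag p == (i, j))
   constL (y (enum_rank p)) * eps ^ (thr0 i j + (tagged p)%:Z).
have cE y (p : P) : coefL (y2m y (tag p).1 (tag p).2) (thr0 (tag p).1 (tag p).2 + (tagged p)%:Z) = y (enum_rank p).
  rewrite mxE coefL_sum (bigD1 p) /=; last by case: (tag p).
  rewrite coefL_constM coefL_epsp eqxx mulr1 big1 ?addr0 // => p' /andP[/eqP tp pp'].
  rewrite coefL_constM coefL_epsp; case: eqP => [/addrI[E]|]; last by rewrite mulr0.
  case/eqP: pp'; case: p p' tp E => [[i j] l] [[i' j'] l'] /= [? ?]; subst i' j' => E.
  by congr existT; apply: val_inj.
have yO y i j : inO (thr0 i j) (y2m y i j).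
  rewrite mxE; apply: inO_sum => p _; rewrite -[thr0 i j]add0r; apply: inO_mul; first exact: inO_const.
  by apply: inO_le (@inO_epsp k _); rewrite add0r; lia.
have dl i : (0 < absz (M%:Z - thr0 i i))%N by rewrite /thr0 ltnn subr0.
pose dp i : P := existT _ (i, i) (Ordinal (dl i)).
pose pr (y : 'I_n -> k) := \prod_(i : 'I_3) y (enum_rank (dp i)).
have pra : alg (@coords k n) pr.
  have H : forall r : seq 'I_3, alg (@coords k n) (fun y => \prod_(i <- r) y (enum_rank (dp i))).
    elim=> [|i r IH]; first by apply: alg_ext (alg_const _ 1) => y; rewrite big_nil.
    apply: (@alg_ext _ _ _ (fun y => y (enum_rank (dp i)) * \prod_(i <- r) y (enum_rank (dp i)))) => [y|].
      by rewrite big_cons.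
    by apply: alg_mul => //; apply: alg_gen; exists (enum_rank (dp i)).
  exact: H.
apply: (bi a) => y _; apply: contrapT => /eqP y0.
have [||z [prz]] := dn pr (fun y => \sum_i a i * b i y) pra _ _ (ex_intro _ y y0).
- by exists (n * s)%N; apply: fil_sum => i _; apply: fil_scale.
- by exists (fun=> 1); rewrite /pr big1 ?oner_eq0.
move/negP; apply.
have [|g gI gE] := @Iw_ex (y2m z).
  apply: iwahoriGLP => [i j|i]; first exact: yO.
  have := cE z (dp i); rewrite /= {1}/thr0 ltnn => ->.
  by move: prz; rewrite prodf_seq_neq0 => /allP/(_ i); rewrite mem_index_enum => /(_ isT).
apply/eqP; rewrite -[RHS](aP g gI); apply: eq_bigr => i _; congr (_ * b i _).
by apply: funext => j; rewrite /= /vec /crd -gE cE enum_valK.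
Qed.

End Growth.

(** * Bounds on the length of chains *)

Lemma mul5AC (F : comRingType) (x y z t u : F) : x * (y * (z * t)) * u = x * z * t * u * y.
Proof. by ring. Qed.

Section UpperGrowth.
Variable k : closedFieldType.
Local Notation L := (laurent k).
Local Notation eps := (eps k).
Local Notation lg := (lg k).
Local Notation rp := (@rp k).
Local Notation sc := (@sc k).
Local Notation bary := (@barycentric int).
Variables M N : nat.
Hypothesis NM : (N < M)%N.
Let C := #|{: pos M thr0}|.

Local Notation R := ('I_3 * 'I_3 * 'I_(M + N))%type.
Let okr (p : R) := ((p.1.1 < p.1.2)%N <= p.2)%N.

(* The truncated coefficients of [g] times the matrix unit indexed by [p]. *)
Let row (g : lg) (p : R) (x : 'I_3 * 'I_3 * int) : k :=
  if [&& okr p, p.1.2 == x.1.2 & x.2 < M%:Z] then coefL (mx g x.1.1 p.1.1) (x.2 - p.2%:Z) else 0.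

Let expand (g x : lg) i j n : pc N g -> Ig x -> n < M%:Z ->
  coefL (mx (g * x)%g i j) n =
  \sum_(p : R) coefL (mx x p.1.1 p.1.2) p.2%:Z * row g p (i, j, n).
Proof.
move=> gN xI nM; rewrite mxME coefL_sum.
have E a : coefL (mx g i a * mx x a j) n =
    \sum_(l < M + N) coefL (mx x a j) l%:Z * coefL (mx g i a) (n - l%:Z).
  rewrite mulrC (@coefLM _ 0 (M + N)%N).
  - by apply: eq_bigr => l _; rewrite subr0 addr0.
  - by rewrite oppr0; apply: inO_le (iwahoriGL_inO xI).
  - by apply: inO_le (gN i a).1; lia.
under eq_bigr => a _ do rewrite E.
rewrite -(pair_bigA _ (fun (ab : 'I_3 * 'I_3) (l : 'I_(M + N)) =>
  coefL (mx x ab.1 ab.2) l%:Z * row g (ab, l) (i, j, n))) /=.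
rewrite -(pair_bigA _ (fun a b : 'I_3 => \sum_(l < M + N)
  coefL (mx x a b) l%:Z * row g ((a, b), l) (i, j, n))) /=.
apply: eq_bigr => a _; rewrite (bigD1 j) //= [X in _ + X]big1 ?addr0 => [|b bj]; last first.
  by apply: big1 => l _; rewrite /row /= (negPf bj) andbF mulr0.
apply: eq_bigr => l _; rewrite /row /okr /= eqxx nM andbT.
case: ifP => // nok; rewrite (iwahoriGL_inO xI) ?mul0r ?mulr0 //.
by move: nok; lia.
Qed.

(** Decompose [g = eps^e i v j]. The factor [j] preserves the span of the matrix units allowed in
    [Ig], [v] moves their orders to the thresholds [thr], and [i] acts linearly. So the rows need
    one dimension for each element of [pos M thr], and there are [C] of these because the exponents
    [A] sum to the determinant valuation 0. *)
Let rank_bound (g : lg) : pc N g -> dv 0 g ->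
  exists (P : finType) (c : R -> P -> k) (B : P -> 'I_3 * 'I_3 * int -> k),
  (#|P| <= C)%N /\ forall p x, row g p x = \sum_q c p q * B q x.
Proof.
move=> gN g0; have [v /D_Ig[e [i [j [iI jI E]]]]] := bruhat g.
have sA : e * 3 + wdeg v = 0 by apply: dv_inj g0; rewrite E; exact: dv_D.
pose A (a : 'I_3) : int := e + bary (tr v) a.
(* The poles of [g^-1] bound the exponents by [N], and [N < M] keeps all thresholds below the
   truncation order. *)
have AN a : A a <= N%:Z.
  have H : mx (sc (- e) * (rp v)^-1)%g = mx j *m mx g^-1%g *m mx i.
    rewrite -!mxM E !invMg !mulgA mulgV mul1g -scN -(mulgA _ (sc _) i) (scC (- e) i) mulgA mulgKV.
    by rewrite scC.
  have : inO (- N%:Z) (mx (sc (- e) * (rp v)^-1)%g (lin v a) a).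
    rewrite H mxE; apply: inO_sum => b _; rewrite -[X in inO X]addr0.
    apply: inO_mul; last by apply: inO_le (iwahoriGL_inO iI).
    rewrite mxE; apply: inO_sum => l _; rewrite -[X in inO X]add0r.
    by apply: inO_mul; [apply: inO_le (iwahoriGL_inO jI) | case: (gN l b)].
  rewrite mx_scM rpVE eqxx -expfzDr ?eps_neq0 // -opprD -/(A a).
  move=> /(_ (- A a)); rewrite coefL_epsp eqxx leNgt => H'.
  by apply/negP => AN; have /eqP := H' ltac:(lia); rewrite oner_eq0.
pose thr (a b : 'I_3) : int := A a + (lin v a < b)%N%:Z.
have thrM a b : thr a b <= M%:Z.
  by have := AN a; rewrite /thr; case: (_ < b)%N; lia.
pose P : finType := pos M thr.
pose W (p : R) (a b : 'I_3) : L :=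
  if okr p && (p.1.2 == b) then eps ^ A a * mx j (lin v a) p.1.1 * eps ^ p.2%:Z else 0.
have WO p a b : inO (thr a b) (W p a b).
  rewrite /W; case: ifP => [/andP[op /eqP pb]|_]; last by move=> n _; rewrite coefL0.
  have := inO_mul (inO_mul (@inO_epsp k (A a)) (iwahoriGL_inO (i := lin v a) (j := p.1.1) jI)) (@inO_epsp k p.2%:Z).
  apply: inO_le; rewrite /thr -pb; move: op; rewrite /okr; move: (A a) => Aa.
  case: (ltnP (lin v a) p.1.2) => // h1; case: (ltnP (lin v a) p.1.1) => h2; case: (ltnP p.1.1 p.1.2) => h3; lia.
exists P, (fun (p : R) (q : P) => coefL (W p (tag q).1 (tag q).2) (thr (tag q).1 (tag q).2 + (tagged q)%:Z)).
exists (fun (q : P) x => if ((tag q).2 == x.1.2) && (x.2 < M%:Z)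
   then coefL (mx i x.1.1 (tag q).1) (x.2 - thr (tag q).1 (tag q).2 - (tagged q)%:Z) else 0).
split.
  suff -> : #|P| = C by [].
  apply/eqP; rewrite -eqz_nat; apply/eqP; rewrite card_pos // card_pos0; last by lia.
  rewrite (thr_sum A (lin v)); rewrite (_ : \sum_a A a = 0) ?mulr0 ?subr0 //.
  by rewrite big_split /= sumr_const card_ord -/(wdeg v) -sA; lia.
move=> p [[a b] n]; rewrite /row /=.
pose F (a' b' : 'I_3) (l : 'I_(absz (M%:Z - thr a' b'))) :=
  coefL (W p a' b') (thr a' b' + l%:Z) *
  (if (b' == b) && (n < M%:Z) then coefL (mx i a a') (n - thr a' b' - l%:Z) else 0).
have -> : \sum_(q : P) coefL (W p (tag q).1 (tag q).2) (thr (tag q).1 (tag q).2 + (tagged q)%:Z) *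
   (if ((tag q).2 == b) && (n < M%:Z)
   then coefL (mx i a (tag q).1) (n - thr (tag q).1 (tag q).2 - (tagged q)%:Z) else 0) =
   \sum_(ab : 'I_3 * 'I_3) \sum_(l < absz (M%:Z - thr ab.1 ab.2)) F ab.1 ab.2 l.
  by rewrite (sig_big_dep xpredT (fun _ => xpredT) (fun (ab : 'I_3 * 'I_3) (l : 'I_(absz (M%:Z - thr ab.1 ab.2))) => F ab.1 ab.2 l)).
rewrite -(pair_bigA _ (fun a' b' => \sum_(l < absz (M%:Z - thr a' b')) F a' b' l)) /=.
under eq_bigr => a' _.
  rewrite (bigD1 b) //= [X in _ + X]big1 ?addr0 => [|b' b'b]; last first.
    by apply: big1 => l _; rewrite /F (negPf b'b) mulr0.
  over.
have [nM|nM] := ltP n M%:Z; last first.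
  rewrite !andbF big1 // => a' _; apply: big1 => l _.
  by rewrite /F ltNge nM andbF mulr0.
rewrite andbT; have [/andP[op /eqP pb]|nop] := boolP (okr p && (p.1.2 == b)); last first.
  rewrite big1 // => a' _; apply: big1 => l _.
  by rewrite /F /W (negPf nop) coefL0 mul0r.
transitivity (coefL (\sum_a' W p a' b * mx i a a') n); last first.
  rewrite coefL_sum; apply: eq_bigr => a' _.
  rewrite (@coefLMz _ (thr a' b) (absz (M%:Z - thr a' b))) //.
  - by apply: eq_bigr => l _; rewrite /F eqxx nM.
  - by apply: inO_le (iwahoriGL_inO iI).
  - by have := thrM a' b; lia.
have -> : \sum_a' W p a' b * mx i a a' = eps ^ p.2%:Z * mx g a p.1.1.
  rewrite mulrC E mx_scM -mulgA mxME mulr_sumr mulr_suml; apply: eq_bigr => a' _.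
  rewrite rp_mull /W op pb eqxx /= /A expfzDr ?eps_neq0 //.
  by symmetry; apply: mul5AC.
by rewrite coefL_epsz.
Qed.

(** Once the spanning rows [f] are fixed, the truncated coefficients of [phi t * x] are polynomials
    in [t] and in the [C] coordinates of [x] with respect to these rows, which gives growth [d + C].
    There are finitely many choices of [f]. *)
Lemma spanle_family (T : Type) (G : set (T -> k)) (phi : T -> lg) d :
  gr G d -> regmx (alg G) phi -> (forall t, pc N (phi t)) -> (forall t, dv 0 (phi t)) ->
  exists K, forall s, spanle [set g | exists t x, Ig x /\ g = (phi t * x)%g] (fil (@gc k M) s)
    (K * s.+1 ^ (d + C)).
Proof.
move=> Gd H HN H0.
pose ok (f : {ffun 'I_C -> option R}) (t : T) (x : lg) := exists z : 'I_C -> k, forall i j n, n < M%:Z ->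
  coefL (mx (phi t * x)%g i j) n = \sum_j' z j' * (if f j' is Some p then row (phi t) p (i, j, n) else 0).
have okP t x : Ig x -> exists f, ok f t x.
  move=> xI; have [P [c [B [PC rE]]]] := rank_bound (HN t) (H0 t).
  have [f fP] := steinitz PC rE; exists f; have /choice[z zP] := fP.
  exists (fun j' => \sum_(p : R) coefL (mx x p.1.1 p.1.2) p.2%:Z * z p j') => i j n nM.
  rewrite expand //; under eq_bigr => p _ do rewrite zP mulr_sumr.
  rewrite exchange_big /=; apply: eq_bigr => j' _; rewrite mulr_suml.
  by apply: eq_bigr => p _; rewrite mulrA.
have key f : exists K, forall s, spanle [set g | exists t x, [/\ Ig x, g = (phi t * x)%g & ok f t x]]
    (fil (@gc k M) s) (K * s.+1 ^ (d + C)).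
  pose Z := {g | exists t x, [/\ Ig x, g = (phi t * x)%g & ok f t x]}.
  have /choice[tz tzP] : forall g : Z, exists tz : T * ('I_C -> k), forall i j n, n < M%:Z ->
     coefL (mx (sval g) i j) n = \sum_j' tz.2 j' * (if f j' is Some p then row (phi tz.1) p (i, j, n) else 0).
    by move=> [g [t [x [xI gE [z zP]]]]]; exists (t, z) => i j n nM /=; rewrite gE zP.
  pose G1 := [set (c \o fst) | c in G] `|` [set (fun t : T * ('I_C -> k) => t.2 i) | i in setT].
  have /choice[e eP] : forall q : 'I_3 * 'I_3 * 'I_(M + N), exists e,
      fil G e (fun t => coefL (mx (phi t) q.1.1 q.1.2) (q.2%:Z - N%:Z)).
    by move=> q; have [[_ Hq] _] := H q.1.1 q.1.2; have [e He] := Hq (q.2%:Z - N%:Z); exists e.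
  pose K0 := \max_q e q.
  have coefK i a m : m < M%:Z -> fil G K0 (fun t => coefL (mx (phi t) i a) m).
    move=> mM; have [mN|mN] := ltP m (- N%:Z).
      by apply: fil_ext (fil_const _ 0 _) => t; rewrite (HN t i a).1.
    have lt : (absz (m + N%:Z)%R < M + N)%N by lia.
    apply: fil_le (fil_ext _ (eP (i, a, Ordinal lt))) => [|t] /=; first exact: (leq_bigmax (i, a, Ordinal lt)).
    by congr coefL; lia.
  have [K KP] : gr [set (fun z : Z => c (sval z)) | c in @gc k M] (d + C).
    apply: (@gr_dom k _ _ G1 _ tz (fun=> 1) K0.+1 1 (d + C)) => //.
    - exact: fil_const.
    - by move=> t; exact: oner_neq0.
    - move=> _ [_ [i [j [n [nM ->]]]] <-].
      exists (fun t => \sum_j' t.2 j' * (if f j' is Some p then row (phi t.1) p (i, j, n) else 0)).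
        apply: fil_sum => j' _; rewrite -add1n; apply: fil_mul.
          by apply: fil_gen; right; exists j'.
        case: (f j') => [p|]; last exact: fil_const.
        rewrite /row /=; case: [&& _, _ & _]; last exact: fil_const.
        have := @fil_comp k _ _ fst G G1 1 K0 (fun t => coefL (mx (phi t) i p.1.1) (n - p.2%:Z)).
        rewrite muln1; apply; last by apply: coefK; lia.
        by move=> c Gc; apply: fil_gen; left; exists c.
      by move=> g; rewrite mulr1 expr1 /= tzP.
    - exact: gr_pow.
  exists K => s; have [b bP] := KP s.
  exists (fun i g => if pselect (exists t x, [/\ Ig x, g = (phi t * x)%g & ok f t x]) is left h then b i (exist _ g h) else 0).
  move=> F Fs; have [|a aP] := bP (fun z : Z => F (sval z)).
    have := @fil_comp k _ _ (fun z : Z => sval z) (@gc k M) [set (fun z : Z => c (sval z)) | c in @gc k M] 1 s F.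
    by rewrite muln1; apply => // c Gc; apply: fil_gen; exists c.
  exists a => g gZ; transitivity (\sum_i a i * b i (exist _ g gZ)); first exact: (aP (exist _ g gZ) I).
  by apply: eq_bigr => i _; case: pselect => // h; rewrite (Prop_irrelevance h gZ).
have /choice[K KP] := key; exists (\sum_f K f)%N => s.
rewrite big_distrl /=; apply: spanle_sub (spanle_big (fun f => KP f s)) => // g [t [x [xI ->]]].
by have [f fP] := okP t x xI; exists f, t, x.
Qed.

End UpperGrowth.

Section RegularInverse.
Variables (k : fieldType) (S : Type) (A : set (S -> k)) (hA : isalg A).
Local Notation L := (laurent k).
Local Notation lg := (lg k).

Lemma reg_det n (X : S -> 'M[L]_n) : (forall i j, reg A (fun s => X s i j)) -> reg A (fun s => \det (X s)).
Proof.
move=> H; apply: (reg_sum hA) => s0 _; apply: (regM hA); first exact: (reg_const hA).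
by apply: (reg_prod hA) => i; exact: H.
Qed.

(** By the rule of Cramer only the determinant has to be inverted. *)
Lemma regmx_inv c (g : S -> lg) : (forall i j, reg A (fun s => mx (g s) i j)) ->
  (forall s, dv c (g s)) -> A (fun s => (coefL (\det (mx (g s))) c)^-1) -> regmx A g.
Proof.
move=> H gc dA i j; split=> //.
have E s : mx (g s)^-1%g i j = (\det (mx (g s)))^-1 * cofactor (mx (g s)) j i.
  by rewrite -invmx_mx /invmx mx_unit !mxE.
apply: (reg_ext (fun s => esym (E s))); apply: (regM hA).
  by apply: (reg_inv hA gc dA); exact: reg_det.
apply: (regM hA); first exact: (reg_const hA).
by apply: reg_det => a b; apply: reg_ext (H _ _) => s; rewrite !mxE.
Qed.

End RegularInverse.

Lemma mul6AC (F : comRingType) (x g y y' g' x' : F) :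
  x * g * y * (y' * g' * x') = g * g' * (x * y * (y' * x')).
Proof. by ring. Qed.

Section UpperBound.
Variable k : closedFieldType.
Local Notation L := (laurent k).
Local Notation eps := (eps k).
Local Notation lg := (lg k).
Local Notation sc := (@sc k).

Lemma Iw_dv0 (x : lg) : Iw x -> dv 0 x -> Ig x.
Proof.
move=> [n xI] x0; have := dvM (dv_sc k n) x0; rewrite addr0 => /dv_inj/(_ (dvK (Ig_Kg xI))) n0.
by move: xI; rewrite (_ : n = 0) ?sc0 ?mul1g //; lia.
Qed.

Lemma dv_Ig (x : lg) : Ig x -> dv 0 x.
Proof. by move=> /Ig_Kg/dvK. Qed.

(* [Ig] is irreducible: it is an open subset of a linear space. *)
Lemma Ig_dom (g1 x : lg) f h : Ig x -> alg (@lgen k) f -> alg (@lgen k) h ->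
  f g1 != 0 -> h (g1 * x)%g != 0 -> exists2 y, Ig y & f (g1 * y)%g * h (g1 * y)%g != 0.
Proof.
move=> xI fa ha f1 hx.
pose A0 : set (k -> k) := [set F | exists P : {poly k}, F = horner P].
have hA0 : isalg A0.
  split=> [c|_ _ [P ->] [Q ->]|_ _ [P ->] [Q ->]].
  - by exists c%:P; apply: funext => s; rewrite hornerC.
  - by exists (P + Q); apply: funext => s; rewrite hornerD.
  - by exists (P * Q); apply: funext => s; rewrite hornerM.
(* The line through [1] and [x] leaves [Ig] only where the determinant loses its constant term, that
   is, at the zeros of a polynomial [p] in [s]. So [f] and [h] can be compared as functions of one
   variable. *)
pose Y (s : k) : 'M[L]_3 := \matrix_(i, j) (constL (1 - s) * (1%:M : 'M[L]_3) i j + constL s * mx x i j).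
have Yreg i j : reg A0 (fun s => Y s i j).
  apply: (@reg_ext _ _ _ (fun s => constL (1 - s) * (1%:M : 'M[L]_3) i j + constL s * mx x i j)) => [s|].
    by rewrite [RHS]mxE.
  apply: (regD hA0); apply: (regM hA0); try exact: (reg_const hA0); apply: (reg_constL hA0).
    by exists (1 - 'X); apply: funext => s; rewrite !hornerE.
  by exists 'X; apply: funext => s; rewrite hornerX.
have [_ /(_ 0)[p pE]] := reg_det hA0 Yreg.
have YO s (i j : 'I_3) : inO (i < j)%N%:Z (Y s i j).
  rewrite mxE; apply: inO_add; rewrite -[X in inO X]add0r; apply: inO_mul; try exact: inO_const.
    rewrite mxE -val_eqE /=; case: ltngtP => _ /=; rewrite ?mulr0n ?mulr1n; by [exact: inO0|exact: inO1].
  exact: iwahoriGL_inO.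
have YI s : p.[s] != 0 -> iwahoriGL (Y s).
  rewrite -pE => ps; have [||X hu hE] := @glOP k (Y s); first by move=> i j; apply: inO_le (YO s i j).
    by [].
  exists X; last by rewrite hE.
  by split=> // i j ij; have := YO s i j 0; rewrite hE ij mxE coefL_ofps; apply.
pose S := {s : k | p.[s] != 0}.
have /choice[y yP] : forall s : S, exists y : lg, Ig y /\ Y (sval s) = mx y.
  by move=> [s ps]; have [y yI E] := Iw_ex (YI s ps); exists y.
pose A : set (S -> k) := [set F | exists (P : {poly k}) e, forall s, F s * p.[sval s] ^+ e = P.[sval s]].
have hA : isalg A.
  split=> [c|F G [P [e EF]] [Q [e' EG]]|F G [P [e EF]] [Q [e' EG]]].
  - by exists c%:P, 0%N => s; rewrite mulr1 hornerC.
  - exists (P * p ^+ e' + Q * p ^+ e), (e + e')%N => s.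
    by rewrite !hornerE -EF -EG exprD; ring.
  - by exists (P * Q), (e + e')%N => s; rewrite !hornerE -EF -EG exprD; ring.
have yreg : regmx A y.
  apply: (@regmx_inv _ _ _ hA 0) => [i j|s|].
  - have [[m Hm] Hc] := Yreg i j; split.
      by exists m => s; rewrite -(yP s).2.
    move=> n; have [P PE] := Hc n; exists P, 0%N => s; rewrite mulr1 -(yP s).2.
    exact: (congr1 (fun F => F (sval s)) PE).
  - by apply: dv_Ig; case: (yP s).
  - exists 1, 1%N => s; rewrite expr1 -(yP s).2 hornerE.
    rewrite (_ : coefL (\det (Y (sval s))) 0 = p.[sval s]) ?mulVf ?(svalP s) //.
    exact: (congr1 (fun F => F (sval s)) pE).
have greg : regmx A (fun s => (g1 * y s)%g) by apply: (regmxM hA _ yreg); exact: (regmx_const hA).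
have [P [e EP]] := alg_regmx hA greg fa; have [Q [e' EQ]] := alg_regmx hA greg ha.
have p0 : p.[0] != 0.
  rewrite -pE (_ : Y 0 = 1%:M) ?det1 ?coefL1 ?eqxx ?oner_eq0 //.
  by apply/matrixP => i j; rewrite mxE subr0 rmorph1 rmorph0 mul1r mul0r addr0.
have Y1 : Y 1 = mx x by apply/matrixP => i j; rewrite mxE subrr rmorph1 rmorph0 mul1r mul0r add0r.
have p1 : p.[1] != 0 by rewrite -pE Y1; case: (dv_Ig xI).
have P0 : P != 0.
  apply: contraNneq f1 => P0; have := EP (exist _ 0 p0); rewrite P0 horner0 => /eqP.
  rewrite mulf_eq0 expf_eq0 (negPf p0) andbF orbF /=.
  suff -> : y (exist _ 0 p0) = 1%g by rewrite mulg1.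
  apply: lg_inj; rewrite -(yP _).2 mx1 /=.
  by apply/matrixP => i j; rewrite mxE subr0 rmorph1 rmorph0 mul1r mul0r addr0.
have Q0 : Q != 0.
  apply: contraNneq hx => Q0; have := EQ (exist _ 1 p1); rewrite Q0 horner0 => /eqP.
  rewrite mulf_eq0 expf_eq0 (negPf p1) andbF orbF /=.
  suff -> : y (exist _ 1 p1) = x by [].
  by apply: lg_inj; rewrite -(yP _).2 Y1.
have pn0 : p != 0 by apply: contraNneq p0 => ->; rewrite horner0.
have /closed_nonrootP[s] : P * Q * p != 0 by rewrite !mulf_neq0.
rewrite rootE !hornerM !mulf_eq0 !negb_or => /andP[/andP[Ps Qs] ps].
exists (y (exist _ s ps)); first by case: (yP (exist _ s ps)).
rewrite mulf_neq0 //.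
  by apply: contraNneq Ps => E; rewrite -(EP (exist _ s ps)) /= E mul0r.
by apply: contraNneq Qs => E; rewrite -(EQ (exist _ s ps)) /= E mul0r.
Qed.

Lemma gc_le (M M' : nat) : (M <= M')%N -> forall f, alg (@gc k M) f -> alg (@gc k M') f.
Proof.
move=> MM f; apply: (@alg_comp k lg lg id) => c [i [j [n [nM ->]]]].
by apply: alg_gen; exists i, j, n; split=> //; lia.
Qed.

(* On a bounded set with fixed determinant valuation the coefficients of
   [g^-1] are polynomials in those of [g], up to powers of the leading
   coefficient of the determinant. *)
Lemma alg_gc (N : nat) f : alg (@lgen k) f -> exists M F, alg (@gc k M) F /\
  forall g, pc N g -> dv 0 g -> (F g == 0) = (f g == 0).
Proof.
move=> fa; pose S := {g : lg | pc N g /\ dv 0 g}.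
pose A0 : set (S -> k) := [set f | exists M F, alg (@gc k M) F /\ f = F \o sval].
have hA0 : isalg A0.
  split=> [c|_ _ [M [F [Fa ->]]] [M' [G [Ga ->]]]|_ _ [M [F [Fa ->]]] [M' [G [Ga ->]]]].
  - by exists 0%N, (fun=> c); split=> //; exact: alg_const.
  - exists (maxn M M'), (fun g => F g + G g); split=> //.
    by apply: alg_add; [apply: gc_le Fa | apply: gc_le Ga]; rewrite ?leq_maxl ?leq_maxr.
  - exists (maxn M M'), (fun g => F g * G g); split=> //.
    by apply: alg_mul; [apply: gc_le Fa | apply: gc_le Ga]; rewrite ?leq_maxl ?leq_maxr.
have ereg i j : reg A0 (fun s : S => mx (sval s) i j).
  split; first by exists (- N%:Z) => -[g gP]; exact: (gP.1 i j).1.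
  move=> n; exists (absz n).+1, (fun g => coefL (mx g i j) n); split=> //.
  by apply: alg_gen; exists i, j, n; split=> //; lia.
have [_ /(_ 0)[M0 [D [Da DE]]]] := reg_det hA0 ereg.
have D0 (s : S) : D (sval s) != 0.
  by case: s (congr1 (fun F => F s) DE) => g [gN [g0 g0']] /= <-.
pose A : set (S -> k) := [set f | exists M F e, alg (@gc k M) F /\ forall s, f s * D (sval s) ^+ e = F (sval s)].
have hA : isalg A.
  split=> [c|F G [M [F' [e [Fa FE]]]] [M' [G' [e' [Ga GE]]]]|F G [M [F' [e [Fa FE]]]] [M' [G' [e' [Ga GE]]]]].
  - by exists 0%N, (fun=> c), 0%N; split=> [|s]; [exact: alg_const | rewrite mulr1].
  - exists (maxn M0 (maxn M M')), (fun g => F' g * D g ^+ e' + G' g * D g ^+ e), (e + e')%N; split=> [|s].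
      apply: alg_add; apply: alg_mul; try apply: alg_exp.
      - by apply: gc_le Fa; lia.
      - by apply: gc_le Da; lia.
      - by apply: gc_le Ga; lia.
      - by apply: gc_le Da; lia.
    by rewrite -FE -GE exprD; ring.
  - exists (maxn M M'), (fun g => F' g * G' g), (e + e')%N; split=> [|s].
      by apply: alg_mul; [apply: gc_le Fa | apply: gc_le Ga]; lia.
    by rewrite -FE -GE exprD; ring.
have greg : regmx A sval.
  apply: (@regmx_inv _ _ _ hA 0) => [i j|[g []] //|].
    have [Hm Hc] := ereg i j; split=> // n; have [M [F [Fa FE]]] := Hc n.
    by exists M, F, 0%N; split=> // s; rewrite mulr1 -[RHS]/((F \o sval) s) -FE.
  exists 0%N, (fun=> 1), 1%N; split=> [|s]; first exact: alg_const.
  rewrite expr1 (_ : coefL _ _ = D (sval s)) ?mulVf //.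
  exact: (congr1 (fun F => F s) DE).
have [M [F [e [Fa FE]]]] := alg_regmx hA greg fa; exists M, F; split=> // g gN g0.
by have := FE (exist _ g (conj gN g0)); rewrite /= => <-; rewrite mulf_eq0 expf_eq0 (negPf (D0 (exist _ g (conj gN g0)))) andbF orbF.
Qed.

Definition Bd (m : nat) : set (flag k) := [set x | exists2 g, x = fl g & bd (fun _ _ _ _ => - m%:Z) g].

Lemma bd_mul (m a b : nat) (x g y : lg) : pc a x -> pc b y -> bd (fun _ _ _ _ => - m%:Z) g ->
  bd (fun _ _ _ _ => - (m + a.*2 + b.*2)%:Z) (x * g * y)%g.
Proof.
move=> xa yb H i j i' j'; rewrite !invMg !mulgA.
have E (p q r : lg) c d : mx (p * q * r)%g c d = \sum_u \sum_v mx p c u * mx q u v * mx r v d :> L.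
  rewrite mxME exchange_big /=; apply: eq_bigr => v _; rewrite mxME mulr_suml.
  by apply: eq_bigr.
rewrite !E big_distrl /=; apply: inO_sum => u _; rewrite big_distrl /=; apply: inO_sum => v _.
rewrite big_distrr /=; apply: inO_sum => u' _; rewrite big_distrr /=; apply: inO_sum => v' _.
have -> : mx x i u * mx g u v * mx y v j * (mx y^-1%g i' u' * mx g^-1%g u' v' * mx x^-1%g v' j') =
  (mx g u v * mx g^-1%g u' v') * ((mx x i u * mx y v j) * (mx y^-1%g i' u' * mx x^-1%g v' j')) :> L.
  exact: mul6AC.
have -> : - (m + a.*2 + b.*2)%:Z = - m%:Z + ((- a%:Z + - b%:Z) + (- b%:Z + - a%:Z)) by lia.
apply: inO_mul; first exact: H.
by apply: inO_mul; apply: inO_mul; [case: (xa i u) | case: (yb v j) | case: (yb i' u') | case: (xa v' j')].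
Qed.

(** [bd] only bounds products of an entry of [g] and one of [g^-1]. The determinant condition makes
    the least valuations of both matrices at most 0, which separates the two bounds. *)
Lemma bd_pc m (g : lg) : dv 0 g -> bd (fun _ _ _ _ => - m%:Z) g -> pc m g.
Proof.
move=> g0 H; have [a [i [j [ga gaO]]]] := minval g; have [b [i' [j' [gb gbO]]]] := minval g^-1%g.
have nonpos (x : lg) c : dv 0 x -> (forall i j, inO c (mx x i j)) -> c <= 0.
  move=> [_ x0] /inO_det xO; rewrite leNgt; apply: contraNN x0 => c0; rewrite xO //; lia.
have a0 := nonpos _ _ g0 gaO; have b0 : b <= 0.
  by apply: (nonpos g^-1%g) gbO; rewrite -oppr0; exact: dvV.
have ab : - m%:Z <= a + b.
  have [_] := hasval_mul ga gb; have := H i j i' j'; move: (_ * _) => z zO.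
  by rewrite leNgt; apply: contraNN => /zO ->.
by move=> c d; split; [apply: inO_le (gaO c d) | apply: inO_le (gbO c d)]; lia.
Qed.

(** A finite union of families of growth at most [d]. All representatives share the determinant
    valuation [c], so that two representatives of one flag differ by [Ig] and not only by [Iw]. *)
Inductive covered c d : set (flag k) -> Prop :=
| cov_family (T : Type) (G : set (T -> k)) (phi : T -> lg) X : gr G d -> regmx (alg G) phi ->
    (forall t, dv c (phi t)) -> (forall x, X x -> exists t, x = fl (phi t)) -> covered c d X
| cov_union X Y Z : covered c d X -> covered c d Y -> Z `<=` X `|` Y -> covered c d Z.

Lemma covered_dv c d X : covered c d X -> forall x, X x -> exists2 g, x = fl g & dv c g.
Proof.
elim=> [T G phi {}X _ _ pc XP x /XP[t ->]|{}X Y Z _ IHX _ IHY ZXY x /ZXY[/IHX|/IHY]//].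
by exists (phi t).
Qed.

Lemma covered_spanle c d X g0 : covered c d X -> dv c g0 ->
  exists M0, forall M, (M0 <= M)%N -> exists K, forall s,
    spanle [set g | dv 0 g /\ X (fl (g0 * g)%g)] (fil (@gc k M) s) (K * s.+1 ^ (d + #|{: pos M thr0}|)).
Proof.
move=> cX g0c; elim: cX => [T G phi {}X Gd H pd XP|{}X Y Z _ [M1 H1] _ [M2 H2] ZXY].
  have iA := @alg_isalg k T G.
  have H' : regmx (alg G) (fun t => g0^-1 * phi t)%g by apply: (regmxM iA _ H); exact: (regmx_const iA).
  have [N HN] := regmx_pc H'; exists N.+1 => M NM.
  have dv0 t : dv 0 (g0^-1 * phi t)%g by have := dvM (dvV g0c) (pd t); rewrite addNr.
  have [K KP] := spanle_family NM Gd H' HN dv0; exists K => s.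
  apply: spanle_sub (KP s) => // g [dg /XP[t /esym/flE E]].
  exists t, ((phi t)^-1 * (g0 * g))%g; split; last by rewrite !mulgA mulgK mulVg mul1g.
  by apply: Iw_dv0 E _; have := dvM (dvV (pd t)) (dvM g0c dg); rewrite addr0 addNr.
exists (maxn M1 M2) => M; rewrite geq_max => /andP[/H1[K1 KP1] /H2[K2 KP2]].
exists (K1 + K2)%N => s; rewrite mulnDl; apply: spanle_sub (spanleU (KP1 s) (KP2 s)) => //.
by move=> g [dg /ZXY[]]; [left | right].
Qed.

(** On the preimages [W i] in the loop group, normalised by [g0], the growth exponent is at least
    [C] at the bottom, as [W 0] contains [Ig]; each step adds one, and the top has at most [d + C].
    Hence [e + C <= d + C]. *)
Lemma covered_chain c d m X (Z : nat -> set (flag k)) e : covered c d X ->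
  (forall i, (i <= e)%N -> irreducible (Z i)) -> (forall i, (i < e)%N -> Z i `<=` Z i.+1) ->
  (forall i, (i <= e)%N -> Z i `<=` X) -> X `<=` Bd m ->
  (forall i, (i < e)%N -> exists C, [/\ closed C, Z i `<=` C & ~ Z i.+1 `<=` C]) -> (e <= d)%N.
Proof.
move=> cX Zirr Zm ZX Xm Zsep.
have [[x0 Zx0] _] := Zirr 0%N (leq0n e).
have [g0 x0E g0c] := covered_dv cX (ZX 0%N (leq0n e) _ Zx0).
pose W i : set lg := [set g | dv 0 g /\ Z i (fl (g0 * g)%g)].
have [n0 g0n] := pc_ex g0; have [n1 n1P] := pc_ex (1%g : lg); have [M0 M0P] := covered_spanle cX g0c.
have [N WN] : exists N, forall i, (i <= e)%N -> forall g, W i g -> pc N g.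
  have [b bP] : exists b, forall x : lg, Ig x -> pc b x.
    exists 0%N => x xI i j; split; first by apply: inO_le (iwahoriGL_inO xI).
    by apply: inO_le (iwahoriGL_inO (IgV xI)).
  exists (m + n0.*2 + (b.*2))%N => i ie g [dg /(ZX i ie)/Xm[h /flE E hb]]; apply: bd_pc => //.
  have [n xI] := E; set x := (sc n * _)%g in xI.
  have hE : h = (g0 * g * (sc (- n) * x))%g by rewrite /x (mulgA (sc (- n))) -scD addNr sc0 mul1g mulKVg.
  clearbody x; have -> : g = (sc n * (g0^-1 * h * x^-1))%g.
    by rewrite hE -!mulgA mulgV mulg1 mulKg -(scC (- n) g) mulgA -scD subrr sc0 mul1g.
  apply/bd_sc; apply: bd_mul hb; last exact: bP (IgV xI).
  by move=> a c'; have [? ?] := g0n a c'; split; rewrite ?invgK.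
have Zf i f : (i <= e)%N -> alg (@lgen k) f -> (exists2 g, W i g & f g != 0) ->
    exists2 U, open U & Z i `&` U !=set0 /\ forall x, U x -> exists g, [/\ x = fl (g0 * g)%g, dv 0 g & f g != 0].
  move=> ie fa [g [dg Zg] fg].
  have oO : lopen [set h | (dv 0 (k := k) `&` [set h | f h != 0]) (g0^-1 * h)%g].
    apply: (@lopen_pre k (fun h => g0^-1 * h)%g (dv 0 (k := k) `&` [set h | f h != 0])).
      by apply: lmorM; [exact: lmor_const | exact: lmor_id].
    by apply: lopenI; [exact: lopen_dv | apply: lopen_locfun => N'; exists f].
  eexists; first exact: open_sat oO.
  split; first by exists (fl (g0 * g)%g); split=> //; exists (g0 * g)%g => //=; rewrite mulKg.
  by move=> _ [h [dh fh] <-]; exists (g0^-1 * h)%g; rewrite mulKVg.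
(* Irreducibility of [Z i] gives one flag in both open sets, but [f] and [h] may be nonzero at
   different representatives of it; [Ig_dom] moves to a common one. *)
have Wirr i : (i <= e)%N -> forall f h, alg (@lgen k) f -> alg (@lgen k) h ->
    (exists2 g, W i g & f g != 0) -> (exists2 g, W i g & h g != 0) ->
    exists2 g, W i g & f g * h g != 0.
  move=> ie f h fa ha Wf Wh; have [U oU [ZU UP]] := Zf i f ie fa Wf.
  have [V oV [ZV VP]] := Zf i h ie ha Wh.
  have /irrP[_ /(_ U V oU oV ZU ZV)[x [Zx [/UP[g1 [xE d1 fg1]] /VP[g2 [xE2 d2 hg2]]]]]] := Zirr i ie.
  have E : Iw (g1^-1 * g2)%g.
    by have /flE := etrans (esym xE) xE2; rewrite invMg -!mulgA mulKg.
  have yI : Ig (g1^-1 * g2)%g.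
    by apply: Iw_dv0 E _; have := dvM (dvV d1) d2; rewrite addNr.
  have [|y yI' fh] := Ig_dom yI fa ha fg1; first by rewrite mulKVg.
  exists (g1 * y)%g => //; split; first by have := dvM d1 (dv_Ig yI'); rewrite addr0.
  by rewrite mulgA fl_mulr -?xE //; exact: Ig_Iw.
have sep i : (i < e)%N -> exists M F r, [/\ fil (@gc k M) r F,
    forall g, W i g -> F g = 0 & exists2 g, W i.+1 g & F g != 0].
  move=> ie; have [C [cC ZC nC]] := Zsep i ie.
  have [z Zz nCz] : exists2 z, Z i.+1 z & ~ C z.
    by apply: contrapT => no; apply: nC => z Zz; apply: contrapT => nz; apply: no; exists z.
  have oO : lopen [set h | [set h | ~ C (fl h)] (g0 * h)%g].
    by apply: lopen_pre; [apply: lmorM; [exact: lmor_const | exact: lmor_id] | exact/closedE].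
  have [S Sr SP] := oO N.
  have [g zE gc'] := covered_dv cX (ZX _ ie _ Zz).
  have Wg : W i.+1 (g0^-1 * g)%g.
    by split; [have := dvM (dvV g0c) gc'; rewrite addNr | rewrite mulKVg -zE].
  have [f Sf fg] := (SP _ (WN _ ie _ Wg)).1 ltac:(by rewrite /= mulKVg -zE).
  have [M [F [[r Fr] FE]]] := alg_gc N (Sr _ Sf); exists M, F, r; split=> //.
    move=> h Wh; apply/eqP; rewrite FE; [|exact: WN _ (ltnW ie) _ Wh|by case: Wh].
    apply/negPn/negP => fh; have := (SP h (WN _ (ltnW ie) _ Wh)).2 (ex_intro2 _ _ f Sf fh).
    by apply; apply: ZC; case: Wh.
  exists (g0^-1 * g)%g => //; rewrite FE //; first exact: WN _ ie _ Wg.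
  by case: Wg.
have /choice[MFr MFrP] : forall i, exists p : nat * (lg -> k) * nat, (i < e)%N ->
    [/\ fil (@gc k p.1.1) p.2 p.1.2, forall g, W i g -> p.1.2 g = 0 & exists2 g, W i.+1 g & p.1.2 g != 0].
  move=> i; case: (ltnP i e) => [/sep[M [F [r ?]]]|_]; first by exists (M, F, r).
  by exists (0%N, fun=> 0, 0%N).
pose M := maxn (maxn 1 M0) (\max_(i < e) (MFr i).1.1); pose r0 := \max_(i < e) (MFr i).2.
have [|K KP] := M0P M; first by rewrite /M; lia.
set C := #|{: pos M thr0}| in KP; rewrite -(leq_add2r C).
have M1 : (0 < M)%N by rewrite /M; lia.
have gcM i : (i < e)%N -> fil (@gc k M) r0 (MFr i).1.2.
  move=> ie; have [H _ _] := MFrP i ie.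
  apply: (@fil_le _ _ _ (MFr i).2); first exact: (leq_bigmax (Ordinal ie)).
  have := @fil_comp k lg lg id (@gc k (MFr i).1.1) (@gc k M) 1 (MFr i).2 (MFr i).1.2.
  rewrite muln1; apply => // c' [a [b [n [nM ->]]]]; apply: fil_gen; exists a, b, n; split=> //.
  have : ((MFr i).1.1 <= M)%N.
    by rewrite /M; apply: leq_trans (leq_maxr _ _); exact: (leq_bigmax (Ordinal ie)).
  by move=> ?; lia.
apply: (@chain_growth k lg (@gc k M) W (fun i => (MFr i).1.2) r0 e (d + C) C C).
- by move=> i ie g [dg Zg]; split=> //; exact: Zm.
- move=> i ie f h fa ha; apply: Wirr => //.
    by apply: (@alg_comp k lg lg id) fa => c' [a [b [n [_ ->]]]]; apply: alg_gen; exists a, b, n; left.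
  by apply: (@alg_comp k lg lg id) ha => c' [a [b [n [_ ->]]]]; apply: alg_gen; exists a, b, n; left.
- by move=> i ie; have [_ ? ?] := MFrP i ie; split=> //; exact: gcM.
- by have := card_pos0 M1; rewrite -/C; lia.
- move=> s; have HI : indge [set g : lg | Ig g] (fil (@gc k M) (C * s)) (s.+1 ^ C) := indge_Ig k M1 s.
  apply: (indge_sub _ _ HI) => // g gI; split; first exact: dv_Ig.
  by rewrite fl_mulr -?x0E //; exact: Ig_Iw.
- exists K => s; apply: spanle_sub (KP s) => // g [dg Zg]; split=> //; exact: (ZX e).
Qed.

Definition Up c d (X : set (flag k)) :=
  (forall x, X x -> exists U m, [/\ open U, U x & X `&` U `<=` Bd m]) /\
  forall m, covered c d (X `&` Bd m).

(** All members of the chain contain a common point [x0]. Intersecting with a bounded neighbourhood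
    of it keeps them irreducible and distinct, since a nonempty open part of an irreducible set is
    dense. *)
Lemma Up_chain c d X e : Up c d X -> has_irreducible_chain X e -> (e <= d)%N.
Proof.
move=> [LF cov] [Z [ZP Zm]].
have [_ [[x0 Zx0] _]] := ZP 0%N (leq0n e).
have ZX i : (i <= e)%N -> Z i `<=` X by move=> /ZP[[C _ ->] _] x [].
have [U [m [oU Ux0 Um]]] := LF x0 (ZX 0%N (leq0n e) _ Zx0).
have Zx i : (i <= e)%N -> Z i x0.
  by elim: i => [//|i IH] ie; have [H _] := Zm i ie; apply: H; apply: IH; exact: ltnW.
apply: (@covered_chain c d m (X `&` Bd m) (fun i => Z i `&` U)) => //.
- move=> i ie; have [_ /irrP[_ H]] := ZP i ie; apply/irrP; split; first by exists x0; split; [exact: Zx|].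
  move=> V V' oV oV' [y [[Zy Uy] Vy]] [y' [[Zy' Uy'] Vy']].
  have [||||z [Zz [[Vz Uz] [Vz' _]]]] := H (V `&` U) (V' `&` U).
  + exact: openI.
  + exact: openI.
  + by exists y.
  + by exists y'.
  by exists z.
- by move=> i ie x [Zix Uix]; split=> //; have [H _] := Zm i ie; exact: H.
- by move=> i ie x [Zix Uix]; split; [exact: ZX Zix | apply: Um; split=> //; exact: ZX Zix].
- move=> i ie; have [[C cC ZC] _] := ZP i (ltnW ie); have [_ nZ] := Zm i ie.
  have [_ [_ irr]] := ZP i.+1 ie.
  exists C; split=> // [x [+ _]|H]; first by rewrite ZC => -[].
  have [|sub|sub] := irr C (~` U) cC (open_closedC oU).
  + by move=> x Zix; have [Uix|] := pselect (U x); [left; apply: H | right].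
  + by apply: nZ => x Zix; rewrite ZC; split; [exact: ZX Zix | exact: sub].
  + by apply: (sub x0) => //; exact: Zx.
Qed.

End UpperBound.

(** * The reduction step *)

Section GroupIdentities.
Variable gT : groupType.
Local Open Scope group_scope.
Implicit Types a b c d e f : gT.

Lemma gid1 a b c d : a^-1 * d = a^-1 * b * (b^-1 * c) * (c^-1 * d).
Proof. by rewrite !mulgA mulgK mulgK. Qed.

Lemma gid2 (g s g' n x : gT) : (g^-1 * s)^-1 * x * n = (g'^-1 * s)^-1 * (g'^-1 * (g * x * n)).
Proof. by rewrite !invMg !invgK !mulgA mulgK. Qed.

Lemma gid3 (g' s s' : gT) : g'^-1 * s' = g'^-1 * s * (s^-1 * s').
Proof. by rewrite mulgA mulgK. Qed.

Lemma gid4 (g' f' s s' : gT) : f'^-1 * s' = f'^-1 * g' * (g'^-1 * s) * (s^-1 * s').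
Proof. exact: gid1. Qed.
Lemma gid5 (h p u n c : gT) : c * p = p * c -> c * h = h * c -> c * u = u * c ->
  h * (p * u * p^-1) * (c * (p * n * p^-1)) = c * (h * p * u * n * p^-1).
Proof.
move=> cp ch cu; rewrite !mulgA -(mulgA _ p^-1 c).
have -> : p^-1 * c = c * p^-1 by apply: (mulgI p); rewrite !mulgA mulgV mul1g -cp mulgK.
by rewrite !mulgA mulgKV -(mulgA _ u c) -cu !mulgA -(mulgA _ p c) -cp !mulgA -ch.
Qed.
Lemma gid6 (i u u' j n c : gT) : n * n = 1 -> u' * n * c = c * (u' * n) -> i * u = c * (u' * j) ->
  i * u * n = u' * n * (c * (n * j * n)).
Proof. by move=> nn cc ->; rewrite [RHS]mulgA cc -!mulgA (mulgA n n) nn mul1g. Qed.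

Lemma gid9 (m a b c x y : gT) : x * c = c * x ->
  m * (a * (b * x * (c * y))) = m * a * b * c * (x * y).
Proof. by move=> H; rewrite !mulgA -(mulgA _ x c) H !mulgA. Qed.

Lemma gid10 (g' s x n : gT) : ((g'^-1 * s)^-1 * x * n)^-1 = (g' * x * n)^-1 * s.
Proof. by rewrite !invMg !invgK !mulgA. Qed.

Lemma gid11 (i v j i' v' j' c c' : gT) : (forall x, c * x = x * c) -> (forall x, c' * x = x * c') ->
  c * (i * v * j) = c' * (i' * v' * j') -> i'^-1 * i = c' * c^-1 * (v' * (j' * j^-1) * v^-1).
Proof.
move=> cC c'C E; have {}E : i * v * j = c^-1 * (c' * (i' * v' * j')) by rewrite -E mulKg.
have {}E : i = c^-1 * (c' * (i' * v' * j')) * j^-1 * v^-1 by rewrite -E !mulgK.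
have cV x : c^-1 * x = x * c^-1 by apply: (mulgI c); rewrite mulKVg mulgA cC mulgK.
by rewrite E !mulgA -(cV i'^-1) -(mulgA _ _ c') -(c'C i'^-1) !mulgA mulgKV (cV c').
Qed.

Lemma gid12 (g' s s' su sn p x n c : gT) : (forall y, c * y = y * c) -> su = p * x * p^-1 ->
  sn = c * (p * n * p^-1) ->
  g'^-1 * s * (s^-1 * (s' * su * sn)) = c * (g'^-1 * s' * p * x * n * p^-1).
Proof.
move=> cC -> ->; rewrite -(gid5 n (cC p) (cC (g'^-1 * s')) (cC x)) !mulgA mulgK //.
Qed.

Lemma gid7 (g g' x y n i : gT) : g'^-1 * g * x = y * n * i -> (g' * y * n)^-1 * g = i * x^-1.
Proof.
move=> E; have {}E : g'^-1 * g = y * n * i * x^-1 by rewrite -E mulgK.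
by rewrite !invMg -!mulgA E -!mulgA mulKg mulKg.
Qed.

Lemma gid8 (f g x y n i : gT) : f^-1 * g * x * n = y * n * i -> g * x * n = f * y * n * i.
Proof. by rewrite -!mulgA => <-; rewrite mulKVg. Qed.
End GroupIdentities.

Section Reduction.
Variables (k : closedFieldType) (q : nat) (qP : [pchar k].-nat q).
Local Notation L := (laurent k).
Local Notation eps := (eps k).
Local Notation lg := (lg k).
Local Notation rp := (@rp k).
Local Notation sc := (@sc k).
Local Notation bary := (@barycentric int).
Local Notation P := (rp tau).
Local Notation n1 := (rp s1).
Local Notation sg := (sg qP).

(** With two decompositions of [g], the element [i'^-1 * i] of [Ig] is a conjugate, up to scalars,
    of [j' * j^-1]. The order of one of its entries, coming from a diagonal entry of [j' * j^-1],
    gives an inequality of windows; by symmetry these agree, so double cosets are disjoint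
    ([D_inj]). *)
Lemma D_fpos v v' (g : lg) : D v g -> D v' g -> exists n : int,
  3 * n = wdeg v - wdeg v' /\ forall j, fpos v j <= fpos v' j + 3 * n.
Proof.
move=> /D_Ig[c [i [j [iI jI ->]]]] /D_Ig[c' [i' [j' [i'I j'I E]]]]; exists (c' - c); split=> [|b].
  by have := dv_D v c iI jI; rewrite E => /dv_inj/(_ (dv_D v' c' i'I j'I)); lia.
have {}E : (i'^-1 * i = sc (c' - c) * (rp v' * (j' * j^-1) * (rp v)^-1))%g.
  by rewrite scD scN; apply: gid11 E; [exact: scC | exact: scC].
set a := ((lin v')^-1)%g b; set d := ((lin v)^-1)%g b.
have xI := IgM (IgV i'I) iI; have yI := IgM j'I (IgV jI).
have := iwahoriGL_inO (i := a) (j := d) xI; rewrite E mx_scM rpV_mulr rp_mull !permKV.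
have [yO y0] : hasval 0 (mx (j' * j^-1)%g b b) by split; [apply: inO_le (iwahoriGL_inO yI) | exact: iwahoriGL_diag yI].
have := hasval_mul (hasval_eps k (c' - c)) (hasval_mul (hasval_mul (hasval_eps k (bary (tr v') a)) (conj yO y0)) (hasval_eps k (- bary (tr v) d))).
move=> [_ H] H'; rewrite /fpos -/a -/d.
have : (a < d)%N%:Z <= c' - c + (bary (tr v') a + 0 + - bary (tr v) d).
  by rewrite leNgt; apply: contraNN H => /H' ->.
by have := ltn_ord a; have := ltn_ord d; case: ltnP; lia.
Qed.

Lemma fpos_eq v v' (n : int) : (forall j, fpos v j = fpos v' j + 3 * n) -> v = v'.
Proof.
move=> H; have lE j : ((lin v)^-1)%g j = ((lin v')^-1)%g j.
  apply: val_inj => /=; have := H j; rewrite /fpos.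
  by have := ltn_ord (((lin v)^-1)%g j); have := ltn_ord (((lin v')^-1)%g j); lia.
have {}lE : lin v = lin v' by apply: invg_inj; apply/permP.
have tE i : bary (tr v) i = bary (tr v') i + n.
  by have := H (lin v i); rewrite /fpos lE permK; lia.
have n0 : n = 0 by have := tE 2%:R; rewrite /barycentric /=; lia.
case: v v' lE tE H => [[a b] p] [[a' b'] p'] /= -> tE _; congr IW.
have := tE 0; have := tE 1; rewrite n0 /barycentric /= !addr0 => -> E.
by congr (_, _); lia.
Qed.

Lemma D_eq w (g h : lg) : g = h -> D w g -> D w h.
Proof. by move=> ->. Qed.

Lemma D_inj v v' (g : lg) : D v g -> D v' g -> v = v'.
Proof.
move=> gv gv'; have [n [nE H]] := D_fpos gv gv'; have [n' [nE' H']] := D_fpos gv' gv.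
by apply: (@fpos_eq _ _ n) => j; have := H j; have := H' j; lia.
Qed.

Lemma wdegM v w : exists n : int, wdeg (v * w)%g = wdeg v + wdeg w + 3 * n.
Proof.
have [n E] := rpM k v w; exists n; have := dv_rp k (v * w)%g; rewrite E => /dv_inj.
by move=> /(_ _ (dvM (dv_sc k n) (dvM (dv_rp k v) (dv_rp k w)))); lia.
Qed.

Definition hh (g : lg) : lg := (g^-1 * sg g)%g.

Definition XX w : set (flag k) := [set x | exists2 g, x = fl g & D w (hh g)].

Lemma XX_fl w g : XX w (fl g) <-> D w (hh g).
Proof.
split=> [[g' /flE E gD]|]; last by exists g.
rewrite (_ : hh g = (g^-1 * g') * hh g' * (sg (g^-1 * g'))^-1)%g; last first.
  by rewrite -sgV invMg invgK sgM sgV; exact: gid1.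
by apply: D_mulr; [apply: IwV; exact: sg_Iw | exact: D_mull].
Qed.

(** [sigma] inverts determinants, so the determinant valuation of [hh g] is [-2] times that of [g],
    hence congruent to it modulo 3. Scalars then reach every value congruent to [wdeg w]. *)
Lemma XX_dv w x : XX w x -> forall n : int, exists g, [/\ x = fl g, D w (hh g) & dv (wdeg w + 3 * n) g].
Proof.
move=> [g -> gD] n; have [m gm] := dv_ex g.
have [e [i [j [iI jI E]]]] := D_Ig gD.
have := dvM (dvV gm) (dv_sg qP gm); rewrite -/(hh g) E => /dv_inj/(_ (dv_D w e iI jI)) mE.
have fE : fl (sc (n - m - e) * g)%g = fl g by rewrite scC fl_mulr //; exact: Iw_sc.
exists (sc (n - m - e) * g)%g; split; [exact/esym | by apply/XX_fl; rewrite fE; exists g |].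
by have := dvM (dv_sc k (n - m - e)) gm; rewrite (_ : _ + m = wdeg w + 3 * n) //; lia.
Qed.

(* [fl (g * u x * n1)], for varying [x], are the points in relative position
   [s1] to [fl g]. *)
Lemma u_Iw i y : Iw i -> exists2 y', exists2 i', Iw i' & (i * u y * n1 = u y' * n1 * i')%g & True.
Proof.
move=> [m iI]; have [y' [j [E jI nj]]] := Ig_u_split (IgM iI (Ig_u y)).
exists y' => //; exists (sc (- m) * (n1 * j * n1))%g; first by apply: IwM; [exact: Iw_sc | exact: Ig_Iw].
have {}E : (i * u y = sc (- m) * (u y' * j))%g by rewrite -E !mulgA -scD addNr sc0 mul1g.
apply: gid6 E; [exact: n1n1 | by rewrite scC].
Qed.

Lemma adj_sym g g' x : fl g' = fl (g * u x * n1)%g -> exists y, fl g = fl (g' * u y * n1)%g.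
Proof.
move=> /flE H; have [y [i iI E] _] := u_Iw 0 H; exists y.
have {}E : (g'^-1 * g * u x = u y * n1 * i)%g.
  by rewrite -E u0 mulg1 -!mulgA n1n1 mulg1.
by apply/esym/flE; rewrite (gid7 E) -uN; apply: IwM => //; exact/Ig_Iw/Ig_u.
Qed.

(** The correspondence of Deligne-Lusztig reduction: from [g] to [g'] the relative position is [s1],
    from [g'] to [sg g] it is [s1 w]. It relates the variety of [w] to the variety in which [g']
    lies. *)
Definition E w g g' := (exists x, fl g' = fl (g * u x * n1)%g) /\ D (s1 * w)%g (g'^-1 * sg g)%g.

Lemma E_fl w g g' f f' : fl g = fl f -> fl g' = fl f' -> E w g g' -> E w f f'.
Proof.
move=> gf gf' [[x gx] H]; split.
  have [y [i iI E] _] := u_Iw x ((flE f g).1 (esym gf)); exists y; rewrite -gf' gx.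
  exact: etrans (congr1 (@fl k) (gid8 E)) (fl_mulr _ iI).
have -> : (f'^-1 * sg f = (f'^-1 * g') * (g'^-1 * sg g) * sg (g^-1 * f))%g.
  by rewrite sgM sgV; exact: gid4.
apply: D_mulr; first by apply: sg_Iw; exact/flE.
by apply: D_mull H; exact/flE.
Qed.

Lemma sg_n1 : exists m, sg n1 = (sc m * (P * n1 * P^-1))%g.
Proof.
have [a Ea] := rpM k (tau * s1)%g tau^-1%g; have [b Eb] := rpM k tau s1; have [c Ec] := rpV k tau.
rewrite sg_rp delta_s1 Ea Eb Ec; set m := (- _)%R; exists (m + a + b + c).
by rewrite !scD; apply: gid9; rewrite scC.
Qed.

Section Step.
Variable w : iwahoriWeyl.
Hypothesis wd : rasc (w^-1 * s1)%g.
Local Notation v := (w^-1)%g.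
Local Notation t := (s1 * w * tau)%g.

Lemma s1s1 : (s1 * s1 = 1)%g.
Proof. by congr IW; rewrite /= ?wact0 ?addr0 // tperm2. Qed.

Lemma s1V : (s1^-1 = s1)%g.
Proof. by apply/eqP; rewrite -eq_mulgV1 || (apply/eqP; apply: (mulgI s1); rewrite mulgV s1s1). Qed.

(** Seen from [g], the point [g'] must lead [(hh g)^-1] along its line to the shorter cell; by
    [ratio] there is one such point. *)
Lemma E_pi g g' x : fl g' = fl (g * u x * n1)%g ->
  D (s1 * w)%g (g'^-1 * sg g)%g <-> D (v * s1)%g ((hh g)^-1 * u x * n1)%g.
Proof.
move=> /flE H; have s1w : ((s1 * w)^-1 = v * s1)%g by rewrite invMg s1V.
have E1 : ((hh g)^-1 * u x * n1 = (g'^-1 * sg g)^-1 * (g'^-1 * (g * u x * n1)))%g.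
  exact: gid2.
rewrite E1; split=> [/DV|]; first by rewrite s1w => ?; exact: D_mulr.
by move/(D_mulr (IwV H)); rewrite mulgK => /DV; rewrite invgK -s1w invgK.
Qed.

Lemma E_XX g g' : E w g g' -> XX w (fl g).
Proof.
move=> [[x gx] H]; have [y gy] := adj_sym gx; rewrite gy; apply/XX_fl.
set f := (g' * u y * n1)%g in gy *.
have {}H : D (s1 * w)%g (g'^-1 * sg f)%g.
  have -> : (g'^-1 * sg f = g'^-1 * sg g * sg (g^-1 * f))%g by rewrite (sgM qP g^-1%g f) (sgV qP g); exact: gid3.
  by apply: D_mulr => //; apply: sg_Iw; exact/flE.
have := D_up y wd; rewrite -mulgA s1s1 mulg1 => /(_ (g'^-1 * sg f)^-1%g)H'.
have := DV H; rewrite (_ : (s1 * w)^-1 = v * s1)%g; last by rewrite invMg s1V.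
by move=> /H'/DV; rewrite invgK => H2; apply: D_eq H2; exact: gid10.
Qed.

(** Seen from [g'], the coordinate [z] of [g] enters only through [sg (u z)], hence as [- z ^+ q].
    This is the source of the [q]-th roots. *)
Lemma E_left g g' z : fl g = fl (g' * u z * n1)%g ->
  D (s1 * w)%g (g'^-1 * sg g)%g <-> D t (hh g' * P * u (- z ^+ q)%R * n1)%g.
Proof.
move=> gz; have H : Iw (sg (g^-1 * (g' * u z * n1)))%g by apply: sg_Iw; exact/flE.
have [m Em] := sg_n1.
have eq1 : (g'^-1 * sg g * sg (g^-1 * (g' * u z * n1)) =
    sc m * (hh g' * P * u (- z ^+ q)%R * n1 * P^-1))%g.
  have -> : sg (g^-1 * (g' * u z * n1))%g = ((sg g)^-1 * (sg g' * sg (u z) * sg n1))%g.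
    by rewrite (sgM qP g^-1%g _) (sgV qP g) (sgM qP (g' * u z)%g _) (sgM qP g' _).
  exact: gid12 (scC m) (sg_u qP z) Em.
split=> [Dg|Dg].
  have := D_mulr H Dg => /(D_eq eq1)/(D_mullE _ _ (Iw_sc k m)).1/D_mulP; apply: D_eq; exact: mulgKV.
have {}Dg : D (s1 * w)%g (hh g' * P * u (- z ^+ q)%R * n1 * P^-1)%g.
  by have := D_mulPV Dg; rewrite (mulgK tau).
exact: (D_mulrE _ _ H).1 (D_eq (esym eq1) (D_mull (Iw_sc k m) Dg)).
Qed.

End Step.

End Reduction.

Section Steps.
Variables (k : closedFieldType) (q : nat) (qP : [pchar k].-nat q).
Local Notation L := (laurent k).
Local Notation lg := (lg k).
Local Notation rp := (@rp k).
Local Notation sc := (@sc k).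
Local Notation P := (rp tau).
Local Notation n1 := (rp s1).
Local Notation sg := (sg qP).
Local Notation hh := (hh qP).
Local Notation XX := (XX qP).
Local Notation E := (E qP).

Lemma rascN_lt v : rasc (v * s1)%g -> fpos v 1 < fpos v 0.
Proof. by rewrite /rasc !fpos_s1 tpermL tpermR. Qed.

Lemma lmor_hh : lmor hh.
Proof. by apply: lmorM; [apply: lmorV; exact: lmor_id | apply: lmor_sg; exact: lmor_id]. Qed.

Lemma locfun_rat_a b r e phi : lmor phi -> locfun (fun g : lg => rat_a b r e (phi g)).
Proof.
move=> H; case: b => /=; first by apply: lfun_locfun; apply: lfun_mx.
move=> N; apply: (isalg_opp (@isalg_loc k N)).
have := @lfun_locfun k _ e (lfun_mx 0 r (lmorV H)) N; exact.
Qed.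

Lemma locfun_rat_b b r e phi : lmor phi -> locfun (fun g : lg => rat_b b r e (phi g)).
Proof.
by move=> H; case: b => /=; apply: lfun_locfun; [exact: lfun_mx | exact: (lfun_mx 1 r (lmorV H))].
Qed.

Lemma locfunN f : locfun f -> locfun (fun g : lg => - f g).
Proof. by move=> H N; exact: (isalg_opp (@isalg_loc k N)). Qed.

(* The ratio lemma along a morphism of fixed determinant valuation. *)
Lemma lmor_ratio v N phi : rasc (v * s1)%g -> lmor phi -> exists a b, [/\ locfun a, locfun b &
  forall g : lg, D v (phi g) -> dv N (phi g) -> a g != 0 /\
    forall x, D (v * s1)%g (phi g * u x * n1)%g <-> x * a g = b g].
Proof.
move=> vd H; have [b [r [e re]]] := @ratio k v N (rascN_lt vd) vd.
exists (fun g => rat_a b r e (phi g)), (fun g => - rat_b b r e (phi g)); split.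
- exact: locfun_rat_a.
- by apply: locfunN; exact: locfun_rat_b.
move=> g gD gN; have [a0 HR] := re _ gD gN; split=> // x; rewrite HR.
split=> [/eqP|->]; last by rewrite subrr.
by rewrite addrC addr_eq0 => /eqP.
Qed.

Lemma dv_hh n g : dv n g -> dv (- n - n) (hh g).
Proof. by move=> gn; exact: dvM (dvV gn) (dv_sg qP gn). Qed.

Lemma Kg_n1 : Kg n1.
Proof.
apply: glOP => [i j|]; first by rewrite mx_rp repE bary0; case: eqP => _; [rewrite expr0z; exact: inO1 | exact: inO0].
by have [_] := dv_rp k s1; rewrite /wdeg !big_ord_recl big_ord0 !bary0.
Qed.

Lemma pcK (y : lg) : Kg y -> pc 0 y.
Proof. by move=> yK i j; split; apply: glO_inO => //; exact: KgV. Qed.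

Lemma bd_K m (g y : lg) : Kg y -> bd (fun _ _ _ _ => - m%:Z) g -> bd (fun _ _ _ _ => - m%:Z) (g * y)%g.
Proof.
by move=> /pcK yK gb; have := bd_mul (pcK (Kg1 k)) yK gb; rewrite mul1g !addn0.
Qed.

Lemma Kg_un1 x : Kg (u x * n1)%g.
Proof. by apply: KgM; [exact/Ig_Kg/Ig_u | exact: Kg_n1]. Qed.

Section Step.
Variable w : iwahoriWeyl.
Hypothesis wd : rasc (w^-1 * s1)%g.
Local Notation v := (w^-1)%g.
Local Notation t := (s1 * w * tau)%g.
Definition ws := (s1 * w * (tau * s1 * tau^-1))%g.

Definition Cond (g' : lg) z := D t (hh g' * P * u (- z ^+ q)%R * n1)%g.

Lemma XX_t w' g : D (w' * tau)%g (hh g * P)%g <-> XX w' (fl g).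
Proof.
split=> [/D_mulPV H|/XX_fl/D_mulP //]; apply/XX_fl; rewrite (mulgK tau) in H.
by apply: D_eq H; exact: mulgK.
Qed.

Lemma ws_t : (ws * tau = t * s1)%g.
Proof. by rewrite /ws -!mulgA mulVg mulg1. Qed.

Lemma pi_ex (c : int) : exists a b, [/\ locfun a, locfun b & forall g : lg, XX w (fl g) -> dv c g -> a g != 0 /\
   forall x g', fl g' = fl (g * u x * n1)%g -> (D (s1 * w)%g (g'^-1 * sg g)%g <-> x * a g = b g)].
Proof.
have [a [b [la lb H]]] := @lmor_ratio v (- (- c - c)) (fun g => (hh g)^-1)%g wd (lmorV lmor_hh).
exists a, b; split=> // g /XX_fl/DV gD gc; have [a0 Hx] := H g gD (dvV (dv_hh gc)).
by split=> // x g' /(E_pi qP w) ->.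
Qed.

Lemma E_ex x : XX w x -> exists g g', x = fl g /\ E w g g'.
Proof.
move=> xX; have [g [xE gD gc]] := XX_dv xX 0; have [a [b [_ _ H]]] := pi_ex (wdeg w + 3 * 0).
rewrite xE in xX; have [a0 Hx] := H g xX gc; exists g, (g * u (b g / a g) * n1)%g; split=> //.
by split; [exists (b g / a g) | apply/(Hx (b g / a g)) => //; rewrite divfK].
Qed.

Lemma E_Cond g g' : E w g g' -> exists2 z, fl g = fl (g' * u z * n1)%g & Cond g' z.
Proof.
move=> [[x gx] H]; have [z gz] := adj_sym gx; exists z => //.
exact: (E_left qP w gz).1.
Qed.

Lemma Cond_E g' z : Cond g' z -> E w (g' * u z * n1)%g g'.
Proof.
move=> H; split; last exact: (E_left qP w erefl).2.
have [x Hx] := @adj_sym k g' (g' * u z * n1)%g z erefl; by exists x.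
Qed.

(** Going back from [g'] to [g] multiplies by an element of [Kg], which does not affect the bound on
    the distance to [l]. *)
Lemma step_near (S : set lg) r x : XX w x ->
  (forall g g', E w g g' -> exists f l, [/\ fl g' = fl f, S l & bd (fun _ _ _ _ => - r%:Z) (l^-1 * f)%g]) ->
  exists f l, [/\ x = fl f, S l & bd (fun _ _ _ _ => - r%:Z) (l^-1 * f)%g].
Proof.
move=> /E_ex[g [g' [-> Egg]]] H; have [f [l [gf Sl lf]]] := H _ _ Egg.
have [z gz _] := E_Cond (E_fl (erefl (fl g)) gf Egg).
exists (f * u z * n1)%g, l; split=> //.
have -> : (l^-1 * (f * u z * n1) = l^-1 * f * (u z * n1))%g by rewrite !mulgA.
by apply: bd_K lf; exact: Kg_un1.
Qed.

Lemma E_Bd m g g' : E w g g' -> Bd m (fl g) -> Bd m (fl g').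
Proof.
move=> [[x gx] _] [f gf fb]; have [y [i iI E] _] := u_Iw x ((flE f g).1 (esym gf)).
exists (f * u y * n1)%g.
  by rewrite gx; have := gid8 E => E2; exact: etrans (congr1 (@fl k) E2) (fl_mulr _ iI).
by rewrite -mulgA; apply: bd_K fb; exact: Kg_un1.
Qed.

End Step.

Lemma covered_sub c d (X Y : set (flag k)) : Y `<=` X -> covered c d X -> covered c d Y.
Proof. by move=> YX H; apply: (cov_union H H) => y /YX; left. Qed.

Lemma covered_le c d d' (X : set (flag k)) : (d <= d')%N -> covered c d X -> covered c d' X.
Proof.
move=> dd; elim=> [T G phi {}X Gd H pd XP|X1 X2 Z _ H1 _ H2 sub]; last exact: cov_union H1 H2 sub.
by apply: (@cov_family k c d' T G phi) => //; exact: gr_le Gd.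
Qed.

Lemma covered0 c d : covered c d (set0 : set (flag k)).
Proof.
have G0 : gr (set0 : set (False -> k)) d by apply: (gr_le (leq0n d)); apply: gr_unit => -[].
apply: (@cov_family k c d False set0 (fun f => match f with end)) => //.
by move=> i j; split; split; try (by exists 0 => -[]); move=> n; exists 0%N; apply: (fil_ext (f := fun=> 0)) (fil_const _ 0 _) => -[].
Qed.

Lemma regmx_fst (T : Type) (G : set (T -> k)) phi : regmx (alg G) phi ->
  regmx (alg (gen_prod G)) (fun t : T * k => phi t.1).
Proof.
move=> H; have sub f : alg G f -> alg (gen_prod G) (fun t => f t.1).
  by apply: (@alg_comp k T _ fst) => c Gc; apply: alg_gen; left; exists c.
move=> i j; have [[[m Hm] Hc] [[m' Hm'] Hc']] := H i j; split; split.
- by exists m => t; exact: Hm.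
- by move=> n; exact: (sub (fun t => coefL (mx (phi t) i j) n)).
- by exists m' => t; exact: Hm'.
- by move=> n; exact: (sub (fun t => coefL (mx (phi t)^-1%g i j) n)).
Qed.

Lemma dv_un1 c (g : lg) x : dv c g -> dv c (g * u x * n1)%g.
Proof.
move=> gc; have := dvM (dvM gc (dv_Ig (Ig_u x))) (dvK Kg_n1).
by rewrite !addr0.
Qed.

Lemma covered_line c d (X Y : set (flag k)) : covered c d Y ->
  (forall x, X x -> exists2 y, Y y & forall g', y = fl g' -> exists z, x = fl (g' * u z * n1)%g) ->
  covered c d.+1 X.
Proof.
move=> cY; elim: cY X => [T G phi {}Y Gd H pd YP|Y1 Y2 Z _ H1 _ H2 sub] X HX.
  apply: (@cov_family k c d.+1 _ (gen_prod G) (fun t => phi t.1 * u t.2 * n1)%g).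
  - exact: gr_prod.
  - apply: (regmxM alg_isalg); last exact: (regmx_const alg_isalg).
    apply: (regmxM alg_isalg); first exact: regmx_fst.
    by apply: (regmx_u alg_isalg); apply: alg_gen; right.
  - by move=> t; apply: dv_un1.
  - by move=> x /HX[y /YP[t yE] /(_ _ yE)[z ->]]; exists (t, z).
pose Xi (Yi : set (flag k)) := [set x | X x /\ exists2 y, Yi y & forall g', y = fl g' -> exists z, x = fl (g' * u z * n1)%g].
apply: (@cov_union k c d.+1 (Xi Y1) (Xi Y2)).
- by apply: H1 => x [_].
- by apply: H2 => x [_].
- by move=> x Xx; have [y /sub[Yy|Yy] Hy] := HX x Xx; [left | right]; split=> //; exists y.
Qed.

Lemma locfun_family (T : Type) (G : set (T -> k)) (phi : T -> lg) a : regmx (alg G) phi -> locfun a ->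
  alg G (a \o phi).
Proof.
move=> H la; have [N HN] := regmx_pc H; have [f fa fE] := la N.
rewrite (_ : a \o phi = f \o phi); first exact: (alg_regmx alg_isalg H).
by apply: funext => t; have := congr1 (fun F => F (exist _ (phi t) (HN t))) fE.
Qed.

(** The new coordinate is a [q]-th root of a quotient of functions of the family, so by [gr_dom] the
    growth does not increase. *)
Lemma covered_root c d (X Y : set (flag k)) a b : covered c d Y -> locfun a -> locfun b ->
  (forall x, X x -> exists2 y, Y y & forall g', y = fl g' -> dv c g' ->
     exists z, [/\ x = fl (g' * u z * n1)%g, a g' != 0 & z ^+ q * a g' = b g']) ->
  covered c d X.
Proof.
move=> cY la lb; elim: cY X => [T G phi {}Y Gd H pd YP|Y1 Y2 Z _ H1 _ H2 sub] X HX.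
  pose T' := {t : T * k | a (phi t.1) != 0 /\ t.2 ^+ q * a (phi t.1) = b (phi t.1)}.
  pose G' : set (T' -> k) := [set (fun t : T' => f (sval t)) | f in gen_prod G].
  have [Ka aK] := locfun_family H la; have [Kb bK] := locfun_family H lb.
  apply: (@cov_family k c d T' G' (fun t => phi (sval t).1 * u (sval t).2 * n1)%g).
  - apply: (@gr_dom k T T' G G' (fun t => (sval t).1) (a \o phi) (q + Ka + Kb)%N q d qP) => //.
    + by apply: fil_le aK; lia.
    + by move=> [t []].
    + move=> _ [_ [[f Gf <-]|->] <-].
        exists (fun t => f t ^+ q * (a \o phi) t) => //.
        apply: fil_le (fil_mul (fil_exp q (fil_gen 0 Gf)) aK); lia.
      exists (b \o phi) => [|[t []] //]; by apply: fil_le bK; lia.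
  - have H' : regmx (alg (gen_prod G)) (fun t => phi t.1 * u t.2 * n1)%g.
      apply: (regmxM alg_isalg); last exact: (regmx_const alg_isalg).
      apply: (regmxM alg_isalg); first exact: regmx_fst.
      by apply: (regmx_u alg_isalg); apply: alg_gen; right.
    have sub f : alg (gen_prod G) f -> alg G' (fun t : T' => f (sval t)).
      by apply: (@alg_comp k _ T' (fun t => sval t)) => e Ge; apply: alg_gen; exists e.
    move=> i j; have [[[m Hm] Hc] [[m' Hm'] Hc']] := H' i j; split; split.
    + by exists m => t; exact: Hm.
    + by move=> n; exact: (sub _ (Hc n)).
    + by exists m' => t; exact: Hm'.
    + by move=> n; exact: (sub _ (Hc' n)).
  - by move=> t; apply: dv_un1.
  - move=> x /HX[y /YP[t yE] /(_ _ yE (pd t))[z [xE a0 zab]]].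
    by exists (exist _ (t, z) (conj a0 zab)).
pose Xi (Yi : set (flag k)) := [set x | X x /\ exists2 y, Yi y & forall g', y = fl g' -> dv c g' ->
     exists z, [/\ x = fl (g' * u z * n1)%g, a g' != 0 & z ^+ q * a g' = b g']].
apply: (@cov_union k c d (Xi Y1) (Xi Y2)).
- by apply: H1 => x [_].
- by apply: H2 => x [_].
- by move=> x Xx; have [y /sub[Yy|Yy] Hy] := HX x Xx; [left | right]; split=> //; exists y.
Qed.

End Steps.

Lemma gid13 (gT : groupType) (g x y n : gT) :
  ((g * x * n)^-1 * (g * y * n) = n^-1 * (x^-1 * y) * n)%g.
Proof. by rewrite !invMg -!mulgA mulKg. Qed.

Section StepTheorems.
Variables (k : closedFieldType) (q : nat) (qP : [pchar k].-nat q).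
Local Notation L := (laurent k).
Local Notation lg := (lg k).
Local Notation rp := (@rp k).
Local Notation sc := (@sc k).
Local Notation P := (rp tau).
Local Notation n1 := (rp s1).
Local Notation sg := (sg qP).
Local Notation hh := (hh qP).
Local Notation XX := (XX qP).
Local Notation E := (E qP).
Local Notation Cond := (Cond qP).

Lemma expq_inj (x y : k) : x ^+ q = y ^+ q -> x = y.
Proof.
move=> xy; apply/eqP; rewrite -subr_eq0; have : (x - y) ^+ q == 0.
  by rewrite (expqD qP) (expqN qP) xy subrr.
by rewrite expf_eq0 => /andP[].
Qed.

Lemma un1_inj (g : lg) x y : fl (g * u x * n1)%g = fl (g * u y * n1)%g -> x = y.
Proof.
move=> /flE; have -> : ((g * u x * n1)^-1 * (g * u y * n1) = n1 * u (y - x)%R * n1)%g.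
  by apply: etrans (gid13 _ _ _ _) _; rewrite n1V -uN -uD addrC.
move=> /Iw_dv0 H; have {H} : Ig (n1 * u (y - x)%R * n1)%g.
  by apply: H; apply: dv_un1; exact: (dvK (Kg_n1 k)).
move=> /(@iwahoriGL_inO _ _ 0 1)/(_ 0 isT); rewrite conj_n1 tpermL tpermR -[u _]mul1g mulu_mx mx1 !mxE /= mulr1n mulr1 add0r.
by rewrite coefL_const /= mulr1n => /eqP; rewrite subr_eq0 => /eqP.
Qed.

Section Step.
Variable w : iwahoriWeyl.
Hypothesis wd : rasc (w^-1 * s1)%g.
Local Notation v := (w^-1)%g.
Local Notation t := (s1 * w * tau)%g.
Local Notation ws := (ws w).

Definition RR (Y : set (flag k)) x y := Y y /\ exists g g', [/\ x = fl g, y = fl g' & E w g g'].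

(** Continuity towards [Y] comes from [pi_ex], since [g'] is represented by [g * u (b / a) * n1].
    Openness and irreducibility of the fibres depend on the admissible [z] and are left to the
    applications. *)
Lemma fib_gen c Y : (forall y, Y y -> exists2 g', y = fl g' & dv c g') ->
  (forall U, open U -> exists2 O, lopen O & forall g', Y (fl g') -> dv c g' ->
     (O g' <-> exists2 z, Cond w g' z & U (fl (g' * u z * n1)%g))) ->
  (forall g', Y (fl g') -> dv c g' -> irreducible [set fl (g' * u z * n1)%g | z in Cond w g']) ->
  fibration (XX w) Y (RR Y).
Proof.
move=> Yc Yo Yi; split.
- by move=> x y [Yy [g [g' [-> _ /(E_XX wd)]]]].
- move=> V oV; have [a [b [la lb H]]] := pi_ex qP wd (wdeg w + 3 * 0).
  have p1 : [pchar k].-nat 1%N by [].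
  have oO := lopen_root p1 la lb (lopen_open oV).
  eexists; first exact: (open_sat (lopenI (@lopen_dv k (wdeg w + 3 * 0)) oO)).
  move=> x y [Yy [g [g' [xE yE Egg]]]]; split.
    move=> [g2 [dg2 [a0 [x0 x0E Vx0]]] g2E].
    have E2 : E w g2 g' by apply: E_fl Egg => //; rewrite g2E.
    have Xg2 : XX w (fl g2) by rewrite g2E xE; exact: (E_XX wd Egg).
    have [[x1 gx1] D1] := E2; have [_ Hx] := H g2 Xg2 dg2.
    have x10 : x1 * a g2 = x0 ^+ 1 * a g2 by rewrite x0E; exact: (Hx x1 g' gx1).1 D1.
    by rewrite yE gx1 (mulIf a0 x10) expr1.
  move=> Vy; have Xx : XX w x by rewrite xE; exact: (E_XX wd Egg).
  have [g2 [xE2 _ dg2]] := XX_dv Xx 0; exists g2 => //; split=> //.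
  have E2 : E w g2 g' by apply: E_fl Egg => //; rewrite -xE.
  have [[x1 gx1] D1] := E2; rewrite xE2 in Xx; have [a0 Hx] := H g2 Xx dg2.
  by split=> //; exists x1; [rewrite expr1; exact: (Hx x1 g' gx1).1 D1 | rewrite /= -gx1 -yE].
- move=> U oU; have [O oO OP] := Yo U oU.
  eexists; first exact: (open_sat (lopenI (@lopen_dv k c) oO)).
  move=> y Yy; split.
    move=> [g [dg Og] gE]; rewrite -gE in Yy *.
    have [z Cz Uz] := (OP g Yy dg).1 Og; exists (fl (g * u z * n1)%g) => //.
    by split=> //; exists (g * u z * n1)%g, g; split=> //; exact: Cond_E.
  move=> [x [_ [g [g' [xE yE Egg]]]] Ux]; have [g2 yE2 dg2] := Yc y Yy.
  have E2 : E w g g2 by apply: E_fl Egg => //; rewrite -yE.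
  have [z gz Cz] := E_Cond E2; exists g2 => //; split=> //.
  by rewrite yE2 in Yy; apply/(OP g2 Yy dg2); exists z; rewrite -?gz -?xE.
- move=> y Yy; have [g' yE dg'] := Yc y Yy; rewrite yE in Yy *.
  suff -> : [set x | RR Y x (fl g')] = [set fl (g' * u z * n1)%g | z in Cond w g'] by exact: Yi.
  apply/seteqP; split=> [x [_ [g [g2 [-> g2E Egg]]]]|_ [z Cz <-]].
    have E2 : E w g g' by apply: E_fl Egg.
    by have [z gz Cz] := E_Cond E2; exists z.
  by split=> //; exists (g' * u z * n1)%g, g'; split=> //; exact: Cond_E.
Qed.

(** The admissible [z] avoid the roots of a nonzero polynomial, so a fibre is a nonempty open part
    of a line, irreducible and infinite. *)
Lemma fib_poly c Y (p : lg -> {poly k}) : (forall y, Y y -> exists2 g', y = fl g' & dv c g') ->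
  (forall z, locfun (fun g => (p g).[z])) ->
  (forall g', Y (fl g') -> dv c g' -> p g' != 0 /\ forall z, Cond w g' z <-> (p g').[z] != 0) ->
  fibration (XX w) Y (RR Y) /\ forall y, Y y -> forall x, exists2 x', RR Y x' y & x' <> x.
Proof.
move=> Yc pl pP; split.
  apply: (@fib_gen c) => // [U oU|g' Yg dg].
    exists (\bigcup_(z in setT) ([set g | (p g).[z] != 0] `&` [set g | U (fl (g * u z * n1)%g)])).
      apply: lopenU => z _; apply: lopenI; first exact: lopen_locfun.
      apply: (@lopen_pre k (fun g => g * u z * n1)%g (fun g => U (fl g))); last exact: lopen_open.
      by apply: lmorM; [apply: lmorM; [exact: lmor_id | exact: lmor_const] | exact: lmor_const].
    move=> g' Yg dg; have [_ H] := pP g' Yg dg.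
    by split=> [[z _ [/(H z) ? ?]]|[z /(H z) ? ?]]; exists z.
  have [p0 H] := pP g' Yg dg; pose T := {z | (p g').[z] != 0}.
  have /closed_nonrootP[z0] := p0; rewrite rootE => z00.
  pose A : set (T -> k) := [set F | exists Q : {poly k}, F = fun s => Q.[sval s]].
  have hA : isalg A.
    split=> [c0|_ _ [Q ->] [Q' ->]|_ _ [Q ->] [Q' ->]].
    - by exists c0%:P; apply: funext => s; rewrite hornerC.
    - by exists (Q + Q'); apply: funext => s; rewrite hornerD.
    - by exists (Q * Q'); apply: funext => s; rewrite hornerM.
  have dA : domA A.
    move=> _ _ [Q ->] [Q' ->] [s Qs] [s' Qs'].
    have Q0 : Q != 0 by apply: contraNneq Qs => ->; rewrite horner0.
    have Q0' : Q' != 0 by apply: contraNneq Qs' => ->; rewrite horner0.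
    have /closed_nonrootP[z] : Q * Q' * p g' != 0 by rewrite !mulf_neq0.
    rewrite rootE !hornerM !mulf_eq0 !negb_or => /andP[/andP[? ?] pz].
    by exists (exist _ z pz).
  rewrite (_ : [set _ | _ in _] = [set fl (g' * u (sval s) * n1)%g | s in [set: T]]).
    apply: (family_irr (exist _ z0 z00) hA dA).
    apply: (regmxM hA); last exact: (regmx_const hA).
    apply: (regmxM hA); first exact: (regmx_const hA).
    by apply: (regmx_u hA); exists 'X; apply: funext => s; rewrite hornerX.
  apply/seteqP; split=> [_ [z /(H z) pz <-]|_ [[z pz] _ <-]].
    by exists (exist _ z pz).
  by exists z => //; apply/H.
move=> y Yy x; have [g' yE dg] := Yc y Yy; rewrite yE in Yy *.
have [p0 H] := pP g' Yy dg.
have /closed_nonrootP[z0] := p0; rewrite rootE => z00.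
have R z : (p g').[z] != 0 -> RR Y (fl (g' * u z * n1)%g) (fl g').
  by move=> pz; split=> //; exists (g' * u z * n1)%g, g'; split=> //; apply: Cond_E; exact/H.
have [xz|xz] := pselect (fl (g' * u z0 * n1)%g = x); last by exists (fl (g' * u z0 * n1)%g); [exact: R |].
have /closed_nonrootP[z1] : p g' * ('X - z0%:P) != 0 by rewrite mulf_neq0 ?polyXsubC_eq0.
rewrite rootE hornerM mulf_eq0 negb_or => /andP[pz1]; rewrite !hornerE subr_eq0 => z10.
exists (fl (g' * u z1 * n1)%g); first exact: R.
by rewrite -xz => /un1_inj z1E; rewrite z1E eqxx in z10.
Qed.

Lemma fib_root c Y a b : (forall y, Y y -> exists2 g', y = fl g' & dv c g') -> locfun a -> locfun b ->
  (forall g', Y (fl g') -> dv c g' -> a g' != 0 /\ forall z, Cond w g' z <-> z ^+ q * a g' = b g') ->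
  fibration (XX w) Y (RR Y).
Proof.
move=> Yc la lb pP; have q0 : (0 < q)%N by case/andP: qP.
apply: (@fib_gen c) => // [U oU|g' Yg dg].
  exists [set g | a g != 0 /\ exists2 x, x ^+ q * a g = b g & U (fl (g * u x * n1)%g)].
    exact: (lopen_root qP la lb (lopen_open oU)).
  move=> g' Yg dg; have [a0 H] := pP g' Yg dg.
  by split=> [[_ [z /(H z) ? ?]]|[z /(H z) ? ?]]; [exists z | split=> //; exists z].
have [a0 H] := pP g' Yg dg; have [r rP] := @root_ex k q q0.
rewrite (_ : [set _ | _ in _] = [set fl (g' * u (r (b g' / a g'))%R * n1)%g]); first exact: irr1.
apply/seteqP; split=> [_ [z /(H z) zE <-]|_ ->] /=.
  by have <- : z = r (b g' / a g') by apply: expq_inj; rewrite rP -zE mulfK.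
by exists (r (b g' / a g')) => //; apply/H; rewrite rP divfK.
Qed.

Variable S : set lg.

(** [Cov] treats all determinant valuations that occur by [XX_dv]. In [Near], the set [S] will be
    that of the invariant lattices [Lam]. *)
Definition Cov w d := forall (n : int) m, covered (wdeg w + 3 * n) d (XX w `&` Bd m).
Definition Near w := exists r : nat, forall x, XX w x ->
  exists f l, [/\ x = fl f, S l & bd (fun _ _ _ _ => - r%:Z) (l^-1 * f)%g].

Lemma near_le r r' x : (r <= r')%N ->
  (exists f l, [/\ x = fl f, S l & bd (fun _ _ _ _ => - r%:Z) (l^-1 * f)%g]) ->
  exists f l, [/\ x = fl f, S l & bd (fun _ _ _ _ => - r'%:Z) (l^-1 * f)%g].
Proof.
move=> rr [f [l [xE Sl H]]]; exists f, l; split=> // i j i' j'.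
by apply: inO_le (H i j i' j'); lia.
Qed.

Lemma wdeg_s1w : exists n : int, wdeg (s1 * w)%g = wdeg w + 3 * n.
Proof.
have [n E1] := wdegM qP s1 w; exists n; rewrite E1 (_ : wdeg s1 = 0) ?add0r //.
by rewrite /wdeg !big_ord_recl big_ord0 !bary0.
Qed.

Lemma wdeg_ws : exists n : int, wdeg ws = wdeg w + 3 * n.
Proof.
have [n E1] := wdeg_s1w; have [n' E2] := wdegM qP (s1 * w)%g (tau * s1 * tau^-1)%g.
exists (n + n'); rewrite /ws E2 E1 -delta_s1 (_ : wdeg (delta s1) = 0); first by lia.
by rewrite /wdeg !big_ord_recl big_ord0 /= /barycentric /=.
Qed.

Lemma XX_rep w' (n : int) : (exists n' : int, wdeg w' = wdeg w + 3 * n') ->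
  forall y, XX w' y -> exists2 g', y = fl g' & dv (wdeg w + 3 * n) g'.
Proof.
move=> [n' E1] y yX; have [g [yE _ dg]] := XX_dv yX (n - n').
by exists g => //; rewrite (_ : wdeg w + 3 * n = wdeg w' + 3 * (n - n')) //; lia.
Qed.

Lemma Cov_rep w' d (n : int) m : (exists n' : int, wdeg w' = wdeg w + 3 * n') -> Cov w' d ->
  covered (wdeg w + 3 * n) d (XX w' `&` Bd m).
Proof.
move=> [n' E1] H; rewrite (_ : wdeg w + 3 * n = wdeg w' + 3 * (n - n')); [exact: H | lia].
Qed.

Section Shorter.
Hypothesis ta : rasc (t * s1)%g.

Lemma E_shorter g g' : E w g g' -> XX ws (fl g') \/ XX (s1 * w)%g (fl g').
Proof.
move=> /E_Cond[z _ Cz]; set x := u (- z ^+ q)%R; set Z := (hh g' * P * x * n1)%g.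
have E1 : (Z * u 0 * n1 * x^-1 = hh g' * P)%g.
  by rewrite u0 mulg1 /Z -(mulgA _ n1 n1) n1n1 mulg1 mulgK.
have Ix : Iw (x^-1)%g by apply: IwV; exact/Ig_Iw/Ig_u.
case: (D_down 0 ta Cz) => /(D_mulr Ix)/(D_eq E1) H; [right | left].
  exact: (XX_t qP (s1 * w)%g g').1.
by apply: (XX_t qP ws g').1; rewrite ws_t.
Qed.

(** Here [hh g' * P] lies in the shorter cell [t s1], and by [D_up] every [z] leads to [t]: the
    fibres are affine lines. *)
Lemma fib_ws : fibration (XX w) (XX ws) (RR (XX ws)) /\
  forall y, XX ws y -> forall x, exists2 x', RR (XX ws) x' y & x' <> x.
Proof.
apply: (@fib_poly (wdeg w + 3 * 0) (XX ws) (fun=> 1)); first exact: (XX_rep 0 wdeg_ws).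
  by move=> z N; exists (fun=> 1); [exact: alg_const | apply: funext => g; rewrite hornerE].
move=> g' Yg _; split=> [|z]; first exact: oner_neq0.
split=> [_|_]; first by rewrite hornerE oner_neq0.
have := (XX_t qP ws g').2 Yg; rewrite ws_t => /(D_up (- z ^+ q) ta).
by rewrite -mulgA s1s1 mulg1.
Qed.

(** Here [hh g' * P] already lies in the cell of [t], and every value of [- z ^+ q] except the one
    of [ratio] keeps it there: the fibres are lines without the root of [b + a z^q]. *)
Lemma fib_s1w : fibration (XX w) (XX (s1 * w)%g) (RR (XX (s1 * w)%g)) /\
  forall y, XX (s1 * w)%g y -> forall x, exists2 x', RR (XX (s1 * w)%g) x' y & x' <> x.
Proof.
have lP : lmor (fun g => hh g * P)%g by apply: lmorM; [exact: lmor_hh | exact: lmor_const].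
pose c := wdeg w + 3 * 0.
have [a [b [la lb H]]] := lmor_ratio (- c - c + 1) ta lP.
have q0 : (0 < q)%N by case/andP: qP.
apply: (@fib_poly c _ (fun g => (b g)%:P + a g *: 'X^q)); first exact: (XX_rep 0 wdeg_s1w).
  move=> z N; have [_ AD AM] := @isalg_loc k N.
  have Az : @locA k N (fun=> z ^+ q) by exists (fun=> z ^+ q) => //; exact: alg_const.
  rewrite (_ : _ \o _ = fun s => b (sval s) + a (sval s) * z ^+ q); last first.
    by apply: funext => s; rewrite /= !hornerE.
  exact: (AD _ _ (lb N) (AM _ _ (la N) Az)).
move=> g' Yg dg; have Dt := (XX_t qP (s1 * w)%g g').2 Yg.
have dP : dv (- c - c + 1) (hh g' * P)%g.
  apply: dvM (dv_hh qP dg) _; have := dv_rp k tau.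
  by rewrite /wdeg !big_ord_recl big_ord0 tr_tau /barycentric.
have [a0 Hx] := H g' Dt dP; split=> [|z].
  apply: contraNneq a0 => /(congr1 (fun p : {poly k} => p`_q)).
  by rewrite coefD coefC coefZ coefXn eqxx mulr1 coef0 gtn_eqF ?add0r // => ->.
have -> : ((b g')%:P + a g' *: 'X^q).[z] = b g' - (- z ^+ q) * a g' by rewrite !hornerE; ring.
have HD := Hx (- z ^+ q); rewrite subr_eq0; split=> [Ct|ne].
  apply/eqP => E1; have := HD.2 (esym E1) => D2; have := D_inj qP Ct D2.
  by move=> /(canLR (mulKg t))/esym; rewrite mulVg => /(congr1 lin)/(congr1 (fun s : 'S_3 => s 0)); rewrite /= tpermL perm1.
case: (D_down (- z ^+ q) ta Dt) => [H1|/HD E1]; first exact: H1.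
by rewrite E1 eqxx in ne.
Qed.

Theorem step_shorter d : (Cov ws d -> Cov (s1 * w)%g d -> Cov w d.+1) /\
  (Near ws -> Near (s1 * w)%g -> Near w).
Proof.
split=> [C1 C2 n m|[r1 H1] [r2 H2]].
  apply: (@covered_line k _ d _ ((XX ws `|` XX (s1 * w)%g) `&` Bd m)).
    apply: (cov_union (Cov_rep n m wdeg_ws C1) (Cov_rep n m wdeg_s1w C2)).
    by move=> x [[?|?] ?]; [left|right].
  move=> x [xX xm]; have [g [g' [xE Egg]]] := E_ex wd xX; exists (fl g').
    by split; [exact: E_shorter Egg | apply: (E_Bd Egg); rewrite -xE].
  move=> g2 gE; have [z gz _] := E_Cond (E_fl (erefl (fl g)) gE Egg); exists z.
  by rewrite xE.
exists (maxn r1 r2) => x xX; apply: (step_near wd xX) => g g' /E_shorter[/H1|/H2]; apply: near_le.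
  exact: leq_maxl.
exact: leq_maxr.
Qed.

End Shorter.

Section Same.
Hypothesis ta : rasc t.

Lemma E_same g g' : E w g g' -> XX ws (fl g').
Proof.
move=> /E_Cond[z _ Cz]; set x := u (- z ^+ q)%R; set Z := (hh g' * P * x * n1)%g.
have E1 : (Z * u 0 * n1 * x^-1 = hh g' * P)%g.
  by rewrite u0 mulg1 /Z -(mulgA _ n1 n1) n1n1 mulg1 mulgK.
have Ix : Iw (x^-1)%g by apply: IwV; exact/Ig_Iw/Ig_u.
have /(D_mulr Ix)/(D_eq E1) H := D_up 0 ta Cz.
by apply: (XX_t qP ws g').1; rewrite ws_t.
Qed.

(** Now [hh g' * P] lies in the longer cell [t s1] and has to come down to [t]. By [ratio] this
    happens for one value of [- z ^+ q], hence for one [z]. *)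
Lemma same_root (n : int) : exists a b, [/\ locfun a, locfun b & forall g', XX ws (fl g') ->
  dv (wdeg w + 3 * n) g' -> a g' != 0 /\ forall z, Cond w g' z <-> z ^+ q * a g' = b g'].
Proof.
have lP : lmor (fun g => hh g * P)%g by apply: lmorM; [exact: lmor_hh | exact: lmor_const].
pose c := wdeg w + 3 * n; have tss : (t * s1 * s1 = t)%g by rewrite -mulgA s1s1 mulg1.
have ta' : rasc (t * s1 * s1)%g by rewrite tss.
have [a [b [la lb H]]] := lmor_ratio (- c - c + 1) ta' lP.
exists a, (fun g => - b g); split=> //; first exact: locfunN.
move=> g' Yg dg; have := (XX_t qP ws g').2 Yg; rewrite ws_t => Dt.
have dP : dv (- c - c + 1) (hh g' * P)%g.
  apply: dvM (dv_hh qP dg) _; have := dv_rp k tau.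
  by rewrite /wdeg !big_ord_recl big_ord0 tr_tau /barycentric.
have [a0 Hx] := H g' Dt dP; split=> // z; have := Hx (- z ^+ q); rewrite tss => HD.
rewrite /Defs.tau in HD *; split=> [/HD <-|E1]; first by rewrite mulNr opprK.
by apply/HD; rewrite mulNr E1 opprK.
Qed.

Lemma fib_same : fibration (XX w) (XX ws) (RR (XX ws)).
Proof.
have [a [b [la lb H]]] := same_root 0.
exact: (fib_root (XX_rep 0 wdeg_ws) la lb H).
Qed.

Theorem step_same d : (Cov ws d -> Cov w d) /\ (Near ws -> Near w).
Proof.
split=> [C1 n m|[r H]]; last by exists r => x xX; apply: (step_near wd xX) => g g' /E_same/H.
have [a [b [la lb H]]] := same_root n.
apply: (@covered_root k q qP _ d _ _ a b (Cov_rep n m wdeg_ws C1)) => // x [xX xm].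
have [g [g' [xE Egg]]] := E_ex wd xX; exists (fl g').
  by split; [exact: E_same Egg | apply: (E_Bd Egg); rewrite -xE].
move=> g2 gE dg; have [z gz Cz] := E_Cond (E_fl (erefl (fl g)) gE Egg).
have Yg : XX ws (fl g2) by rewrite -gE; exact: E_same Egg.
by have [a0 Hz] := H g2 Yg dg; exists z; split=> //; [rewrite xE | exact/Hz].
Qed.

End Same.
End Step.
End StepTheorems.

Lemma gid14 (gT : groupType) (g s p c : gT) : (forall x, c * x = x * c)%g ->
  ((g * p)^-1 * (s * (c * p^-1)) = c * (p^-1 * (g^-1 * s) * p^-1))%g.
Proof. by move=> cC; rewrite invMg -!mulgA (mulgA s c) -cC -!mulgA (mulgA g^-1 c)%g -cC -!mulgA (mulgA p^-1 c)%g -cC -!mulgA. Qed.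

Lemma gid15 (gT : groupType) (t w : gT) : (t * (t^-1 * w * t^-1) * t = w)%g.
Proof. by rewrite !mulgA mulgV mul1g mulgKV. Qed.

(** * Conjugation by [tau] *)

Section Rotation.
Variables (k : closedFieldType) (q : nat) (qP : [pchar k].-nat q).
Local Notation L := (laurent k).
Local Notation lg := (lg k).
Local Notation rp := (@rp k).
Local Notation sc := (@sc k).
Local Notation P := (rp tau).
Local Notation sg := (sg qP).
Local Notation hh := (hh qP).
Local Notation XX := (XX qP).

(** The [delta]-conjugate of [w] by [tau^-1], since [delta] inverts [tau]. *)
Definition rot w := (tau^-1 * w * tau^-1)%g.

Lemma sg_P : exists m, sg P = (sc m * P^-1)%g.
Proof.
have [c Ec] := rpV k tau; exists (- ((tr tau).1 + (tr tau).2) + c).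
by rewrite sg_rp delta_tau Ec scD mulgA.
Qed.

Lemma hh_P g : exists m, hh (g * P)%g = (sc m * (P^-1 * hh g * P^-1))%g.
Proof.
have [m Em] := sg_P; exists m.
have -> : hh (g * P)%g = ((g * P)^-1 * (sg g * sg P))%g by congr (_ * _)%g; exact: sgM.
by rewrite Em; apply: gid14; exact: scC.
Qed.

Lemma rotK w : (tau * rot w * tau = w)%g.
Proof. exact: gid15. Qed.

Lemma XX_rot w g : XX (rot w) (fl (g * P)%g) <-> XX w (fl g).
Proof.
have [m Em] := hh_P g; split=> /XX_fl H; apply/XX_fl.
  have := D_mulP (D_Pmul ((D_mullE _ _ (Iw_sc k m)).1 (D_eq Em H))).
  rewrite rotK => H2; apply: D_eq H2.
  by rewrite !mulgA mulgV mul1g mulgKV.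
by apply: (D_eq (esym Em)); apply: D_mull (Iw_sc k m) _; exact: (D_mulPV (D_PVmul H)).
Qed.

Lemma fl_P (g g' : lg) : fl g = fl g' <-> fl (g * P)%g = fl (g' * P)%g.
Proof.
have E1 : ((g * P)^-1 * (g' * P) = P^-1 * (g^-1 * g') * P)%g by rewrite invMg !mulgA.
split=> /flE H; apply/flE; first by rewrite E1; exact: Iw_PV.
have := Iw_P H; rewrite E1; have -> // : (P * (P^-1 * (g^-1 * g') * P) * P^-1 = g^-1 * g')%g.
by rewrite !mulgA mulgV mul1g mulgK.
Qed.

Lemma fib_rot w : fibration (XX (rot w)) (XX w) (fun x y => XX w y /\ exists2 g, y = fl g & x = fl (g * P)%g).
Proof.
split.
- by move=> x y [Yy [g yE ->]]; split=> //; rewrite yE in Yy; exact/XX_rot.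
- move=> V oV; have oO := lopen_pre (lmorM (@lmor_id k) (lmor_const P^-1%g)) (lopen_open oV).
  eexists; first exact: (open_sat oO).
  move=> x y [Yy [g -> ->]]; split=> [[g' /= Vg' /esym E]|Vg].
    by rewrite (fl_P g (g' * P^-1)%g).2 // mulgKV.
  by exists (g * P)%g => //=; rewrite mulgK.
- move=> U oU; have oO := lopen_pre (lmorM (@lmor_id k) (lmor_const P)) (lopen_open oU).
  eexists; first exact: (open_sat oO).
  move=> y Yy; split=> [[g Ug gE]|[x [_ [g -> ->]] Ux]]; last by exists g.
  by exists (fl (g * P)%g) => //; split=> //; exists g.
- move=> y Yy; have [g yE] := fl_ex y.
  suff -> : [set x | XX w y /\ exists2 g, y = fl g & x = fl (g * P)%g] = [set fl (g * P)%g] by exact: irr1.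
  apply/seteqP; split=> [x [_ [g' yE' ->]]|_ ->].
    by apply: (fl_P g' g).1; rewrite -yE'.
  by split=> //; exists g.
Qed.

Lemma wdeg_rot w : exists n : int, wdeg (rot w) = wdeg w + 1 + 3 * n.
Proof.
have [n1 E1] := wdegM qP (tau^-1 * w)%g tau^-1%g; have [n2 E2] := wdegM qP tau^-1%g w.
have [n3 E3] := wdegM qP tau^-1%g tau; rewrite mulVg in E3.
have d1 : wdeg 1%g = 0 by rewrite /wdeg !big_ord_recl big_ord0 !bary0.
rewrite d1 in E3.
have dt : wdeg tau = 1 by rewrite /wdeg !big_ord_recl big_ord0 tr_tau /barycentric.
rewrite dt in E3.
by exists (n1 + n2 - 2 * n3 - 1); rewrite /rot E1 E2; lia.
Qed.

Lemma pc_P : pc 1 P.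
Proof.
move=> i j; rewrite mx_rp repE rpVE; split; case: eqP => _; try exact: inO0.
  by apply: inO_le (@inO_epsp k _); elim/ord3P: i; rewrite bary_tau.
by apply: inO_le (@inO_epsp k _); elim/ord3P: j; rewrite bary_tau.
Qed.

Lemma covered_P c d (Y : set (flag k)) : covered c d Y ->
  covered (c + 1) d [set x | exists2 g, Y (fl g) & x = fl (g * P)%g].
Proof.
elim=> [T G phi {}Y Gd H pd YP|Y1 Y2 Z _ H1 _ H2 sub].
  apply: (@cov_family k _ d T G (fun t => phi t * P)%g) => // [|t|x [g /YP[t gE] ->]].
  - by apply: (regmxM alg_isalg H); exact: (regmx_const alg_isalg).
  - apply: dvM (pd t) _; have := dv_rp k tau.
    by rewrite /wdeg !big_ord_recl big_ord0 tr_tau /barycentric.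
  - by exists t; exact: (fl_P _ _).1.
by apply: (cov_union H1 H2) => x [g /sub[Yg|Yg] ->]; [left | right]; exists g.
Qed.

Theorem step_rot (S : set lg) w d : (Cov qP w d -> Cov qP (rot w) d) /\ (Near qP S w -> Near qP S (rot w)).
Proof.
have bdP m f : bd (fun _ _ _ _ => - m%:Z) f -> forall g : lg, pc 1 g -> bd (fun _ _ _ _ => - (m + 2)%:Z) (f * g)%g.
  by move=> fb g gp; have := bd_mul (pcK (Kg1 k)) gp fb; rewrite mul1g addn0.
split=> [C1 n m|[r H]].
  have [n' E1] := wdeg_rot w.
  have := covered_P (C1 (n + n') (m + 2)%N).
  have -> : wdeg w + 3 * (n + n') + 1 = wdeg (rot w) + 3 * n by lia.
  apply: covered_sub => x [+ [f fE fb]]; rewrite {}fE => xX.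
  exists (f * P^-1)%g; last by rewrite mulgKV.
  split; first by apply/XX_rot; rewrite mulgKV.
  exists (f * P^-1)%g => //; apply: bdP => // i j; rewrite invgK.
  by have [? ?] := pc_P i j.
exists (r + 2)%N => x; have [f ->] := fl_ex x => fX.
have fX' : XX w (fl (f * P^-1)%g) by apply/XX_rot; rewrite mulgKV.
have [g [l [gE Sl lg']]] := H _ fX'; exists (g * P)%g, l; split=> //.
  by have := (fl_P _ _).1 gE; rewrite mulgKV.
by rewrite mulgA; apply: bdP => //; exact: pc_P.
Qed.

End Rotation.

(** * Points fixed by the square of the Frobenius *)

Section PowerMorphism.
Variables (k : fieldType) (Q : nat) (QP : [pchar k].-nat Q).
Definition powH of [pchar k].-nat Q : k -> k := fun x => x ^+ Q.

Fact powH_nmod : zmod_morphism (powH QP).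
Proof. by move=> x y; rewrite /powH expqD // expqN. Qed.
Fact powH_monoid : monoid_morphism (powH QP).
Proof. by split=> [|x y]; rewrite /powH ?expr1n ?exprMn. Qed.
HB.instance Definition _ := GRing.isZmodMorphism.Build k k (powH QP) powH_nmod.
HB.instance Definition _ := GRing.isMonoidMorphism.Build k k (powH QP) powH_monoid.
(* A subspace stable under the Frobenius has a basis in reduced form with
   respect to some set of coordinates, which is then fixed by the Frobenius. *)
Lemma frob_basis n (A : 'M[k]_n) : (map_mx (powH QP) A == A)%MS ->
  exists2 E : 'M[k]_n, (E :=: A)%MS & forall i j, E i j ^+ Q = E i j.
Proof.
move=> AF; have rf : row_full (row_base A)^T by rewrite /row_full mxrank_tr; have := row_base_free A; rewrite /row_free.
pose f := fullrankfun rf; have fu : rowsub f (row_base A)^T \in unitmx by exact: fullrowsub_unit.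
pose D := (rowsub f (row_base A)^T)^T; have Du : D \in unitmx by rewrite unitmx_tr.
pose B := invmx D *m row_base A.
have BA : (B :=: A)%MS.
  apply: eqmx_trans (eq_row_base A); apply: eqmxMfull; rewrite row_full_unit unitmx_inv //.
have Bf : colsub f B = 1%:M.
  rewrite -[1%:M](mulVmx Du) /B /D; apply/matrixP => a b; rewrite !mxE.
  by apply: eq_bigr => c _; rewrite !mxE.
have BF : map_mx (powH QP) B = B.
  have /submxP[X XE] : (map_mx (powH QP) B <= B)%MS.
    by rewrite BA -(eqmxP AF) map_submx BA.
  have : colsub f (map_mx (powH QP) B) = X *m colsub f B.
    by rewrite XE; apply/matrixP => a b; rewrite !mxE; apply: eq_bigr => c _; rewrite !mxE.
  have F1 : colsub f (map_mx (powH QP) B) = 1%:M.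
    by rewrite -(map_mx1 (powH QP)) -Bf; apply/matrixP => a b; rewrite !mxE.
  by rewrite F1 Bf mulmx1 XE => <-; rewrite mul1mx.
have BFE a j : B a j ^+ Q = B a j by have /matrixP/(_ a j) := BF; rewrite mxE.
pose S : 'M[k]_(n, \rank A) := \matrix_(i, a) (i == f a)%:R.
exists (S *m B) => [|i j].
  apply: eqmx_trans BA; apply/eqmxP; rewrite submxMl /=.
  have : (S^T *m (S *m B) <= S *m B)%MS by exact: submxMl.
  rewrite mulmxA (_ : S^T *m S = 1%:M) ?mul1mx //; apply/matrixP => a b.
  rewrite !mxE (bigD1 (f a)) //= !mxE eqxx mul1r big1 ?addr0 => [|i ia]; last by rewrite !mxE (negPf ia) mul0r.
  by rewrite (inj_eq (@fullrankfun_inj _ _ _ _ rf)).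
rewrite mxE (expq_sum QP); apply: eq_bigr => a _; rewrite exprMn BFE mxE.
by case: (i == f a); rewrite ?expr1n // (expq0 QP).
Qed.
End PowerMorphism.

Section Lattices.
Variables (k : closedFieldType) (q : nat) (qP : [pchar k].-nat q).
Hypothesis q1 : (1 < q)%N.
Local Notation L := (laurent k).
Local Notation eps := (eps k).
Local Notation lg := (lg k).
Local Notation sc := (@sc k).
Local Notation sg := (sg qP).
Variable M : nat.
Hypothesis M0 : (0 < M)%N.

Let I := ('I_3 * 'I_(M.*2))%type.
Let n := #|{: I}|.
Let ev (a : 'I_n) : I := enum_val a.

(* The row space of [Amx l] is the lattice of [l] modulo [eps ^ M]. *)
Definition Amx (l : lg) : 'M[k]_n :=
  \matrix_(a, b) coefL (mx l (ev b).1 (ev a).1) ((ev b).2%:Z - M%:Z - (ev a).2%:Z).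

Let tr (v : 'I_3 -> L) : 'rV[k]_n := \row_b coefL (v (ev b).1) ((ev b).2%:Z - M%:Z).

Let tr_mul (l : lg) (x : 'I_3 -> L) : pc M l -> (forall j, inO 0 (x j)) ->
  tr (fun i => \sum_j mx l i j * x j) = (\row_a coefL (x (ev a).1) (ev a).2%:Z) *m Amx l.
Proof.
move=> lM xO; apply/rowP => b; rewrite !mxE coefL_sum.
have E j : coefL (mx l (ev b).1 j * x j) ((ev b).2%:Z - M%:Z) =
    \sum_(m < M.*2) coefL (x j) m%:Z * coefL (mx l (ev b).1 j) ((ev b).2%:Z - M%:Z - m%:Z).
  rewrite mulrC (@coefLM _ 0 M.*2).
  - by apply: eq_bigr => m _; rewrite subr0 addr0.
  - by rewrite oppr0.
  - by apply: inO_le (lM (ev b).1 j).1; have := ltn_ord (ev b).2; lia.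
under eq_bigr => j _ do rewrite E.
rewrite (pair_bigA _ (fun j (m : 'I_(M.*2)) => coefL (x j) m%:Z * coefL (mx l (ev b).1 j) ((ev b).2%:Z - M%:Z - m%:Z))) /=.
rewrite (reindex (fun a : 'I_n => ev a)) /=; last by apply: onW_bij; exact: enum_val_bij.
by apply: eq_bigr => a _; rewrite !mxE.
Qed.

Let Amx_row (l : lg) a : row a (Amx l) = tr (fun i => eps ^ (ev a).2%:Z * mx l i (ev a).1).
Proof. by apply/rowP => b; rewrite !mxE coefL_epsz. Qed.

Lemma Amx_le (l kk : lg) : pc M l -> Kg kk -> (Amx (l * kk)%g <= Amx l)%MS.
Proof.
move=> lM kO; apply/row_subP => a; rewrite Amx_row.
have -> : (fun i => eps ^ (ev a).2%:Z * mx (l * kk)%g i (ev a).1) =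
    (fun i => \sum_j mx l i j * (eps ^ (ev a).2%:Z * mx kk j (ev a).1)).
  apply: funext => i; rewrite mxME mulr_sumr; apply: eq_bigr => j _.
  by rewrite mulrCA.
rewrite tr_mul //; first exact: submxMl.
move=> j; rewrite -[X in inO X]addr0; apply: inO_mul; last exact: glO_inO.
by apply: inO_le (@inO_epsp k _).
Qed.

(** A column of [l'] agrees modulo [eps^M] with an integral combination of columns of [l]. The error
    is harmless because [l^-1] has poles of order at most [M]. *)
Lemma Amx_inO (l l' : lg) : pc M l -> pc M l' -> (Amx l' <= Amx l)%MS ->
  forall i j, inO 0 (mx (l^-1 * l')%g i j).
Proof.
move=> lM lM' le i j.
have z0 : (0 < M.*2)%N by lia.
pose a0 : 'I_n := enum_rank (j, Ordinal z0).
have /submxP[c cE] : (row a0 (Amx l') <= Amx l)%MS by apply: submx_trans le; exact: row_sub.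
pose y (j' : 'I_3) : L := \sum_(m < M.*2) constL (c 0 (enum_rank (j', m))) * eps ^ m%:Z.
have yO j' : inO 0 (y j').
  apply: inO_sum => m _; rewrite -[X in inO X]addr0; apply: inO_mul; first exact: inO_const.
  by apply: inO_le (@inO_epsp k _).
have yc : (\row_a coefL (y (ev a).1) (ev a).2%:Z) = c.
  apply/rowP => a; rewrite mxE /y coefL_sum (bigD1 (ev a).2) //= coefL_constM coefL_epsp eqxx mulr1.
  rewrite big1 ?addr0 => [|m ma]; first by rewrite -surjective_pairing enum_valK.
  rewrite coefL_constM coefL_epsp; case: eqP => [[E]|]; last by rewrite mulr0.
  by case/eqP: ma; apply: val_inj.
have ev0 : ev a0 = (j, Ordinal z0) by rewrite /ev enum_rankK.
pose d (i : 'I_3) : L := mx l' i j - \sum_j' mx l i j' * y j'.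
have dO i' : inO M%:Z (d i').
  move=> m mM; have [mN|mN] := ltP m (- M%:Z).
    rewrite coefLD coefLN (lM' i' j).1 // add0r; apply/eqP; rewrite oppr_eq0; apply/eqP.
    suff H : inO (- M%:Z) (\sum_j' mx l i' j' * y j') by exact: H.
    by apply: inO_sum => j' _; rewrite -[X in inO X]addr0; apply: inO_mul => //; case: (lM i' j').
  have lt : (absz (m + M%:Z)%R < M.*2)%N by lia.
  have /rowP/(_ (enum_rank (i', Ordinal lt))) := etrans (tr_mul lM yO) (etrans (congr1 (mulmx^~ (Amx l)) yc) (esym cE)).
  rewrite Amx_row !mxE /ev !enum_rankK /= expr0z mul1r => H.
  rewrite (_ : (absz (m + M%:Z))%:Z - M%:Z = m) in H; last by lia.
  by rewrite /d coefLD coefLN H subrr.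
have -> : mx (l^-1 * l')%g i j = y i + \sum_i' mx l^-1%g i i' * d i'.
  have V : \sum_i' mx l^-1%g i i' * (\sum_j' mx l i' j' * y j') = y i.
    under eq_bigr => i' _ do rewrite mulr_sumr.
    rewrite exchange_big /= (eq_bigr (fun j' => mx (l^-1 * l)%g i j' * y j')) => [|j' _].
      rewrite mulVg mx1 (bigD1 i) //= mxE eqxx mul1r big1 ?addr0 // => j' ji.
      by rewrite mxE eq_sym (negPf ji) mul0r.
    by rewrite mxME mulr_suml; apply: eq_bigr => i' _; rewrite mulrA.
  rewrite -{1}V -big_split mxME; apply: eq_bigr => i' _; by rewrite /d mulrBr [RHS]addrC subrK.
apply: inO_add (yO i) _; apply: inO_sum => i' _; rewrite -(addNr M%:Z).
by apply: inO_mul (dO i'); case: (lM i i').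
Qed.

(** [sg (sg l)] is [l] with all coefficients raised to the power [q ^ 2], so the lattice of [l] is
    required to be stable under a Frobenius. *)
Definition Lam : set lg := [set l | Kg (l^-1 * sg (sg l))%g].

Let Q := (q * q)%N.
Let QP : [pchar k].-nat Q. Proof. by rewrite pnatM qP. Qed.

Let Amx_sg2 (l : lg) : Amx (sg (sg l)) = map_mx (powH QP) (Amx l).
Proof.
apply/matrixP => a b; rewrite !mxE !sgE sgVE !rev_ordK (coefL_frob qP) (coefL_frob qP) /powH.
by rewrite -exprM.
Qed.

Lemma Lam_basis (l : lg) : pc M l -> Lam l ->
  exists2 E : 'M[k]_n, (E :=: Amx l)%MS & forall i j, E i j ^+ Q = E i j.
Proof.
move=> lM lL; have pcs (x : lg) : pc M x -> pc M (sg x).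
  by move=> xM a b; have [h1 h2] := xM (rev_ord b) (rev_ord a); rewrite sgE sgVE; split; exact: (inO_frob qP).
apply: (frob_basis (QP := QP)); rewrite -Amx_sg2; apply/andP; split.
  have lE : sg (sg l) = (l * (l^-1 * sg (sg l)))%g by rewrite mulKVg.
  by rewrite lE; exact: Amx_le.
have {1}-> : Amx l = Amx (sg (sg l) * (l^-1 * sg (sg l))^-1)%g by congr Amx; rewrite invMg invgK mulKVg.
by apply: Amx_le; [exact/pcs/pcs | exact: KgV].
Qed.

(** Modulo [eps^M] a stable lattice becomes a subspace stable under the Frobenius. By [frob_basis]
    it is spanned by a matrix whose entries are roots of [X^Q - X]; there are finitely many such
    matrices, and the matrix serves as invariant. *)
Lemma Lam_finite : exists (F : finType) (inv : lg -> F), forall l l', pc M l -> pc M l' ->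
  Lam l -> Lam l' -> inv l = inv l' -> Kg (l^-1 * l')%g.
Proof.
have [rs rsP] : exists rs : seq k, forall c, c ^+ Q = c -> c \in rs.
  have Q1 : (1 < Q)%N by rewrite /Q; nia.
  have s : size ('X^Q - 'X : {poly k}) = Q.+1.
    by rewrite size_polyDl ?size_polyXn // size_polyN size_polyX.
  have [rs E] := closed_field_poly_normal ('X^Q - 'X : {poly k}).
  exists rs => c cQ; have : root ('X^Q - 'X) c by rewrite rootE !hornerE cQ subrr.
  rewrite E rootZ ?root_prod_XsubC //.
  by rewrite lead_coef_eq0 -size_poly_eq0 s.
have /choice[B BP] : forall l, exists E : 'M[k]_n, pc M l -> Lam l ->
    (E :=: Amx l)%MS /\ forall i j, E i j ^+ Q = E i j.
  move=> l; have [[lM lL]|nl] := pselect (pc M l /\ Lam l).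
    by have [E E1 E2] := Lam_basis lM lL; exists E.
  by exists 0 => lM lL; case: nl.
exists {ffun 'I_n * 'I_n -> 'I_(size rs).+1}, (fun l => [ffun ij => inord (index (B l ij.1 ij.2) rs)]).
move=> l l' lM lM' lL lL' /ffunP E.
have [B1 B2] := BP l lM lL; have [B1' B2'] := BP l' lM' lL'.
have {}E : B l = B l'.
  apply/matrixP => i j; have := congr1 (@nat_of_ord _) (E (i, j)); rewrite !ffunE /=.
  have h1 := rsP _ (B2 i j); have h2 := rsP _ (B2' i j).
  by rewrite !inordK ?ltnS ?index_size // => ii; rewrite -(nth_index 0 h1) ii nth_index.
have /eqmxP/andP[le1 le2] : (Amx l :=: Amx l')%MS by apply: eqmx_trans (eqmx_sym B1) _; rewrite E.
have O1 := Amx_inO lM lM' le2; have O2 := Amx_inO lM' lM le1.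
have inv1 : (l'^-1 * l = (l^-1 * l')^-1)%g by rewrite invMg invgK.
apply: glOP => //; have [d dd] := dv_ex (l^-1 * l')%g.
have dV := dvV dd; rewrite -inv1 in dV.
have ge (x : lg) c : (forall i j, inO 0 (mx x i j)) -> dv c x -> 0 <= c.
  by move=> /inO_det xO [_ x0]; rewrite leNgt; apply: contraNN x0 => c0; rewrite xO.
have d0 : 0 = d by have := ge _ _ O1 dd; have := ge _ _ O2 dV; lia.
by rewrite d0; case: dd.
Qed.

End Lattices.

Lemma gid16 (gT : groupType) (c c' f f0 l : gT) : (forall x, c * x = x * c)%g -> (forall x, c' * x = x * c')%g ->
  (c' * c^-1 * f = f0 * (c * (l^-1 * f0))^-1 * (c' * (l^-1 * f)))%g.
Proof.
move=> cC cC'; rewrite !invMg invgK !mulgA mulgV mul1g -(mulgA l) -(mulgA l).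
have E x : (c^-1 * c' * x = x * (c^-1 * c'))%g.
  by rewrite -mulgA cC' mulgA [RHS]mulgA; congr (_ * _)%g; apply: (mulgI c); rewrite mulKVg mulgA cC mulgK.
by rewrite E mulKVg -(cC' c^-1%g).
Qed.

(** * Boundedness modulo scalars, and local boundedness *)

Section Bounded.
Variable k : closedFieldType.
Local Notation L := (laurent k).
Local Notation eps := (eps k).
Local Notation lg := (lg k).
Local Notation sc := (@sc k).
Local Notation bdd r := (bd (fun _ _ _ _ => - r%:Z)).

Lemma bdd_pc (r : nat) (g : lg) : bdd r g -> exists m, pc r (sc m * g)%g.
Proof.
move=> gr; have [m [i [j [hv le]]]] := minval g; exists (- m) => a b.
rewrite invMg -scN -scC !mx_scM opprK; split.
  have H : inO 0 (eps ^ (- m) * mx g a b) by rewrite -(addNr m); apply: inO_mul (le a b); exact: inO_epsp.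
  by apply: inO_le H; lia.
have H := hasvalM_inO hv (gr i j a b).
by rewrite (_ : - r%:Z = m + (- r%:Z - m)); [apply: inO_mul H; exact: inO_epsp | lia].
Qed.

Lemma pcM (M N : nat) (g h : lg) : pc M g -> pc N h -> pc (M + N) (g * h)%g.
Proof.
move=> gM hN i j; rewrite invMg !mxME PoszD opprD; split.
  by apply: inO_sum => l _; apply: inO_mul; [case: (gM i l) | case: (hN l j)].
by rewrite addrC; apply: inO_sum => l _; apply: inO_mul; [case: (hN i l) | case: (gM l j)].
Qed.

Lemma pcV (M : nat) (g : lg) : pc M g -> pc M g^-1%g.
Proof. by move=> gM i j; rewrite invgK; case: (gM i j). Qed.

Lemma pc_le (M N : nat) (g : lg) : (M <= N)%N -> pc M g -> pc N g.
Proof.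
move=> MN gM i j; have [h1 h2] := gM i j.
by split; [apply: inO_le h1 | apply: inO_le h2]; lia.
Qed.

Lemma pc_bdd (M : nat) (g : lg) : pc M g -> bdd M.*2 g.
Proof.
move=> gM i j i' j'; rewrite (_ : - _ = - M%:Z + - M%:Z); last by lia.
by apply: inO_mul; [case: (gM i j) | case: (gM i' j')].
Qed.

Lemma bdd_Iw (r : nat) (g i : lg) : Iw i -> bdd r g -> bdd r (g * i)%g.
Proof.
move=> [n /Ig_Kg nK] gr; have := bd_K nK gr.
by rewrite mulgA -scC -mulgA bd_sc.
Qed.

End Bounded.

Section LocalFiniteness.
Variables (k : closedFieldType) (q : nat) (qP : [pchar k].-nat q).
Hypothesis q1 : (1 < q)%N.
Local Notation L := (laurent k).
Local Notation eps := (eps k).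
Local Notation lg := (lg k).
Local Notation sc := (@sc k).
Local Notation sg := (sg qP).
Local Notation Lam := (Lam qP).
Local Notation bdd r := (bd (fun _ _ _ _ => - r%:Z)).

Lemma Lam_sc m (l : lg) : Lam l -> Lam (sc m * l)%g.
Proof.
by rewrite /Lam /= !sgM !sg_sc opprK invMg -mulgA mulKg.
Qed.

(** The elements that are near no lattice of [Far] form a neighbourhood of [f0], as on each piece
    only finitely many lattices matter. A point of [X] in it is near some invariant lattice; this
    lattice is not in [Far], hence near [f0], and so the point has bounded distance from [f0]. *)
Lemma near_locally_bounded (X : set (flag k)) (r : nat) :
  (forall x, X x -> exists f l, [/\ x = fl f, Lam l & bdd r (l^-1 * f)%g]) ->
  forall x, X x -> exists U m, [/\ open U, U x & X `&` U `<=` Bd m].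
Proof.
move=> XN x Xx; have [f0 xE] := fl_ex x; have [N0 fN] := pc_ex f0.
pose Far := [set l : lg | Lam l /\ ~ bdd r (l^-1 * f0)%g].
pose O := [set g : lg | forall l, Far l -> ~ bdd r (l^-1 * g)%g].
have O_Iw g i : Iw i -> O g -> O (g * i)%g.
  move=> iI Og l lF; have := Og l lF; apply: contra_not; rewrite mulgA => /(bdd_Iw (IwV iI)).
  by rewrite mulgK.
have oO : lopen O.
  move=> N; pose M := (N + r).+1.
  have [F [inv invP]] := Lam_finite qP q1 (ltn0Sn (N + r)).
  have /choice[rho rhoP] : forall c, exists l, (exists l', [/\ Far l', pc M l' & inv l' = c]) ->
      [/\ Far l, pc M l & inv l = c].
    move=> c; have [[l lP]|n] := pselect (exists l', [/\ Far l', pc M l' & inv l' = c]).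
      by exists l.
    by exists 1%g.
  pose D c := exists l', [/\ Far l', pc M l' & inv l' = c].
  (* On the piece [pc N] it suffices to avoid one representative [rho c] for each class, because a
     lattice near a point of this piece lies in [pc M] up to a scalar. *)
  pose ON := [set g : lg | forall c, D c -> ~ bdd r ((rho c)^-1 * g)%g].
  have oON : lopen ON.
    have H (s : seq F) : lopen [set g : lg | forall c, c \in s -> D c -> ~ bdd r ((rho c)^-1 * g)%g].
      elim: s => [|c s IH].
        move=> N'; exists [set fun=> 1]; first by move=> _ ->; exact: alg_const.
        by move=> g _; split=> // _; exists (fun=> 1) => //; rewrite oner_eq0.
      rewrite (_ : [set g | _] = [set g | D c -> ~ bdd r ((rho c)^-1 * g)%g] `&`
        [set g | forall c, c \in s -> D c -> ~ bdd r ((rho c)^-1 * g)%g]).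
        apply: lopenI IH; have [Dc|nD] := pselect (D c).
          rewrite (_ : [set g | _] = [set g | ~ bdd r ((rho c)^-1 * g)%g]).
            by apply: lopen_bdN; apply: lmorM; [exact: lmor_const | exact: lmor_id].
          by apply/seteqP; split=> g /=; [apply | move=> ?].
        move=> N'; exists [set fun=> 1]; first by move=> _ ->; exact: alg_const.
        by move=> g _; split=> [_|_ /nD//]; exists (fun=> 1) => //; rewrite oner_eq0.
      apply/seteqP; split=> [g H|g [H1 H2] c' ].
        split=> [|c' cs]; first by apply: H; rewrite mem_head.
        by apply: H; rewrite inE cs orbT.
      by rewrite inE => /orP[/eqP->|]; [exact: H1 | exact: H2].
    have := H (enum F); rewrite (_ : [set g | _] = ON) //.
    by apply/seteqP; split=> g H' c => [|_]; apply: H'; rewrite ?mem_enum.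
  have [S Sr SP] := oON N; exists S => // g gN; rewrite -SP //; split=> Og.
    by move=> c /rhoP[lF _ _]; exact: Og.
  move=> l [lL lf] lb; have [m mP] := bdd_pc lb.
  pose l' := (sc (- m) * l)%g.
  have l'E : (l'^-1 * g = sc m * (l^-1 * g))%g by rewrite /l' invMg -scN opprK -scC !mulgA.
  have lM' : pc M l'.
    have -> : l' = (g * (l'^-1 * g)^-1)%g by rewrite invMg invgK mulKVg.
    by apply: (@pc_le _ (N + r)) => //; apply: pcM gN _; apply: pcV; rewrite l'E.
  have lF' : Far l'.
    split; first exact: Lam_sc.
    have -> : (l'^-1 * f0 = sc m * (l^-1 * f0))%g by rewrite /l' invMg -scN opprK -scC !mulgA.
    by rewrite bd_sc.
  have Dc : D (inv l') by exists l'.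
  have [[rL _] rM rI] := rhoP _ Dc.
  apply: (Og _ Dc).
  have kK : Kg ((rho (inv l'))^-1 * l')%g by exact: (invP _ _ rM lM' rL lF'.1 rI).
  have -> : ((rho (inv l'))^-1 * g = (rho (inv l'))^-1 * l' * (l'^-1 * g) * 1)%g by rewrite mulg1 mulgA mulgK.
  rewrite (_ : - r%:Z = - (r + 0.*2 + 0.*2)%:Z); last by lia.
  apply: bd_mul (pcK kK) (pcK (@Kg1 k)) _; rewrite l'E bd_sc; exact: lb.
exists [set y | exists2 g, y = fl g & O g], (N0 + r + r).*2; split.
- have := open_sat oO; rewrite (_ : [set fl g | g in O] = [set y | exists2 g, y = fl g & O g]) //.
  by apply/seteqP; split=> y [g]; [move=> Og <-; exists g | move=> -> Og; exists g].
- by exists f0 => // l [].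
move=> y [/XN[f [l [yE lL fl0]]] [g yg Og]].
have Of : O f.
  have /flE H : fl g = fl f by rewrite -yg.
  by rewrite -(mulKVg g f); apply: O_Iw.
have lf0 : bdd r (l^-1 * f0)%g.
  apply: contrapT => nb; exact: (Of l (conj lL nb) fl0).
have [m mP] := bdd_pc lf0; have [m' m'P] := bdd_pc fl0.
exists f => //; rewrite -(bd_sc _ (m' - m)).
have -> : (sc (m' - m) * f = f0 * (sc m * (l^-1 * f0))^-1 * (sc m' * (l^-1 * f)))%g.
  by rewrite scD scN; apply: gid16 => x'; exact: scC.
by apply: pc_bdd; apply: pcM m'P; apply: pcM fN _; exact: pcV.
Qed.

End LocalFiniteness.

(** * The minimal elements *)

Section Cell.
Variables (k : closedFieldType) (q : nat) (qP : [pchar k].-nat q).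
Local Notation L := (laurent k).
Local Notation eps := (eps k).
Local Notation lg := (lg k).
Local Notation rp := (@rp k).
Local Notation sc := (@sc k).
Local Notation sg := (sg qP).
Local Notation hh := (hh qP).
Local Notation n1 := (rp s1).
Local Notation n121 := (rp (s1 * s2 * s1)%g).

Definition cmx (A : 'M[k]_3) : 'M[L]_3 := map_mx (@constL k) A.

Lemma cmx_coef A i j n : coefL (cmx A i j) n = A i j *+ (n == 0).
Proof. by rewrite mxE coefL_const. Qed.

Lemma cmx_inO A i j : inO 0 (cmx A i j).
Proof. by rewrite mxE; exact: inO_const. Qed.

Lemma det_cmx A : \det (cmx A) = constL (\det A) :> L.
Proof. exact: det_map_mx. Qed.

Lemma Kg_cmx A (g : lg) : A \in unitmx -> mx g = cmx A -> Kg g.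
Proof.
move=> Au gE; rewrite /Kg gE; apply: glOP => [i j|]; first exact: cmx_inO.
by rewrite det_cmx coefL_const eqxx mulr1n -unitfE -unitmxE.
Qed.

Lemma cmx_ex A : A \in unitmx -> exists2 g : lg, Kg g & mx g = cmx A.
Proof.
move=> Au; have H : glO (cmx A).
  apply: glOP => [i j|]; first exact: cmx_inO.
  by rewrite det_cmx coefL_const eqxx mulr1n -unitfE -unitmxE.
by have [g gE] := lg_of (glO_unit H); exists g; rewrite /Kg -?gE.
Qed.

Lemma Ig_cmx (A : 'M[k]_3) (g : lg) : (forall i j : 'I_3, (i < j)%N -> A i j = 0) -> (forall i, A i i != 0) ->
  mx g = cmx A -> Ig g.
Proof.
move=> At Ad gE; rewrite /Ig gE; apply: iwahoriGLP => [i j|i]; last by rewrite cmx_coef eqxx mulr1n; exact: Ad.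
case ij : (i < j)%N; last exact: cmx_inO.
by rewrite mxE At // rmorph0; exact: inO0.
Qed.

Definition mx3 (x00 x01 x02 x10 x11 x12 x20 x21 x22 : k) : 'M[k]_3 :=
  \matrix_(i, j) nth 0 (nth [::] [:: [:: x00; x01; x02]; [:: x10; x11; x12]; [:: x20; x21; x22]] i) j.

Lemma mx3M a00 a01 a02 a10 a11 a12 a20 a21 a22 b00 b01 b02 b10 b11 b12 b20 b21 b22 :
  mx3 a00 a01 a02 a10 a11 a12 a20 a21 a22 *m mx3 b00 b01 b02 b10 b11 b12 b20 b21 b22 =
  mx3 (a00 * b00 + a01 * b10 + a02 * b20) (a00 * b01 + a01 * b11 + a02 * b21) (a00 * b02 + a01 * b12 + a02 * b22)
      (a10 * b00 + a11 * b10 + a12 * b20) (a10 * b01 + a11 * b11 + a12 * b21) (a10 * b02 + a11 * b12 + a12 * b22)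
      (a20 * b00 + a21 * b10 + a22 * b20) (a20 * b01 + a21 * b11 + a22 * b21) (a20 * b02 + a21 * b12 + a22 * b22).
Proof.
apply/matrixP; apply: ord3_case; rewrite !mxE !big_ord_recl big_ord0 !mxE /= addr0 addrA; reflexivity.
Qed.

Definition U0 a b c := mx3 1 a b 0 1 c 0 0 1.

Lemma U0M a b c a' b' c' : U0 a b c *m U0 a' b' c' = U0 (a' + a) (b' + a * c' + b) (c' + c).
Proof. by rewrite mx3M /U0 !(mulr0, mul0r, mulr1, mul1r, add0r, addr0). Qed.

Lemma U00 : U0 0 0 0 = 1%:M.
Proof. by apply/matrixP; apply: ord3_case; rewrite !mxE. Qed.

Fact uu_subproof a b c : cmx (U0 a b c) *m cmx (U0 (- a) (a * c - b) (- c)) = 1%:M /\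
  cmx (U0 (- a) (a * c - b) (- c)) *m cmx (U0 a b c) = 1%:M.
Proof.
have E x y : x *m y = 1%:M -> cmx x *m cmx y = 1%:M by move=> xy; rewrite /cmx -map_mxM xy map_mx1.
by split; apply: E; rewrite U0M -U00; congr U0; ring.
Qed.

(* A point of the big cell of the flag variety [K / I]. *)
Definition uu a b c : lg := Lg (uu_subproof a b c).

Lemma uuV a b c : (uu a b c)^-1%g = uu (- a) (a * c - b) (- c).
Proof. by apply: lg_inj; rewrite mxVE. Qed.

Lemma uuM a b c a' b' c' : (uu a b c * uu a' b' c')%g = uu (a' + a) (b' + a * c' + b) (c' + c).
Proof. by apply: lg_inj; rewrite mxM /= /cmx -map_mxM U0M. Qed.

Lemma det_U0 a b c : \det (U0 a b c) = 1.
Proof.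
rewrite -det_tr det_trig; last first.
  by apply/is_trig_mxP; apply: ord3_case; rewrite ?mxE // mxE.
by rewrite !big_ord_recl big_ord0 !mxE /= !mulr1.
Qed.

Lemma Kg_uu a b c : Kg (uu a b c).
Proof. by apply: (@Kg_cmx (U0 a b c)) => //; rewrite unitmxE det_U0 unitr1. Qed.

Lemma sg_uu a b c : sg (uu a b c) = uu (- c ^+ q) ((a * c - b) ^+ q) (- a ^+ q).
Proof.
apply: lg_inj; apply/matrixP => i j; rewrite sgE mxVE /= !mxE (frob_const qP).
move: i j; apply: ord3_case; rewrite /= ?(expqN qP) ?(expq0 qP) ?expr1n; reflexivity.
Qed.

Lemma hh_uu a b c : hh (uu a b c) =
  uu (- c ^+ q - a) ((a * c - b) ^+ q + a * a ^+ q + (a * c - b)) (- a ^+ q - c).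
Proof. by rewrite /hh uuV sg_uu uuM; congr uu; ring. Qed.

Lemma D_uu1 a : a != 0 -> D s1 (uu a 0 0).
Proof.
move=> a0; have -> : uu a 0 0 = (n1 * u a * n1)%g.
  apply: lg_inj; apply/matrixP => i j; rewrite conj_n1 mx_u /= !mxE; move: i j.
  by apply: ord3_case; rewrite ?permE /= ?mulr0 ?addr0 ?mulr1 ?rmorph0 ?rmorph1 ?add0r.
have [b bI ->] := n1_u_n1 a0.
by apply: D_mulr (Ig_Iw bI) _; apply: D_mull (Ig_Iw (Ig_u _)) _; exact: D_rp.
Qed.

(** [b] and [a c - b] are the corner minors whose nonvanishing defines the big cell; [l] and [r] are
    the triangular factors, solved for explicitly. *)
Lemma D_uu121 a b c : b != 0 -> a * c - b != 0 -> D (s1 * s2 * s1)%g (uu a b c).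
Proof.
move=> b0 d0; pose l := mx3 1 0 0 (c / b) 1 0 b^-1 (a / (a * c - b)) 1.
pose r := mx3 (a * c - b)^-1 0 0 (- c / b) (- (a * c - b) / b) 0 1 a b.
have Ex (A : 'M[k]_3) : (forall i j : 'I_3, (i < j)%N -> A i j = 0) -> (forall i, A i i != 0) ->
    exists2 g : lg, Iw g & mx g = cmx A.
  move=> At Ad; have Au : A \in unitmx.
    rewrite unitmxE det_trig; last exact/is_trig_mxP.
    by rewrite unitfE; apply/prodf_neq0.
  by have [g _ gE] := cmx_ex Au; exists g => //; apply: Ig_Iw; exact: Ig_cmx gE.
have [gl lI lE] : exists2 g : lg, Iw g & mx g = cmx l.
  apply: Ex; first by apply: ord3_case; rewrite ?mxE.
  by apply: ord3P; rewrite !mxE /= oner_eq0.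
have [gr rI rE] : exists2 g : lg, Iw g & mx g = cmx r.
  apply: Ex; first by apply: ord3_case; rewrite ?mxE.
  by apply: ord3P; rewrite !mxE /= ?invr_eq0 // mulf_neq0 ?oppr_eq0 ?invr_eq0.
exists gl, gr; split=> //; apply: lg_inj; rewrite !mxM lE rE mx_rp.
have -> : rep k (s1 * s2 * s1)%g = cmx (mx3 0 0 1 0 1 0 1 0 0).
  have -> : (s1 * s2 * s1)%g = IW 0 (tperm 0%R 1%R * tperm 1%R 2%:R%R * tperm 0%R 1%R)%g.
    by congr IW; rewrite /= ?(wactM, wact_s1, wact_s2, wact1).
  apply/matrixP => i j; rewrite repE [in RHS]mxE /= bary0 expr0z mxE; move: i j.
  by apply: ord3_case; rewrite ?permM ?permE /= ?(rmorph0, rmorph1) //.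
rewrite /= /cmx -!map_mxM !mx3M; congr map_mx.
by rewrite /U0 !(mulr0, mul0r, mulr1, mul1r, add0r, addr0); congr mx3; field; rewrite ?b0 ?d0.
Qed.

Lemma regmx_uu (S : Type) (A : set (S -> k)) fa fb fc : isalg A -> A fa -> A fb -> A fc ->
  regmx A (fun s => uu (fa s) (fb s) (fc s)).
Proof.
move=> hA Aa Ab Ac; have [A1 AD AM] := hA.
have H (ga gb gc : S -> k) i j : A ga -> A gb -> A gc -> reg A (fun s => cmx (U0 (ga s) (gb s) (gc s)) i j).
  move=> Aa' Ab' Ac'; apply: (@reg_ext _ _ A (fun s => constL (U0 (ga s) (gb s) (gc s) i j))) => [s|]; first by rewrite [RHS]mxE.
  apply: (reg_constL hA); move: i j.
  have E f g : (forall s, f s = g s) -> A g -> A f by move=> /funext ->.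
  by apply: ord3_case; (eapply E; [move=> s; rewrite mxE /=; reflexivity | by []]).
move=> i j; split; first exact: H.
apply: (@reg_ext _ _ A (fun s => cmx (U0 (- fa s) (fa s * fc s - fb s) (- fc s)) i j)) => [s|]; first by rewrite uuV.
by apply: H; [exact: isalg_opp | apply: AD; [exact: AM | exact: isalg_opp] | exact: isalg_opp].
Qed.

Definition red (X : 'M[L]_3) : 'M[k]_3 := \matrix_(i, j) coefL (X i j) 0.

Lemma redM (X Y : 'M[L]_3) : (forall i j, inO 0 (X i j)) -> (forall i j, inO 0 (Y i j)) ->
  red (X *m Y) = red X *m red Y.
Proof.
move=> XO YO; apply/matrixP => i j; rewrite !mxE coefL_sum; apply: eq_bigr => l _.
by rewrite !mxE -[in LHS](addr0 (0 : int)) coefL_mul_lead.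
Qed.

Lemma red_cmx A : red (cmx A) = A.
Proof. by apply/matrixP => i j; rewrite mxE cmx_coef eqxx. Qed.

Lemma red_unit (y : lg) : Kg y -> red (mx y) \in unitmx.
Proof.
move=> yK; have H : red (mx y) *m red (mx y^-1%g) = 1%:M.
  rewrite -redM => [|i j|i j]; [|exact: glO_inO..|by apply: glO_inO; exact: KgV].
  by rewrite -mxM mulgV mx1 -[RHS]red_cmx /cmx map_mx1.
exact: mulmx1_unitl H.
Qed.

Lemma Ig_red (y : lg) : Kg y -> (forall i j : 'I_3, (i < j)%N -> red (mx y) i j = 0) -> Ig y.
Proof.
move=> yK yt; have := red_unit yK; rewrite unitmxE det_trig; last exact/is_trig_mxP.
rewrite unitfE => /prodf_neq0 yd; apply: iwahoriGLP => [i j|i]; last first.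
  by have := yd i isT; rewrite mxE.
case ij : (i < j)%N; last exact: glO_inO.
move=> n n1; have [n0|n0] := ltP n 0; first by apply: (glO_inO i j yK).
by have -> : n = 0; [lia | have := yt i j ij; rewrite mxE].
Qed.

Lemma mx_rp0 (p : 'S_3) : mx (rp (IW 0 p)) = cmx (perm_mx p).
Proof.
by apply/matrixP => i j; rewrite mx_rp repE !mxE /= bary0 expr0z; case: eqP => _; rewrite ?rmorph0 ?rmorph1.
Qed.

Lemma Kg_rp0 (p : 'S_3) : Kg (rp (IW 0 p)).
Proof. exact: Kg_cmx (unitmx_perm _ _) (mx_rp0 p). Qed.

(* Modulo a permutation every element of [K / I] lies in the big cell. *)
Lemma Kg_cell (y : lg) : Kg y -> exists (p : 'S_3) a b c i, Ig i /\ y = (rp (IW 0 p) * uu a b c * i)%g.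
Proof.
move=> yK; pose J : 'M[k]_3 := perm_mx rho.
have rr : (rho * rho = 1)%g by apply/permP => i; rewrite permM perm1 /rho !permE rev_ordK.
have rV : (rho^-1 = rho)%g by apply: (mulgI rho); rewrite mulgV rr.
have JJ : J *m J = 1%:M by rewrite -perm_mxM rr perm_mx1.
have JE (X : 'M[k]_3) i j : (J *m X *m J) i j = X (rev_ord i) (rev_ord j).
  have <- : col_perm rho (row_perm rho X) i j = X (rev_ord i) (rev_ord j) by rewrite !mxE /rho !permE.
  by rewrite col_permE rV row_permE.
pose A := red (mx y); have [s [l [r [E lE rE]]]] := lup_ex (J *m A *m J).
pose p := (rho * s^-1 * rho)%g.
have ss : perm_mx s^-1%g *m perm_mx s = 1%:M :> 'M[k]_3 by rewrite -perm_mxM mulVg perm_mx1.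
have AE : A = perm_mx p *m (J *m l *m J) *m (J *m r *m J).
  have -> : A = J *m (perm_mx s^-1%g *m (perm_mx s *m (J *m A *m J))) *m J.
    by rewrite (mulmxA (perm_mx s^-1%g)) ss mul1mx !mulmxA JJ mul1mx -mulmxA JJ mulmx1.
  rewrite E /p !perm_mxM -/J !mulmxA; congr (_ *m r *m J).
  by rewrite -!(mulmxA _ J J) !JJ !mulmx1.
have lU : J *m l *m J = U0 ((J *m l *m J) 0 1) ((J *m l *m J) 0 2%:R) ((J *m l *m J) 1 2%:R).
  apply/matrixP => i j; rewrite [RHS]mxE !JE; move: i j.
  by apply: ord3_case => //=; rewrite lE.
set a := _ 0 1 in lU; set b := _ 0 2%:R in lU; set c := _ 1 2%:R in lU.
have gK := KgM (Kg_rp0 p) (Kg_uu a b c); pose i := ((rp (IW 0 p) * uu a b c)^-1 * y)%g.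
have iK : Kg i by apply: KgM yK; exact: KgV.
exists p, a, b, c, i; split; last by rewrite /i mulKVg.
have iE : red (mx i) = J *m r *m J.
  have gE : red (mx (rp (IW 0 p) * uu a b c)%g) = perm_mx p *m (J *m l *m J).
    by rewrite mxM mx_rp0 lU /= /cmx -map_mxM red_cmx.
  have yE : y = (rp (IW 0 p) * uu a b c * i)%g by rewrite /i mulKVg.
  have gu := red_unit gK; rewrite -(mulKmx gu (red _)) -redM => [|? ?|? ?]; [|exact: glO_inO..].
  by rewrite -mxM -yE -/A {1}AE -gE mulKmx.
apply: Ig_red iK _ => x z xz; rewrite iE JE rE //.
by rewrite /=; have := ltn_ord x; have := ltn_ord z; lia.
Qed.

End Cell.

Lemma gid17 (gT : groupType) (g s s' : gT) : (g^-1 * s' = g^-1 * s * (s^-1 * s'))%g.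
Proof. by rewrite mulgA mulgK. Qed.

Lemma gid19 (gT : groupType) (a c1 c2 s t d p : gT) : (forall x, c1 * x = x * c1)%g -> (forall x, c2 * x = x * c2)%g ->
  (a * (s * (c1 * p^-1) * (c2 * p^-1)) = c1 * c2 * (a * p^-1 * p^-1 * (p * (p * s * p^-1) * p^-1)))%g.
Proof.
move=> cC cC'; rewrite !mulgA !mulgVK.
by rewrite -(cC (a * s)%g) -(cC' (c1 * (a * s) * p^-1)%g) !mulgA (cC' c1).
Qed.

Lemma gid20 (gT : groupType) (c d i r j : gT) : (forall x, d * x = x * d)%g ->
  (c * d * (i * r * j) = (c * i) * r * (d * j))%g.
Proof. by move=> dC; rewrite -(mulgA c d) (dC (i * r * j)%g) (dC j) !mulgA. Qed.

Lemma gid21 (gT : groupType) (c x y : gT) : (forall x, c * x = x * c)%g -> ((c * x) * (c^-1 * y) = x * y)%g.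
Proof. by move=> cC; rewrite cC -mulgA mulKVg. Qed.

Lemma gid22 (gT : groupType) (c d r g : gT) : (forall x, c * x = x * c)%g -> (forall x, d * x = x * d)%g ->
  ((c * r)^-1 * (d * g) = d * c^-1 * (r^-1 * g))%g.
Proof.
move=> cC dC; have cV x : (c^-1 * x = x * c^-1)%g by apply: (mulgI c); rewrite mulKVg mulgA cC mulgK.
by rewrite invMg -cV !mulgA -(dC (c^-1 * r^-1)%g) !mulgA.
Qed.

Lemma gid23 (gT : groupType) (c g s p : gT) : (forall x, c * x = x * c)%g ->
  (c^-1 * ((g * p)^-1 * (s * (c * p))) = p^-1 * (g^-1 * s) * p)%g.
Proof.
move=> cC; rewrite (mulgA s) -(cC s) -(mulgA c) (mulgA (g * p)^-1%g c) -(cC (g * p)^-1%g) -(mulgA c) mulKg.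
by rewrite invMg !mulgA.
Qed.

Lemma gid24 (gT : groupType) (c d x y p : gT) : (forall x, d * x = x * d)%g ->
  (c * d * (x * y) = (c * x) * (d * y))%g /\
  (p * (c * d * (x * y)) * p^-1 = (p * (c * x) * p^-1) * (p * (d * y) * p^-1))%g.
Proof.
move=> dC; have E : (c * d * (x * y) = (c * x) * (d * y))%g.
  by rewrite -(mulgA c d) (dC (x * y)%g) (dC y) !mulgA.
by rewrite E; split=> //; rewrite !mulgA mulgVK.
Qed.

Lemma gid25 (gT : groupType) (t s : gT) : (t * (t * t) = 1)%g ->
  (t * (t * (t * s * t^-1) * t^-1) * t^-1 = s)%g.
Proof.
move=> E; have -> : (t * (t * (t * s * t^-1) * t^-1) * t^-1 = (t * (t * t)) * s * (t * (t * t))^-1)%g.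
  by rewrite !invMg !mulgA.
by rewrite E invg1 mul1g mulg1.
Qed.

(** * Upper bounds for [1], [s0] and [s1 s2 s1] *)

Section Bases.
Variables (k : closedFieldType) (q : nat) (qP : [pchar k].-nat q).
Hypothesis q1 : (1 < q)%N.
Local Notation L := (laurent k).
Local Notation eps := (eps k).
Local Notation lg := (lg k).
Local Notation rp := (@rp k).
Local Notation sc := (@sc k).
Local Notation sg := (sg qP).
Local Notation hh := (hh qP).
Local Notation XX := (XX qP).
Local Notation Lam := (Lam qP).
Local Notation Cov := (Cov qP).
Local Notation Near := (Near qP Lam).
Local Notation bary := (@barycentric int).
Local Notation P := (rp tau).
Local Notation n1 := (rp s1).

(** In each piece the elements of [A] fall into finitely many classes modulo [H]. For [Lam] and [Kg]
    this is the finiteness of invariant lattices; intersections and translates give it for chains of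
    lattices. *)
Definition fine (A H : set lg) := forall M, (0 < M)%N -> exists (F : finType) (inv : lg -> F),
  forall l l', pc M l -> pc M l' -> A l -> A l' -> inv l = inv l' -> H (l^-1 * l')%g.

Lemma fine_Lam : fine Lam (Kg (k := k)).
Proof. by move=> M M0; exact: Lam_finite. Qed.

Lemma fineI A H A' H' : fine A H -> fine A' H' -> fine (fun g => A g /\ A' g) (fun h => H h /\ H' h).
Proof.
move=> f f' M M0; have [F [inv invP]] := f M M0; have [F' [inv' invP']] := f' M M0.
exists (F * F')%type, (fun g => (inv g, inv' g)) => l l' lM lM' [lA lA'] [lB lB'] [E E'].
by split; [exact: invP | exact: invP'].
Qed.

Lemma fine_mulr p A H : fine A H -> fine (fun g => A (g * p)%g) (fun h => H (p^-1 * h * p)%g).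
Proof.
move=> f M M0; have [N pN] := pc_ex p; have MN : (0 < M + N)%N by lia.
have [F [inv invP]] := f _ MN; exists F, (fun g => inv (g * p)%g) => l l' lM lM' lA lA' E.
have := invP _ _ (pcM lM pN) (pcM lM' pN) lA lA' E.
by rewrite /= invMg !mulgA.
Qed.

Lemma covered_fin (F : finType) (Z : F -> set (flag k)) c d : (forall cl, covered c d (Z cl)) ->
  covered c d [set x | exists cl, Z cl x].
Proof.
move=> covZ; have covs (s : seq F) : covered c d [set x | exists2 cl, cl \in s & Z cl x].
  elim: s => [|cl s IH]; first by apply: covered_sub (covered0 k c d) => x [].
  apply: cov_union (covZ cl) IH _ => x [cl']; rewrite inE => /orP[/eqP->|cs] Zx; first by left.
  by right; exists cl'.
by apply: covered_sub (covs (enum F)) => x [cl Zx]; exists cl; rewrite ?mem_enum.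
Qed.

(** With one representative for each class, the bounded part of [X] is covered by finitely many
    cosets [l H], so a bound on each of these suffices. *)
Lemma covered_fine (A H : set lg) X c d : fine A H -> (forall n g, A g -> A (sc n * g)%g) ->
  (forall h, H h -> dv 0 h) -> (forall x, X x -> exists2 g, x = fl g & dv c g /\ A g) ->
  (forall l, A l -> dv c l -> covered c d [set x | X x /\ exists2 h, H h & x = fl (l * h)%g]) ->
  forall m, covered c d (X `&` Bd m).
Proof.
move=> fA Asc Hdv XA cov m; have [F [inv invP]] := fA _ (ltn0Sn m).
pose C cl (t : lg * int) := [/\ A t.1, dv c t.1, pc m.+1 (sc t.2 * t.1)%g & inv (sc t.2 * t.1)%g = cl].
have /choice[rho rhoP] : forall cl, exists t, (exists t, C cl t) -> C cl t.
  move=> cl; have [[t tP]|nt] := pselect (exists t, C cl t); first by exists t.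
  by exists (1%g, 0) => -[t tC]; case: nt; exists t.
pose Z cl := [set x | X x /\ C cl (rho cl) /\ exists2 h, H h & x = fl ((rho cl).1 * h)%g].
have covZ cl : covered c d (Z cl).
  have [[rA rd _ _]|nC] := pselect (C cl (rho cl)).
    by apply: covered_sub (cov _ rA rd) => x [Xx [_ xh]].
  by apply: covered_sub (covered0 k c d) => x [_ []].
apply: covered_sub (covered_fin covZ) => x [Xx [f xf fb]].
have [g xg [gd gA]] := XA x Xx.
have gb : bd (fun _ _ _ _ => - m%:Z) g.
  have /flE H1 : fl f = fl g by rewrite -xf.
  by rewrite -(mulKVg f g); apply: bdd_Iw.
have [a aP] := bdd_pc gb; have {}aP : pc m.+1 (sc a * g)%g by exact: pc_le (leqnSn m) aP.
pose cl := inv (sc a * g)%g.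
have [rA rd rM rI] : C cl (rho cl) by apply: rhoP; exists (g, a).
exists cl; split=> //; split=> //.
have Hh : H ((sc (rho cl).2 * (rho cl).1)^-1 * (sc a * g))%g.
  by apply: invP => //; exact: Asc.
have E : ((sc (rho cl).2 * (rho cl).1)^-1 * (sc a * g) = sc (a - (rho cl).2) * ((rho cl).1^-1 * g))%g.
  by rewrite scD scN gid22 // => z; exact: scC.
have aE : a - (rho cl).2 = 0.
  have d1 := Hdv _ Hh; rewrite E in d1.
  have d2 := dvM (dv_sc k (a - (rho cl).2)) (dvM (dvV rd) gd).
  by have := dv_inj d1 d2; lia.
exists ((rho cl).1^-1 * g)%g; last by rewrite mulKVg.
by move: Hh; rewrite E aE sc0 mul1g.
Qed.

Lemma covered1 c d (l : lg) : dv c l -> covered c d [set fl l].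
Proof.
move=> ld; apply: (@cov_family _ c d unit setT (fun=> l)) => //.
- by apply: gr_le (gr_unit (setT : set (unit -> k)) _) => // -[] [].
- by apply: regmx_const; exact: alg_isalg.
Qed.

Lemma Kg_dv0 n (y : lg) : Kg (sc n * y)%g -> dv 0 y -> Kg y.
Proof.
move=> yK y0; have := dv_inj (dvK yK) (dvM (dv_sc k n) y0).
rewrite addr0 => n0; have {}n0 : n = 0 by lia.
by move: yK; rewrite n0 sc0 mul1g.
Qed.

Lemma Kg_sg (y : lg) : Kg y -> Kg (sg y).
Proof.
move=> yK; apply: glOP => [i j|]; last by have [] := dv_sg qP (dvK yK).
by rewrite sgE; apply: (inO_frob qP); apply: glO_inO; exact: KgV.
Qed.

Lemma dv_sg2 (g : lg) : dv 0 (g^-1 * sg (sg g))%g.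
Proof.
have [n gn] := dv_ex g; have := dvM (dvV gn) (dv_sg qP (dv_sg qP gn)).
by rewrite opprK addNr.
Qed.

Lemma D_tr0 w (y : lg) : tr w = 0 -> D w y -> exists n, Kg (sc n * y)%g.
Proof.
move=> w0 [i [j [[m mI] [n nJ] ->]]]; exists (m + n).
have rK : Kg (rp w) by case: w w0 => t p /= ->; exact: Kg_rp0.
rewrite scD gid20; last exact: scC.
by apply: KgM (Ig_Kg nJ); apply: KgM rK; exact: Ig_Kg.
Qed.

(** [g^-1 * sg (sg g)] is [hh g * sg (hh g)], and for [w] in the finite Weyl group both factors lie
    in [Kg] up to scalars that cancel. *)
Lemma Lam_D w (g : lg) : tr w = 0 -> D w (hh g) -> Lam g.
Proof.
move=> w0 /(D_tr0 w0)[n nK]; rewrite /Lam /=; apply: (@Kg_dv0 0); last exact: dv_sg2.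
rewrite sc0 mul1g (gid17 g (sg g)).
have E : sg (sc n * hh g)%g = ((sc n)^-1 * ((sg g)^-1 * sg (sg g)))%g.
  by rewrite sgM sg_sc scN /hh sgM sgV.
have := KgM nK (Kg_sg nK); rewrite E gid21 //; exact: scC.
Qed.

Lemma near_Lam w : (forall g, D w (hh g) -> Lam g) -> Near w.
Proof.
move=> H; exists 0%N => x [g -> gD]; exists g, g; split=> //; first exact: H.
by rewrite mulVg; apply: (@pc_bdd k 0); apply: pcK; exact: Kg1.
Qed.

Lemma Lam_mulr p m (g : lg) : sg (sg p) = (sc m * p)%g ->
  Kg (p^-1 * (g^-1 * sg (sg g)) * p)%g -> Lam (g * p)%g.
Proof.
move=> pE gK; rewrite /Lam /=; apply: (@Kg_dv0 (- m)); last exact: dv_sg2.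
have E2 : sg (sg (g * p)%g) = (sg (sg g) * (sc m * p))%g.
  exact: etrans (congr1 sg (sgM qP g p)) (etrans (sgM qP _ _) (congr1 (fun z => (sg (sg g) * z)%g) pE)).
have E : (sc (- m) * ((g * p)^-1 * sg (sg (g * p))) = p^-1 * (g^-1 * sg (sg g)) * p)%g.
  apply: etrans (congr2 (fun a b => (a * ((g * p)^-1 * b))%g) (scN k m) E2) _.
  by apply: gid23 => x; exact: scC.
by rewrite E.
Qed.

Lemma sg2_P : exists m, sg (sg P) = (sc m * P)%g.
Proof.
have [m E] := sg_P qP; exists (- m - m).
by rewrite E sgM sg_sc sgV E invMg invgK -scN -scC mulgA -scD.
Qed.

Lemma sg2_PV : exists m, sg (sg P^-1%g) = (sc m * P^-1)%g.
Proof. by have [m E] := sg2_P; exists (- m); rewrite !sgV E invMg -scN scC. Qed.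

Lemma Lam_scl n (g p : lg) : Lam (g * p)%g -> Lam (sc n * g * p)%g.
Proof. by rewrite -mulgA; exact: Lam_sc. Qed.

Lemma Lam_P (g : lg) : Kg (P^-1 * (g^-1 * sg (sg g)) * P)%g -> Lam (g * P)%g.
Proof. by have [m E] := sg2_P; exact: Lam_mulr E. Qed.

Lemma Lam_PV (g : lg) : Kg (P * (g^-1 * sg (sg g)) * P^-1)%g -> Lam (g * P^-1)%g.
Proof. by have [m E] := sg2_PV => H; apply: Lam_mulr E _; rewrite invgK. Qed.

Lemma Kg_P_inO (h : lg) : Kg (P * h * P^-1)%g -> inO 1 (mx h 0 2%:R) /\ inO 1 (mx h 1 2%:R).
Proof.
have tV : lin tau (0 : 'I_3) = 2%:R :> 'I_3 by exact: lin_tau.1.1.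
move=> hK; split.
  have := glO_inO 1 0 hK; rewrite conj_rpE !lin_tau !bary_tau => H.
  by have := inO_mul (@inO_epsp k 1) H; rewrite mulrA -expfzDr ?eps_neq0 // expr0z mul1r.
have := glO_inO 2%:R 0 hK; rewrite conj_rpE !lin_tau !bary_tau => H.
by have := inO_mul (@inO_epsp k 1) H; rewrite mulrA -expfzDr ?eps_neq0 // expr0z mul1r.
Qed.

Lemma Kg_PV_inO (h : lg) : Kg (P^-1 * h * P)%g -> inO 1 (mx h 0 1) /\ inO 1 (mx h 0 2%:R).
Proof.
have E i j : mx (P^-1 * h * P)%g (lin tau i) (lin tau j) = eps ^ (bary (tr tau) j - bary (tr tau) i) * mx h i j.
  have := conj_rpE tau (P^-1 * h * P)%g i j; rewrite !mulgA mulgV mul1g mulgK => ->.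
  by rewrite mulrA -expfzDr ?eps_neq0 // addrA subrK subrr expr0z mul1r.
move=> hK; split.
  have := glO_inO (lin tau 0) (lin tau 1) hK; rewrite E !bary_tau => H.
  by have := inO_mul (@inO_epsp k 1) H; rewrite mulrA -expfzDr ?eps_neq0 // expr0z mul1r.
have := glO_inO (lin tau 0) (lin tau 2%:R) hK; rewrite E !bary_tau => H.
by have := inO_mul (@inO_epsp k 1) H; rewrite mulrA -expfzDr ?eps_neq0 // expr0z mul1r.
Qed.

Lemma inO1_red (h : lg) i j : inO 1 (mx h i j) -> red (mx h) i j = 0.
Proof. by move=> H; rewrite mxE; apply: H. Qed.

Lemma Iw_sg2 (g : lg) : Iw (hh g) -> Ig (g^-1 * sg (sg g))%g.
Proof.
move=> gI; apply: Iw_dv0 (dv_sg2 _); rewrite (gid17 g (sg g)); apply: IwM (gI) _.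
by have := sg_Iw qP gI; rewrite /hh sgM sgV.
Qed.

(** For [w = 1] the lattices of [g], [g P] and [g P^-1] are all invariant. The common stabiliser of
    the standard three is [Ig], so each class is a single flag. *)
Theorem base_1 : Cov 1%g 0 /\ Near 1%g.
Proof.
split; last by apply: near_Lam => g; apply: Lam_D.
move=> n; set c := _ + _.
pose A (g : lg) := (Lam g /\ Lam (g * P^-1)%g) /\ Lam (g * P)%g.
pose H (h : lg) := (Kg h /\ Kg (P^-1^-1 * h * P^-1)%g) /\ Kg (P^-1 * h * P)%g.
have fA : fine A H by apply: fineI (fine_mulr _ fine_Lam); apply: fineI (fine_mulr _ fine_Lam); exact: fine_Lam.
apply: (covered_fine fA).
- by move=> a g [[h1 h2] h3]; split; [split; [exact: Lam_sc h1 | exact: Lam_scl h2] | exact: Lam_scl h3].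
- by move=> h [[hK _] _]; exact: dvK.
- move=> x Xx; have [g [xg gD gd]] := XX_dv Xx n; exists g => //; split=> //.
  have gI := Iw_sg2 ((D1 (hh g)).1 gD).
  split; [split|].
  + exact: Lam_D gD.
  + by apply: Lam_PV; apply: Ig_Kg; exact: Ig_P.
  + by apply: Lam_P; apply: Ig_Kg; exact: Ig_PV.
- move=> l _ ld; apply: covered_sub (covered1 0 ld) => x [_ [h [[hK h1] h2] ->]].
  rewrite invgK in h1; have [a b] := Kg_P_inO h1; have [d _] := Kg_PV_inO h2.
  apply: fl_mulr; apply: Ig_Iw; apply: (Ig_red qP hK).
  by apply: ord3_case => // _; exact: inO1_red.
Qed.

Lemma Par_n1 : Kg (P * n1 * P^-1)%g.
Proof.
have [n nK] : exists n, Kg (sc n * (P * n1 * P^-1))%g.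
  apply: (@D_tr0 (tau * s1 * tau^-1)%g); first by rewrite tau_s1 mulgK.
  by apply: D_mulPV; apply: D_Pmul; exact: D_rp.
apply: Kg_dv0 nK _; have [a aP] := dv_ex P.
by have := dvM (dvM aP (dvK (Kg_n1 k))) (dvV aP); rewrite addr0 subrr.
Qed.

(** The parahoric subgroup of [s1], up to scalars: the common stabiliser of the lattices of [1] and
    [P^-1]. *)
Definition Par (y : lg) := exists n, Kg (sc n * y)%g /\ Kg (P * (sc n * y) * P^-1)%g.

Lemma ParM x y : Par x -> Par y -> Par (x * y)%g.
Proof.
move=> [m [m1 m2]] [n [n1' n2]]; exists (m + n).
have [E1 E2] := gid24 (sc m) x y P (@scC k n).
by rewrite scD E2 E1; split; exact: KgM.
Qed.

Lemma Par_Iw i : Iw i -> Par i.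
Proof. by move=> [n nI]; exists n; split; [exact: Ig_Kg | apply: Ig_Kg; exact: Ig_P]. Qed.

Lemma Par_D y : D s1 y -> Par y.
Proof.
move=> [i [j [iI jI ->]]]; apply: ParM (Par_Iw jI); apply: ParM (Par_Iw iI) _.
by exists 0; rewrite sc0 mul1g; split; [exact: Kg_n1 | exact: Par_n1].
Qed.

Lemma Par_Lam (g : lg) : Par (g^-1 * sg (sg g))%g -> Lam g /\ Lam (g * P^-1)%g.
Proof.
move=> [n [n1' n2]]; have n0 := dv_inj (dvK n1') (dvM (dv_sc k n) (dv_sg2 g)).
have {}n0 : n = 0 by move: n0; rewrite addr0; lia.
rewrite n0 sc0 mul1g in n1' n2; split; first exact: n1'.
by apply: Lam_PV; exact: n2.
Qed.

Lemma Par_cell (h : lg) : Kg h -> Kg (P * h * P^-1)%g -> Ig h \/ exists z i, Ig i /\ h = (u z * n1 * i)%g.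
Proof.
move=> hK hP; have [h02 h12] := Kg_P_inO hP.
have [E|h01] := eqVneq (red (mx h) 0 1) 0.
  by left; apply: (Ig_red qP hK); apply: ord3_case => // _; exact: inO1_red.
right; pose z := red (mx h) 1 1 / red (mx h) 0 1; pose i := (n1 * (u (- z)%R * h))%g.
exists z, i; split; last by rewrite /i uN -mulgA (mulgA n1) n1n1 mul1g mulKVg.
have zE : z * red (mx h) 0 1 = red (mx h) 1 1 by rewrite /z mulfVK.
rewrite [red (mx h) 0 1]mxE [red (mx h) 1 1]mxE in zE.
have iK : Kg i by apply: KgM (Kg_n1 k) _; apply: KgM hK; exact: Ig_Kg (Ig_u _).
have iE a b : mx i a b = mx (u (- z)%R * h)%g (tperm 0 1 a) b.
  by rewrite rp_mull /= bary0 expr0z mul1r.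
apply: (Ig_red qP iK); apply: ord3_case => // _; rewrite mxE iE umul_mx permE /= ?mulr1n ?addr0.
- by rewrite coefLD coefL_constM mulNr zE subrr.
- by rewrite coefLD coefL_constM (h12 0) // (h02 0) // mulr0 addr0.
- by rewrite (h02 0).
Qed.

(** A rotation of [s0] ([rot_w0]). In this form [hh g * P^-1 * P^-1] lies in the cell of [s1], so
    that everything takes place in the parahoric subgroup of [s1]. *)
Definition w0 : iwahoriWeyl := (s1 * tau * tau)%g.

Lemma Par_w0 (g : lg) : D w0 (hh g) -> Par (g^-1 * sg (sg g))%g.
Proof.
move=> gD; pose a := (hh g * P^-1 * P^-1)%g.
have aD : D s1 a by have := D_mulPV (D_mulPV gD); rewrite /w0 !mulgK.
have [m mE] := sg_P qP.
have hE : hh g = (a * P * P)%g by rewrite /a !mulgVK.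
have sE : sg (hh g) = (sg a * (sc m * P^-1) * (sc m * P^-1))%g.
  by rewrite hE !sgM mE.
have yE : (g^-1 * sg (sg g) = sc m * sc m * (a * (P * (P * sg a * P^-1) * P^-1)))%g.
  rewrite (gid17 g (sg g)); apply: etrans (_ : hh g * sg (hh g) = _)%g.
    by rewrite /hh (sgM qP g^-1%g) sgV.
  rewrite sE; apply: gid19 => //; exact: scC.
rewrite yE; apply: ParM; first by rewrite -scD; apply: Par_Iw; exact: Iw_sc.
apply: ParM (Par_D aD) _; apply: Par_D.
have := D_mulPV (D_Pmul (D_mulPV (D_Pmul (sg_D qP aD)))).
rewrite delta_s1 gid25 //; have := tau3; by rewrite !expgS expg0 mulg1.
Qed.

Theorem base_w0 : Cov w0 1 /\ Near w0.
Proof.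
split; last by apply: near_Lam => g /Par_w0/Par_Lam[].
move=> n; set c := _ + _.
pose A (g : lg) := Lam g /\ Lam (g * P^-1)%g.
pose H (h : lg) := Kg h /\ Kg (P^-1^-1 * h * P^-1)%g.
have fA : fine A H by apply: fineI (fine_mulr _ fine_Lam); exact: fine_Lam.
apply: (covered_fine fA).
- by move=> a g [h1 h2]; split; [exact: Lam_sc h1 | exact: Lam_scl h2].
- by move=> h [hK _]; exact: dvK.
- move=> x Xx; have [g [xg gD gd]] := XX_dv Xx n; exists g => //; split=> //.
  by apply: Par_Lam; exact: Par_w0.
move=> l _ ld; have c1 := covered1 0 ld.
have c2 : covered c 1 [set x | exists z, x = fl (l * u z * n1)%g].
  apply: covered_line c1 _ => x [z xz]; exists (fl l) => // g' lg.
  have [y yE] : exists y, fl (l * u z * n1)%g = fl (g' * u y * n1)%g.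
    have [z' [i' iI E] _] := u_Iw z ((flE _ _).1 (esym lg)).
    by exists z'; exact: etrans (congr1 (@fl k) (gid8 E)) (fl_mulr _ iI).
  by exists y; rewrite xz.
apply: cov_union (covered_le (leq0n 1) c1) c2 _ => x [_ [h [hK hP ->]]].
rewrite invgK in hP; have [hI|[z [i [iI ->]]]] := Par_cell hK hP.
  by left; exact: fl_mulr (Ig_Iw hI).
by right; exists z; rewrite !mulgA; exact: fl_mulr (Ig_Iw iI).
Qed.

Lemma covered_cell (T : Type) (G : set (T -> k)) c d (l : lg) (X : set (flag k)) fa fb fc :
  gr G d -> alg G fa -> alg G fb -> alg G fc -> dv c l ->
  (forall x, X x -> exists t, x = fl (l * uu (fa t) (fb t) (fc t))%g) -> covered c d X.
Proof.
move=> Gd Ga Gb Gc ld H; apply: (cov_family (G := G) (phi := fun t => (l * uu (fa t) (fb t) (fc t))%g)) => //.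
  apply: regmxM; [exact: alg_isalg | apply: regmx_const; exact: alg_isalg |].
  by apply: regmx_uu => //; exact: alg_isalg.
by move=> t; rewrite -[c]addr0; apply: dvM ld (dvK (Kg_uu _ _ _)).
Qed.

(** Every point lies in [l Kg] for an invariant lattice [l], and by [Kg_cell] the flags in [l Kg]
    are covered by six cells of dimension 3. *)
Theorem base_s121 : Cov (s1 * s2 * s1)%g 3 /\ Near (s1 * s2 * s1)%g.
Proof.
have t0 : tr (s1 * s2 * s1)%g = 0 by rewrite /= ?(wactM, wact_s1, wact_s2, wact1).
split; last by apply: near_Lam => g; exact: Lam_D.
move=> n; set c := _ + _.
apply: (covered_fine fine_Lam); [exact: Lam_sc | exact: dvK | |].
  move=> x Xx; have [g [xg gD gd]] := XX_dv Xx n; exists g => //; split=> //.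
  exact: Lam_D gD.
move=> l _ ld.
pose Z (p : 'S_3) := [set x | exists t : (k * k) * k, x = fl (l * rp (IW 0 p) * uu t.1.1 t.1.2 t.2)%g].
apply: (covered_sub (X := [set x | exists p, Z p x])).
  move=> x [_ [h hK ->]]; have [p [a [b [e [i [iI ->]]]]]] := Kg_cell qP hK.
  by exists p, ((a, b), e); rewrite !mulgA; exact: fl_mulr (Ig_Iw iI).
apply: covered_fin => p.
have G2 : gr (gen_prod (@gen2 k)) 3 by apply: gr_prod; exact: gr2.
apply: (covered_cell (fa := fun t => t.1.1) (fb := fun t => t.1.2) (fc := snd) G2).
- by apply: alg_gen; left; exists fst => //; left.
- by apply: alg_gen; left; exists snd => //; right.
- by apply: alg_gen; right.
- by rewrite -[c]addr0; apply: dvM ld (dvK (Kg_rp0 _ _)).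
- by [].
Qed.

End Bases.

(** * Upper bound for [s1]: a plane curve *)

Section CurveBase.
Variables (k : closedFieldType) (q : nat) (qP : [pchar k].-nat q).
Hypothesis q1 : (1 < q)%N.
Local Notation L := (laurent k).
Local Notation eps := (eps k).
Local Notation lg := (lg k).
Local Notation rp := (@rp k).
Local Notation sc := (@sc k).
Local Notation sg := (sg qP).
Local Notation hh := (hh qP).
Local Notation XX := (XX qP).
Local Notation Lam := (Lam qP).
Local Notation Cov := (Cov qP).
Local Notation Near := (Near qP Lam).
Local Notation bary := (@barycentric int).
Local Notation P := (rp tau).
Local Notation n1 := (rp s1).

Lemma poly4_eq0 (A B C E : k) : (forall x, A + B * x + C * x ^+ q + E * x ^+ q.+1 = 0) ->
  [/\ A = 0, B = 0, C = 0 & E = 0].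
Proof.
move=> H; pose p := A%:P + B *: 'X + C *: 'X^q + E *: 'X^(q.+1).
have p0 : p = 0.
  apply/eqP/negPn/negP => pN; have [x [+ _]] := poly_nonroot2 pN pN.
  by rewrite /p !hornerE H eqxx.
have cE i : p`_i = 0 by rewrite p0 coef0.
have [q0 q1'] : (0 == q)%N = false /\ (1 == q)%N = false by split; apply/eqP; lia.
have := (cE 0%N, cE 1%N, cE q, cE q.+1); rewrite /p !coefE q0 q1'.
have -> : (q == 0)%N = false by apply/eqP; lia.
have -> : (q == 1)%N = false by apply/eqP; lia.
rewrite !eqxx !eqSS (_ : (0 == q)%N = false) // (_ : (q == 0)%N = false); last by apply/eqP; lia.
rewrite (_ : (q == q.+1) = false); last by apply/eqP; lia.
rewrite (_ : (q.+1 == q) = false); last by apply/eqP; lia.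
by rewrite !(mulr0, mulr1, addr0, add0r) => -[[[-> ->] ->] ->].
Qed.

Section Curve.
Variable h : 'I_3 -> 'I_3 -> k.
(** For the point [g0 * uu a b e] put [t = (- a, a e - b)]; then [(1, t.1, t.2)] is the first row of
    [(uu a b e)^-1]. With [h] the leading coefficients of [hh g0], those in the last column of
    [hh g0 * sg (uu a b e)] are [N i t]. In the cell of [s1] this column is proportional to
    [(b, e, 1)]; it is then orthogonal to that row, which is [f t = 0], and [e] is [N 1 / N 2]. *)
Let N i (t : k * k) := h i 0 * t.2 ^+ q + h i 1 * t.1 ^+ q + h i 2%:R.
Let f t := N 0 t + t.1 * N 1 t + t.2 * N 2%:R t.

Let Nalg i : alg (@gen2 k) (N i).
Proof.
have [a1 a2] : alg (@gen2 k) fst /\ alg (@gen2 k) snd by split; apply: alg_gen; [left | right].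
apply: alg_add (alg_const _ _); apply: alg_add; apply: alg_mul (alg_const _ _) _; exact: alg_exp.
Qed.

Let falg : alg (@gen2 k) f.
Proof.
have [a1 a2] : alg (@gen2 k) fst /\ alg (@gen2 k) snd by split; apply: alg_gen; [left | right].
by apply: alg_add (alg_mul a2 (Nalg _)); apply: alg_add (Nalg _) (alg_mul a1 (Nalg _)).
Qed.

(** The nine monomials of [f] are distinct because [q > 1], so [f] vanishes identically only if all
    entries of [h] do, in particular those in [N 2]. *)
Let f_neq0 t : N 2%:R t != 0 -> exists t, f t != 0.
Proof.
move=> Nt; apply: contrapT => nf; move/eqP: Nt; apply.
have f0 x y : f (x, y) = 0 by apply/eqP/negPn/negP => fN; apply: nf; exists (x, y).
have H y : [/\ h 0 0 * y ^+ q + h 0 2%:R + h 2%:R 0 * y ^+ q.+1 + h 2%:R 2%:R * y = 0,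
    h 1 0 * y ^+ q + h 1 2%:R = 0, h 0 1 + h 2%:R 1 * y = 0 & h 1 1 = 0].
  by apply: poly4_eq0 => x; rewrite -(f0 x y) /f /N /= !exprS; ring.
have [_ h22 _ h20] : [/\ h 0 2%:R = 0, h 2%:R 2%:R = 0, h 0 0 = 0 & h 2%:R 0 = 0].
  by apply: poly4_eq0 => y; have [<- _ _ _] := H y; ring.
have [_ h21 _ _] : [/\ h 0 1 = 0, h 2%:R 1 = 0, (0 : k) = 0 & (0 : k) = 0].
  by apply: poly4_eq0 => y; rewrite !mul0r !addr0; have [_ _ -> _] := H y.
by rewrite /N h22 h20 h21 !mul0r !addr0.
Qed.

Lemma covered_curve c (l : lg) (X : set (flag k)) : dv c l ->
  (forall x, X x -> exists t : (k * k) * k, [/\ f t.1 = 0, N 2%:R t.1 != 0, t.2 * N 2%:R t.1 = N 1 t.1 &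
     x = fl (l * uu (- t.1.1) (- t.1.1 * t.2 - t.1.2) t.2)%g]) -> covered c 1 X.
Proof.
move=> ld H; have [[x Xx]|nX] := pselect (exists x, X x); last first.
  by apply: covered_sub (covered0 k c 1) => x Xx; apply: nX; exists x.
have [t0 [_ /f_neq0 fN _ _]] := H x Xx.
pose T' := {t : (k * k) * k | [/\ f t.1 = 0, N 2%:R t.1 != 0 & t.2 * N 2%:R t.1 = N 1 t.1]}.
have h0 (t : T') : f (sval t).1 = 0 by case: (svalP t).
pose phi (t : T') : {t | f t = 0} := exist _ (sval t).1 (h0 t).
pose G : set ({t | f t = 0} -> k) := [set (c \o (@sval _ (fun t => f t = 0))) | c in @gen2 k].
pose G' : set (T' -> k) := [set (fun t => (sval t).1.1); (fun t => (sval t).1.2)] `|` [set (fun t => (sval t).2)].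
have up g : alg (@gen2 k) g -> alg G (g \o sval).
  move=> ga; apply: (alg_comp (phi := @sval _ (fun t => f t = 0))) ga => c' cG.
  by apply: alg_gen; exists c'.
have [[s sP] [s' sP']] := (up _ (Nalg 2%:R), up _ (Nalg 1)).
have G1 : gr G 1 by apply: gr_curve.
have G'1 : gr G' 1.
  apply: (gr_dom (Q := 1) (phi := phi) (K := (1 + s + s')%N) _ _ _ _ G1).
  - by [].
  - by apply: fil_le sP; lia.
  - by move=> t; have [_ + _] := svalP t.
  move=> c' [[->|->]|->].
  - exists (fun t => (sval t).1 * (N 2%:R \o sval) t) => //.
    by apply: fil_le (leq_addr _ _) _; apply: fil_mul sP; apply: fil_gen; exists fst => //; left.
  - exists (fun t => (sval t).2 * (N 2%:R \o sval) t) => //.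
    by apply: fil_le (leq_addr _ _) _; apply: fil_mul sP; apply: fil_gen; exists snd => //; right.
  - exists (N 1 \o sval); first by apply: fil_le sP'; lia.
    by move=> t; have [_ _ +] := svalP t.
have [a1 [a2 a3]] : alg G' (fun t => (sval t).1.1) /\ alg G' (fun t => (sval t).1.2) /\ alg G' (fun t => (sval t).2).
  by split; [|split]; apply: alg_gen; [left; left | left; right | right].
apply: (covered_cell (l := l) (fa := fun t => - (sval t).1.1) (fb := fun t => - (sval t).1.1 * (sval t).2 - (sval t).1.2)
   (fc := fun t => (sval t).2) G'1) => //.
- exact: alg_opp.
- by apply: alg_add (alg_opp a2); apply: alg_mul (alg_opp a1) a3.
- by move=> y /H[t [t1 t2 t3 ->]]; exists (exist _ t (And3 t1 t2 t3)).
Qed.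
End Curve.

(** [s1] fixes the last basis vector, so to leading order the last column of [y] has only its last
    entry. *)
Lemma D_s1_col n (y : lg) : D s1 y -> dv (3 * n) y ->
  [/\ inO n (mx y 2%:R 2%:R), coefL (mx y 2%:R 2%:R) n != 0, inO (n + 1) (mx y 0 2%:R) & inO (n + 1) (mx y 1 2%:R)].
Proof.
move=> yD yd; have [m [i [j [iI jI yE]]]] := D_Ig yD.
have mn : m = n.
  rewrite yE in yd; have := dv_inj yd (dv_D s1 m iI jI).
  rewrite /wdeg !big_ord_recl big_ord0 /= !bary0; lia.
rewrite {}mn in yE.
have E a : mx y a 2%:R = eps ^ n * (mx i a 0 * mx j 1 2%:R + mx i a 1 * mx j 0 2%:R + mx i a 2%:R * mx j 2%:R 2%:R).
  rewrite yE mx_scM -mulgA mxME !big_ord_recl big_ord0 !rp_mull /= !bary0 !expr0z !mul1r addr0 !permE /= addrA.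
  have e1 : lift ord0 ord0 = 1 :> 'I_3 by exact: val_inj.
  have e2 : lift ord0 (lift ord0 ord0) = 2%:R :> 'I_3 by exact: val_inj.
  by rewrite e1 e2 (_ : ord0 = 0).
have jO : inO 1 (mx j 0 2%:R) /\ inO 1 (mx j 1 2%:R) by split; [exact: (@iwahoriGL_inO _ _ 0 2%:R jI) | exact: (@iwahoriGL_inO _ _ 1 2%:R jI)].
have iO a b : inO 0 (mx i a b) by apply: glO_inO; exact: Ig_Kg.
have H1 a : inO 1 (mx i a 0 * mx j 1 2%:R + mx i a 1 * mx j 0 2%:R).
  by apply: inO_add; rewrite -[1]add0r; apply: inO_mul => //; case: jO.
have H2 a : inO 1 (mx i a 2%:R) -> inO 1 (mx i a 2%:R * mx j 2%:R 2%:R).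
  by move=> ia; rewrite -[1]addr0; apply: inO_mul ia _; apply: glO_inO; exact: Ig_Kg.
have en a x : inO a x -> inO (n + a) (eps ^ n * x) by apply: inO_mul; exact: inO_epsp.
split.
- rewrite E -{1}(addr0 n); apply: (en); apply: inO_add; first by apply: inO_le (H1 _).
  by rewrite -[0]addr0; apply: inO_mul; [exact: iO | apply: glO_inO; exact: Ig_Kg].
- rewrite E coefL_epsz subrr coefLD H1 // add0r.
  rewrite -[X in coefL _ X](addr0 (0 : int)) coefL_mul_lead; [|exact: iO | apply: glO_inO; exact: Ig_Kg].
  by rewrite mulf_neq0 //; exact: iwahoriGL_diag.
- by rewrite E; apply: (en); apply: inO_add (H1 _) (H2 _ _); exact: (@iwahoriGL_inO _ _ 0 2%:R iI).
- by rewrite E; apply: (en); apply: inO_add (H1 _) (H2 _ _); exact: (@iwahoriGL_inO _ _ 1 2%:R iI).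
Qed.

Lemma gid27 (gT : groupType) (g u s t : gT) : ((g * u)^-1 * (s * t) = u^-1 * (g^-1 * s * t))%g.
Proof. by rewrite invMg !mulgA. Qed.

Lemma mxM3 (g h : lg) i j : mx (g * h)%g i j =
  mx g i 0 * mx h 0 j + mx g i 1 * mx h 1 j + mx g i 2%:R * mx h 2%:R j.
Proof.
have e1 : lift ord0 ord0 = 1 :> 'I_3 by exact: val_inj.
have e2 : lift ord0 (lift ord0 ord0) = 2%:R :> 'I_3 by exact: val_inj.
by rewrite mxME !big_ord_recl big_ord0 addr0 e1 e2 addrA.
Qed.

Lemma column_eq (h y : lg) N a b e i : (h * sg (uu a b e) = uu a b e * y)%g ->
  inO (N + 1) (mx y 0 2%:R) -> inO (N + 1) (mx y 1 2%:R) ->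
  coefL (mx h i 0) N * (a * e - b) ^+ q + coefL (mx h i 1) N * (- a) ^+ q + coefL (mx h i 2%:R) N =
  U0 a b e i 2%:R * coefL (mx y 2%:R 2%:R) N.
Proof.
move=> hE d3 d4.
have cc (x : k) (z : L) : coefL (z * constL x) N = coefL z N * x by rewrite mulrC coefL_constM mulrC.
have E1 (a' b' e' : k) i' j' : mx (uu a' b' e') i' j' = constL (U0 a' b' e' i' j') by rewrite [LHS]mxE.
have E2 : coefL (mx (uu a b e * y)%g i 2%:R) N = U0 a b e i 2%:R * coefL (mx y 2%:R 2%:R) N.
  have d3' : coefL (mx y 0 2%:R) N = 0 by apply: d3; lia.
  have d4' : coefL (mx y 1 2%:R) N = 0 by apply: d4; lia.
  rewrite mxM3 (E1 a b e i 0) (E1 a b e i 1) (E1 a b e i 2%:R) 2!coefLD 3!coefL_constM d3' d4'.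
  by rewrite !mulr0 !add0r.
rewrite -E2 -hE sg_uu mxM3 (E1 _ _ _ 0 2%:R) (E1 _ _ _ 1 2%:R) (E1 _ _ _ 2%:R 2%:R) 2!coefLD 3!cc [U0 _ _ _ 0 2%:R]mxE [U0 _ _ _ 1 2%:R]mxE [U0 _ _ _ 2%:R 2%:R]mxE /=.
by rewrite mulr1 (expqN qP).
Qed.

Theorem base_s1 : Cov s1 1 /\ Near s1.
Proof.
split; last by apply: near_Lam => g; exact: Lam_D.
move=> n; set c := _ + _.
apply: (covered_fine qP q1 (@fine_Lam _ _ qP q1)); [exact: Lam_sc | exact: dvK | |].
  move=> x Xx; have [g [xg gD gd]] := XX_dv Xx n; exists g => //; split=> //.
  exact: Lam_D gD.
move=> l _ ld.
pose Z (p : 'S_3) := [set x | XX s1 x /\ exists a b e, x = fl (l * rp (IW 0 p) * uu a b e)%g].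
apply: (covered_sub (X := [set x | exists p, Z p x])).
  move=> x [Xx [h hK xE]]; have [p [a [b [e [i [iI hE]]]]]] := Kg_cell qP hK.
  have {}xE : x = fl (l * rp (IW 0 p) * uu a b e)%g.
    by rewrite xE hE !mulgA; exact: fl_mulr (Ig_Iw iI).
  by exists p; split=> //; exists a, b, e.
apply: covered_fin => p; pose g0 := (l * rp (IW 0 p))%g.
have g0d : dv c g0 by rewrite -[c]addr0; apply: dvM ld (dvK (Kg_rp0 _ _)).
have gd a b e : dv (- c - c) (hh (g0 * uu a b e)%g).
  by apply: dv_hh; rewrite -[c]addr0; apply: dvM g0d (dvK (Kg_uu _ _ _)).
(* If [- c - c] is not a multiple of 3, no representative of determinant valuation [c] occurs, since
   [s1] has degree 0. *)
have [[N cN]|nN] := pselect (exists N, - c - c = 3 * N); last first.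
  apply: covered_sub (covered0 k c 1) => x [/= Xx [a [b [e xE]]]]; apply: nN.
  rewrite xE in Xx; have [m [i [j [iI jI yE]]]] := D_Ig ((XX_fl _ _ _).1 Xx).
  exists m; have := gd a b e; rewrite yE => H; have := dv_inj H (dv_D s1 m iI jI).
  by rewrite /wdeg !big_ord_recl big_ord0 /= !bary0; lia.
apply: (covered_curve (h := fun i j => coefL (mx (hh g0) i j) N) g0d) => x [Xx [a [b [e xE]]]].
have [d1 d2 d3 d4] : [/\ inO N (mx (hh (g0 * uu a b e)%g) 2%:R 2%:R),
    coefL (mx (hh (g0 * uu a b e)%g) 2%:R 2%:R) N != 0, inO (N + 1) (mx (hh (g0 * uu a b e)%g) 0 2%:R) &
    inO (N + 1) (mx (hh (g0 * uu a b e)%g) 1 2%:R)].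
  by apply: D_s1_col; [apply/XX_fl; rewrite -xE | rewrite -cN; exact: gd].
have hE : (hh g0 * sg (uu a b e) = uu a b e * hh (g0 * uu a b e))%g.
  have -> : hh (g0 * uu a b e)%g = ((uu a b e)^-1 * (hh g0 * sg (uu a b e)))%g.
    by apply: etrans (gid27 _ _ _ _); rewrite /hh (sgM qP g0).
  by rewrite mulKVg.
have NE i := column_eq i hE d3 d4.
exists ((- a, a * e - b), e); rewrite /= !NE ![U0 _ _ _ _ _]mxE /=; split.
- ring.
- by rewrite mul1r.
- by rewrite mul1r.
- have E1 : - - a = a by rewrite opprK.
  have E2 : - - a * e - (a * e - b) = b by ring.
  exact: etrans xE (congr2 (fun a' b' => fl (g0 * uu a' b' e)%g) (esym E1) (esym E2)).
Qed.

End CurveBase.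

Lemma curve_inverse (F : fieldType) (b e : F) n : b != 0 -> b + b ^+ n = - e ^+ n.+1 ->
  b^-1 ^+ n + b^-1 + (e / b) ^+ n.+1 = 0.
Proof.
move=> b0 E; rewrite expr_div_n exprVn -[e ^+ n.+1]opprK -E [b ^+ n.+1]exprS.
have : b ^+ n != 0 by rewrite expf_neq0.
move: (b ^+ n) => B B0; field; by rewrite ?b0 ?B0.
Qed.

Lemma curve_telescope (F : comRingType) (B Bq c d x xq : F) : B + Bq = c - d ->
  x + xq - c = x - B + (xq - Bq) - d.
Proof. by move=> E; have -> : c = B + Bq + d by [rewrite E subrK]; ring. Qed.

Lemma weight_inj (q i j i' j' : nat) : - (q%:Z * j%:Z + q.+1%:Z * i%:Z) = - (q%:Z * j'%:Z + q.+1%:Z * i'%:Z) ->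
  (i < q)%N -> (i' < q)%N -> i = i' /\ j = j'.
Proof.
move=> /oppr_inj; rewrite -!PoszM -!PoszD => -[E] iq iq'.
have E1 : ((j + i) * q + i = (j' + i') * q + i')%N by rewrite !mulnDl; lia.
have ii : i = i' by have := congr1 (modn^~ q) E1; rewrite !modnMDl !modn_small.
by split=> //; move: E; rewrite ii => /eqP; rewrite eqn_add2r eqn_pmul2l; [move/eqP | lia].
Qed.

(** * Irreducibility of the curve [y^q + y + x^(q+1) = 0] *)

Section UnitalCurve.
Variables (k : closedFieldType) (q : nat) (qP : [pchar k].-nat q).
Hypothesis q1 : (1 < q)%N.
Local Notation L := (laurent k).
Local Notation eps := (eps k).

(* Elements with pairwise distinct valuations are linearly independent. *)
Lemma sum_hasval (I : finType) (F : I -> L) (v : I -> int) (P : pred I) i0 :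
  (forall i, P i -> hasval (v i) (F i)) -> (forall i, ~~ P i -> F i = 0) ->
  (forall i j, P i -> P j -> v i = v j -> i = j) -> P i0 -> \sum_i F i != 0.
Proof.
move=> FP F0 vI Pi0; pose i := [arg min_(i < i0 | P i) v i]%O.
have [iP imin] : P i /\ forall j, P j -> v i <= v j by rewrite /i; case: arg_minP.
have F1 : coefL (\sum_i F i) (v i) = coefL (F i) (v i).
  rewrite coefL_sum (bigD1 i) //= big1 ?addr0 // => j ji.
  have [jP|/F0->] := boolP (P j); last by rewrite coefL0.
  have [jO _] := FP j jP; apply: jO; rewrite lt_neqAle imin // andbT.
  by apply: contraNneq ji => /vI -> //.
apply/negP => /eqP S0; have [_] := FP i iP; rewrite -F1 S0 coefL0 eqxx; by [].
Qed.

Lemma qPL : [pchar L].-nat q.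
Proof. by apply: sub_in_pnat qP => p _; exact: (rmorph_pchar (@constL k : {rmorphism k -> L})). Qed.

Lemma q_eq0 : q%:R = 0 :> k.
Proof.
have pq : pdiv q \in \pi(q) by rewrite pi_pdiv.
by apply/eqP; rewrite -(dvdn_pcharf (pnatPpi qP pq)) pdiv_dvd.
Qed.

(** The series with terms [(-1)^(i+1) eps^((q+1) q^i)] telescopes: the [q]-th power of each term is
    minus the next one. The partial sum [bN N] agrees with the limit below order [e N]. *)
Lemma beta_ex : exists2 b : L, b + b ^+ q = - eps ^+ q.+1 & hasval q.+1%:Z b.
Proof.
pose e i := (q.+1 * q ^ i)%N.
have e_lt i : (i < e i)%N.
  by apply: (@leq_trans (q ^ i)); [exact: ltn_expl | rewrite leq_pmull].
have e_le i j : (i <= j)%N -> (e i <= e j)%N by move=> ij; rewrite leq_mul2l leq_exp2l.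
pose c i : L := (-1) ^+ i.+1 * eps ^ (e i)%:Z.
have cO i : inO (e i)%:Z (c i).
  rewrite -[X in inO X]add0r; apply: inO_mul; last exact: inO_epsp.
  by rewrite -[-1](rmorphN1 (@constL k)) -rmorphXn; exact: inO_const.
pose bN N : L := \sum_(i < N) c i.
have cq i : c i ^+ q = - c i.+1.
  have sq : (-1) ^+ q = -1 :> L by rewrite (expqN qPL) expr1n.
  rewrite /c exprMn exprAC sq -[eps ^ (e i)%:Z]/(eps ^+ e i) -exprM.
  have -> : (e i * q)%N = e i.+1 by rewrite /e expnSr mulnA.
  by rewrite [in RHS]exprS mulN1r mulNr opprK.
have bNE N : bN N + bN N ^+ q = c 0%N - c N.
  elim: N => [|N IH]; first by rewrite /bN big_ord0 (expq0 qPL) addr0 subrr.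
  by rewrite /bN big_ord_recr /= (expqD qPL) cq addrACA IH addrA subrK.
have stab N d n : n < (e N)%:Z -> coefL (bN (N + d)%N) n = coefL (bN N) n.
  move=> nN; elim: d => [|d IH]; first by rewrite addn0.
  rewrite addnS /bN big_ord_recr /= coefLD IH cO ?addr0 //.
  by have := e_le N (N + d)%N (leq_addr _ _); lia.
have bN0 N n : n < 0 -> coefL (bN N) n = 0.
  by move=> n0; apply: (@inO_sum k 0) => // i _; apply: inO_le (cO i).
pose b : L := (@FracField.tofrac (fps k)) (Fps (fun n => coefL (bN n) n%:Z)).
have bE N : inO (e N)%:Z (b - bN N).
  move=> n nN; rewrite coefLD coefLN coefL_ofps; case: n nN => n nN; last by rewrite /= bN0 ?subrr.
  by rewrite /= -(stab n N n%:Z) ?ltz_nat // addnC (stab N n) ?subrr.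
have powO N (x : L) : inO (e N)%:Z x -> inO (e N)%:Z (x ^+ q).
  move=> xO; rewrite (_ : q = q.-1.+1); last by lia.
  rewrite exprS -[X in inO X]addr0; apply: inO_mul (xO) _.
  elim: (q.-1) => [|m IH]; first by rewrite expr0; exact: inO1.
  by rewrite exprS -[X in inO X]addr0; apply: inO_mul IH; apply: inO_le xO; lia.
exists b.
  have c0 : c 0%N = - eps ^+ q.+1 by rewrite /c expr1 mulN1r /e expn0 muln1.
  rewrite -c0; apply/eqP; rewrite -subr_eq0; apply/eqP; apply: coefL_inj => n; rewrite coefL0.
  pose N := (absz n).+1.
  have -> : b + b ^+ q - c 0%N = (b - bN N) + (b - bN N) ^+ q - c N.
    by rewrite (expqD qPL) (expqN qPL); exact: curve_telescope (bNE N).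
  have O : inO (e N)%:Z ((b - bN N) + (b - bN N) ^+ q - c N).
    by apply: inO_add (inO_opp (cO N)); apply: inO_add (bE N) (powO N _ (bE N)).
  by apply: O; have := e_lt N; rewrite /N; lia.
have b1 : bN 1%N = c 0%N by rewrite /bN big_ord_recl big_ord0 addr0.
have e0 : e 0%N = q.+1 by rewrite /e expn0 muln1.
have e1 : (e 0%N < e 1%N)%N by rewrite /e expn0 expn1; nia.
have -> : b = c 0%N + (b - bN 1%N) by rewrite b1 addrC subrK.
rewrite -e0; split.
  by apply: inO_add (cO 0%N) _; apply: inO_le (bE 1%N); lia.
rewrite coefLD (bE 1%N) ?addr0; last by lia.
by rewrite /c expr1 mulN1r coefLN coefL_epsp eqxx oppr_eq0 oner_eq0.
Qed.

(* In [y] over [k[x]]. *)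
Definition curve_poly : {poly {poly k}} := 'X^q + 'X + ('X^(q.+1))%:P.
Definition ev2 (x y : k) (p : {poly {poly k}}) : k := p.[y%:P].[x].

Lemma curve_monic : curve_poly \is monic /\ size curve_poly = q.+1.
Proof.
have s : (size ('X + ('X^(q.+1))%:P : {poly {poly k}})%R < size ('X^q : {poly {poly k}})%R)%N.
  rewrite size_polyXn; apply: leq_ltn_trans (size_polyD _ _) _.
  rewrite size_polyX gtn_max; apply/andP; split; first by lia.
  by apply: leq_ltn_trans (size_polyC_leq1 _) _; lia.
rewrite /curve_poly -addrA; split; last by rewrite size_polyDl // size_polyXn.
by rewrite monicE lead_coefDl // lead_coefXn.
Qed.

Lemma ev2D x y p r : ev2 x y (p + r) = ev2 x y p + ev2 x y r.
Proof. by rewrite /ev2 !hornerE. Qed.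

Lemma ev2M x y p r : ev2 x y (p * r) = ev2 x y p * ev2 x y r.
Proof. by rewrite /ev2 !hornerE. Qed.

Lemma ev2_curve x y : ev2 x y curve_poly = y ^+ q + y + x ^+ q.+1.
Proof. by rewrite /ev2 /curve_poly !hornerE. Qed.

(* A reduced polynomial vanishing on the curve is zero, as the [q] points
   above each [x] are distinct. *)
Lemma reduced_point (r : {poly {poly k}}) : r != 0 -> (size r <= q)%N ->
  exists x y, y ^+ q + y + x ^+ q.+1 = 0 /\ ev2 x y r != 0.
Proof.
move=> r0 rq; have l0 : lead_coef r != 0 by rewrite lead_coef_eq0.
have [x [rx _]] := poly_nonroot2 l0 l0.
pose s := map_poly (horner_eval x) r.
have s0 : s != 0.
  by apply: contraNneq rx => s0; rewrite -[_.[x]]/(horner_eval x _) lead_coefE -coef_map -/s s0 coef0.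
have sq : (size s <= q)%N by apply: leq_trans rq; exact: size_poly.
pose g : {poly k} := 'X^q + 'X + (x ^+ q.+1)%:P.
have [rs gE] := closed_field_poly_normal g.
have gs : size g = q.+1.
  rewrite /g -addrA size_polyDl ?size_polyXn //; apply: leq_ltn_trans (size_polyD _ _) _.
  rewrite size_polyX gtn_max; apply/andP; split; first by lia.
  by apply: leq_ltn_trans (size_polyC_leq1 _) _; lia.
have lg0 : lead_coef g != 0 by rewrite lead_coef_eq0 -size_poly_eq0 gs.
have us : uniq rs.
  rewrite -separable_prod_XsubC -(eqp_separable (eqp_scale _ lg0)) -gE unlock.
  rewrite /g !derivD derivXn derivX derivC addr0 -scaler_nat q_eq0 scale0r add0r.
  exact: coprimep1.
have srs : size rs = q.
  by have := gs; rewrite gE size_scale // size_prod_XsubC => -[].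
have [/allP all0|/allPn[y yr sy]] := boolP (all (root s) rs).
  by have := leq_trans (max_poly_roots s0 (introT allP all0) us) sq; rewrite srs ltnn.
exists x, y; split.
  have : root g y by rewrite gE rootZ // root_prod_XsubC.
  by rewrite rootE /g !hornerE => /eqP.
move: sy; rewrite rootE; congr (_ != _).
by rewrite /s -{1}[y](hornerC y x) -[_.[x]]/(horner_eval x _) horner_map.
Qed.

(* The function field of the curve embeds into [L], with [x] and [y] of
   valuations [-q] and [-(q+1)]. *)
Lemma evL_ex : exists x y : L, [/\ y ^+ q + y + x ^+ q.+1 = 0, hasval (- q%:Z) x & hasval (- q.+1%:Z) y].
Proof.
have [b bE bv] := beta_ex; exists (eps / b), b^-1.
have b0 := hasval_neq0 bv; have bV := hasvalV bv; split=> //; last first.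
  rewrite (_ : - q%:Z = 1 + - q.+1%:Z); last by lia.
  by apply: hasval_mul bV; rewrite -[eps]expr1z; exact: hasval_eps.
exact: curve_inverse.
Qed.

Definition evL (x y : L) (p : {poly {poly k}}) : L := (map_poly (map_poly (@constL k)) p).[y%:P].[x].

Lemma evLE x y p : evL x y p = \sum_(i < size p) \sum_(j < size p`_i) constL p`_i`_j * x ^+ j * y ^+ i.
Proof.
rewrite /evL (horner_coef _ y%:P) size_map_inj_poly; last first.
- by rewrite rmorph0.
- exact: map_poly_inj.
rewrite horner_sum; apply: eq_bigr => i _; rewrite !hornerE coef_map /= horner_coef.
rewrite size_map_inj_poly; [|exact: fmorph_inj | exact: rmorph0].
by rewrite mulr_suml; apply: eq_bigr => j _; rewrite coef_map.
Qed.

(** The monomial [x^j y^i] has valuation [-(q j + (q+1) i)], and these values are distinct for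
    [i < q] ([weight_inj]). *)
Lemma reduced_evL x y (r : {poly {poly k}}) : hasval (- q%:Z) x -> hasval (- q.+1%:Z) y ->
  r != 0 -> (size r <= q)%N -> evL x y r != 0.
Proof.
move=> xv yv r0 rq.
pose M := (\max_(i < size r) size (r`_i)%R)%N.
pose F (ij : 'I_(size r) * 'I_M) : L := constL r`_ij.1`_ij.2 * x ^+ ij.2 * y ^+ ij.1.
have hvX (z : L) a n : hasval a z -> hasval (n%:Z * a) (z ^+ n).
  move=> za; elim: n => [|n IH]; first by rewrite mul0r expr0; exact: hasval1.
  by rewrite exprS (_ : n.+1%:Z * a = a + n%:Z * a); [exact: hasval_mul | lia].
have -> : evL x y r = \sum_ij F ij.
  rewrite evLE -(pair_bigA _ (fun i j => F (i, j))); apply: eq_bigr => i _ /=.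
  have iM : (size (r`_i)%R <= M)%N by exact: (@leq_bigmax _ (fun i : 'I_(size r) => size (r`_i)%R) i).
  rewrite (big_ord_widen M (fun j => constL r`_i`_j * x ^+ j * y ^+ i)) //.
  rewrite [LHS]big_mkcond; apply: eq_bigr => j _; rewrite /F /=.
  by case: ltnP => // ji; rewrite nth_default // rmorph0 !mul0r.
have i0P : ((size r).-1 < size r)%N by rewrite prednK // size_poly_gt0.
pose i0 := Ordinal i0P.
have j0P : ((size (r`_i0)%R).-1 < M)%N.
  apply: (@leq_trans (size (r`_i0)%R)); last exact: (@leq_bigmax _ (fun i : 'I_(size r) => size (r`_i)%R) i0).
  by rewrite prednK // size_poly_gt0 -lead_coefE lead_coef_eq0.
apply: (@sum_hasval _ F (fun ij => - (q%:Z * ij.2%:Z + q.+1%:Z * ij.1%:Z)) (fun ij => r`_ij.1`_ij.2 != 0) (i0, Ordinal j0P)).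
- move=> [i j] /= c0; rewrite (_ : - _ = 0 + j%:Z * - q%:Z + i%:Z * - q.+1%:Z); last by ring.
  apply: hasval_mul (hvX _ _ _ yv); apply: hasval_mul (hvX _ _ _ xv).
  by split; [exact: inO_const | rewrite coefL_const].
- by move=> [i j] /=; rewrite negbK => /eqP E; rewrite /F /= E rmorph0 !mul0r.
- move=> [i j] [i' j'] /= _ _ E; have iq := leq_trans (ltn_ord i) rq; have iq' := leq_trans (ltn_ord i') rq.
  by have [ii jj] := weight_inj E iq iq'; congr (_, _); apply: val_inj.
- by rewrite /= -lead_coefE -lead_coefE lead_coef_eq0 lead_coef_eq0.
Qed.

Definition curve := {t : k * k | t.2 ^+ q + t.2 + t.1 ^+ q.+1 = 0}.
Definition curve_gen : set (curve -> k) := [set (c \o sval) | c in @gen2 k].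

Lemma curve_rep f : alg curve_gen f -> exists p, forall t, f t = ev2 (sval t).1 (sval t).2 p.
Proof.
case=> s; elim=> [c _|_ _ [c [->|->] <-]|_ g h _ [pg Eg] _ [ph Eh]|_ _ g h _ [pg Eg] _ [ph Eh]].
- by exists c%:P%:P => t; rewrite /ev2 !hornerE.
- by exists 'X%:P => t; rewrite /ev2 !hornerE.
- by exists 'X => t; rewrite /ev2 !hornerE.
- by exists (pg + ph) => t; rewrite ev2D Eg Eh.
- by exists (pg * ph) => t; rewrite ev2M Eg Eh.
Qed.

(** A function on the curve is nonzero if and only if its remainder modulo [curve_poly] is:
    [reduced_point] then finds a point, and [reduced_evL] a nonzero value in [L]. As evaluation in
    the field [L] is multiplicative, products of nonzero functions are nonzero. *)
Lemma dom_curve : dom curve_gen.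
Proof.
have [x [y [E xv yv]]] := evL_ex; have [cm cs] := curve_monic.
have evM p r : evL x y (p * r) = evL x y p * evL x y r by rewrite /evL rmorphM !hornerE.
have evD p r : evL x y (p + r) = evL x y p + evL x y r by rewrite /evL rmorphD !hornerE.
have ev0 : evL x y curve_poly = 0.
  by rewrite /evL /curve_poly !rmorphD /= map_polyXn map_polyX map_polyC /= map_polyXn !hornerE.
have key p : (exists t : curve, ev2 (sval t).1 (sval t).2 p != 0) <-> evL x y p != 0.
  have dE := Pdiv.RingMonic.rdivp_eq cm p; set r := Pdiv.CommonRing.rmodp _ _ in dE.
  have rq : (size r <= q)%N by rewrite -ltnS -cs Pdiv.CommonRing.ltn_rmodp monic_neq0.
  have -> : evL x y p = evL x y r by rewrite dE evD evM ev0 mulr0 add0r.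
  have Er (t : curve) : ev2 (sval t).1 (sval t).2 p = ev2 (sval t).1 (sval t).2 r.
    rewrite {1}dE ev2D ev2M ev2_curve; case: t => -[a b] /= ->.
    by rewrite mulr0 add0r.
  split=> [[t]|rN].
    rewrite Er => tr; apply: reduced_evL => //; apply: contraNneq tr => ->.
    by rewrite /ev2 !hornerE.
  have r0 : r != 0 by apply: contraNneq rN => ->; rewrite /evL rmorph0 !hornerE.
  have [a [b [ab rab]]] := reduced_point r0 rq.
  by exists (exist _ (a, b) ab); rewrite Er.
move=> f g /curve_rep[p pE] /curve_rep[r rE] [t ft] [t' gt'].
have pN : evL x y p != 0 by apply/key; exists t; rewrite -pE.
have rN : evL x y r != 0 by apply/key; exists t'; rewrite -rE.
have prN : evL x y (p * r) != 0 by rewrite evM; exact: mulf_neq0 pN rN.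
have [z] := (key (p * r)).2 prN.
rewrite ev2M mulf_eq0 negb_or => /andP[h1 h2].
by exists z; rewrite pE rE.
Qed.

End UnitalCurve.

Lemma gid28 (gT : groupType) (c d a b e : gT) : (forall y, d * y = y * d)%g ->
  (c * a * b * (d * e) = c * d * (a * b * e))%g.
Proof. by move=> dC; rewrite -(mulgA c d) (dC (a * b * e)%g) (dC e) !mulgA. Qed.

Lemma gid29 (gT : groupType) (p v w n m m' x : gT) : (p * (p * p) = m)%g -> (forall y, m * y = y * m)%g ->
  (forall y, m' * y = y * m')%g ->
  ((p^-1 * v * n)^-1 * (m' * (p * (p * w * p^-1) * (p * x * p^-1))) =
   m' * m * (n^-1 * (v^-1 * w) * x * p^-1))%g.
Proof.
move=> E mC mC'; rewrite mulgA -mC' -!(mulgA m'); congr (m' * _)%g.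
rewrite !invMg invgK !mulgA mulgVK -(mulgA _ p p) -(mulgA _ p (p * p)%g) E.
by rewrite -mC !mulgA.
Qed.

Lemma gid30 (gT : groupType) (c p x : gT) : (forall y, c * y = y * c)%g -> (c * (p * x) = p * (c * x))%g.
Proof. by move=> cC; rewrite !mulgA cC. Qed.

(** * Chains for the minimal elements *)

Section BaseChains.
Variables (k : closedFieldType) (q : nat) (qP : [pchar k].-nat q).
Hypothesis q1 : (1 < q)%N.
Local Notation L := (laurent k).
Local Notation eps := (eps k).
Local Notation lg := (lg k).
Local Notation rp := (@rp k).
Local Notation sc := (@sc k).
Local Notation sg := (sg qP).
Local Notation hh := (hh qP).
Local Notation XX := (XX qP).
Local Notation P := (rp tau).
Local Notation n1 := (rp s1).

Lemma chain_1 : has_irreducible_chain (XX 1%g) 0.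
Proof.
apply: (@chain_of _ _ (fun=> [set fl (1 : lg)%g])) => [i _|//|i _|//]; first exact: irr1.
move=> _ ->; apply/XX_fl; rewrite /hh (sg1 qP) mulg1 invg1; apply/D1; exact: Iw1.
Qed.

(* A family over the locus [p != 0] of an irreducible parameter space. *)
Lemma irr_locus (T : Type) (G : set (T -> k)) (phi : T -> lg) p : dom G -> alg G p -> regmx (alg G) phi ->
  (exists t, p t != 0) -> irreducible [set x | exists2 t, p t != 0 & x = fl (phi t)].
Proof.
move=> dG pG ph [t0 pt0]; pose T' := {t | p t != 0}.
pose G' : set (T' -> k) := [set c \o sval | c in G].
have up f : alg G f -> alg G' (f \o sval) by move=> fG; apply: (alg_comp (phi := @sval _ (fun t => p t != 0))) fG => c cG; apply: alg_gen; exists c.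
have dG' : dom G'.
  apply: (dom_open (phi := @sval _ (fun t => p t != 0)) dG pG) => [t|t pt|_ [c cG <-]]; first exact: (svalP t).
    by exists (exist _ t pt).
  by exists c => //; exact: alg_gen.
have ph' : regmx (alg G') (phi \o sval).
  have H (F : T -> L) : reg (alg G) F -> reg (alg G') (F \o sval).
    by move=> [[N FN] FA]; split; [exists N => t; exact: FN | move=> n; exact: up (FA n)].
  by move=> i j; have [a b] := ph i j; split; [exact: H a | exact: H b].
have := @family_irr _ _ (alg G') (phi \o sval) (exist _ t0 pt0 : T') (@alg_isalg _ _ _) dG' ph'.
congr (irreducible _); apply/seteqP; split=> x.
  by move=> [[t pt] _ <-]; exists t.
by move=> [t pt ->]; exists (exist _ t pt : T').
Qed.

Definition line_gen : set (unit * k -> k) := gen_prod (setT : set (unit -> k)).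

Lemma dom_line : dom line_gen.
Proof. by apply: dom_prod; apply: dom_unit => -[] []. Qed.

Lemma dom_cell : dom (gen_prod (@gen2 k)).
Proof. by apply: dom_prod; exact: dom2. Qed.

Lemma nonroot (p : {poly k}) : p != 0 -> exists x, p.[x] != 0.
Proof. by move=> p0; have [x []] := poly_nonroot2 p0 p0; exists x. Qed.

Lemma trace_ex : exists z0 z1 : k, [/\ z0 != z1, z0 ^+ q + z0 != 0 & z1 ^+ q + z1 != 0].
Proof.
have p0 : 'X^q + 'X != 0 :> {poly k}.
  by rewrite -size_poly_eq0 size_polyDl ?size_polyXn // size_polyX; lia.
have [z0 h0] := nonroot p0; have [z1 [h1 h2]] := poly_nonroot2 p0 (negbT (polyXsubC_eq0 z0)).
move: h0 h1 h2; rewrite !hornerE subr_eq0 => h0 h1 h2.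
by exists z0, z1; split; rewrite // eq_sym.
Qed.

Lemma P3_sc : exists m, (P * (P * P) = sc m)%g.
Proof.
have [a aE] := rpM k tau tau; have [b bE] := rpM k tau (tau * tau)%g.
have t3 : (tau * (tau * tau) = 1)%g by rewrite -tau3 !expgS expg0 mulg1.
rewrite t3 rp1 aE in bE; exists (- (b + a)).
apply: (mulgI (sc (b + a))); rewrite -scD subrr sc0 bE scD -!mulgA; congr (_ * _)%g.
by apply: gid30; exact: scC.
Qed.

Lemma chain_w0 : has_irreducible_chain (XX w0) 1.
Proof.
have [z0 [z1 [z01 h0 h1]]] := trace_ex.
(* For this family [hh (phi t)] is, up to a scalar, [n1 * u (- p t) * n1 * P^-1], which lies in the
   cell of [w0] as soon as [p t] is nonzero. *)
pose phi (t : unit * k) : lg := (P^-1 * u t.2 * n1)%g; pose p (t : unit * k) := t.2 ^+ q + t.2.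
have a2 : alg line_gen snd by apply: alg_gen; right.
have pA : alg line_gen p by apply: alg_add (a2); exact: alg_exp.
have phA : regmx (alg line_gen) phi.
  apply: regmxM; [exact: alg_isalg | | by apply: regmx_const; exact: alg_isalg].
  apply: regmxM; [exact: alg_isalg | by apply: regmx_const; exact: alg_isalg |].
  by apply: regmx_u => //; exact: alg_isalg.
have [M ME] := P3_sc; have [m1 mE1] := sg_P qP; have [m2 mE2] := sg_n1 qP.
have inX t : p t != 0 -> XX w0 (fl (phi t)).
  move=> pt; have sE : sg (phi t) = (sc (- m1) * sc m2 * (P * (P * u (- t.2 ^+ q)%R * P^-1) * (P * n1 * P^-1)))%g.
    rewrite -gid28; last exact: scC.
    by rewrite /phi (sgM qP (P^-1 * u t.2)%g) (sgM qP P^-1%g) sgV mE1 invMg invgK -scN -scC sg_u mE2.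
  have hE : hh (phi t) = (sc (- m1) * sc m2 * sc M * (n1 * u (- p t)%R * n1 * P^-1))%g.
    have mC (y : lg) : (sc (- m1) * sc m2 * y = y * (sc (- m1) * sc m2))%g by rewrite -scD; exact: scC.
    rewrite /hh sE /phi; apply: etrans (gid29 _ _ _ _ ME (scC M) mC) _.
    by rewrite n1V -uN -uD /p opprD addrC.
  apply/XX_fl; rewrite hE -!scD; apply: D_mull (Iw_sc _ _) _.
  have -> : w0 = (s1 * tau^-1)%g.
    by rewrite /w0 -mulgA; congr (_ * _)%g; apply: (mulgI tau); rewrite mulgV -tau3 !expgS expg0 mulg1.
  apply: D_mulPV; have pN : - p t != 0 by rewrite oppr_eq0.
  have [b bI ->] := n1_u_n1 pN.
  by apply: D_mulr (Ig_Iw bI) _; apply: D_mull (Ig_Iw (Ig_u _)) _; exact: D_rp.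
pose Z i : set (flag k) := if i is 0%N then [set fl (phi (tt, z0))] else [set x | exists2 t, p t != 0 & x = fl (phi t)].
apply: (@chain_of _ _ Z) => [[|i] _|[|//] _|[|i] _|[|//] _].
- exact: irr1.
- by apply: irr_locus phA _ => //; [exact: dom_line | exists (tt, z0)].
- by move=> _ ->; exists (tt, z0).
- by move=> _ ->; exact: inX.
- by move=> _ [t pt ->]; exact: inX.
exists [set fl (phi (tt, z0))]; split=> //; first exact: closed_fl.
move=> H; have := H (fl (phi (tt, z1))) (ex_intro2 _ _ (tt, z1) h1 erefl).
by move=> /un1_inj /= E; move: z01; rewrite E eqxx.
Qed.

(* In the cell [g0 * uu] this is the coordinate hyperplane [row r of the last column = 0]. *)
Definition cut (g0 : lg) (r : 'I_3) : set (flag k) := [set x | forall g, x = fl g ->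
  bd (fun i j _ _ => ((i == r) && (j == 2%:R))%:R) (g0^-1 * g)%g].

Lemma closed_cut g0 r : closed (cut g0 r).
Proof.
pose O := [set g : lg | ~ bd (fun i j _ _ => ((i == r) && (j == 2%:R))%:R) (g0^-1 * g)%g].
have oO : lopen O by apply: lopen_bdN; apply: lmorM; [exact: lmor_const | exact: lmor_id].
rewrite (_ : cut g0 r = ~` [set fl g | g in O]); first by apply: open_closedC; exact: open_sat.
apply/seteqP; split=> x.
  by move=> H [g Og gx]; apply: Og; apply: H.
by move=> H g xg; apply: contrapT => nb; apply: H; exists g.
Qed.

Lemma cutE (g0 : lg) (r : 'I_3) (a b e : k) : r != 2%:R ->
  cut g0 r (fl (g0 * uu a b e)%g) <-> U0 a b e r 2%:R = 0.
Proof.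
move=> r2; have Um i j : mx (uu a b e) i j = constL (U0 a b e i j) by rewrite [LHS]mxE.
split=> [/(_ _ erefl)|U2 g /flE gI].
  rewrite mulKg => /(_ r 2%:R 0 0 0); rewrite !eqxx uuV.
  have -> : mx (uu (- a) (a * e - b) (- e)) 0 0 = 1 by rewrite [LHS]mxE mxE /= rmorph1.
  by rewrite mulr1 Um coefL_const eqxx mulr1n; apply.
pose i := ((g0 * uu a b e)^-1 * g)%g; have [n nI] : Iw i by exact: gI.
have gE : (g0^-1 * g = uu a b e * i)%g by rewrite /i invMg -!mulgA mulKVg.
have sE : (sc n * (uu a b e * i) = uu a b e * (sc n * i))%g by apply: gid30; exact: scC.
rewrite gE -(bd_sc _ n) sE => i' j' a' b'.
have yK : Kg (uu a b e * (sc n * i))%g by apply: KgM (Kg_uu _ _ _) (Ig_Kg nI).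
rewrite -[X in inO X]addr0; apply: inO_mul; last by apply: glO_inO; exact: KgV.
case: eqP => [->|_]; last by rewrite andFb; exact: glO_inO.
case: eqP => [->|_]; last by rewrite andbF; exact: glO_inO.
rewrite andTb.
rewrite mxM3 !Um U2 rmorph0 mul0r addr0.
have O1 (x : k) y : inO 1 y -> inO 1 (constL x * y).
  by move=> yO; rewrite -[1]add0r; apply: inO_mul yO; exact: inO_const.
by apply: inO_add; apply: O1; [exact: (@iwahoriGL_inO _ _ 0 2%:R nI) | exact: (@iwahoriGL_inO _ _ 1 2%:R nI)].
Qed.

Lemma uu_Iw (a b e : k) : Iw (uu a b e) -> a = 0.
Proof.
move=> /Iw_dv0/(_ (dvK (Kg_uu _ _ _))) uI; have := @iwahoriGL_inO _ _ 0 1 uI 0 isT.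
by rewrite [mx _ _ _]mxE coefL_const mxE.
Qed.

Lemma uu_inj (a b e a' b' e' : k) : fl (uu a b e) = fl (uu a' b' e') -> a = a'.
Proof.
by move=> /flE; rewrite uuV uuM => /uu_Iw /eqP; rewrite subr_eq0 => /eqP.
Qed.

Lemma chain_s1 : has_irreducible_chain (XX s1) 1.
Proof.
pose A x := - (x ^+ q) ^+ q + x : k.
have A0 : - 'X^(q * q) + 'X != 0 :> {poly k}.
  by rewrite -size_poly_eq0 size_polyDl size_polyN size_polyXn ?size_polyX //; nia.
have AE x : (- 'X^(q * q) + 'X : {poly k}).[x] = A x by rewrite !hornerE /A exprM.
have [x0 h0] := nonroot A0; have [x1 [h1 h2]] := poly_nonroot2 A0 (negbT (polyXsubC_eq0 x0)).
rewrite !AE in h0 h1; have x10 : x1 != x0 by move: h2; rewrite !hornerE subr_eq0.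
have lift_pt x : exists t : curve k q, (sval t).1 = x.
  pose g : {poly k} := 'X^q + 'X + (x ^+ q.+1)%:P.
  have gs : size g != 1%N.
    rewrite /g -addrA size_polyDl ?size_polyXn; first by lia.
    apply: leq_ltn_trans (size_polyD _ _) _.
    rewrite size_polyX gtn_max; apply/andP; split; first by lia.
    by apply: leq_ltn_trans (size_polyC_leq1 _) _; lia.
  have /closed_rootP[y] := gs; rewrite rootE /g !hornerE => /eqP yE.
  by exists (exist _ (x, y) yE).
have [t0 t0E] := lift_pt x0; have [t1 t1E] := lift_pt x1.
(* With these coordinates the equation of the curve kills the last two coordinates in [hh_uu], so
   that [hh (phi t) = uu (p t) 0 0]. *)
pose phi (t : curve k q) := uu (- (sval t).1) ((sval t).2 ^+ q) ((sval t).1 ^+ q).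
pose p (t : curve k q) := A (sval t).1.
have [a1 a2] : alg (@curve_gen k q) (fun t => (sval t).1) /\ alg (@curve_gen k q) (fun t => (sval t).2).
  by split; apply: alg_gen; [exists fst | exists snd] => //; [left | right].
have pA : alg (@curve_gen k q) p.
  by apply: alg_add (a1); apply: alg_opp; apply: alg_exp; exact: alg_exp.
have phA : regmx (alg (@curve_gen k q)) phi.
  by apply: regmx_uu; [exact: alg_isalg | exact: alg_opp | exact: alg_exp | exact: alg_exp].
have inX t : p t != 0 -> XX s1 (fl (phi t)).
  move=> pt; apply/XX_fl; rewrite /phi hh_uu.
  case: t pt => -[x y] /= E pt.
  have d0 : - x * x ^+ q - y ^+ q = y.
    by apply/eqP; rewrite mulNr -exprS -opprD eq_sym -addr_eq0 [_ + y ^+ q]addrC addrA [y + _]addrC E.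
  rewrite d0 (expqN qP) mulrNN -exprS (_ : y ^+ q + x ^+ q.+1 + y = 0); last by rewrite addrAC.
  by rewrite !opprK subrr; exact: D_uu1.
pose Z i : set (flag k) := if i is 0%N then [set fl (phi t0)] else [set x | exists2 t, p t != 0 & x = fl (phi t)].
have pt0 : p t0 != 0 by rewrite /p t0E.
apply: (@chain_of _ _ Z) => [[|i] _|[|//] _|[|i] _|[|//] _].
- exact: irr1.
- by apply: irr_locus phA _ => //; [exact: dom_curve | exists t0].
- by move=> _ ->; exists t0.
- by move=> _ ->; exact: inX.
- by move=> _ [t pt ->]; exact: inX.
exists [set fl (phi t0)]; split=> //; first exact: closed_fl.
have pt1 : p t1 != 0 by rewrite /p t1E.
move=> H; have := H (fl (phi t1)) (ex_intro2 _ _ t1 pt1 erefl).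
by move=> /uu_inj /oppr_inj; rewrite t0E t1E => E; move: x10; rewrite E eqxx.
Qed.

Lemma chain_s121 : has_irreducible_chain (XX (s1 * s2 * s1)%g) 3.
Proof.
(* [B] and [C] are the two minors that [D_uu121] requires of [hh (uu a b e)]. *)
pose B (a b e : k) := (a * e - b) ^+ q + a * a ^+ q + (a * e - b).
pose C (b e : k) := e ^+ q.+1 + b ^+ q + b.
have inX a b e : B a b e * C b e != 0 -> XX (s1 * s2 * s1)%g (fl (uu a b e)).
  rewrite mulf_eq0 negb_or => /andP[B0 C0]; apply/XX_fl; rewrite hh_uu; apply: D_uu121 => //.
  have -> : (- e ^+ q - a) * (- a ^+ q - e) - ((a * e - b) ^+ q + a * a ^+ q + (a * e - b)) = C b e.
    rewrite /C exprS (_ : (a * e - b) ^+ q = a ^+ q * e ^+ q - b ^+ q); first by ring.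
    by rewrite (expqD qP) (expqN qP) exprMn.
  by [].
have [b0 [b1 [b01 h0 h1]]] := trace_ex.
pose Y (T : Type) (fa fb fe : T -> k) : set (flag k) := [set x | exists2 t, B (fa t) (fb t) (fe t) * C (fb t) (fe t) != 0 &
  x = fl (uu (fa t) (fb t) (fe t))].
have irrY (T : Type) (G : set (T -> k)) fa fb fe : dom G -> alg G fa -> alg G fb -> alg G fe ->
    (exists t, B (fa t) (fb t) (fe t) * C (fb t) (fe t) != 0) -> irreducible (Y T fa fb fe).
  move=> dG Ga Gb Ge ex.
  have Gd : alg G (fun t => fa t * fe t - fb t) by apply: alg_add (alg_opp Gb); exact: alg_mul.
  apply: (irr_locus (G := G) (p := fun t => B (fa t) (fb t) (fe t) * C (fb t) (fe t))) ex => //; last first.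
    by apply: regmx_uu => //; exact: alg_isalg.
  apply: alg_mul; last by apply: alg_add (Gb); apply: alg_add; exact: alg_exp.
  by apply: alg_add (Gd); apply: alg_add (alg_exp _ Gd) _; apply: alg_mul (Ga) (alg_exp _ Ga).
have subY T fa fb fe : Y T fa fb fe `<=` XX (s1 * s2 * s1)%g by move=> _ [t pt ->]; exact: inX.
(* Open parts of a point, a line, a plane and the whole cell; the first is separated by its point,
   the others by coordinate hyperplanes [cut]. *)
pose Z i := match i with
  | 0%N => Y unit (fun=> 0) (fun=> b0) (fun=> 0)
  | 1%N => Y (unit * k)%type snd (fun=> b0) (fun=> 0)
  | 2%N => Y (k * k)%type fst snd (fun=> 0)
  | _ => Y ((k * k) * k)%type (fun t => t.1.1) (fun t => t.1.2) snd end.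
have q0 : (0 : k) ^+ q = 0 by exact: expq0.
have ok a b : a * a ^+ q - (b ^+ q + b) != 0 -> b ^+ q + b != 0 -> B a b 0 * C b 0 != 0.
  move=> H1 H2; rewrite /B /C mulr0 sub0r (expqN qP) exprS mul0r add0r mulf_neq0 //.
  by rewrite (_ : _ + _ = a * a ^+ q - (b ^+ q + b)) //; ring.
have ok0 b : b ^+ q + b != 0 -> B 0 b 0 * C b 0 != 0.
  by move=> H; apply: ok => //; rewrite mul0r sub0r oppr_eq0.
have [a1 [a10 ha1]] : exists a, a != 0 /\ a * a ^+ q - (b0 ^+ q + b0) != 0.
  have p0 : 'X^(q.+1) - (b0 ^+ q + b0)%:P != 0 :> {poly k}.
    by rewrite -size_poly_eq0 size_polyDl size_polyXn // size_polyN; apply: leq_ltn_trans (size_polyC_leq1 _) _.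
  have [a []] := poly_nonroot2 p0 (negbT (polyX_eq0 k)); rewrite !hornerE exprS => h1' h2'.
  by exists a.
have [e1 [e10 he1]] : exists e, e != 0 /\ B 0 b0 e * C b0 e != 0.
  have p0 : 'X^(q.+1) + (b0 ^+ q + b0)%:P != 0 :> {poly k}.
    by rewrite -size_poly_eq0 size_polyDl size_polyXn //; apply: leq_ltn_trans (size_polyC_leq1 _) _.
  have [e []] := poly_nonroot2 p0 (negbT (polyX_eq0 k)); rewrite !hornerE => h1' h2'.
  exists e; split=> //; rewrite mulf_neq0 //.
  by rewrite /B mul0r sub0r (expqN qP) mul0r addr0 -opprD oppr_eq0.
have uE0 a b : uu a b 0 = (uu 0 b0 0 * uu a (b - b0) 0)%g.
  by rewrite uuM; congr uu; rewrite ?addr0 ?mul0r ?addr0 ?subrK.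
have c0 a b : cut (uu 0 b0 0) 0 (fl (uu a b 0)) <-> b - b0 = 0.
  by rewrite [X in fl X]uE0 cutE // mxE.
have c1 a b e : cut 1%g 1 (fl (uu a b e)) <-> e = 0.
  by have := @cutE 1%g 1 a b e isT; rewrite mul1g mxE.
apply: (@chain_of _ _ Z) => [[|[|[|i]]] _|[|[|[|//]]] _|[|[|[|i]]] _|[|[|[|//]]] _]; try exact: subY.
- apply: (irrY unit setT) => //; try exact: alg_const; first by apply: dom_unit => -[] [].
  by exists tt; exact: ok0.
- apply: (irrY _ line_gen); [exact: dom_line | by apply: alg_gen; right | exact: alg_const | exact: alg_const |].
  by exists (tt, 0); exact: ok0.
- apply: (irrY _ (@gen2 k)); [exact: dom2 | by apply: alg_gen; left | by apply: alg_gen; right | exact: alg_const |].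
  by exists (0, b0); exact: ok0.
- apply: (irrY _ (gen_prod (@gen2 k))); [exact: dom_cell | | | by apply: alg_gen; right |].
  + by apply: alg_gen; left; exists fst => //; left.
  + by apply: alg_gen; left; exists snd => //; right.
  + by exists ((0, b0), 0); exact: ok0.
- by move=> _ [t pt ->]; exists (tt, 0).
- by move=> _ [t pt ->]; exists (t.2, b0).
- by move=> _ [t pt ->]; exists (t, 0).
- exists [set fl (uu 0 b0 0)]; split; [exact: closed_fl | by move=> _ [t _ ->] |].
  move=> H; have := H (fl (uu a1 b0 0)) (ex_intro2 _ _ (tt, a1) (ok _ _ ha1 h0) erefl).
  by move=> /uu_inj E; move: a10; rewrite E eqxx.
- exists (cut (uu 0 b0 0) 0); split; first exact: closed_cut.
    by move=> _ [t pt ->]; apply/c0; rewrite subrr.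
  move=> H; have /c0 E := H (fl (uu 0 b1 0)) (ex_intro2 _ _ (0, b1) (ok0 _ h1) erefl).
  by move: b01; rewrite eq_sym -subr_eq0 E eqxx.
- exists (cut 1%g 1); split; [exact: closed_cut | by move=> _ [t pt ->]; apply/c1 |].
  move=> H; have /c1 E := H (fl (uu 0 b0 e1)) (ex_intro2 _ _ ((0, b0), e1) he1 erefl).
  by move: e10; rewrite E eqxx.
Qed.

End BaseChains.

(** * Emptiness *)

Lemma gidmid (gT : groupType) (g s t : gT) : (g^-1 * s * (s^-1 * t) = g^-1 * t)%g.
Proof. by rewrite mulgA mulgK. Qed.

Section Emptiness.
Variables (k : closedFieldType) (q : nat) (qP : [pchar k].-nat q).
Local Notation L := (laurent k).
Local Notation eps := (eps k).
Local Notation lg := (lg k).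
Local Notation rp := (@rp k).
Local Notation sc := (@sc k).
Local Notation sg := (sg qP).
Local Notation hh := (hh qP).
Local Notation XX := (XX qP).
Local Notation bary := (@barycentric int).

(* With [eps^n e_i] in position [3 n + i], all vectors are shifted by at least [m]. *)
Definition shifts (m : int) (x : lg) := forall (i j : 'I_3) (n : int),
  3 * n + (i : nat)%:Z < (j : nat)%:Z + m -> coefL (mx x i j) n = 0.

Lemma ceil3 (z : int) : exists a : int, z <= 3 * a /\ 3 * a < z + 3.
Proof. by exists ((z + 2) %/ 3)%Z; lia. Qed.

(** In the second part [s] is the only index whose product reaches the lowest order, because the
    position reached by a shift determines its residue modulo 3. *)
Lemma shiftsM m m' (x y : lg) : shifts m x -> shifts m' y -> shifts (m + m') (x * y)%g /\
  forall (r s j : 'I_3) (a b : int), 3 * b + (s : nat)%:Z = (j : nat)%:Z + m' -> 3 * a + (r : nat)%:Z = (s : nat)%:Z + m ->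
    coefL (mx (x * y)%g r j) (a + b) = coefL (mx x r s) a * coefL (mx y s j) b.
Proof.
move=> xm ym.
have H (i l j : 'I_3) : exists a b : int, [/\ (l : nat)%:Z + m - (i : nat)%:Z <= 3 * a, (j : nat)%:Z + m' - (l : nat)%:Z <= 3 * b,
    inO a (mx x i l) & inO b (mx y l j)].
  have [a [a1 a2]] := ceil3 ((l : nat)%:Z + m - (i : nat)%:Z).
  have [b [b1 b2]] := ceil3 ((j : nat)%:Z + m' - (l : nat)%:Z).
  by exists a, b; split=> // n nn; [apply: xm | apply: ym]; lia.
split=> [i j n nP|r s j a b sj rs].
  rewrite mxME coefL_sum big1 // => l _; have [a [b [a1 b1 xa yb]]] := H i l j.
  by apply: (inO_mul xa yb); lia.
rewrite mxME coefL_sum (bigD1 s) //= big1 ?addr0 => [|l ls].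
  by apply: coefL_mul_lead => n nP; [apply: xm | apply: ym]; lia.
have [a' [b' [a1 b1 xa yb]]] := H r l j; apply: (inO_mul xa yb).
have ls' : (l : nat)%:Z != (s : nat)%:Z by apply: contraNneq ls => - [E]; apply/eqP; apply: val_inj.
have := ltn_ord l; have := ltn_ord s; lia.
Qed.

Lemma shifts_Ig (x : lg) : Ig x -> shifts 0 x.
Proof.
move=> xI i j n nP; have := @iwahoriGL_inO _ _ i j xI; apply.
by have := ltn_ord i; have := ltn_ord j; case: (ltnP i j) => ij; lia.
Qed.

Lemma fposE x (i : 'I_3) : fpos x (lin x i) = 3 * bary (tr x) i + (i : nat)%:Z.
Proof. by rewrite /fpos permK. Qed.

Lemma shifts_D x (y : lg) m N : (forall j : 'I_3, m <= fpos x j - (j : nat)%:Z) -> D x y -> dv (wdeg x + 3 * N) y ->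
  shifts (m + 3 * N) y /\ forall r, fpos x (lin x r) = (lin x r : nat)%:Z + m ->
    coefL (mx y r (lin x r)) (bary (tr x) r + N) != 0.
Proof.
move=> xm yD yd; have [n [i [j [iI jI yE]]]] := D_Ig yD.
have nN : n = N by rewrite yE in yd; have := dv_inj yd (dv_D x n iI jI); lia.
rewrite {}nN in yE.
have sx : shifts m (rp x).
  move=> a b c cP; rewrite mx_rp repE; case: eqP => [E|_]; last by rewrite coefL0.
  rewrite coefL_epsp; case: eqP => // E'; move: cP; rewrite E' -fposE E.
  by have := xm b; lia.
have [s1' l1] := shiftsM (shifts_Ig iI) sx; have [s2' l2] := shiftsM s1' (shifts_Ig jI).
rewrite add0r addr0 in s1' s2' l1 l2.
have yc a b c : coefL (mx y a b) c = coefL (mx (i * rp x * j)%g a b) (c - N).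
  by rewrite yE mx_scM coefL_epsz.
split=> [a b c cP|r rE]; first by rewrite yc; apply: s2'; lia.
have fE := fposE x r; rewrite yc.
have -> : bary (tr x) r + N - N = bary (tr x) r + 0 by lia.
rewrite (l2 r (lin x r) (lin x r)); [|lia|lia].
rewrite -[bary (tr x) r]add0r (l1 r r (lin x r)); [|lia|lia].
rewrite mx_rp repE eqxx coefL_epsp eqxx mulr1 mulf_neq0 //; exact: iwahoriGL_diag.
Qed.

Let phi (x : lg) := sg (sg x).

Let phiE (x : lg) i j n : coefL (mx (phi x) i j) n = (coefL (mx x i j) n ^+ q) ^+ q.
Proof. by rewrite sgE sgVE !rev_ordK !(coefL_frob qP). Qed.

Let phiM (x y : lg) : phi (x * y)%g = (phi x * phi y)%g.
Proof. by rewrite /phi (sgM qP x) sgM. Qed.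

Let phiV (x : lg) : phi x^-1%g = (phi x)^-1%g.
Proof. by rewrite /phi (sgV qP x) sgV. Qed.

Lemma pc_sg M (x : lg) : pc M x -> pc M (sg x).
Proof.
by move=> xM a b; have [h1 h2] := xM (rev_ord b) (rev_ord a); rewrite sgE sgVE; split; exact: (inO_frob qP).
Qed.

(** [g^-1 * phi^n g] is a product of [n] Frobenius twists of [B], so its [(j, j)] entry has a
    nonzero coefficient of order [n c]. But its poles are bounded, since [phi] preserves
    valuations. *)
Lemma bounded_shift (g : lg) (c : int) (j : 'I_3) : shifts (3 * c) (g^-1 * phi g)%g ->
  coefL (mx (g^-1 * phi g)%g j j) c != 0 -> 0 <= c.
Proof.
set B := (g^-1 * phi g)%g => Bs Bl; rewrite leNgt; apply/negP => c0.
pose it n := iter n phi g.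
have key n : shifts (3 * (n%:Z * c)) (g^-1 * it n)%g /\ coefL (mx (g^-1 * it n)%g j j) (n%:Z * c) != 0.
  elim: n => [|n [IH1 IH2]].
    have -> : it 0%N = g by [].
    rewrite mul0r mulr0 mulVg; split; first by apply: shifts_Ig; exact: Ig1.
    by rewrite mx1 mxE eqxx coefL1 eqxx oner_eq0.
  have E : (g^-1 * it n.+1 = B * phi (g^-1 * it n)%g)%g.
    exact: esym (etrans (congr1 (fun z => (B * z)%g) (etrans (phiM g^-1%g (it n))
      (congr1 (fun z => (z * phi (it n))%g) (phiV g)))) (gidmid _ _ _)).
  have ps : shifts (3 * (n%:Z * c)) (phi (g^-1 * it n)%g).
    by move=> a b m mP; rewrite phiE (IH1 a b m mP) !(expq0 qP).
  have [h1 h2] := shiftsM Bs ps.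
  rewrite E (_ : 3 * (n.+1%:Z * c) = 3 * c + 3 * (n%:Z * c)); last by lia.
  split; first exact: h1.
  rewrite (_ : n.+1%:Z * c = c + n%:Z * c); last by lia.
  rewrite (h2 j j j); [|lia|lia]; apply: mulf_neq0; first exact: Bl.
  by rewrite phiE; apply: expf_neq0; apply: expf_neq0; exact: IH2.
have [M gM] := pc_ex g.
have itM n : pc M (it n) by elim: n => [|n IH] //=; apply: pc_sg; exact: pc_sg.
have [_] := key (M + M).+1; rewrite (pcM (pcV gM) (itM _) j j).1 ?eqxx //.
nia.
Qed.

(** [m] and [m'] are the least shifts of [x] and [delta x], attained at indices that compose to
    [r -> lin x r -> r]. For [g] of determinant valuation [wdeg x], the [(r, r)] entry of
    [hh g * sg (hh g)] then has a nonzero coefficient of order [c], where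
    [3 c = m + m' - wdeg x - wdeg (delta x)] is negative, against [bounded_shift]. *)
Theorem XX_empty x (r : 'I_3) m m' : (forall j : 'I_3, m <= fpos x j - (j : nat)%:Z) ->
  (forall j : 'I_3, m' <= fpos (delta x) j - (j : nat)%:Z) ->
  lin (delta x) (lin x r) = r ->
  fpos x (lin x r) = (lin x r : nat)%:Z + m -> fpos (delta x) r = (r : nat)%:Z + m' ->
  m + m' < wdeg x + wdeg (delta x) -> forall y, ~ XX x y.
Proof.
move=> xm dxm lr e1 e2 lt y yX; have [g [yE gD gd]] := XX_dv yX 0.
rewrite mulr0 addr0 in gd; have hd := dv_hh qP gd.
have shD := sg_D qP gD; have shd := dv_sg qP hd.
have [a [ia [ja [iaI jaI aE]]]] := D_Ig gD; have [b [ib [jb [ibI jbI bE]]]] := D_Ig shD.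
have aN : - wdeg x - wdeg x = wdeg x + 3 * a.
  by rewrite aE in hd; have := dv_inj hd (dv_D x a iaI jaI); lia.
have bN : - (- wdeg x - wdeg x) = wdeg (delta x) + 3 * b.
  by rewrite bE in shd; have := dv_inj shd (dv_D (delta x) b ibI jbI); lia.
rewrite aN in hd; rewrite bN in shd.
have [s1' l1] := shifts_D xm gD hd; have [s2' l2] := shifts_D dxm shD shd.
have [s3 l3] := shiftsM s1' s2'.
have E : (hh g * sg (hh g) = g^-1 * phi g)%g.
  by rewrite [X in sg X]/(hh g) (sgM qP g^-1%g) sgV /hh gidmid.
have {}l1 := l1 r e1; have := l2 (lin x r); rewrite lr => /(_ e2) {}l2.
have f1 := fposE x r; have f2 := fposE (delta x) (lin x r); rewrite lr in f2.
pose c := bary (tr x) r + a + (bary (tr (delta x)) (lin x r) + b).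
have cM : m + 3 * a + (m' + 3 * b) = 3 * c by rewrite /c; lia.
suff : 0 <= c by lia.
rewrite E cM in s3 l3; apply: (bounded_shift s3 (j := r)).
rewrite (l3 r (lin x r) r); [|lia|lia].
exact: mulf_neq0 l1 l2.
Qed.

End Emptiness.

(** * The combinatorial induction *)

Lemma gid_nodes (gT : groupType) (t s0 s1 s2 w : gT) : (t * (t * t) = 1)%g -> (s2 = t * s1 * t^-1)%g -> (s0 = t * s2 * t^-1)%g ->
  let r x := (t^-1 * x * t^-1)%g in let ws x := (s1 * x * (t * s1 * t^-1))%g in
  [/\ r (s2 * w * s1)%g = ws (r w), r (s2 * w)%g = (s1 * r w)%g,
      ((r w)^-1 * s1 = t * (w^-1 * s2 * t))%g & (s1 * r w * t = t^-1 * (s2 * w))%g] /\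
  [/\ r (r (s0 * w * s0)%g) = ws (r (r w)), r (r (s0 * w)%g) = (s1 * r (r w))%g,
      ((r (r w))^-1 * s1 = t * (t * (w^-1 * s0 * (t * t))))%g & (s1 * r (r w) * t = t^-1 * (t^-1 * (s0 * w * t^-1)))%g].
Proof.
move=> E -> -> r ws0; rewrite /r /ws0 !invMg !invgK !mulgA.
have tV : (t^-1 = t * t)%g by apply: (mulgI t); rewrite mulgV E.
have E3 x : (x * t * t * t = x)%g by rewrite -!mulgA E mulg1.
have E4 : (t * t * t = 1)%g by rewrite -mulgA.
by rewrite !tV !mulgA !(E3, E4, mul1g); split; split.
Qed.

Section Windows.
Local Notation bary := (@barycentric int).

Lemma fpos_taul v : exists c : int, forall j, fpos (tau * v)%g j = fpos v j + 1 + 3 * c.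
Proof.
exists (- bary (tr v) (lin tau 2%:R)) => j; rewrite /fpos invMg permM.
set i := (lin v)^-1%g j.
rewrite baryD bary_wact permKV.
have : 3 * bary (tr tau) ((lin tau)^-1%g i) + ((lin tau)^-1%g i : nat)%:Z = (i : nat)%:Z + 1.
  move: i; apply: ord3P.
  - by rewrite -{1 2}(lin_tau.1.2) !permK bary_tau.
  - by rewrite -{1 2}(lin_tau.2) !permK bary_tau.
  - by rewrite -{1 2}(lin_tau.1.1) !permK bary_tau.
by move=> H; rewrite mulrDr addrAC H; ring.
Qed.

Lemma fpos_taur v : exists c : int, [/\ fpos (v * tau)%g 0 = fpos v 1 + c,
  fpos (v * tau)%g 1 = fpos v 2%:R + c & fpos (v * tau)%g 2%:R = fpos v 0 + 3 + c].
Proof.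
exists (- 3 * bary (tr tau) (lin v 2%:R)).
have H j : fpos (v * tau)%g j = fpos v ((lin tau)^-1%g j) + 3 * bary (tr tau) ((lin tau)^-1%g j) - 3 * bary (tr tau) (lin v 2%:R).
  by rewrite /fpos invMg permM baryD bary_wact permKV; ring.
split; rewrite H.
- by rewrite -{1 2}(lin_tau.1.2) !permK bary_tau; ring.
- by rewrite -{1 2}(lin_tau.2) !permK bary_tau; ring.
- by rewrite -{1 2}(lin_tau.1.1) !permK bary_tau; ring.
Qed.

Variant node := N0 | N1 | N2.
Definition nd i := match i with N0 => s0 | N1 => s1 | N2 => s2 end.
Definition dn i := match i with N0 => N0 | N1 => N2 | N2 => N1 end.
(** [v s_i > v] in terms of the window [fpos v]; for [N0] the window is continued with period 3. *)
Definition asc i v := match i with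
  | N0 => fpos v 2%:R < fpos v 0 + 3 | N1 => fpos v 0 < fpos v 1 | N2 => fpos v 1 < fpos v 2%:R end.

Lemma asc2 v : asc N2 v = rasc (v * tau)%g.
Proof. by rewrite /asc /rasc; have [c [-> -> _]] := fpos_taur v; lia. Qed.

Lemma asc0 v : asc N0 v = rasc (v * tau^-1)%g.
Proof.
rewrite /asc /rasc; have [c] := fpos_taur (v * tau^-1)%g; rewrite mulgVK => -[-> _ ->]; lia.
Qed.

Lemma asc0' v : asc N0 v = rasc (v * (tau * tau))%g.
Proof.
have -> : (v * (tau * tau) = v * tau * tau)%g by exact: mulgA.
rewrite /asc /rasc; have [c [-> -> _]] := fpos_taur (v * tau)%g; have [c' [_ -> ->]] := fpos_taur v; lia.
Qed.

Lemma rasc_taul v : rasc (tau * v)%g = rasc v.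
Proof. by rewrite /rasc; have [c H] := fpos_taul v; rewrite !H; lia. Qed.

Lemma rasc_tauVl v : rasc (tau^-1 * v)%g = rasc v.
Proof. by rewrite -[in RHS](mulKVg tau v) rasc_taul. Qed.

Lemma s2E : s2 = (tau * s1 * tau^-1)%g. Proof. by rewrite tau_s1 mulgK. Qed.
Lemma s0E : s0 = (tau * s2 * tau^-1)%g. Proof. by rewrite tau_s2 mulgK. Qed.
Lemma s1E : s1 = (tau * s0 * tau^-1)%g. Proof. by rewrite tau_s0 mulgK. Qed.
Lemma tau3' : (tau * (tau * tau) = 1)%g. Proof. by rewrite -tau3 !expgS expg0 mulg1. Qed.

Lemma s0_tauV : (s0 * tau^-1 = tau^-1 * s1)%g.
Proof. by apply: (mulgI tau); rewrite mulgA tau_s0 mulgK mulKVg. Qed.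

Lemma asc_nd i v : asc i (v * nd i)%g = ~~ asc i v.
Proof.
case: i; rewrite /nd.
- by rewrite !asc0 -rasc_s1N; congr rasc; exact: etrans (esym (mulgA _ _ _)) (etrans (congr1 (mulg v) s0_tauV) (mulgA _ _ _)).
- exact: rasc_s1N.
- by rewrite !asc2 -rasc_s1N; congr rasc; exact: etrans (esym (mulgA _ _ _)) (etrans (congr1 (mulg v) (esym tau_s1)) (mulgA _ _ _)).
Qed.

End Windows.

(** * The reduction at an arbitrary node *)

Section NodeSteps.
Variables (k : closedFieldType) (q : nat) (qP : [pchar k].-nat q).
Local Notation XX := (XX qP).
Local Notation Lam := (Lam qP).

Definition UpTo w d := Cov qP w d /\ Near qP Lam w.
Definition Ch w d := has_irreducible_chain (XX w) d.

Lemma rot3 w : rot (rot (rot w)) = w.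
Proof.
have t3 : (tau^-1 * (tau^-1 * tau^-1) = 1)%g by rewrite -!invMg -mulgA tau3' invg1.
by rewrite /rot !mulgA -(mulgA tau^-1%g) t3 mul1g -!mulgA t3 mulg1.
Qed.

Lemma UpTo_rot w d : UpTo (rot w) d <-> UpTo w d.
Proof.
have H v : UpTo v d -> UpTo (rot v) d.
  by move=> [h1 h2]; have [f1 f2] := step_rot qP Lam v d; split; [exact: f1 | exact: f2].
by split=> [h|]; [rewrite -(rot3 w); exact/H/H | exact: H].
Qed.

Lemma Ch_rot w d : Ch (rot w) d <-> Ch w d.
Proof.
have H v : Ch v d -> Ch (rot v) d by move=> h; exact: chain_fib (fib_rot qP v) h.
by split=> [h|]; [rewrite -(rot3 w); exact/H/H | exact: H].
Qed.

Lemma XX_rot0 w : (forall y, ~ XX w y) <-> (forall y, ~ XX (rot w) y).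
Proof.
have H v : (forall y, ~ XX v y) -> forall y, ~ XX (rot v) y.
  move=> h y; have [g ->] := fl_ex y => yX; apply: (h (fl (g * (rp k tau)^-1)%g)).
  by apply/XX_rot; rewrite mulgVK.
by split=> h; [exact: H | rewrite -(rot3 w); exact/H/H].
Qed.

(* The reduction at a node: [w] is longer than [s w] by one, and than [s w delta(s)] by two. *)
Definition conj i w := (nd i * w * nd (dn i))%g.

(** One rotation carries the reduction at [s2] to that at [s1], two rotations the one at [s0]. So a
    property that descends along rotation need only be proved at [s1]. The boolean [b] tells whether
    [conj i w] has the length of [w]. *)
Lemma node_reduce (Pr : iwahoriWeyl -> iwahoriWeyl -> iwahoriWeyl -> Prop) (b : bool) i w :
  (forall v, rasc (v^-1 * s1)%g -> rasc (s1 * v * tau)%g = b -> Pr v (ws v) (s1 * v)%g) ->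
  (forall v v1 v2, Pr (rot v) (rot v1) (rot v2) -> Pr v v1 v2) ->
  ~~ asc i w^-1%g -> asc (dn i) (nd i * w)%g = b -> Pr w (conj i w) (nd i * w)%g.
Proof.
move=> H1 Hr ia ib; have wd : asc i (w^-1 * nd i)%g by rewrite asc_nd.
have [[g1 g2 g3 g4] [g5 g6 g7 g8]] := gid_nodes w tau3' s2E s0E.
case: i ia ib wd; rewrite /nd /dn /conj => ia ib wd.
- apply: (Hr); apply: (Hr); rewrite /rot g5 g6; apply: H1.
    by rewrite g7 !rasc_taul -asc0'.
  by rewrite g8 !rasc_tauVl -asc0.
- have := H1 w wd; rewrite -asc2 => /(_ ib); rewrite /ws -s2E; exact: id.
- apply: (Hr); rewrite /rot g1 g2; apply: H1; first by rewrite g3 rasc_taul -asc2.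
  by rewrite g4 rasc_tauVl.
Qed.

Theorem node_up i w d : ~~ asc i w^-1%g ->
  UpTo (conj i w) d -> (asc (dn i) (nd i * w)%g = true \/ UpTo (nd i * w)%g d) ->
  if asc (dn i) (nd i * w)%g then UpTo w d else UpTo w d.+1.
Proof.
move=> ia Uc Us; case: ifP => ib.
  move: Uc; apply: (node_reduce (Pr := fun w wc _ => UpTo wc d -> UpTo w d) _ _ ia ib).
    move=> v wd ta [h1 h2]; have [f1 f2] := step_same qP wd Lam ta d.
    by split; [exact: f1 | exact: f2].
  by move=> v v1 v2 H h; apply/UpTo_rot/H/UpTo_rot.
case: Us => [ib'|Us]; first by rewrite ib' in ib.
move: Uc Us; apply: (node_reduce (Pr := fun w wc sw => UpTo wc d -> UpTo sw d -> UpTo w d.+1) _ _ ia ib).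
  move=> v wd ta [h1 h2] [h3 h4]; have ta' : rasc (s1 * v * tau * s1)%g by rewrite rasc_s1N ta.
  have [f1 f2] := step_shorter qP wd Lam ta' d.
  by split; [exact: f1 | exact: f2].
by move=> v v1 v2 H h h'; apply/UpTo_rot/H; exact/UpTo_rot.
Qed.

Theorem node_chain i w d : ~~ asc i w^-1%g -> Ch (conj i w) d \/ (~~ asc (dn i) (nd i * w)%g /\ Ch (nd i * w)%g d) ->
  if asc (dn i) (nd i * w)%g then Ch w d else Ch w d.+1.
Proof.
move=> ia H; case: ifP => ib.
  case: H => [|[nb _]]; last by case/negP: nb.
  apply: (node_reduce (Pr := fun w wc _ => Ch wc d -> Ch w d) _ _ ia ib).
    by move=> v wd ta h; exact: chain_fib (fib_same qP wd ta) h.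
  by move=> v v1 v2 H h; exact: (Ch_rot v d).1 (H ((Ch_rot v1 d).2 h)).
case: H => [|[_]].
  apply: (node_reduce (Pr := fun w wc _ => Ch wc d -> Ch w d.+1) _ _ ia ib).
    move=> v wd ta h; have ta' : rasc (s1 * v * tau * s1)%g by rewrite rasc_s1N ta.
    have [f1 f2] := fib_ws qP wd ta'; apply: chain_fibS f1 _ f2 h.
    by move=> x; have [g ->] := fl_ex x; exact: closed_fl.
  by move=> v v1 v2 H h; exact: (Ch_rot v d.+1).1 (H ((Ch_rot v1 d).2 h)).
apply: (node_reduce (Pr := fun w _ sw => Ch sw d -> Ch w d.+1) _ _ ia ib).
  move=> v wd ta h; have ta' : rasc (s1 * v * tau * s1)%g by rewrite rasc_s1N ta.
  have [f1 f2] := fib_s1w qP wd ta'; apply: chain_fibS f1 _ f2 h.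
  by move=> x; have [g ->] := fl_ex x; exact: closed_fl.
by move=> v v1 v2 H h; exact: (Ch_rot v d.+1).1 (H ((Ch_rot v2 d).2 h)).
Qed.

Lemma UpTo_le w d d' : (d <= d')%N -> UpTo w d -> UpTo w d'.
Proof. by move=> dd [h1 h2]; split=> // n m; exact: covered_le dd (h1 n m). Qed.

Lemma UpTo_empty w d : (forall y, ~ XX w y) -> UpTo w d.
Proof.
move=> h; split=> [n m|]; first by apply: covered_sub (covered0 k _ _) => y [/h].
by exists 0%N => y /h.
Qed.

End NodeSteps.

(** * Integer coordinates on the affine Weyl group *)

Section Coordinates.
Local Notation bary := (@barycentric int).

Variant wtype := W1 | WS1 | WS2 | W12 | W21 | W121.

Definition wperm c : 'S_3 := let p1 := tperm 0 1 in let p2 := tperm 1 2%:R in match c with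
  | W1 => 1 | WS1 => p1 | WS2 => p2 | W12 => p1 * p2 | W21 => p2 * p1 | W121 => p1 * p2 * p1 end%g.

(* The element [t^(a alpha1 + b alpha2) w] of the affine Weyl group. *)
Definition elt := (wtype * int * int)%type.
Definition el (e : elt) : iwahoriWeyl := let: (c, a, b) := e in IW (2 * a - b, 2 * b - a) (wperm c).

Definition lmul i (e : elt) : elt := let: (c, a, b) := e in match i with
  | N0 => (match c with W1 => W121 | WS1 => W12 | WS2 => W21 | W12 => WS1 | W21 => WS2 | W121 => W1 end, 1 - b, 1 - a)
  | N1 => (match c with W1 => WS1 | WS1 => W1 | WS2 => W12 | W12 => WS2 | W21 => W121 | W121 => W21 end, b - a, b)
  | N2 => (match c with W1 => WS2 | WS2 => W1 | WS1 => W21 | W21 => WS1 | W12 => W121 | W121 => W12 end, a, a - b) end.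

Definition rmul i (e : elt) : elt := let: (c, a, b) := e in match i with
  | N0 => match c with W1 => (W121, a + 1, b + 1) | WS1 => (W21, a, b + 1) | WS2 => (W12, a + 1, b)
     | W12 => (WS2, a - 1, b) | W21 => (WS1, a, b - 1) | W121 => (W1, a - 1, b - 1) end
  | N1 => (match c with W1 => WS1 | WS1 => W1 | WS2 => W21 | W21 => WS2 | W12 => W121 | W121 => W12 end, a, b)
  | N2 => (match c with W1 => WS2 | WS2 => W1 | WS1 => W12 | W12 => WS1 | W21 => W121 | W121 => W21 end, a, b) end.

Definition einv (e : elt) : elt := let: (c, a, b) := e in match c with
  | W1 => (W1, - a, - b) | WS1 => (WS1, a - b, - b) | WS2 => (WS2, - a, b - a)
  | W12 => (W21, a - b, a) | W21 => (W12, b, b - a) | W121 => (W121, b, a) end.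

Definition edelta (e : elt) : elt := let: (c, a, b) := e in
  (match c with W1 => W1 | WS1 => WS2 | WS2 => WS1 | W12 => W21 | W21 => W12 | W121 => W121 end, b, a).

Lemma iw_eq (t t' : int * int) (p p' : 'S_3) : t = t' -> (forall i, p i = p' i) -> IW t p = IW t' p'.
Proof. by move=> -> /permP ->. Qed.

Ltac el_compute := apply: iw_eq; [ by rewrite /= ?(wactM, wact_s1, wact_s2, wact1); apply/eqP; rewrite xpair_eqE /=; lia
  | by apply: ord3P; rewrite /= ?permM ?permE ].

Lemma lmulE i e : (nd i * el e)%g = el (lmul i e).
Proof. by case: e => [[c a] b]; case: i; case: c; el_compute. Qed.

Lemma rmulE i e : (el e * nd i)%g = el (rmul i e).
Proof. by case: e => [[c a] b]; case: i; case: c; el_compute. Qed.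

Lemma einvE e : (el e)^-1%g = el (einv e).
Proof.
apply: (mulgI (el e)); rewrite mulgV; symmetry.
by case: e => [[c a] b]; case: c; el_compute.
Qed.

Lemma edeltaE e : delta (el e) = el (edelta e).
Proof.
case: e => [[c a] b]; apply: iw_eq => // i.
have rE j : rev_ord j = match j : 'I_3 with Ordinal 0 _ => 2%:R | Ordinal 1 _ => 1 | _ => 0 end.
  by apply: val_inj; case: j => -[|[|[|//]]] ? /=.
by case: c; move: i; apply: ord3P; rewrite /= !permM /rho !permE !rE /= ?permM ?permE /= ?rE.
Qed.

Definition wpre c : 'I_3 * 'I_3 * 'I_3 := match c with
  | W1 => (0, 1, 2%:R) | WS1 => (1, 0, 2%:R) | WS2 => (0, 2%:R, 1)
  | W12 => (1, 2%:R, 0) | W21 => (2%:R, 0, 1) | W121 => (2%:R, 1, 0) end.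

Definition win (e : elt) : int * int * int := let: (c, a, b) := e in
  let x := 3 * (a + b) in let y := 3 * (2 * b - a) + 1 in match c with
  | W1 => (x, y, 2) | WS1 => (y, x, 2) | WS2 => (x, 2, y)
  | W12 => (y, 2, x) | W21 => (2, x, y) | W121 => (2, y, x) end.

Lemma fpos_el e : [/\ fpos (el e) 0 = (win e).1.1, fpos (el e) 1 = (win e).1.2 & fpos (el e) 2%:R = (win e).2].
Proof.
case: e => [[c a] b]; have [p0 p1 p2] : [/\ wperm c (wpre c).1.1 = 0, wperm c (wpre c).1.2 = 1 & wperm c (wpre c).2 = 2%:R].
  by case: c; split; rewrite /= ?permM ?permE.
have H i j : wperm c i = j -> fpos (el (c, a, b)) j = 3 * bary (2 * a - b, 2 * b - a) i + (i : nat)%:Z.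
  by move=> <-; exact: (fposE (el (c, a, b))).
by split; [rewrite (H _ _ p0) | rewrite (H _ _ p1) | rewrite (H _ _ p2)]; case: c {p0 p1 p2 H}; rewrite /barycentric /=; lia.
Qed.

Definition ascb i (e : elt) : bool := match i with
  | N0 => (win e).2 < (win e).1.1 + 3 | N1 => (win e).1.1 < (win e).1.2 | N2 => (win e).1.2 < (win e).2 end.

Lemma ascE i e : asc i (el e) = ascb i e.
Proof. by have [h0 h1 h2] := fpos_el e; case: i; rewrite /asc ?h0 ?h1 ?h2. Qed.

Definition az (x : int) : int := (absz x)%:Z.

(** The length formula of Iwahori and Matsumoto, one term for each positive root; [x] and [y] are
    the first two barycentric coordinates of the translation. *)
Definition len (e : elt) : int := let: (c, a, b) := e in let x := a + b in let y := 2 * b - a in match c with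
  | W1 => az (y - x) + az x + az y | WS1 => az (x - y - 1) + az y + az x
  | WS2 => az x + az (y - x) + az (y - 1) | W12 => az y + az (x - y - 1) + az (x - 1)
  | W21 => az (x - 1) + az (y - 1) + az (y - x) | W121 => az (y - 1) + az (x - 1) + az (x - y - 1) end.

(** On the types [W1], [W12] and [W21] this is the [m] of [dclass_even m], with 0 for [dclass0]. *)
Definition even_index (e : elt) : int := let: (c, a, b) := e in match c with
  | W1 => az (a + b) | W21 => az (b - 2 * a) | W12 => az (a - 2 * b) | _ => 0 end.

(** Elements of length [2 m] in the class of index [m > 0]. By [solved_all] they are exactly the
    affine Weyl elements with empty variety. *)
Definition dead (e : elt) : bool := match e.1.1 with
  | W1 | W21 | W12 => (0 < even_index e) && (len e == 2 * even_index e) | _ => false end.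

Definition crit_low (a b : int) : bool :=
  ~~ (((a %% 2)%Z == 0) && ((b %% 2)%Z == 0)) && [|| 2 * a - b == 1, 2 * b - a == 1 | a + b == 1].

(** Twice the claimed dimension, to stay in the integers; it is meaningful for elements that are not
    [dead]. *)
Definition dim2 (e : elt) : int := let: (c, a, b) := e in len e + match c with
  | W1 => 2 - 2 * (((a == 0) && (b == 0)) : nat)%:Z | W12 | W21 => 2 | WS1 | WS2 => 1
  | W121 => 3 - 2 * (crit_low a b : nat)%:Z end.

Definition cj i e := rmul (dn i) (lmul i e).
Definition rdc i e := ~~ ascb i (einv e) && ~~ ascb (dn i) (lmul i e).
Definition shf i e := ~~ ascb i (einv e) && ascb (dn i) (lmul i e).

(** The reduction at [i] shortens; each of the two resulting elements is [dead] or has claimed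
    dimension at most one less than [e], which gives the upper bound, and one of them attains this,
    which gives the chain. *)
Definition good i e := [&& rdc i e, len (cj i e) < len e, len (lmul i e) < len e,
  dead (cj i e) || (dim2 (cj i e) <= dim2 e - 2), dead (lmul i e) || (dim2 (lmul i e) <= dim2 e - 2) &
  (~~ dead (cj i e) && (dim2 (cj i e) == dim2 e - 2)) || (~~ dead (lmul i e) && (dim2 (lmul i e) == dim2 e - 2))].

End Coordinates.

Definition shg i e := [&& shf i e, ~~ dead e, ~~ dead (cj i e), dim2 (cj i e) == dim2 e & len (cj i e) <= len e].

(** Conjugations that neither lengthen [e] nor change the claimed dimension lead to an element with
    a good reduction. *)
Inductive reach : elt -> Prop :=
| reach_good i e : ~~ dead e -> good i e -> reach e
| reach_shift i e : shg i e -> reach (cj i e) -> reach e.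

Lemma az_ge0 x : 0 <= x -> az x = x. Proof. by rewrite /az; lia. Qed.
Lemma az_le0 x : x <= 0 -> az x = - x. Proof. by rewrite /az; lia. Qed.

Lemma crit_lowE a b : crit_low a b = [|| 2 * a - b == 1, 2 * b - a == 1 | a + b == 1].
Proof. by rewrite /crit_low; lia. Qed.

(** Replaces absolute values by linear terms, splitting on a sign only where the context leaves it
    open. *)
Ltac signs := repeat match goal with |- context [az ?x] =>
  first [rewrite (@az_ge0 x); [|lia] | rewrite (@az_le0 x); [|lia]
        | let h := fresh in have [h|h] := leP 0 x; [rewrite (@az_ge0 x); [|lia]|rewrite (@az_le0 x); [|lia]]] end.
Ltac comb := rewrite /shg /good /rdc /shf /cj /dim2 /dead /even_index /len /= ?crit_lowE; signs;
  repeat (apply/andP; split); lia.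

Lemma reach_W1 (a b : int) : ~~ dead (W1, a, b) -> ~~ ((a == 0) && (b == 0)) -> reach (W1, a, b).
Proof.
by move=> nd nb; case: (ltP (2 * b - a) (a + b)) => h; [apply: (@reach_good N2) (nd) _ | apply: (@reach_good N1) (nd) _];
  move: nd; rewrite /dead /even_index /len /az /= => nd; comb.
Qed.

Lemma reach_W12 (a b : int) : ~~ dead (W12, a, b) -> reach (W12, a, b).
Proof. by case: (ltP (a + b) 1) => h nd; [apply: (@reach_good N1) (nd) _ | apply: (@reach_good N0) (nd) _]; move: nd; rewrite /dead /even_index /len /az /= => nd; comb. Qed.

Lemma reach_W21 (a b : int) : ~~ dead (W21, a, b) -> reach (W21, a, b).
Proof. by case: (ltP (a + b) 1) => h nd; [apply: (@reach_good N2) (nd) _ | apply: (@reach_good N0) (nd) _]; move: nd; rewrite /dead /even_index /len /az /= => nd; comb. Qed.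

(** The signs of the three pairings select the chamber and with it the node; next to some walls
    another node is needed. The two excluded elements are the base cases [s1 s2 s1] and [s0]. *)
Lemma reach_W121 (a b : int) : ~~ ((a == 0) && (b == 0)) -> ~~ ((a == 1) && (b == 1)) -> reach (W121, a, b).
Proof.
move=> n0 n1.
have [x|x] := ltP (a + b) 1; have [y|y] := ltP (2 * b - a) 1; have [z|z] := ltP (2 * a - b) 1; try lia.
- have [w|w] := eqVneq (2 * a - b) 0.
    apply: (@reach_good N2) => //; first by comb.
  apply: (@reach_good N1) => //; first by comb.
- apply: (@reach_good N2) => //; first by comb.
- apply: (@reach_good N1) => //; first by comb.
- have [w|w] := eqVneq (2 * b - a) 0.
    apply: (@reach_good N0) => //; first by comb.
  apply: (@reach_good N2) => //; first by comb.
- have [w|w] := eqVneq (2 * a - b) 0.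
    apply: (@reach_good N0) => //; first by comb.
  apply: (@reach_good N1) => //; first by comb.
- apply: (@reach_good N0) => //; first by comb.
Qed.

(** Where no node gives a good reduction at once, up to two conjugations come first. *)
Lemma reach_WS1 (a b : int) : ~~ ((a == 0) && (b == 0)) -> reach (WS1, a, b).
Proof.
move=> n0; have nd c d : (~~ dead (WS1, c, d)) * (~~ dead (WS2, c, d)) * (~~ dead (W121, c, d)) by [].
have [x|x] := ltP (a + b) 1; have [y|y] := ltP (2 * b - a) 1; have [z|z] := ltP (2 * a - b) 1; try lia.
- have [w|w] := eqVneq (2 * b - a) 0; last by apply: (@reach_good N2) (nd _ _).1.1 _; comb.
  apply: (@reach_shift N1); first by comb.
  apply: (@reach_shift N2); first by comb.
  by apply: (@reach_good N1); comb.
- apply: (@reach_shift N2); first by comb.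
  have [w|w] := eqVneq (a + b) 0; last by apply: (@reach_good N0); comb.
  apply: (@reach_shift N0); first by comb.
  by apply: (@reach_good N2); comb.
- apply: (@reach_shift N1); first by comb.
  by apply: (@reach_good N2); comb.
- have [w|w] := eqVneq (2 * b - a) 0; last by apply: (@reach_good N0) (nd _ _).1.1 _; comb.
  apply: (@reach_shift N0); first by comb.
  by apply: (@reach_good N1); comb.
- by apply: (@reach_good N1) (nd _ _).1.1 _; comb.
- apply: (@reach_shift N0); first by comb.
  have [w|w] := eqVneq (2 * a - b) 1; last by apply: (@reach_good N1); comb.
  apply: (@reach_shift N1); first by comb.
  by apply: (@reach_good N0); comb.
Qed.

Lemma reach_WS2 (a b : int) : ~~ ((a == 0) && (b == 0)) -> reach (WS2, a, b).
Proof.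
move=> n0; have nd c d : (~~ dead (WS1, c, d)) * (~~ dead (WS2, c, d)) * (~~ dead (W121, c, d)) by [].
have [x|x] := ltP (a + b) 1; have [y|y] := ltP (2 * b - a) 1; have [z|z] := ltP (2 * a - b) 1; try lia.
- have [w|w] := eqVneq (2 * a - b) 0; last by apply: (@reach_good N1) (nd _ _).1.2 _; comb.
  apply: (@reach_shift N2); first by comb.
  apply: (@reach_shift N1); first by comb.
  by apply: (@reach_good N2); comb.
- apply: (@reach_shift N2); first by comb.
  by apply: (@reach_good N1); comb.
- apply: (@reach_shift N1); first by comb.
  have [w|w] := eqVneq (a + b) 0; last by apply: (@reach_good N0); comb.
  apply: (@reach_shift N0); first by comb.
  by apply: (@reach_good N1); comb.
- by apply: (@reach_good N2) (nd _ _).1.2 _; comb.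
- have [w|w] := eqVneq (2 * a - b) 0; last by apply: (@reach_good N0) (nd _ _).1.2 _; comb.
  apply: (@reach_shift N0); first by comb.
  by apply: (@reach_good N2); comb.
- apply: (@reach_shift N0); first by comb.
  have [w|w] := eqVneq (2 * b - a) 1; last by apply: (@reach_good N2); comb.
  apply: (@reach_shift N2); first by comb.
  by apply: (@reach_good N0); comb.
Qed.

Lemma len_ge0 e : 0 <= len e.
Proof. by case: e => [[[] a] b]; rewrite /len /az; lia. Qed.

Lemma gid31 (gT : groupType) (t s r : gT) : (r = t * s * t^-1)%g -> (t^-1 * (r * t * t) * t^-1 = s)%g.
Proof. by move=> ->; rewrite mulgKV !mulgA mulVg mul1g mulgK. Qed.

Lemma rot_w0 : rot w0 = s0.
Proof. exact: gid31 s1E. Qed.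

Lemma el_s0 : el (W121, 1, 1) = s0.
Proof. iw_compute. Qed.

Lemma el_s1 : el (WS1, 0, 0) = s1.
Proof. by []. Qed.

Lemma el_1 : el (W1, 0, 0) = 1%g.
Proof. by []. Qed.

Lemma el_s121 : el (W121, 0, 0) = (s1 * s2 * s1)%g.
Proof. by apply: iw_eq; [rewrite /= !wact0 | apply: ord3P; rewrite /= ?permM ?permE]. Qed.

Section Induction.
Variables (k : closedFieldType) (q : nat) (qP : [pchar k].-nat q).
Hypothesis q1 : (1 < q)%N.
Local Notation XX := (XX qP).
Local Notation UpTo := (UpTo qP).
Local Notation Ch := (Ch qP).

Lemma empty_at (x : iwahoriWeyl) (r j : 'I_3) : lin x r = j ->
  (forall i : 'I_3, fpos x j - (j : nat)%:Z <= fpos x i - (i : nat)%:Z) ->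
  (forall i : 'I_3, fpos (delta x) r - (r : nat)%:Z <= fpos (delta x) i - (i : nat)%:Z) ->
  lin (delta x) j = r ->
  (fpos x j - (j : nat)%:Z) + (fpos (delta x) r - (r : nat)%:Z) < wdeg x + wdeg (delta x) -> forall y, ~ XX x y.
Proof. by move=> <- h1 h2 h3 h4; apply: (XX_empty h1 h2 h3) h4; rewrite addrC subrK. Qed.

(** The length condition confines the translation part to two opposite regions; in each of them [r]
    and [j] are indices of least shift for [el e] and its [delta] image. *)
Lemma dead_empty e : dead e -> forall y, ~ XX (el e) y.
Proof.
case: e => [[c a] b] ed.
have cE : c = W1 \/ c = W12 \/ c = W21 by case: c ed => //; auto.
have [f0 f1 f2] := fpos_el (c, a, b); have [g0 g1 g2] := fpos_el (edelta (c, a, b)).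
have w1 : wdeg (el (c, a, b)) = 3 * b.
  by rewrite /wdeg !big_ord_recl big_ord0 /barycentric /=; lia.
have w2 : wdeg (el (edelta (c, a, b))) = 3 * a.
  by case: c {ed cE f0 f1 f2 g0 g1 g2 w1}; rewrite /wdeg !big_ord_recl big_ord0 /barycentric /=; lia.
have at_ (r j : 'I_3) : lin (el (c, a, b)) r = j -> lin (el (edelta (c, a, b))) j = r ->
    (forall i : 'I_3, fpos (el (c, a, b)) j - (j : nat)%:Z <= fpos (el (c, a, b)) i - (i : nat)%:Z) ->
    (forall i : 'I_3, fpos (el (edelta (c, a, b))) r - (r : nat)%:Z <= fpos (el (edelta (c, a, b))) i - (i : nat)%:Z) ->
    (fpos (el (c, a, b)) j - (j : nat)%:Z) + (fpos (el (edelta (c, a, b))) r - (r : nat)%:Z) < 3 * b + 3 * a ->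
    forall y, ~ XX (el (c, a, b)) y.
  move=> rj jr h1 h2 h3; apply: (empty_at rj); rewrite ?edeltaE ?w1 ?w2; [exact: h1|exact: h2|exact: jr|exact: h3].
case: cE ed f0 f1 f2 g0 g1 g2 at_ {w1 w2} => [->|[->|->]]; rewrite /dead /even_index /len /az /= => ed f0 f1 f2 g0 g1 g2 at_.
- have [h|h] := ltP 0 (a + b); [apply: (at_ 2%:R 2%:R)|apply: (at_ 0 0)];
    rewrite ?permE //; try (apply: ord3P); rewrite ?f0 ?f1 ?f2 ?g0 ?g1 ?g2 /=; lia.
- have [h|h] : a + b <= 1 /\ 2 * b - a < 0 /\ 1 <= 2 * a - b \/ 1 <= a + b /\ 0 < 2 * b - a /\ 2 * a - b <= 1 by lia.
    apply: (at_ 1 0); rewrite ?permM ?permE //; try (apply: ord3P); rewrite ?f0 ?f1 ?f2 ?g0 ?g1 ?g2 /=; lia.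
  apply: (at_ 2%:R 1); rewrite ?permM ?permE //; try (apply: ord3P); rewrite ?f0 ?f1 ?f2 ?g0 ?g1 ?g2 /=; lia.
- have [h|h] : a + b <= 1 /\ 2 * a - b < 0 /\ 1 <= 2 * b - a \/ 1 <= a + b /\ 0 < 2 * a - b /\ 2 * b - a <= 1 by lia.
    apply: (at_ 0 1); rewrite ?permM ?permE //; try (apply: ord3P); rewrite ?f0 ?f1 ?f2 ?g0 ?g1 ?g2 /=; lia.
  apply: (at_ 1 2%:R); rewrite ?permM ?permE //; try (apply: ord3P); rewrite ?f0 ?f1 ?f2 ?g0 ?g1 ?g2 /=; lia.
Qed.

Definition solved e := if dead e then (forall y, ~ XX (el e) y)
  else exists d : nat, [/\ 2 * d%:Z = dim2 e, UpTo (el e) d & Ch (el e) d].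

Lemma conj_el i e : conj i (el e) = el (cj i e).
Proof. by rewrite /conj lmulE rmulE. Qed.

Lemma asc_inv i e : asc i (el e)^-1%g = ascb i (einv e).
Proof. by rewrite einvE ascE. Qed.

Lemma solved_shift i e : shg i e -> solved (cj i e) -> solved e.
Proof.
case/and5P=> /andP[h1 h2] h3 h4 /eqP h5 _; rewrite /solved (negPf h3) (negPf h4) => -[d [dE dU dC]].
have ia : ~~ asc i (el e)^-1%g by rewrite asc_inv.
have ib : asc (dn i) (nd i * el e)%g = true by rewrite lmulE ascE.
exists d; split; first by rewrite dE.
  by have := @node_up _ _ qP i (el e) d ia; rewrite ib conj_el; apply => //; left.
by have := @node_chain _ _ qP i (el e) d ia; rewrite ib conj_el; apply; left.
Qed.

Lemma solved_good i e : good i e -> ~~ dead e -> (forall e', len e' < len e -> solved e') -> solved e.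
Proof.
case/and5P=> /andP[h1 h2] l1 l2 u1 /andP[u2 ex] nde IH; rewrite /solved (negPf nde).
have ia : ~~ asc i (el e)^-1%g by rewrite asc_inv.
have ib : asc (dn i) (nd i * el e)%g = false by rewrite lmulE ascE; apply: negbTE.
have s1' := IH _ l1; have s2' := IH _ l2.
have [d dE] : exists d : nat, 2 * d%:Z = dim2 e - 2.
  case/orP: ex => /andP[nd' /eqP dE]; [move: s1' | move: s2']; rewrite /solved (negPf nd') => -[d [E _ _]];
  by exists d; rewrite E.
have up e' : solved e' -> dead e' || (dim2 e' <= dim2 e - 2) -> UpTo (el e') d.
  rewrite /solved; case: (dead e') => /= [H _|[d' [E U _]] le]; first exact: UpTo_empty.
  by apply: UpTo_le U; lia.
exists d.+1; split; first by lia.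
  have := @node_up _ _ qP i (el e) d ia; rewrite ib conj_el lmulE; apply; first exact: up.
  by right; exact: up.
have := @node_chain _ _ qP i (el e) d ia; rewrite ib conj_el lmulE; apply.
case/orP: ex => /andP[nd' /eqP dE']; [left; move: s1' | right; split => //; move: s2']; rewrite /solved (negPf nd') => -[d' [E _ C]];
by have <- : d' = d by lia.
Qed.

Lemma solved_reach e : reach e -> (forall e', len e' < len e -> solved e') -> solved e.
Proof.
elim=> [i {}e nd gd IH|i {}e sg _ IHr IH]; first exact: solved_good gd nd IH.
apply: (solved_shift sg); apply: IHr => e' lt; apply: IH.
by case/and5P: sg => _ _ _ _ le; exact: lt_le_trans lt le.
Qed.

Lemma solved_s1 : solved (WS1, 0, 0).
Proof. by exists 1%N; rewrite el_s1; split; [|exact: base_s1|exact: chain_s1]. Qed.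

Theorem solved_all e : solved e.
Proof.
have [n le] : exists n : nat, len e < n%:Z by exists (absz (len e)).+1; have := len_ge0 e; lia.
elim: n e le => [|n IH] e le; first by have := len_ge0 e; lia.
have {}IH e' : len e' < len e -> solved e' by move=> lt; apply: IH; lia.
have [de|nde] := boolP (dead e); first by rewrite /solved de; exact: dead_empty.
case: e le IH nde => [[c a] b] _ IH nde.
have [/andP[/eqP a0 /eqP b0]|n0] := boolP ((a == 0) && (b == 0)).
  move: a b a0 b0 IH nde => _ _ -> ->; case: c => IH nde.
  - by exists 0%N; rewrite el_1; split; [|exact: base_1|exact: chain_1].
  - exact: solved_s1.
  - by apply: (@solved_shift N2) => //; exact: solved_s1.
  - exact: solved_reach (reach_W12 nde) IH.
  - exact: solved_reach (reach_W21 nde) IH.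
  - by exists 3%N; rewrite el_s121; split; [|exact: base_s121|exact: chain_s121].
case: c IH nde => IH nde.
- exact: solved_reach (reach_W1 nde n0) IH.
- exact: solved_reach (reach_WS1 n0) IH.
- exact: solved_reach (reach_WS2 n0) IH.
- exact: solved_reach (reach_W12 nde) IH.
- exact: solved_reach (reach_W21 nde) IH.
- have [/andP[/eqP -> /eqP ->]|n1] := boolP ((a == 1) && (b == 1)).
    by exists 1%N; rewrite el_s0 -rot_w0; split; [|exact/UpTo_rot/base_w0|exact/Ch_rot/chain_w0].
  exact: solved_reach (reach_W121 n0 n1) IH.
Qed.

End Induction.

(** * Length and conjugacy classes *)

Lemma gid32 (gT : groupType) (t x y : gT) j : (t * (t * t) = 1)%g -> (t * x = y * t)%g ->
  (t^-1 * (y * t ^+ j) * t^-1 = x * t ^+ j.+1)%g.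
Proof.
move=> t3 E; have -> : y = (t * x * t^-1)%g by rewrite E mulgK.
rewrite !mulgA mulVg mul1g -!mulgA; congr (_ * _)%g.
apply: (mulgI t); rewrite mulKVg; apply: (mulIg t); rewrite mulgKV -expgS -expgSr -addn3.
by rewrite expgnDr !expgS expg0 mulg1 t3 mulg1.
Qed.

Lemma gid33 (gT : groupType) (t x : gT) : (t * (t * t) = 1)%g ->
  (t * x * t^-1 * t ^+ 2 = t^-1 * (t^-1 * x * t^-1) * t^-1)%g /\ (t ^+ 2 * x * t ^- 2 * t = t^-1 * x * t^-1)%g.
Proof.
move=> t3; have tV : (t^-1 = t * t)%g by apply: (mulgI t); rewrite mulgV.
have t2 : (t ^+ 2 = t^-1)%g by rewrite expgS expg1.
have t1 : (t^-1 * t^-1 = t)%g by rewrite {1}tV mulgK.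
by rewrite t2 invgK; split; [rewrite !mulgA t1 | rewrite -mulgA -tV].
Qed.

Lemma tauX_mod j : (tau ^+ j = tau ^+ (j %% 3))%g.
Proof. by rewrite {1}(divn_eq j 3) expgnDr mulnC expgM tau3 expg1n mul1g. Qed.

Lemma tau_wordV v : exists2 u, size u = size v & (tau * word u = word v * tau)%g.
Proof.
have Ei i : (tau * simple_refl i = simple_refl (i + 1) * tau)%g.
  by elim/ord3P: i; [exact: tau_s0 | exact: tau_s1 | exact: tau_s2].
elim: v => [|i v [u su E]]; first by exists [::]; rewrite // /word !big_nil mulg1 mul1g.
exists (i - 1 :: u); first by rewrite /= su.
by rewrite /word !big_cons -!/(word _) mulgA Ei subrK -mulgA E mulgA.
Qed.

Lemma rot_word v j : exists2 u, size u = size v & rot (word v * tau ^+ j)%g = (word u * tau ^+ j.+1)%g.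
Proof. by have [u su E] := tau_wordV v; exists u => //; exact: gid32 tau3' E. Qed.

Lemma expressible_rot n w : expressible n w -> expressible n (rot w).
Proof.
case/existsP=> v /existsP[j /eqP ->]; have [u su E] := rot_word v j.
have su' : size u == n by rewrite su size_tuple.
apply/existsP; exists (Tuple su'); apply/existsP; exists (inord (j.+1 %% 3)).
by rewrite inordK ?ltn_mod // -tauX_mod E.
Qed.

Lemma iw_length_rot w : iw_length (rot w) = iw_length w.
Proof.
have le x : (iw_length (rot x) <= iw_length x)%N.
  rewrite /iw_length; case: ex_minnP => m _ mmin; case: (ex_minnP (expressible_ex x)) => n xn _.
  exact/mmin/expressible_rot.
apply/eqP; rewrite eqn_leq le /= -{1}(rot3 w); exact: leq_trans (le _) (le _).
Qed.

Lemma len_lmul i e : len (lmul i e) <= len e + 1.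
Proof. by case: e => [[c a] b]; case: i; case: c; rewrite /len /az /=; lia. Qed.

Lemma len_descent i e : ~~ ascb i (einv e) -> len (lmul i e) = len e - 1.
Proof. by case: e => [[c a] b]; case: i; case: c; rewrite /len /az /=; lia. Qed.

Lemma len_gt0 e : (forall i, ascb i (einv e)) -> len e = 0.
Proof.
move=> h; have := h N0; have := h N1; have := h N2; case: e {h} => [[c a] b].
by case: c; rewrite /len /az /=; lia.
Qed.

Lemma len_eq0 e : len e = 0 -> e = (W1, 0, 0).
Proof.
case: e => [[c a] b]; case: c; rewrite /len /az => h; try lia.
by have [-> ->] : a = 0 /\ b = 0 by lia.
Qed.

Lemma lmulK i e : lmul i (lmul i e) = e.
Proof. by case: e => [[c a] b]; case: i; case: c; congr (_, _, _); lia. Qed.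

Definition ndi i : 'I_3 := match i with N0 => 0 | N1 => 1 | N2 => 2%:R end.

Lemma simple_ndi i : simple_refl (ndi i) = nd i.
Proof. by case: i. Qed.

Lemma ndiP (i : 'I_3) : exists j, i = ndi j.
Proof. by elim/ord3P: i; [exists N0 | exists N1 | exists N2]. Qed.

Lemma word_cons i u : word (i :: u) = (simple_refl i * word u)%g.
Proof. by rewrite /word big_cons. Qed.

Lemma el_word u : exists2 e, word u = el e & len e <= (size u)%:Z.
Proof.
elim: u => [|i u [e E le]]; first by exists (W1, 0, 0); rewrite // /word big_nil.
have [j ->] := ndiP i; exists (lmul j e); first by rewrite word_cons simple_ndi E lmulE.
by rewrite /=; have := len_lmul j e; lia.
Qed.

Lemma word_el m e : len e = m%:Z -> exists2 u, size u = m & word u = el e.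
Proof.
elim: m e => [|m IH] e le; first by exists [::]; rewrite // (len_eq0 le) /word big_nil.
have [i ie] : exists i, ~~ ascb i (einv e).
  apply: contrapT => no; suff : len e = 0 by lia.
  by apply: len_gt0 => i; apply: contrapT => /negP h; apply: no; exists i.
have [|u su uE] := IH (lmul i e); first by rewrite len_descent //; lia.
by exists (ndi i :: u); rewrite /= ?su // word_cons simple_ndi uE lmulE lmulK.
Qed.

Lemma wdeg_el (e : elt) : wdeg (el e) = 3 * e.2.
Proof. by case: e => [[c a] b]; rewrite /wdeg !big_ord_recl big_ord0 /barycentric /=; lia. Qed.

Section Degree.
Variables (k : closedFieldType) (q : nat) (qP : [pchar k].-nat q).

Lemma wdeg_tau : exists n : int, wdeg tau = 1 + 3 * n.
Proof.
have [n ->] := wdegM qP (transl omega1) (s1 * s2)%g; have [m ->] := wdegM qP s1 s2.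
by exists (m + n); rewrite /wdeg !big_ord_recl !big_ord0 /barycentric /=; lia.
Qed.

Lemma wdeg_tauX j : exists n : int, wdeg (tau ^+ j)%g = j%:Z + 3 * n.
Proof.
elim: j => [|j [n IH]]; first by exists 0; rewrite expg0 /wdeg !big_ord_recl !big_ord0 /barycentric.
rewrite expgS; have [m ->] := wdegM qP tau (tau ^+ j)%g; have [l ->] := wdeg_tau.
by rewrite IH; exists (m + n + l); lia.
Qed.

Lemma wdeg_tauV : exists n : int, wdeg tau^-1%g = 2 + 3 * n.
Proof.
have -> : (tau^-1 = tau ^+ 2)%g by apply: (mulgI tau); rewrite mulgV -expgS tau3.
exact: wdeg_tauX 2.
Qed.

Lemma wdeg_iter_rot i w : exists n : int, wdeg (iter i rot w) = wdeg w + i%:Z + 3 * n.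
Proof.
elim: i => [|i [n IH]]; first by exists 0; rewrite /=; lia.
rewrite iterS /rot; have [m ->] := wdegM qP (tau^-1 * iter i rot w)%g tau^-1%g.
have [l ->] := wdegM qP tau^-1%g (iter i rot w); have [c ->] := wdeg_tauV.
by rewrite IH; exists (m + n + l + 2 * c + 1); lia.
Qed.

Lemma el_inj : injective el.
Proof.
move=> e e' E; have [h0 h1 h2] := fpos_el e; have [] := fpos_el e'; rewrite -E h0 h1 h2 {E h0 h1 h2}.
case: e e' => [[c a] b] [[c' a'] b']; rewrite /win.
case: c; case: c' => /= h0 h1 h2; first [exfalso; lia | by have [-> ->] : a = a' /\ b = b' by lia].
Qed.

(** [iw_length] minimises over words followed by a power of [tau]; the degree modulo 3 forces this
    power to be trivial for affine elements. *)
Lemma iw_length_el e : (iw_length (el e))%:Z = len e.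
Proof.
rewrite /iw_length; case: ex_minnP => n /existsP[u /existsP[j /eqP E]] nmin.
have [e' eE le] := el_word u; rewrite eE in E.
have j0 : j = 0 :> nat.
  have [m h] := wdegM qP (el e') (tau ^+ j)%g; have [l h'] := wdeg_tauX j.
  by move: h; rewrite -E h' !wdeg_el; have := ltn_ord j; lia.
rewrite j0 expg0 mulg1 in E; rewrite -(el_inj E) size_tuple in le.
have [|v sv vE] := @word_el (absz (len e)) e; first by have := len_ge0 e; lia.
suff : (n <= absz (len e))%N by have := len_ge0 e; lia.
have sv' : size v == absz (len e) by rewrite sv.
apply: nmin; apply/existsP; exists (Tuple sv'); apply/existsP; exists 0.
by rewrite /= expg0 mulg1 vE.
Qed.

Lemma rot_inj : injective rot.
Proof. by move=> x y E; rewrite -(rot3 x) E rot3. Qed.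

(** Affine Weyl elements have degree divisible by 3 and each rotation adds 1 modulo 3, so the number
    of rotations can be read off. *)
Lemma rot_el_inj i j e e' : (i < 3)%N -> (j < 3)%N -> iter i rot (el e) = iter j rot (el e') -> e = e'.
Proof.
move=> i3 j3 E; have [n h] := wdeg_iter_rot i (el e); have [m h'] := wdeg_iter_rot j (el e').
have ij : i = j by move: h h'; rewrite E !wdeg_el => ->; lia.
rewrite ij in E; apply: el_inj; elim: j {ij j3 h h'} E => //= j IH E; exact/IH/rot_inj.
Qed.

Lemma rot_elP w : exists i e, (i < 3)%N /\ w = iter i rot (el e).
Proof.
have [n /existsP[u /existsP[j /eqP E]]] := expressible_ex w.
case: j E => -[|[|[|//]]] /= _ E.
- by have [e eE _] := el_word u; exists 0%N, e; rewrite E expg0 mulg1.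
- have [v _ E1] := rot_word u 1; have [v' _ E2] := rot_word v 2; have [e eE _] := el_word v'.
  by exists 1%N, e; split=> //=; rewrite -eE -(rot3 w) E E1 E2 tau3 mulg1.
- have [v _ E1] := rot_word u 2; have [e eE _] := el_word v.
  by exists 2%N, e; split=> //=; rewrite -eE -(rot3 w) E E1 tau3 mulg1.
Qed.

(** The two conjugated copies in [hat X] are the images of [X] under two rotations and under one
    ([gid33]), so membership is decided by the affine element. *)
Lemma hatP (X : set iwahoriWeyl) (P : elt -> Prop) : (forall w, X w <-> exists2 e, P e & w = el e) ->
  forall i e, (i < 3)%N -> hat X (iter i rot (el e)) <-> P e.
Proof.
move=> XP i e i3; have g x := gid33 x tau3'.
split=> [[[]|]|Pe].
- by move=> /XP[e' Pe' E]; rewrite (@rot_el_inj i 0 e e').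
- move=> [x /XP[e' Pe' ->]]; rewrite (g _).1 => E.
  by rewrite (@rot_el_inj i 2 e e' i3 isT) //= -E.
- move=> [x /XP[e' Pe' ->]]; rewrite (g _).2 => E.
  by rewrite (@rot_el_inj i 1 e e' i3 isT) //= -E.
have Xe : X (el e) by apply/XP; exists e.
case: i i3 => [|[|[|//]]] _ /=.
- by left; left.
- by right; exists (el e) => //; rewrite (g _).2.
- by left; right; exists (el e) => //; rewrite (g _).1.
Qed.

End Degree.

Lemma tQ_el c a b : (tQ a b * el (c, 0, 0))%g = el (c, a, b).
Proof.
have h (x : int * int) (n : int) : x *~ n = (x.1 * n, x.2 * n).
  by rewrite [LHS]surjective_pairing (raddfMz fst) (raddfMz snd) !mulrzz.
apply: iw_eq => [|i]; last by rewrite /= mul1g.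
by rewrite /= !h wact1; apply/eqP; rewrite xpair_eqE /=; lia.
Qed.

(** * Critical strips *)

Section Critical.
Variable R : realType.
Local Notation act := (@apt_act R).
Local Notation crit := (in_critical_strips R).
Local Notation cast t := ((t.1%:~R, t.2%:~R) : R * R).

Lemma wact_cast w (t : int * int) : wact w (cast t) = cast (wact w t).
Proof.
have E i : barycentric (cast t) i = (barycentric t i)%:~R.
  by elim/ord3P: i; rewrite /barycentric /= ?intrD.
by rewrite /wact !E /= !intrB.
Qed.

Lemma apt_actM v w x : act (v * w)%g x = act v (act w x).
Proof.
apply: etrans (_ : _ = cast (tr v) + (wact (lin v) (cast (tr w)) + wact (lin v) (wact (lin w) x))) _; last by rewrite -wactD.
rewrite wact_cast addrA /apt_act [lin _]/= wactM; congr (_ + _).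
by apply/eqP; rewrite xpair_eqE /= !intrD !eqxx.
Qed.

Lemma apt_tau x : act tau x = (1 - x.1 - x.2, x.1).
Proof.
rewrite /tau !apt_actM /apt_act /= wact1 wact_s1 wact_s2.
by apply/eqP; rewrite xpair_eqE /= ?mulr0z ?mulr1z; apply/andP; split; apply/eqP; ring.
Qed.

Lemma base_tau x : @base_alcove R x -> @base_alcove R (act tau x).
Proof.
move=> h; have := h 0; have := h 1; have := h 2%:R; rewrite /pairing /= => /andP[h1 h2] /andP[h3 h4] /andP[h5 h6].
by rewrite apt_tau; elim/ord3P; rewrite /pairing /=; apply/andP; split; lra.
Qed.

(** [tau] permutes the three strips cyclically. *)
Lemma crit_taul w : crit w -> crit (tau * w)%g.
Proof.
case=> i; elim/ord3P: i => H; [exists 1|exists 2%:R|exists 0]; move=> _ [x bx <-];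
  have := H _ (ex_intro2 _ _ x bx erefl); rewrite /= apt_actM apt_tau /pairing /= => /andP[h1 h2];
  by apply/andP; split; lra.
Qed.

Lemma crit_taur w : crit w -> crit (w * tau)%g.
Proof.
case=> i H; exists i => _ [x bx <-]; rewrite apt_actM; apply: H.
by exists (act tau x) => //; exact: base_tau.
Qed.

Lemma gid34 (gT : groupType) (t x : gT) : (t * (t * t) = 1)%g -> (t^-1 * x * t^-1 = t * (t * x) * t * t)%g.
Proof. by move=> t3; have -> : (t^-1 = t * t)%g; [apply: (mulgI t); rewrite mulgV | rewrite !mulgA]. Qed.

Lemma crit_rot1 w : crit w -> crit (rot w).
Proof.
move=> h; have -> : rot w = (tau * (tau * w) * tau * tau)%g by exact: gid34 tau3'.
by do 2!apply: crit_taur; do 2!apply: crit_taul.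
Qed.

Lemma crit_rot i w : crit (iter i rot w) <-> crit w.
Proof.
have A v : crit (rot v) <-> crit v.
  by split=> [h|]; [rewrite -(rot3 v); do 2!apply: crit_rot1 | exact: crit_rot1].
by elim: i => //= i IH; rewrite A.
Qed.

Lemma int_eq1 (n : int) (c : R) : 0 < c -> c < 1 -> 0 < n%:~R - c < 1 -> n = 1.
Proof.
move=> c0 c1 /andP[h1 h2].
have n0 : 0 < n by rewrite -(ltr0z R); lra.
have : n < 2 by rewrite -(ltr_int R); have -> : (2 : int)%:~R = 2 :> R by []; lra.
lia.
Qed.

Lemma act_W121 a b x : act (el (W121, a, b)) x = ((2 * a - b)%:~R - x.2, (2 * b - a)%:~R - x.1).
Proof.
rewrite /apt_act /el /= !wactM wact_s1 wact_s2 wact_s1.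
by apply/eqP; rewrite xpair_eqE /=; apply/andP; split; apply/eqP; ring.
Qed.

(** On the base alcove the pairing with each positive root has the form [n - c] with [n] an integer
    and [0 < c < 1], so the image lies in the strip exactly when [n = 1]; the barycentre detects
    this. *)
Lemma crit_W121 a b : crit (el (W121, a, b)) <-> [|| 2 * a - b == 1, 2 * b - a == 1 | a + b == 1].
Proof.
have sE : (a + b)%:~R = (2 * a - b)%:~R + (2 * b - a)%:~R :> R.
  by rewrite -intrD; congr (_%:~R); ring.
split.
  case=> i H; pose x : R * R := (3^-1, 3^-1).
  have bx : @base_alcove R x by elim/ord3P; rewrite /pairing /x /=; apply/andP; split; lra.
  have := H _ (ex_intro2 _ _ x bx erefl); rewrite act_W121 /x /=.
  elim/ord3P: i {H} => /=; rewrite /pairing /= => h.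
  - by rewrite (int_eq1 _ _ h) ?eqxx //; lra.
  - by rewrite (int_eq1 _ _ h) ?eqxx ?orbT //; lra.
  - rewrite (@int_eq1 (a + b) (2 / 3)) ?eqxx ?orbT //; [lra|lra|].
    by move: h => /andP[h1 h2]; rewrite sE; apply/andP; split; lra.
have bnd (x : R * R) : @base_alcove R x -> [/\ 0 < x.1 < 1, 0 < x.2 < 1 & 0 < x.1 + x.2 < 1].
  by move=> h; split; [exact: (h 0) | exact: (h 1) | exact: (h 2%:R)].
case/or3P=> /eqP e; [exists 0|exists 1|exists 2%:R]; move=> _ [x /bnd[/andP[h1 h2] /andP[h3 h4] /andP[h5 h6]] <-];
  rewrite act_W121 /pairing /=.
- by rewrite e; apply/andP; split; lra.
- by rewrite e; apply/andP; split; lra.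
- by rewrite e in sE; apply/andP; split; lra.
Qed.

End Critical.

Lemma el_s2 : el (WS2, 0, 0) = s2. Proof. by []. Qed.
Lemma el_s21 : el (W21, 0, 0) = (s2 * s1)%g.
Proof. by apply: iw_eq; [rewrite /= !wact0 | apply: ord3P; rewrite /= ?permM ?permE]. Qed.
Lemma el_s12 : el (W12, 0, 0) = (s1 * s2)%g.
Proof. by apply: iw_eq; [rewrite /= !wact0 | apply: ord3P; rewrite /= ?permM ?permE]. Qed.
Lemma tQ_1 a b : tQ a b = el (W1, a, b).
Proof. by rewrite -tQ_el el_1 mulg1. Qed.

Arguments el : simpl never.

(** * The [delta]-conjugacy classes in coordinates *)

Definition cl0 (e : elt) : Prop := match e with
  | (W1, a, b) => a + b = 0 | (W21, a, b) => b = 2 * a | (W12, a, b) => a = 2 * b | _ => False end.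
Definition cl1 (e : elt) : Prop := match e with (WS1, _, _) | (WS2, _, _) => True | _ => False end.
Definition cl3 (e : elt) : Prop := match e with
  | (W121, a, b) => (a %% 2)%Z = 0 /\ (b %% 2)%Z = 0 | _ => False end.
Definition cl1' (e : elt) : Prop := match e with
  | (W121, a, b) => ~ ((a %% 2)%Z = 0 /\ (b %% 2)%Z = 0) | _ => False end.
Definition cl_even (m : nat) (e : elt) : Prop := match e with
  | (W1, _, _) | (W21, _, _) | (W12, _, _) => even_index e = m%:Z | _ => False end.

Section Classes.
Variables (k : closedFieldType) (q : nat) (qP : [pchar k].-nat q).
Variables (i : nat) (e : elt).
Hypothesis i3 : (i < 3)%N.

Lemma dclass0P : dclass0 (iter i rot (el e)) <-> cl0 e.
Proof.
apply: (hatP qP) i3 => w; split.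
  case=> c [->|->|->]; rewrite -?el_s21 -?el_s12 ?tQ_el ?tQ_1.
  - by exists (W21, c, 2 * c).
  - by exists (W12, 2 * c, c).
  - by exists (W1, c, - c); rewrite //= subrr.
case=> -[[c a] b] + ->; case: c => //= h.
- by exists a; apply: Or33; rewrite tQ_1; congr (el (_, _, _)); lia.
- by exists b; apply: Or32; rewrite -el_s12 tQ_el h.
- by exists a; apply: Or31; rewrite -el_s21 tQ_el h.
Qed.

Lemma dclass1P : dclass1 (iter i rot (el e)) <-> cl1 e.
Proof.
apply: (hatP qP) i3 => w; split.
  by case=> a [b [->|->]]; rewrite -?el_s1 -?el_s2 tQ_el; [exists (WS1, a, b)|exists (WS2, a, b)].
case=> -[[c a] b] + ->; case: c => //= _; exists a, b; [left|right];
  by rewrite -?el_s1 -?el_s2 tQ_el.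
Qed.

Lemma dclass1'P : dclass1' (iter i rot (el e)) <-> cl1' e.
Proof.
apply: (hatP qP) i3 => w; split.
  case=> a [b [->|->]]; rewrite -el_s121 tQ_el.
    by exists (W121, a, 2 * b + 1) => //=; lia.
  by exists (W121, 2 * a + 1, 2 * b) => //=; lia.
case=> -[[c a] b] + ->; case: c => //= h; rewrite -el_s121.
have [b0|b1] := eqVneq (b %% 2)%Z 0.
  by exists (a %/ 2)%Z, (b %/ 2)%Z; right; rewrite tQ_el; congr (el (_, _, _)); lia.
by exists a, (b %/ 2)%Z; left; rewrite tQ_el; congr (el (_, _, _)); lia.
Qed.

Lemma dclass3P : dclass3 (iter i rot (el e)) <-> cl3 e.
Proof.
apply: (hatP qP) i3 => w; split.
  by case=> a [b ->]; rewrite -el_s121 tQ_el; exists (W121, 2 * a, 2 * b) => //=; lia.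
case=> -[[c a] b] + ->; case: c => //= h; rewrite -el_s121.
by exists (a %/ 2)%Z, (b %/ 2)%Z; rewrite tQ_el; congr (el (_, _, _)); lia.
Qed.

Lemma dclass_evenP m : dclass_even m (iter i rot (el e)) <-> cl_even m e.
Proof.
rewrite /dclass_even; have hE : (m.+1./2)%:Z = (m./2)%:Z + (odd m : nat)%:Z by have := odd_double_half m; have := odd_double_half m.+1; rewrite oddS; case: (odd m) => /=; lia.
have mE : m%:Z = (odd m : nat)%:Z + 2 * (m./2)%:Z by have := odd_double_half m; lia.
have o1 : (odd m : nat)%:Z = 0 \/ (odd m : nat)%:Z = 1 by case: (odd m); [right|left].
(* The two halves and the parity of [m] become integers with [m = o + 2 lo], so that linear
   arithmetic applies. *)
rewrite hE; move: (m./2)%:Z (odd m : nat)%:Z mE o1 => lo o mE o1.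
apply: (hatP qP) i3 => w; split.
  case=> c [[]->|[]->|->|->]; rewrite -?el_s21 -?el_s12 ?tQ_el ?tQ_1.
  - by exists (W21, c - lo, 2 * c + o); rewrite //= /az; lia.
  - by exists (W21, c + (lo + o), 2 * c + o); rewrite //= /az; lia.
  - by exists (W12, 2 * c + o, c + (lo + o)); rewrite //= /az; lia.
  - by exists (W12, 2 * c + o, c - lo); rewrite //= /az; lia.
  - by exists (W1, c, m%:Z - c); rewrite //= /az; lia.
  - by exists (W1, c - m%:Z, - c); rewrite //= /az; lia.
case=> -[[c a] b] + ->; case: c => //=; rewrite /az => h; rewrite -?el_s21 -?el_s12.
- have [s|s] : a + b = m%:Z \/ a + b = - m%:Z by lia.
    by exists a; apply: Or43; rewrite tQ_1; congr (el (_, _, _)); lia.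
  by exists (- b); apply: Or44; rewrite tQ_1; congr (el (_, _, _)); lia.
- have [s|s] : a - 2 * b = m%:Z \/ a - 2 * b = - m%:Z by lia.
    by exists (b + lo); apply: Or42; right; rewrite tQ_el; congr (el (_, _, _)); lia.
  by exists (b - (lo + o)); apply: Or42; left; rewrite tQ_el; congr (el (_, _, _)); lia.
- have [s|s] : b - 2 * a = m%:Z \/ b - 2 * a = - m%:Z by lia.
    by exists (a + lo); apply: Or41; left; rewrite tQ_el; congr (el (_, _, _)); lia.
  by exists (a - (lo + o)); apply: Or41; right; rewrite tQ_el; congr (el (_, _, _)); lia.
Qed.

End Classes.

(** * The dimension of the varieties *)

Section Dimension.
Variables (k : closedFieldType) (q : nat) (qP : [pchar k].-nat q).

Lemma adlv_XX w : adlv q (1%:M : 'M[laurent k]_3) w = XX qP w.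
Proof.
apply/seteqP; split=> x.
  case=> g [gu xE gD]; pose g' : lg k := Lg (Logic.conj (mulmxV gu) (mulVmx gu)).
  exists g'; first exact/fl_icoset.
  by apply/double_cosetE; move: gD; rewrite mulmx1 mxM mx_sg.
case=> g xE gD; exists (mx g); split; [exact: mx_unit | exact/fl_icoset|].
by move/double_cosetE: gD; rewrite mulmx1 mxM mx_sg invmx_mx.
Qed.

Hypothesis q1 : (1 < q)%N.

Lemma krull_dim_UpTo w d : UpTo qP w d -> Ch qP w d -> krull_dim (XX qP w) d.
Proof.
move=> [wC [r wN]] wCh; split=> // e de eC.
have U : Up (wdeg w + 3 * 0) d (XX qP w).
  by split; [exact: (@near_locally_bounded _ _ qP q1 _ r wN) | move=> m; exact: wC].
by have := Up_chain U eC; rewrite leqNgt de.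
Qed.

Lemma krull_dim_el i e : XX qP (iter i rot (el e)) !=set0 ->
  exists2 d : nat, 2 * d%:Z = dim2 e & krull_dim (XX qP (iter i rot (el e))) d.
Proof.
move=> [y Xy]; have := solved_all qP q1 e; rewrite /solved; case: (dead e) => [no|[d [dE U C]]].
  suff /(_ y) : forall y, ~ XX qP (iter i rot (el e)) y by [].
  by elim: {y Xy} i => //= i IH; exact: (XX_rot0 qP (iter i rot (el e))).1 IH.
exists d => //; apply: krull_dim_UpTo.
  by elim: {y Xy} i => //= i IH; apply/UpTo_rot.
by elim: {y Xy} i => //= i IH; apply/Ch_rot.
Qed.

End Dimension.

Lemma card_pnat (Fq : finFieldType) (k : fieldType) (iota : {rmorphism Fq -> k}) : [pchar k].-nat #|Fq|.
Proof.
have [p p_pr pF] := finPcharP Fq.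
have pk : p \in [pchar k] by rewrite inE p_pr -(rmorph_nat iota) (pcharf0 pF) rmorph0 eqxx.
have := pprimeChar_pgroup pF; rewrite /pgroup cardsT => h.
by rewrite (eq_pnat _ (pcharf_eq pk)).
Qed.

Lemma half_eq (d l c : nat) : (2 * d = l + c)%N -> d%:R = (l%:R + c%:R) / 2%:R :> rat.
Proof. by move=> h; rewrite -natrD -h natrM mulrAC divff ?mul1r. Qed.

Lemma dim2_len e : dim2 e = len e + match e with
  | (W1, a, b) => 2 - 2 * (((a == 0) && (b == 0)) : nat)%:Z | (W12, _, _) | (W21, _, _) => 2
  | (WS1, _, _) | (WS2, _, _) => 1
  | (W121, a, b) => 3 - 2 * ([|| 2 * a - b == 1, 2 * b - a == 1 | a + b == 1] : nat)%:Z end.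
Proof. by case: e => [[[] a] b]; rewrite /dim2 // crit_lowE. Qed.

Theorem theorem3p5 (R : realType) (Fq : finFieldType) (k : closedFieldType)
    (iota : {rmorphism Fq -> k})
    (k_alg : forall x : k, algebraicOver iota x)
    (w : iwahoriWeyl)
    (X_neq0 : adlv #|Fq| (1%:M : 'M[laurent k]_3) w !=set0) :
  exists2 d : nat, krull_dim (adlv #|Fq| (1%:M : 'M[laurent k]_3) w) d &
    let l : rat := (iw_length w)%:R in
    let case0 := dclass0 w /\ iw_length w = 0%N in
    let case1 := dclass1' w /\ in_critical_strips R w \/ dclass1 w in
    let case2 := dclass0 w /\ (0 < iw_length w)%N \/
                 (exists2 m : nat, (0 < m)%N & dclass_even m w) in
    let case3 := dclass1' w /\ in_shrunken_chambers R w \/ dclass3 w in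
    [/\ [\/ case0, case1, case2 | case3],
        case0 -> d%:R = 0 :> rat,
        case1 -> d%:R = (l + 1) / 2%:R,
        case2 -> d%:R = (l + 2%:R) / 2%:R &
        case3 -> d%:R = (l + 3%:R) / 2%:R].
Proof.
have qP := card_pnat iota; have q1 : (1 < #|Fq|)%N := finNzRing_gt1 Fq.
(* Dimension, length, classes and critical strips are all invariant under rotation, so everything is
   computed on an affine Weyl element in coordinates. *)
have [i [e [i3 wE]]] := rot_elP w.
rewrite (adlv_XX qP) in X_neq0 *; rewrite wE in X_neq0 *.
have [d dE dK] := krull_dim_el q1 X_neq0; exists d => // {X_neq0 dK}.
have H0 := dclass0P qP e i3; have H1 := dclass1P qP e i3; have H1' := dclass1'P qP e i3.
have H3 := dclass3P qP e i3; have Hm := dclass_evenP qP e i3.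
have Hc := crit_rot R i (el e); have He := iw_length_el qP e.
have -> : iw_length (iter i rot (el e)) = iw_length (el e).
  by elim: i {i3 wE H0 H1 H1' H3 Hm Hc} => //= i IH; rewrite iw_length_rot.
move: (iw_length (el e)) He => n He; rewrite dim2_len -He in dE.
rewrite /in_shrunken_chambers.
have crE a b : e = (W121, a, b) ->
    in_critical_strips R (iter i rot (el e)) <-> [|| 2 * a - b == 1, 2 * b - a == 1 | a + b == 1].
  by move=> ee; rewrite Hc ee; exact: crit_W121.
case: e wE H0 H1 H1' H3 Hm Hc He dE crE => [[c a] b] wE H0 H1 H1' H3 Hm _ He dE crE.
split.
- case: c wE H0 H1 H1' H3 Hm He dE crE => /= wE H0 H1 H1' H3 Hm He dE crE.
  + have [s|s] := eqVneq (a + b) 0.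
      case: n He dE => [|n] He dE; first by apply: Or41; split=> //; exact/H0.
      by apply: Or43; left; split=> //; exact/H0.
    by apply: Or43; right; exists (absz (a + b)%R); [lia | apply/Hm].
  + by apply: Or42; right; exact/H1.
  + by apply: Or42; right; exact/H1.
  + have [s|s] := eqVneq a (2 * b).
      case: n He dE => [|n] He dE; first by apply: Or41; split=> //; exact/H0.
      by apply: Or43; left; split=> //; exact/H0.
    by apply: Or43; right; exists (absz (a - 2 * b)%R); [lia | apply/Hm].
  + have [s|s] := eqVneq b (2 * a).
      case: n He dE => [|n] He dE; first by apply: Or41; split=> //; exact/H0.
      by apply: Or43; left; split=> //; exact/H0.
    by apply: Or43; right; exists (absz (b - 2 * a)%R); [lia | apply/Hm].
  + have [h|h] := pselect ((a %% 2)%Z = 0 /\ (b %% 2)%Z = 0).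
      by apply: Or44; right; exact/H3.
    have [cr|cr] := pselect (in_critical_strips R (iter i rot (el (W121, a, b)))).
      by apply: Or42; left; split=> //; exact/H1'.
    by apply: Or44; left; split=> //; exact/H1'.
- case=> _ n0; rewrite n0 in He; have [? ? ?] := len_eq0 (esym He); subst c a b.
  by have -> : d = 0%N by move: dE; rewrite n0 /=; lia.
- move=> h; apply: (@half_eq d n 1); case: h => [[/H1' + /(crE _ _)]|/H1].
    by case: c {wE H0 H1 H1' H3 Hm He crE} dE => //= dE _ /(_ _ _ erefl) cr; rewrite cr in dE; lia.
  by case: c {wE H0 H1 H1' H3 Hm He crE} dE => //= dE _; lia.
- move=> h; apply: (@half_eq d n 2); case: h => [[/H0 + n0]|[m m0 /Hm]].
    case: c {wE H0 H1 H1' H3 Hm crE} He dE => //= He dE s; [|by lia|by lia].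
    (* In [dclass0] only the identity among affine elements is set apart by [dim2]; positive length
       excludes it. *)
    have : ~~ ((a == 0) && (b == 0)) by apply/negP => /andP[/eqP a0 /eqP b0]; move: He n0; rewrite a0 b0 /az /=; lia.
    by move/negPf => nab; rewrite nab in dE; lia.
  case: c {wE H0 H1 H1' H3 Hm crE} He dE => //= He dE; rewrite /az => s; [|by lia|by lia].
  have /negPf nab : ~~ ((a == 0) && (b == 0)) by lia.
  by rewrite nab in dE; lia.
- move=> h; apply: (@half_eq d n 3); case: h => [[/H1' + ncr]|/H3].
    case: c {wE H0 H1 H1' H3 Hm He } dE crE ncr => //= dE crE ncr _.
    have /negPf cr : ~~ [|| 2 * a - b == 1, 2 * b - a == 1 | a + b == 1].
      by apply/negP => /(crE _ _ erefl).
    by rewrite cr in dE; lia.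
  case: c {wE H0 H1 H1' H3 Hm He crE} dE => //= dE s.
  have /negPf cr : ~~ [|| 2 * a - b == 1, 2 * b - a == 1 | a + b == 1] by lia.
  by rewrite cr in dE; lia.
Qed.
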